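(* Let $f:\mathbb{T}^d\times\mathbb{R}^d\to\mathbb{T}^d\times\mathbb{R}^d$ be a symplectic twist map, $F:\mathbb{R}^d\times\mathbb{R}^d\to\mathbb{R}^d\times\mathbb{R}^d$ a lift of $f$ and $S:\mathbb{R}^d\times\mathbb{R}^d\to\mathbb{R}$ its generating function. Let $G:\mathbb{T}^d\to\mathbb{R}$ be a potential function. Consider the family of symplectic twist maps $(f_\varepsilon)_{\varepsilon\in\mathbb{R}}$, $f_\varepsilon(q,p):=f(q,p+\varepsilon\nabla G(q))$, and let $(F_\varepsilon)_{\varepsilon\in\mathbb{R}}$ be a continuous family of lifts of the $f_\varepsilon$. I. Assume that: (i) $f$ is strongly positive; (ii) $f$ satisfies the analyticity property; (iii) $G$ admits a holomorphic extension to $\mathbb{C}^d$. Then, for every $(m,n)\in\mathbb{Z}^d\times\mathbb{N}^*$ with $m$ and $n$ coprime, the set $$\{\varepsilon\in\mathbb{R}:\ F_\varepsilon\text{ has a Lipschitz Lagrangian }(m,n)\text{-periodic graph}\}$$ is either the whole of $\mathbb{R}$ or consists of isolated points. II. If, in addition to (i), (ii) and (iii), $f$ has bounded rate and $G$ is non-constant, then, for every $(m,n)\in\mathbb{Z}^d\times\mathbb{N}^*$ with $m$ and $n$ coprime, the set $$\{\varepsilon\in\mathbb{R}:\ F_\varepsilon\text{ has a Lipschitz Lagrangian }(m,n)\text{-periodic graph}\}$$ consists of at most finitely many points.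
   Context: Here $d\ge1$, $\mathbb{T}^d=\mathbb{R}^d/\mathbb{Z}^d$, $\mathbb{N}^*=\{1,2,\dots\}$; functions on $\mathbb{T}^d$ are identified with $\mathbb{Z}^d$-periodic functions on $\mathbb{R}^d$. For $m=(m_1,\dots,m_d)\in\mathbb{Z}^d$ and $n\in\mathbb{N}^*$, coprime means $\gcd(m_1,\dots,m_d,n)=1$. Symplectic twist map: a $C^1$ diffeomorphism $f$ of $\mathbb{T}^d\times\mathbb{R}^d$ admitting a lift $F:\mathbb{R}^d\times\mathbb{R}^d\to\mathbb{R}^d\times\mathbb{R}^d$, $F(q,p)=(Q(q,p),P(q,p))$, such that: (1) $F(q+k,p)=F(q,p)+(k,0)$ for all $k\in\mathbb{Z}^d$; (2) $(q,p)\mapsto(q,Q(q,p))$ is a diffeomorphism of $\mathbb{R}^d\times\mathbb{R}^d$; (3) there is a generating function $S:\mathbb{R}^d\times\mathbb{R}^d\to\mathbb{R}$ with $S(q+k,Q+k)=S(q,Q)$ for all $k\in\mathbb{Z}^d$ and $P\,dQ-p\,dq=dS(q,Q)$. The map $f$ is strongly positive if there are $\alpha,\beta>0$ such that $-\beta\|v\|^2\le\partial_q\partial_QS(q,Q)(v,v)\le-\alpha\|v\|^2$ for all $q,Q,v\in\mathbb{R}^d$ (Euclidean norm). It has bounded rate if $\|\partial_q\partial_qS\|_\infty+\|\partial_Q\partial_QS\|_\infty<\infty$. Potentials $G$ are at least $C^2$. The map $f_\varepsilon$ has generating function $S(q,Q)+\varepsilon G(q)$. Analyticity property of $f$: there is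 a holomorphic map $\mathcal{F}:\mathbb{C}^d\times\mathbb{C}^d\to\mathbb{C}^d\times\mathbb{C}^d$, $\mathcal{F}(q,p)=(Q(q,p),P(q,p))$, such that: $\mathcal{F}$ is a holomorphic diffeomorphism of $\mathbb{C}^d\times\mathbb{C}^d$; $\mathcal{F}|_{\mathbb{R}^d\times\mathbb{R}^d}$ is a lift of $f$; $(q,p)\mapsto(q,Q(q,p))$ is a diffeomorphism of $\mathbb{C}^d\times\mathbb{C}^d$; there is a generating function $S:\mathbb{C}^d\times\mathbb{C}^d\to\mathbb{C}$ with $S(q+k,Q+k)=S(q,Q)$ for $k\in\mathbb{Z}^d$ and $P\,dQ-p\,dq=dS(q,Q)$. Let $\gamma:\mathbb{R}^d\to\mathbb{R}^d$ be continuous and $\mathbb{Z}^d$-periodic and $(m,n)\in\mathbb{Z}^d\times\mathbb{N}^*$ with $m,n$ coprime. $\mathrm{graph}(\gamma)=\{(q,\gamma(q)):q\in\mathbb{R}^d\}$ is an $(m,n)$-periodic graph of a lift $F$ if $F^n(q,\gamma(q))=(q+m,\gamma(q))$ for all $q\in\mathbb{R}^d$. It is Lipschitz if $\gamma$ is Lipschitz. For $\gamma$ Lipschitz, $\mathrm{graph}(\gamma)$ is Lagrangian if $\int_{\mathbb{T}}\gamma(\nu(t))\cdot\dot\nu(t)\,dt=0$ for every $C^1$ loop $\nu:\mathbb{T}\to\mathbb{R}^d$. *)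

(* Defs.v *)
From HB Require Import structures.
From mathcomp Require Import all_boot all_order all_algebra.
From mathcomp Require Import generic_quotient.
From mathcomp Require Import complex.
From mathcomp Require Import all_classical all_reals all_analysis.
Set Implicit Arguments.
Unset Strict Implicit.
Unset Printing Implicit Defensive.
Import Order.TTheory GRing.Theory Num.Theory.
Import numFieldNormedType.Exports.
Local Open Scope quotient_scope.
Local Open Scope classical_set_scope.
Local Open Scope ring_scope.

Definition dotp (K : numFieldType) (d : nat) (u v : 'rV[K]_d) : K :=
  \sum_(i < d) u 0 i * v 0 i.

Definition intv (K : numFieldType) (d : nat) (k : 'rV[int]_d) : 'rV[K]_d :=
  map_mx intr k.
Arguments intv K {d} k.

Definition evec (K : numFieldType) (d : nat) (i : 'I_d) : 'rV[K]_d :=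
  delta_mx 0 i.
Arguments evec K {d} i.

(* Only used between finite-dimensional spaces, where pointwise continuity of
   [x |-> 'd f x] is the same as continuity for the operator norm. *)
Definition C1 (K : numFieldType) (V W : normedModType K) (f : V -> W) : Prop :=
  (forall x, differentiable f x) /\
  (forall v, continuous (fun x => 'd f x v)).

Definition C2 (K : numFieldType) (V W : normedModType K) (f : V -> W) : Prop :=
  C1 f /\ (forall v, C1 (fun x => 'd f x v)).

Definition C1_diffeo (K : numFieldType) (V W : normedModType K) (f : V -> W)
  : Prop :=
  exists g : W -> V, [/\ cancel f g, cancel g f, C1 f & C1 g].

(* For [K] the complex numbers, [differentiable] is Frechet differentiability
   over the complex field. *)
Definition entire (K : numClosedFieldType) (V W : normedModType K)
  (f : V -> W) : Prop := forall x, differentiable f x.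

Definition holomorphic_diffeo (K : numClosedFieldType) (V W : normedModType K)
  (f : V -> W) : Prop :=
  exists g : W -> V, [/\ cancel f g, cancel g f, entire f & entire g].

(* [(q, p) |-> (q, Q(q, p))], where [F = (Q, P)] *)
Definition twist_coord (K : numFieldType) (d : nat)
    (F : 'rV[K]_d * 'rV[K]_d -> 'rV[K]_d * 'rV[K]_d)
    (x : 'rV[K]_d * 'rV[K]_d) : 'rV[K]_d * 'rV[K]_d :=
  (x.1, (F x).1).

(* The last clause is the equality [P dQ - p dq = dS(q, Q)] of 1-forms in the
   variables [x = (q, p)], evaluated on the tangent vector [h]. *)
Definition generating_function (K : numFieldType) (d : nat)
    (F : 'rV[K]_d * 'rV[K]_d -> 'rV[K]_d * 'rV[K]_d)
    (S : 'rV[K]_d * 'rV[K]_d -> K) : Prop :=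
  [/\ forall (k : 'rV[int]_d) q Q, S (q + intv K k, Q + intv K k) = S (q, Q),
      forall z, differentiable S z
    & forall x h, 'd (fun y => S (twist_coord F y)) x h =
        dotp (F x).2 ('d (fun y => (F y).1) x h) - dotp x.2 h.1].

Section Torus.
Variables (R : realType) (d : nat).
Local Notation E := 'rV[R]_d.

Definition torus_rel : rel E :=
  fun x y => `[< exists k : 'rV[int]_d, y = x + intv R k >].

Lemma torus_rel_refl : reflexive torus_rel.
Proof. by move=> x; apply/asboolP; exists 0; rewrite /intv map_mx0 addr0. Qed.

Lemma torus_rel_sym : symmetric torus_rel.
Proof.
have H x y : torus_rel x y -> torus_rel y x.
  move=> /asboolP[k ->]; apply/asboolP; exists (- k).
  by rewrite /intv map_mxN addrK.
by move=> x y; apply/idP/idP; exact: H.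
Qed.

Lemma torus_rel_trans : transitive torus_rel.
Proof.
move=> y x z /asboolP[k ->] /asboolP[l ->]; apply/asboolP; exists (k + l).
by rewrite /intv map_mxD addrA.
Qed.

Canonical torus_equiv :=
  EquivRel torus_rel torus_rel_refl torus_rel_sym torus_rel_trans.

Definition torus := {eq_quot torus_rel}.

Definition torus_pi (q : E) : torus := \pi_({eq_quot torus_rel}) q.

Definition torus_repr (x : torus) : E := repr (x : {eq_quot torus_rel}).

(* the universal covering of the annulus [torus * E] *)
Definition cover (x : E * E) : torus * E := (torus_pi x.1, x.2).

Definition is_lift (f : torus * E -> torus * E) (F : E * E -> E * E) : Prop :=
  continuous F /\ forall x, cover (F x) = f (cover x).

(* Smoothness is read in the charts given by the local inverses of [cover];
   every germ of C^1 map is the germ of a C^1 map defined on the whole space. *)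
Definition annulus_C1 (f : torus * E -> torus * E) : Prop :=
  forall x : E * E, exists2 H : E * E -> E * E,
    C1 H & \forall y \near x, f (cover y) = cover (H y).

Definition annulus_C1_diffeo (f : torus * E -> torus * E) : Prop :=
  exists g : torus * E -> torus * E,
    [/\ cancel f g, cancel g f, annulus_C1 f & annulus_C1 g].

Definition twist_lift (F : E * E -> E * E) (S : E * E -> R) : Prop :=
  [/\ forall (k : 'rV[int]_d) q p,
        F (q + intv R k, p) = ((F (q, p)).1 + intv R k, (F (q, p)).2),
      C1_diffeo (twist_coord F)
    & generating_function F S].

Definition symplectic_twist_map (f : torus * E -> torus * E) : Prop :=
  annulus_C1_diffeo f /\
  exists F : E * E -> E * E, is_lift f F /\ exists S, twist_lift F S.

Definition hess_qq (S : E * E -> R) (z : E * E) : 'M[R]_d :=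
  \matrix_(i, j) 'D_(evec R i, 0) ('D_(evec R j, 0) S) z.

Definition hess_qQ (S : E * E -> R) (z : E * E) : 'M[R]_d :=
  \matrix_(i, j) 'D_(evec R i, 0) ('D_(0, evec R j) S) z.

Definition hess_QQ (S : E * E -> R) (z : E * E) : 'M[R]_d :=
  \matrix_(i, j) 'D_(0, evec R i) ('D_(0, evec R j) S) z.

Definition strongly_positive (S : E * E -> R) : Prop :=
  exists alpha beta : R, [/\ 0 < alpha, 0 < beta &
    forall q Q v : E,
      - beta * dotp v v <= dotp (v *m hess_qQ S (q, Q)) v <= - alpha * dotp v v].

Definition sup_norm (A : E * E -> 'M[R]_d) : \bar R :=
  ereal_sup (range (fun z => (`|A z|)%:E)).

Definition bounded_rate (S : E * E -> R) : Prop :=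
  (sup_norm (hess_qq S) + sup_norm (hess_QQ S) < +oo)%E.

(* Gradient at a point of the torus of a function on the torus, computed on its
   periodic extension; by periodicity the choice of representative is
   irrelevant. *)
Definition torus_grad (G : torus -> R) (x : torus) : E :=
  \row_i 'D_(evec R i) (G \o torus_pi) (torus_repr x).

Definition perturbed (f : torus * E -> torus * E) (G : torus -> R) (eps : R)
    (x : torus * E) : torus * E :=
  f (x.1, x.2 + eps *: torus_grad G x.1).

Definition continuous_family_of_lifts (f_ : R -> torus * E -> torus * E)
    (F_ : R -> E * E -> E * E) : Prop :=
  continuous (fun x : R * (E * E) => F_ x.1 x.2) /\
  forall eps, is_lift (f_ eps) (F_ eps).

Definition complexify (q : E) : 'rV[R[i]]_d := map_mx (real_complex R) q.

Definition analyticity_property (f : torus * E -> torus * E) : Prop :=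
  exists (Fc : 'rV[R[i]]_d * 'rV[R[i]]_d -> 'rV[R[i]]_d * 'rV[R[i]]_d),
    [/\ holomorphic_diffeo Fc,
        exists2 F : E * E -> E * E, is_lift f F &
          forall q p, Fc (complexify q, complexify p) =
            (complexify (F (q, p)).1, complexify (F (q, p)).2),
        holomorphic_diffeo (twist_coord Fc)
      & exists Sc, generating_function Fc Sc].

Definition has_entire_extension (G : torus -> R) : Prop :=
  exists2 Gc : 'rV[R[i]]_d -> (R[i])^o, entire Gc &
    forall q : E, Gc (complexify q) = real_complex R (G (torus_pi q)).

Definition coprime_vec (m : 'rV[int]_d) (n : nat) : bool :=
  coprime (\big[gcdn/0]_(i < d) `|m ord0 i|)%N n.

Definition periodic (gamma : E -> E) : Prop :=
  forall q (k : 'rV[int]_d), gamma (q + intv R k) = gamma q.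

Definition periodic_graph (F : E * E -> E * E) (m : 'rV[int]_d) (n : nat)
    (gamma : E -> E) : Prop :=
  forall q, iter n F (q, gamma q) = (q + intv R m, gamma q).

(* [nu] ranges over the C^1 loops in R^d, not over those in the torus. *)
Definition lagrangian (gamma : E -> E) : Prop :=
  forall nu : R -> E, C1 nu -> (forall t, nu (t + 1) = nu t) ->
    \int[lebesgue_measure]_(t in `[0, 1]) dotp (gamma (nu t)) (derive1 nu t) = 0.

Definition has_lip_lag_periodic_graph (F : E * E -> E * E)
    (m : 'rV[int]_d) (n : nat) : Prop :=
  exists gamma : E -> E,
    [/\ continuous gamma, periodic gamma, lipschitz gamma, lagrangian gamma
      & periodic_graph F m n gamma].

End Torus.

(* Main.v *)
(* Strong positivity makes the action W of F_eps coercive.  A Lipschitz Lagrangian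
   (m, n)-periodic graph has a C^{1,1} potential U; minimising U(y_0) + W(y) - U(y_n - m)
   shows that W(y) + U(y_0) >= U(y_n - m) + w for every y, and that the closed chains with
   W(y) = w are exactly the orbits on the graph.  Hence the graph is unique, its norm and
   Lipschitz constant are bounded locally uniformly in eps, the set A of parameters is
   closed, and p |-> (first component of F_eps^n(q, p)) has an injective differential on
   the graph.

   Part I: at a limit point eps0 of A, the holomorphic implicit function theorem solves
   Q_n(eps, q, p) = q + m by a function of eps in a complex disc of radius independent of q,
   which agrees with the graph at the parameters of A close to eps0.  A holomorphic function
   is interpolated from its values at accumulating real points with real coefficients that
   do not depend on the function, so the graph relation, the reality, the periodicity and
   the Lagrangian property extend to all eps close to eps0.  The set of limit points of A is
   thus open and closed.

   Part II: the second variation of the action of period (2m, 2n) at a maximum and at a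
   minimum of G, together with the bounded rate, bounds A; so A is not the whole line, has
   no limit point, and is finite. *)

Require Import Defs.
From HB Require Import structures.
From mathcomp Require Import all_boot all_order all_algebra.
From mathcomp Require Import generic_quotient.
From mathcomp Require Import complex.
From mathcomp Require Import all_classical all_reals all_analysis.
From mathcomp Require Import ring lra.
Set Implicit Arguments.
Unset Strict Implicit.
Unset Printing Implicit Defensive.
Import Order.TTheory GRing.Theory Num.Theory.
Import numFieldNormedType.Exports.
Local Open Scope classical_set_scope.
Local Open Scope ring_scope.

Section RealCalculus.
Variable R : realType.
Implicit Types (f g phi psi : R -> R) (a b x y : R).

Lemma is_derive_continuous f (df x : R) :
  is_derive x 1 f df -> {for x, continuous f}.
Proof. by move=> [+ _] => /derivable1_diffP /differentiable_continuous. Qed.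

Lemma mvt_segment f (df : R -> R) a b : a <= b ->
  (forall x, a <= x <= b -> is_derive x 1 f (df x)) ->
  exists2 c, a <= c <= b & f b - f a = df c * (b - a).
Proof.
move=> ab dfE.
have [c cab ->] : exists2 c, c \in `[a, b]%R & f b - f a = df c * (b - a).
  apply: MVT_segment => //.
    by move=> x; rewrite in_itv/= => /andP[/ltW ax /ltW xb]; apply: dfE; rewrite ax.
  apply: continuous_in_subspaceT => x; rewrite inE/= in_itv/= => xab.
  exact: is_derive_continuous (dfE _ xab).
by exists c => //; move: cab; rewrite in_itv.
Qed.

Lemma mean_value_ineq f (df : R -> R) a b (K : R) : a <= b ->
  (forall x, a <= x <= b -> is_derive x 1 f (df x)) ->
  (forall x, a <= x <= b -> `|df x| <= K) -> `|f b - f a| <= K * (b - a).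
Proof.
move=> ab dfE dfK; have [c cab ->] := mvt_segment ab dfE.
by rewrite normrM (ger0_norm (_ : 0 <= b - a)) ?subr_ge0 // ler_wpM2r ?subr_ge0// dfK.
Qed.

Lemma eq_of_derive f g (df : R -> R) a b : a <= b ->
  (forall x, a <= x <= b -> is_derive x 1 f (df x)) ->
  (forall x, a <= x <= b -> is_derive x 1 g (df x)) ->
  f b - f a = g b - g a.
Proof.
move=> ab Hf Hg.
have /= := @mean_value_ineq (f - g) (fun x => df x - df x) a b 0 ab _ _.
rewrite mul0r normr_le0 => H.
apply/eqP; rewrite -subr_eq0; rewrite [X in X == 0](_ : _ = (f - g) b - (f - g) a); last first.
  by rewrite !fctE; ring.
apply: H => x xab; last by rewrite subrr normr0.
by apply: is_deriveB; [exact: Hf|exact: Hg].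
Qed.

Lemma primitive_right phi (a : R) : continuous phi ->
  exists F : R -> R, forall x, a < x -> is_derive x 1 F (phi x).
Proof.
move=> cphi; exists (fun x => \int[lebesgue_measure]_(t in `[a, x]) phi t) => x ax.
have xx1 : x < x + 1 by rewrite ltrDl.
have [] := @continuous_FTC1_closed R phi a x (x + 1) xx1 _ ax (cphi x).
  apply: continuous_compact_integrable; first exact: segment_compact.
  exact: continuous_subspaceT.
move=> H1 H2; split; [exact: H1|by rewrite -derive1E; exact: H2].
Qed.

Lemma primitive_ex phi : continuous phi ->
  exists F : R -> R, forall x, is_derive x 1 F (phi x).
Proof.
move=> cphi.
have /choice[F HF] : forall n : nat, exists F : R -> R,
    F 0 = 0 /\ forall x, - n.+1%:R < x -> is_derive x 1 F (phi x).
  move=> n; have [F HF] := primitive_right (- n.+1%:R) cphi.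
  exists (fun x => F x - F 0); split; first by rewrite subrr.
  move=> x /HF Hx; have : is_derive x 1 (F - cst (F 0)) (phi x - 0) by apply: is_deriveB.
  by rewrite subr0.
have FE n m x : - n.+1%:R < x -> - m.+1%:R < x -> F n x = F m x.
  move=> nx mx; have [x0|/ltW x0] := leP 0 x.
    have : F n x - F n 0 = F m x - F m 0.
      by apply: (@eq_of_derive _ _ phi) => // y /andP[y0 yx]; apply: (HF _).2;
        apply: lt_le_trans y0; rewrite oppr_lt0.
    by rewrite (HF n).1 (HF m).1 !subr0.
  have : F n 0 - F n x = F m 0 - F m x.
    apply: (@eq_of_derive _ _ phi) => // y /andP[y0 yx]; apply: (HF _).2;
      exact: lt_le_trans y0.
  by rewrite (HF n).1 (HF m).1 !sub0r => /oppr_inj.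
exists (fun x => F (Num.truncn `|x|) x) => x.
have Hn (y : R) : - (Num.truncn `|y|).+1%:R < y.
  rewrite ltrNl (le_lt_trans (ler_norm _))// normrN.
  by have /truncn_itv/andP[] := normr_ge0 y.
set n := (Num.truncn `|x|).
apply: (@near_eq_is_derive _ _ _ (F n)) => //; last exact: (HF n).2 _ (Hn x).
near=> y; apply: FE; last exact: Hn.
near: y; apply: lt_nbhsr; exact: Hn.
Unshelve. all: by end_near. Qed.

End RealCalculus.

(** * One complex variable: mean value property, maximum principle, interpolation *)

Section Goursat.
Variable R : realType.
Implicit Types (f g phi psi F G : R -> R) (a b c x y : R).

Lemma Rintegral_primitive phi F : continuous phi ->
  (forall x : R, is_derive x 1 F (phi x)) ->
  \int[lebesgue_measure]_(t in `[0, 1]) phi t = F 1 - F 0.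
Proof.
move=> cphi dF; rewrite /Rintegral.
have cF : continuous F by move=> x; exact: is_derive_continuous (dF x).
rewrite (@continuous_FTC2 _ phi F 0 1) //.
- exact: continuous_subspaceT.
- split; first by move=> x _; have [] := dF x.
  + exact: cvg_at_right_filter (cF 0).
  + exact: cvg_at_left_filter (cF 1).
- by move=> x _; rewrite derive1E; have [] := dF x.
Qed.

Lemma primitive_close F G phi psi x y c (K : R) : x <= y ->
  (forall z : R, is_derive z 1 F (phi z)) -> (forall z : R, is_derive z 1 G (psi z)) ->
  (forall z, x <= z <= y -> `|phi z - psi z - c| <= K) ->
  `|(F y - F x) - (G y - G x) - c * (y - x)| <= K * (y - x).
Proof.
move=> xy dF dG H.
have D (z : R) : is_derive z 1 (F - G - ( *%R c)) (phi z - psi z - c).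
  have d1 : is_derive z 1 (fun z : R => c * z) c.
    have := @is_deriveM _ _ (cst c) id z 1 _ _ (is_derive_cst _ _ _) (is_derive_id _ _).
    by rewrite scaler0 addr0 [c *: 1]mulr1.
  by apply: is_deriveB.
have := @mean_value_ineq _ _ _ x y K xy (fun z _ => D z) H.
congr (`|_| <= _); rewrite !fctE; ring.
Qed.

Definition prim phi : R -> R := get [set F : R -> R | forall x : R, is_derive x 1 F (phi x)].

Lemma primP phi : continuous phi -> forall x : R, is_derive x 1 (prim phi) (phi x).
Proof. by move=> /primitive_ex H; exact: (getPex H). Qed.

Lemma nested_intervals (s A : R^nat) : (forall k, s k <= s k.+1) ->
  (forall k, 0 <= A k) -> (forall k, s k.+1 + A k.+1 <= s k + A k) ->
  exists p, forall k, s k <= p <= s k + A k.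
Proof.
move=> H1 A0 H2.
have m1 k l : s k <= s (k + l)%N.
  by elim: l => [|l IH]; rewrite ?addn0// addnS (le_trans IH).
have m2 k l : s (k + l)%N + A (k + l)%N <= s k + A k.
  by elim: l => [|l IH]; rewrite ?addn0// addnS (le_trans _ IH).
have ub k : ubound (range s) (s k + A k).
  move=> _ [l _ <-]; rewrite (le_trans (m1 l k))// addnC (le_trans _ (m2 k l))//.
  by rewrite lerDl.
exists (sup (range s)) => k; apply/andP; split.
  by apply: ub_le_sup; [exists (s 0 + A 0); exact: ub|exists k].
by apply: ge_sup; [exists (s 0); exists 0%N|exact: ub].
Qed.

Variables u v : R -> R -> R.
Hypothesis cu : forall s, continuous (u s).
Hypothesis cv : forall t, continuous (v^~ t).

(* The imaginary part of the integral of (u + i v) d(s + i t) along the boundary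
   of the rectangle [s, s + A] x [t, t + B]. *)
Definition rect_int (s t A B : R) : R :=
  (prim (v^~ t) (s + A) - prim (v^~ t) s) - (prim (v^~ (t + B)) (s + A) - prim (v^~ (t + B)) s)
  + (prim (u (s + A)) (t + B) - prim (u (s + A)) t) - (prim (u s) (t + B) - prim (u s) t).

Definition cauchy_riemann_at s t := exists a b : R, forall k : R, 0 < k -> exists2 r : R, 0 < r &
  forall s' t' : R, `|s' - s| <= r -> `|t' - t| <= r ->
    `|u s' t' - u s t - (a * (s' - s) - b * (t' - t))| <= k * (`|s' - s| + `|t' - t|) /\
    `|v s' t' - v s t - (b * (s' - s) + a * (t' - t))| <= k * (`|s' - s| + `|t' - t|).

Lemma normB_le x y (K z : R) : `|x| <= K -> `|y| <= K -> z = x - y -> `|z| <= 2 * K.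
Proof.
move=> xK yK ->; rewrite (le_trans (ler_normB _ _))//.
by rewrite (le_trans (lerD xK yK))// mulr_natl mulr2n.
Qed.

Lemma rect_int_small s t : cauchy_riemann_at s t -> forall k : R, 0 < k -> exists2 r : R, 0 < r &
  forall s0 t0 A B : R, 0 <= A <= r -> 0 <= B <= r -> s0 <= s <= s0 + A -> t0 <= t <= t0 + B ->
  `|rect_int s0 t0 A B| <= 2 * k * (A + B) ^+ 2.
Proof.
move=> [a [b H]] k k0; have [r r0 {}H] := H k k0; exists r => // s0 t0 A B.
move=> /andP[A0 Ar] /andP[B0 Br] /andP[s0s ss] /andP[t0t tt].
have sx z : s0 <= z <= s0 + A -> `|z - s| <= A.
  by move=> /andP[z1 z2]; rewrite ler_norml; apply/andP; split; lra.
have tx z : t0 <= z <= t0 + B -> `|z - t| <= B.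
  by move=> /andP[z1 z2]; rewrite ler_norml; apply/andP; split; lra.
have HH s' t' : s0 <= s' <= s0 + A -> t0 <= t' <= t0 + B ->
    `|u s' t' - u s t - (a * (s' - s) - b * (t' - t))| <= k * (A + B) /\
    `|v s' t' - v s t - (b * (s' - s) + a * (t' - t))| <= k * (A + B).
  move=> /sx Hs /tx Ht; have [] := H s' t' (le_trans Hs Ar) (le_trans Ht Br).
  have kAB : k * (`|s' - s| + `|t' - t|) <= k * (A + B) by rewrite ler_pM2l// lerD.
  by move=> h1 h2; split; [apply: le_trans h1 _|apply: le_trans h2 _].
have sA : s0 <= s0 + A by rewrite lerDl.
have tB : t0 <= t0 + B by rewrite lerDl.
have HY := @primitive_close (prim (v^~ t0)) (prim (v^~ (t0 + B))) (v^~ t0) (v^~ (t0 + B))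
  s0 (s0 + A) (- (a * B)) (2 * (k * (A + B))) sA (primP (@cv t0)) (primP (@cv (t0 + B))).
have HX := @primitive_close (prim (u (s0 + A))) (prim (u s0)) (u (s0 + A)) (u s0)
  t0 (t0 + B) (a * A) (2 * (k * (A + B))) tB (primP (@cu (s0 + A))) (primP (@cu s0)).
set X := (X in _ -> `|X| <= _) in HX; set Y := (X in _ -> `|X| <= _) in HY.
have {}HX : `|X| <= 2 * (k * (A + B)) * (t0 + B - t0).
  apply: HX => z Hz.
  have [|h1 _] := HH (s0 + A) z _ Hz; first by rewrite sA lexx.
  have [|h2 _] := HH s0 z _ Hz; first by rewrite sA lexx.
  by apply: normB_le h1 h2 _; ring.
have {}HY : `|Y| <= 2 * (k * (A + B)) * (s0 + A - s0).
  apply: HY => z Hz.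
  have [|_ h1] := HH z t0 Hz; first by rewrite tB lexx.
  have [|_ h2] := HH z (t0 + B) Hz; first by rewrite tB lexx.
  by apply: normB_le h1 h2 _; ring.
have -> : rect_int s0 t0 A B = X + Y by rewrite /rect_int /X /Y; ring.
rewrite (le_trans (ler_normD _ _))//.
by rewrite (le_trans (lerD HX HY))// le_eqVlt; apply/orP; left; apply/eqP; ring.
Qed.

Lemma rect_int_split s t A B : rect_int s t (2 * A) (2 * B) =
  rect_int s t A B + rect_int (s + A) t A B + rect_int s (t + B) A B + rect_int (s + A) (t + B) A B.
Proof.
rewrite /rect_int.
have -> : s + 2 * A = s + A + A by ring.
have -> : t + 2 * B = t + B + B by ring.
ring.
Qed.

Lemma rect_int0 (s0 t0 A B : R) : 0 <= A -> 0 <= B ->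
  (forall s t : R, s0 <= s <= s0 + A -> t0 <= t <= t0 + B -> cauchy_riemann_at s t) ->
  rect_int s0 t0 A B = 0.
Proof.
move=> A0 B0 CR; apply/eqP; rewrite -normr_le0.
set J := `|_|.
pose a k : R := A / 2 ^+ k; pose b k : R := B / 2 ^+ k.
have p2 k : (0 : R) < 2 ^+ k by rewrite exprn_gt0.
have a2 k : a k = 2 * a k.+1.
  by rewrite /a exprS; field; rewrite gt_eqF.
have b2 k : b k = 2 * b k.+1.
  by rewrite /b exprS; field; rewrite gt_eqF.
have a0 k : 0 <= a k by rewrite divr_ge0// ltW.
have b0 k : 0 <= b k by rewrite divr_ge0// ltW.
pose bad k (z : R * R) := J / 4 ^+ k <= `|rect_int z.1 z.2 (a k) (b k)|.
pose sub k (z z' : R * R) := (z.1 <= z'.1 <= z.1 + a k.+1) && (z.2 <= z'.2 <= z.2 + b k.+1).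
have step (kz : nat * (R * R)) : exists z', bad kz.1 kz.2 -> bad kz.1.+1 z' /\ sub kz.1 kz.2 z'.
  case: kz => k [s t] /=.
  have ak := a0 k.+1; have bk := b0 k.+1.
  have [H|H] := pselect (exists z', bad k.+1 z' /\ sub k (s, t) z').
    by case: H => z' Hz'; exists z'.
  exists (0, 0) => Hb; exfalso.
  have N x y : s <= x <= s + a k.+1 -> t <= y <= t + b k.+1 ->
      `|rect_int x y (a k.+1) (b k.+1)| < J / 4 ^+ k.+1.
    move=> Hx Hy; rewrite ltNge; apply/negP => HH; apply: H; exists (x, y).
    by rewrite /bad /sub/= Hx Hy.
  have la : s <= s + a k.+1 by rewrite lerDl.
  have lb : t <= t + b k.+1 by rewrite lerDl.
  have h1 := N s t; have h2 := N (s + a k.+1) t; have h3 := N s (t + b k.+1).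
  have h4 := N (s + a k.+1) (t + b k.+1); rewrite ?lexx ?la ?lb in h1 h2 h3 h4.
  move: (h1 isT isT) (h2 isT isT) (h3 isT isT) (h4 isT isT) Hb.
  rewrite /bad /= (a2 k) (b2 k) rect_int_split.
  have -> : J / 4 ^+ k = 4 * (J / 4 ^+ k.+1).
    by rewrite exprS; field; rewrite expf_neq0.
  set x1 := rect_int _ _ _ _; set x2 := rect_int _ _ _ _; set x3 := rect_int _ _ _ _;
  set x4 := rect_int _ _ _ _ => n1 n2 n3 n4 n5.
  have := le_trans (ler_normD (x1 + x2 + x3) x4) (lerD (ler_normD (x1 + x2) x3) (lexx _)).
  have := ler_normD x1 x2.
  lra.
have /choice[nx Hnx] := step.
pose Z := fix Z k := if k is k'.+1 then nx (k', Z k') else (s0, t0).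
have Zbad k : bad k (Z k).
  elim: k => [|k IH]; first by rewrite /bad /= /a /b !expr0 !divr1.
  by have [] := Hnx (k, Z k) IH.
have Zsub k : sub k (Z k) (Z k.+1) by have [] := Hnx (k, Z k) (Zbad k).
have [p Hp] : exists p, forall k, (Z k).1 <= p <= (Z k).1 + a k.
  apply: nested_intervals => // k; have /andP[/andP[h1 h2] _] := Zsub k => //.
  by rewrite (a2 k); lra.
have [q Hq] : exists p, forall k, (Z k).2 <= p <= (Z k).2 + b k.
  apply: nested_intervals => // k; have /andP[_ /andP[h1 h2]] := Zsub k => //.
  by rewrite (b2 k); lra.
have CRpq : cauchy_riemann_at p q.
  by apply: CR; [have := Hp 0%N|have := Hq 0%N]; rewrite /= /a /b expr0 divr1.
have Jk k : 0 < k -> J <= 2 * k * (A + B) ^+ 2.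
  move=> k0; have [r r0 Hr] := rect_int_small CRpq k0.
  have [n Hn] : exists n : nat, A + B <= r * 2 ^+ n.
    have [n Hn] : exists n : nat, (A + B) / r <= n%:R.
      by exists (Num.truncn ((A + B) / r)).+1; rewrite ltW// truncnS_gt.
    exists n; rewrite mulrC -ler_pdivrMr// (le_trans Hn)//.
    by rewrite -natrX ler_nat ltnW// ltn_expl.
  have := Zbad n; rewrite /bad => Hb.
  have := Hr (Z n).1 (Z n).2 (a n) (b n) _ _ (Hp n) (Hq n).
  have an : 0 <= a n <= r.
    by rewrite a0 /= /a ler_pdivrMr// (le_trans _ Hn)// lerDl.
  have bn : 0 <= b n <= r.
    by rewrite b0 /= /b ler_pdivrMr// (le_trans _ Hn)// lerDr.
  move=> /(_ an bn) /(le_trans Hb).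
  rewrite ler_pdivrMr ?exprn_gt0// => /le_trans; apply.
  rewrite /a /b le_eqVlt; apply/orP; left; apply/eqP.
  have -> : (4 : R) ^+ n = 2 ^+ n * 2 ^+ n by rewrite -exprMn; congr (_ ^+ _); ring.
  by field; rewrite gt_eqF.
rewrite leNgt; apply/negP => J0.
pose D := 2 * ((A + B) ^+ 2 + 1).
have D0 : 0 < D by rewrite mulr_gt0// ltr_wpDl// sqr_ge0.
have JD : 0 < J / (2 * D) by apply: divr_gt0 => //; apply: mulr_gt0.
have := Jk _ JD.
have -> : 2 * (J / (2 * D)) * (A + B) ^+ 2 = J * ((A + B) ^+ 2 / D).
  by field; rewrite gt_eqF.
rewrite -[X in X <= _]mulr1 ler_pM2l// ler_pdivlMr// mul1r /D.
have := sqr_ge0 (A + B); lra.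
Qed.

End Goursat.

Section ComplexDifferentiability.
Variable R : realType.
Local Notation C := R[i].
Local Open Scope complex_scope.
Implicit Types (f g : C -> C) (z w D : C).

Local Notation nc := (@ComplexField.Normc.normc R).
Local Notation Re := (@complex.Re R).
Local Notation Im := (@complex.Im R).

Lemma normcE z : `|z| = (nc z)%:C.
Proof. by case: z. Qed.

Lemma normc_ge0 z : 0 <= nc z.
Proof. by case: z => a b; exact: sqrtr_ge0. Qed.

Lemma normcM z w : nc (z * w) = nc z * nc w.
Proof. exact: ComplexField.Normc.normcM. Qed.

Lemma normc0 : nc 0 = 0. Proof. exact: ComplexField.Normc.normc0. Qed.

Lemma normc1 : nc 1 = 1. Proof. exact: ComplexField.Normc.normc1. Qed.

Lemma normcV z : nc z^-1 = (nc z)^-1.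
Proof. exact: ComplexField.Normc.normcV. Qed.

Lemma normc_eq0 z : (nc z == 0) = (z == 0).
Proof.
by apply/eqP/eqP => [|->]; [exact: ComplexField.Normc.eq0_normc|exact: normc0].
Qed.

Lemma normc_gt0 z : (0 < nc z) = (z != 0).
Proof. by rewrite lt_def normc_eq0 normc_ge0 andbT. Qed.

Lemma ler_normcD z w : nc (z + w) <= nc z + nc w.
Proof. by have := ler_normD z w; rewrite !normcE -rmorphD lecR. Qed.

Lemma normcN z : nc (- z) = nc z.
Proof. by apply: complexI; rewrite -!normcE normrN. Qed.

Lemma normcB z w : nc (z - w) = nc (w - z).
Proof. by rewrite -normcN opprB. Qed.

Lemma ler_normcB z w : nc (z - w) <= nc z + nc w.
Proof. by rewrite (le_trans (ler_normcD _ _))// normcN. Qed.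

Lemma normc_real (x : R) : nc x%:C = `|x|.
Proof. by rewrite /= expr0n/= addr0 sqrtr_sqr. Qed.

Lemma ler_Re z : `|Re z| <= nc z.
Proof.
by case: z => a b /=; rewrite -sqrtr_sqr ler_sqrt ?addr_ge0 ?sqr_ge0// lerDl sqr_ge0.
Qed.

Lemma ler_Im z : `|Im z| <= nc z.
Proof.
by case: z => a b /=; rewrite -sqrtr_sqr ler_sqrt ?addr_ge0 ?sqr_ge0// lerDr sqr_ge0.
Qed.

Lemma normc_le_ReIm z : nc z <= `|Re z| + `|Im z|.
Proof.
case: z => a b /=; rewrite -[leRHS]ger0_norm ?addr_ge0// -sqrtr_sqr ler_sqrt ?sqr_ge0//.
by rewrite sqrrD !real_normK ?num_real// addrAC lerDl mulrn_wge0// mulr_ge0.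
Qed.

Lemma normc_sqr z : nc z ^+ 2 = Re z ^+ 2 + Im z ^+ 2.
Proof. by case: z => a b /=; rewrite sqr_sqrtr// addr_ge0// sqr_ge0. Qed.

Definition ccont f := forall z (k : R), 0 < k -> exists2 r : R, 0 < r &
  forall z', nc (z' - z) <= r -> nc (f z' - f z) <= k.

Definition cderiv f z D := forall k : R, 0 < k -> exists2 r : R, 0 < r &
  forall z', nc (z' - z) <= r -> nc (f z' - f z - D * (z' - z)) <= k * nc (z' - z).

Definition cdiff f z := exists D, cderiv f z D.

Lemma cderiv_lip f z D : cderiv f z D -> exists2 r : R, 0 < r &
  forall z', nc (z' - z) <= r -> nc (f z' - f z) <= (nc D + 1) * nc (z' - z).
Proof.
move=> /(_ 1 ltr01)[r r0 H]; exists r => // z' /H.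
have -> : f z' - f z = f z' - f z - D * (z' - z) + D * (z' - z) by rewrite subrK.
move=> h; rewrite (le_trans (ler_normcD _ _))// normcM mulrDl addrC lerD//.
by rewrite subrK in h.
Qed.

Lemma cderiv_comp f g z D D' : cderiv g z D -> cderiv f (g z) D' ->
  cderiv (f \o g) z (D' * D).
Proof.
move=> dg df k k0.
have [r1 r10 lipg] := cderiv_lip dg.
have A0 : 0 < nc D' + 1 by rewrite ltr_wpDl// normc_ge0.
have B0 : 0 < nc D + 1 by rewrite ltr_wpDl// normc_ge0.
have [r2 r20 Hg] := dg (k / (2 * (nc D' + 1))) (divr_gt0 k0 (mulr_gt0 (ltr0Sn R 1) A0)).
have [r3 r30 Hf] := df (k / (2 * (nc D + 1))) (divr_gt0 k0 (mulr_gt0 (ltr0Sn R 1) B0)).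
exists (Num.min r1 (Num.min r2 (r3 / (nc D + 1)))).
  by rewrite !lt_min r10 r20 divr_gt0.
move=> z'; rewrite !le_min => /andP[h1 /andP[h2 h3]].
have l1 := lipg _ h1.
have := Hf (g z'); rewrite (le_trans l1); last by rewrite mulrC -ler_pdivlMr.
move=> /(_ isT) e1; have e2 := Hg _ h2.
have -> : (f \o g) z' - (f \o g) z - D' * D * (z' - z) =
  (f (g z') - f (g z) - D' * (g z' - g z)) + D' * (g z' - g z - D * (z' - z)).
  by rewrite /=; ring.
have n0 := normc_ge0 (z' - z).
rewrite (le_trans (ler_normcD _ _))// normcM.
have -> : k * nc (z' - z) = k / (2 * (nc D + 1)) * ((nc D + 1) * nc (z' - z)) +
   (nc D' + 1) * (k / (2 * (nc D' + 1)) * nc (z' - z)).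
  by field; rewrite !gt_eqF.
apply: lerD.
  by rewrite (le_trans e1)// ler_pM2l// divr_gt0// mulr_gt0.
by rewrite ler_pM ?normc_ge0// lerDl.
Qed.

Lemma cdiff_comp f g z : cdiff g z -> cdiff f (g z) -> cdiff (f \o g) z.
Proof. by move=> [D H] [D' H']; exists (D' * D); exact: cderiv_comp. Qed.

Lemma cderivD f g z D D' : cderiv f z D -> cderiv g z D' ->
  cderiv (fun z => f z + g z) z (D + D').
Proof.
move=> df dg k k0; have k20 : 0 < k / 2 by rewrite divr_gt0.
have [r1 r10 H1] := df _ k20; have [r2 r20 H2] := dg _ k20.
exists (Num.min r1 r2); first by rewrite lt_min r10.
move=> z'; rewrite le_min => /andP[/H1 h1 /H2 h2].
have -> : f z' + g z' - (f z + g z) - (D + D') * (z' - z) =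
  (f z' - f z - D * (z' - z)) + (g z' - g z - D' * (z' - z)) by ring.
rewrite (le_trans (ler_normcD _ _))// (le_trans (lerD h1 h2))//.
by rewrite -mulrDl -splitr.
Qed.

Lemma cderiv_cst (c : C) z : cderiv (fun=> c) z 0.
Proof.
move=> k k0; exists 1 => // z' _; rewrite subrr mul0r subr0 normc0.
by rewrite mulr_ge0 ?normc_ge0// ltW.
Qed.

Lemma cderiv_id z : cderiv id z 1.
Proof.
move=> k k0; exists 1 => // z' _; rewrite mul1r subrr normc0.
by rewrite mulr_ge0 ?normc_ge0// ltW.
Qed.

Lemma cderivM f g z D D' : cderiv f z D -> cderiv g z D' ->
  cderiv (fun z => f z * g z) z (D * g z + f z * D').
Proof.
move=> df dg k k0.
have [ra ra0 lipf] := cderiv_lip df; have [rb rb0 lipg] := cderiv_lip dg.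
set A := nc D + 1 in lipf; set B := nc D' + 1 in lipg.
have A0 : 0 < A by rewrite ltr_wpDl// normc_ge0.
have B0 : 0 < B by rewrite ltr_wpDl// normc_ge0.
pose K := nc (f z) + nc (g z) + 1.
have K0 : 0 < K by rewrite ltr_wpDl// addr_ge0// normc_ge0.
have k20 : 0 < k / (2 * K) by rewrite divr_gt0// mulr_gt0.
have [r1 r10 H1] := df _ k20; have [r2 r20 H2] := dg _ k20.
exists (Num.min (k / (2 * (A * B))) (Num.min (Num.min ra rb) (Num.min r1 r2))).
  by rewrite !lt_min r10 r20 ra0 rb0 divr_gt0// !mulr_gt0.
move=> z'; rewrite !le_min => /andP[h0 /andP[/andP[/lipf ha /lipg hb] /andP[/H1 h1 /H2 h2]]].
have -> : f z' * g z' - f z * g z - (D * g z + f z * D') * (z' - z) =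
  (f z' - f z) * (g z' - g z) + ((f z' - f z - D * (z' - z)) * g z + f z * (g z' - g z - D' * (z' - z))).
  by ring.
have n0 := normc_ge0 (z' - z).
have -> : k * nc (z' - z) = k / 2 * nc (z' - z) + k / 2 * nc (z' - z) by field.
apply: le_trans (ler_normcD _ _) _; apply: lerD.
  rewrite normcM (le_trans (ler_pM _ _ ha hb)) ?normc_ge0//.
  have -> : A * nc (z' - z) * (B * nc (z' - z)) = (nc (z' - z) * (A * B)) * nc (z' - z) by ring.
  rewrite ler_wpM2r// -ler_pdivlMr ?mulr_gt0// (le_trans h0)//.
  by rewrite le_eqVlt; apply/orP; left; apply/eqP; field; rewrite !gt_eqF.
apply: le_trans (ler_normcD _ _) _; rewrite !normcM.
have -> : k / 2 * nc (z' - z) = (k / (2 * K) * nc (z' - z)) * K.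
  by field; rewrite gt_eqF.
set T := k / (2 * K) * _ in h1 h2 *.
have T0 : 0 <= T by rewrite mulr_ge0// ltW.
have a1 := ler_wpM2r (normc_ge0 (g z)) h1.
have a2 := ler_wpM2l (normc_ge0 (f z)) h2.
apply: le_trans (lerD a1 a2) _.
by rewrite -subr_ge0 (_ : _ - _ = T)// /K; ring.
Qed.

Lemma cderivV z : z != 0 -> cderiv GRing.inv z (- z ^- 2).
Proof.
move=> z0 k k0.
have n0 : 0 < nc z by rewrite normc_gt0.
exists (Num.min (nc z / 2) (k * nc z ^+ 3 / 2)).
  by rewrite lt_min !divr_gt0// mulr_gt0// exprn_gt0.
move=> z'; rewrite le_min => /andP[h1 h2].
have nz' : nc z / 2 <= nc z'.
  have := ler_normcB z (z - z'); rewrite subKr normcB.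
  have := ler_normcD (z' - z) (z - z'); have := ler_normcD z' (z - z').
  rewrite (addrC z') subrK (normcB z z'); lra.
have n0' : 0 < nc z' by rewrite (lt_le_trans _ nz')// divr_gt0.
have z'0 : z' != 0 by rewrite -normc_gt0.
have -> : z'^-1 - z^-1 - - z ^- 2 * (z' - z) = (z' - z) * (z' - z) / (z ^+ 2 * z').
  by field; apply/andP.
rewrite normcM normcM mulrAC ler_wpM2r ?normc_ge0//.
rewrite normcV normcM ler_pdivrMr ?mulr_gt0// ?exprn_gt0// expr2 normcM ?mulr_gt0//.
rewrite (le_trans h2)//.
have -> : k * nc z ^+ 3 / 2 = k * (nc z * nc z * (nc z / 2)) by field.
by rewrite ler_pM2l// ler_pM2l// mulr_gt0.
Qed.

Lemma is_derive1_eps (f : R -> R) (x df : R) : is_derive x 1 f df ->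
  forall k : R, 0 < k -> exists2 r : R, 0 < r &
    forall x', `|x' - x| <= r -> `|f x' - f x - df * (x' - x)| <= k * `|x' - x|.
Proof.
move=> [dfx <-] k k0; have /derivable_nbhs := dfx.
move=> /eqaddoP/(_ k k0) /nbhs_ballP[e /= e0 H].
exists (e / 2); first by rewrite divr_gt0.
move=> x' xx'; have := H (x' - x).
rewrite /ball/= sub0r normrN (le_lt_trans xx') ?ltr_pdivrMr ?ltr_pMr ?ltr1n// => /(_ isT).
rewrite !fctE/= [(x' - x) *: 1]mulr1 subrK.
by congr (`|_| <= _); rewrite opprD addrA [_ *: _]mulrC.
Qed.

Definition expc w : C := (expR (Re w) * cos (Im w)) +i* (expR (Re w) * sin (Im w)).

Lemma expcD z w : expc (z + w) = expc z * expc w.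
Proof.
case: z w => [a b] [c d]; rewrite /expc /= expRD cosD sinD.
by apply/eqP; rewrite eq_complex /=; apply/andP; split; apply/eqP; ring.
Qed.

Lemma cderiv_expc z : cderiv expc z (expc z).
Proof.
move=> k0' k0'0.
pose k := k0' / (nc (expc z) + 1) / 8.
have K0 : 0 < nc (expc z) + 1 by rewrite ltr_wpDl// normc_ge0.
have k0 : 0 < k by rewrite !divr_gt0.
pose l := Num.min k 1.
have l0 : 0 < l by rewrite lt_min k0 ltr01.
have lk : l <= k by rewrite ge_min lexx.
have l1 : l <= 1 by rewrite ge_min lexx orbT.
have [r1 r10 H1] := is_derive1_eps (is_derive_expR (0 : R)) l0.
have [r2 r20 H2] := is_derive1_eps (is_derive_cos (0 : R)) l0.
have [r3 r30 H3] := is_derive1_eps (is_derive_sin (0 : R)) l0.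
exists (Num.min (l / 2) (Num.min r1 (Num.min r2 r3))).
  by rewrite !lt_min r10 r20 r30 divr_gt0.
move=> z'; rewrite !le_min => /andP[h0 /andP[h1 /andP[h2 h3]]].
set h := z' - z in h0 h1 h2 h3 *.
have -> : z' = z + h by rewrite /h addrC subrK.
rewrite expcD -[X in _ * expc h - X]mulr1 -!mulrBr normcM.
have xh := ler_Re h; have yh := ler_Im h.
move: (H1 (Re h)) (H2 (Im h)) (H3 (Im h)).
rewrite !subr0 expR0 cos0 sin0 !subr0 oppr0 mul0r subr0 !mul1r.
move=> /(_ (le_trans xh h1)) e1 /(_ (le_trans yh h2)) e2 /(_ (le_trans yh h3)) e3.
have hh := normc_ge0 h.
have E1 : `|expR (Re h) - 1| <= l.
  have -> : expR (Re h) - 1 = (expR (Re h) - 1 - Re h) + Re h by ring.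
  rewrite (le_trans (ler_normD _ _))// (le_trans (lerD e1 xh))//.
  have : l * `|Re h| <= 1 * nc h by rewrite ler_pM// ltW.
  lra.
have E3 : `|sin (Im h)| <= 2 * nc h.
  have -> : sin (Im h) = (sin (Im h) - Im h) + Im h by ring.
  rewrite (le_trans (ler_normD _ _))// (le_trans (lerD e3 yh))//.
  have : l * `|Im h| <= 1 * nc h by rewrite ler_pM// ltW.
  lra.
have main : nc (expc h - 1 - h) <= 8 * k * nc h.
  rewrite (le_trans (normc_le_ReIm _))//.
  have -> : Re (expc h - 1 - h) = (expR (Re h) - 1 - Re h) * cos (Im h) + (1 + Re h) * (cos (Im h) - 1).
    by case: (h) => x y; rewrite /expc /=; ring.
  have -> : Im (expc h - 1 - h) = (expR (Re h) - 1) * sin (Im h) + (sin (Im h) - Im h).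
    by case: (h) => x y; rewrite /expc /=; ring.
  have a1 : `|(expR (Re h) - 1 - Re h) * cos (Im h)| <= l * nc h.
    rewrite normrM -[leRHS]mulr1 ler_pM//.
      by rewrite (le_trans e1)// ler_pM2l.
    by rewrite ler_norml cos_geN1 cos_le1.
  have a2 : `|(1 + Re h) * (cos (Im h) - 1)| <= 2 * (l * nc h).
    rewrite normrM ler_pM//.
      rewrite (le_trans (ler_normD _ _))// normr1; have := le_trans xh h0; lra.
    by rewrite (le_trans e2)// ler_pM2l.
  have a3 : `|(expR (Re h) - 1) * sin (Im h)| <= l * (2 * nc h) by rewrite normrM ler_pM.
  have a4 : `|sin (Im h) - Im h| <= l * nc h by rewrite (le_trans e3)// ler_pM2l.
  have lk' : l * nc h <= k * nc h by rewrite ler_wpM2r.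
  have kh : 0 <= k * nc h by rewrite mulr_ge0// ltW.
  rewrite (le_trans (lerD (ler_normD _ _) (ler_normD _ _)))//; lra.
rewrite (le_trans (ler_pM _ _ (lexx _) main)) ?normc_ge0//.
rewrite mulrA ler_wpM2r//.
have -> : k0' = (nc (expc z) + 1) * (8 * k) by rewrite /k; field; rewrite gt_eqF.
by rewrite ler_wpM2r// ?lerDl// mulr_ge0// ltW.
Qed.

End ComplexDifferentiability.

Section MeanValue.
Variable R : realType.
Local Notation C := R[i].
Local Open Scope complex_scope.
Local Notation nc := (@ComplexField.Normc.normc R).
Local Notation Re := (@complex.Re R).
Local Notation Im := (@complex.Im R).
Implicit Types (f g : C -> C) (z w : C).

Definition ccontR (F : C -> R) := forall z (k : R), 0 < k -> exists2 r : R, 0 < r &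
  forall z', nc (z' - z) <= r -> `|F z' - F z| <= k.

Lemma ccont_Re f : ccont f -> ccontR (Re \o f).
Proof.
move=> cf z k /(cf z)[r r0 H]; exists r => // z' /H; apply: le_trans.
by rewrite -raddfB /=; exact: ler_Re.
Qed.

Lemma ccont_Im f : ccont f -> ccontR (Im \o f).
Proof.
move=> cf z k /(cf z)[r r0 H]; exists r => // z' /H; apply: le_trans.
by rewrite -raddfB /=; exact: ler_Im.
Qed.

Lemma ler_dist_normc z w : `|nc z - nc w| <= nc (z - w).
Proof.
rewrite ler_norml; apply/andP; split.
  by rewrite lerNl opprB lerBlDr normcB; have := ler_normcD (w - z) z; rewrite subrK.
by rewrite lerBlDr; have := ler_normcD (z - w) w; rewrite subrK.
Qed.

Lemma ccont_normc f : ccont f -> ccontR (nc \o f).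
Proof.
move=> cf z k /(cf z)[r r0 H]; exists r => // z' /H; apply: le_trans; exact: ler_dist_normc.
Qed.

Lemma ccontRD (F G : C -> R) : ccontR F -> ccontR G -> ccontR (fun z => F z + G z).
Proof.
move=> cF cG z k k0; have k20 : 0 < k / 2 by rewrite divr_gt0.
have [r1 r10 H1] := cF z _ k20; have [r2 r20 H2] := cG z _ k20.
exists (Num.min r1 r2); first by rewrite lt_min r10.
move=> z'; rewrite le_min => /andP[/H1 h1 /H2 h2].
have -> : F z' + G z' - (F z + G z) = (F z' - F z) + (G z' - G z) by ring.
by rewrite (le_trans (ler_normD _ _))// [k]splitr lerD.
Qed.

Lemma cdiff_cont_at f z : cdiff f z -> forall k : R, 0 < k -> exists2 r : R, 0 < r &
  forall z', nc (z' - z) <= r -> nc (f z' - f z) <= k.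
Proof.
move=> [D /cderiv_lip[r r0 H]] k k0.
have A0 : 0 < nc D + 1 by rewrite ltr_wpDl// normc_ge0.
exists (Num.min r (k / (nc D + 1))); first by rewrite lt_min r0 divr_gt0.
move=> z'; rewrite le_min => /andP[/H h1 h2]; apply: le_trans h1 _.
by rewrite mulrC -ler_pdivlMr.
Qed.

Lemma ccont_comp f g : ccont g -> ccont f -> ccont (f \o g).
Proof.
move=> cg cf z k /(cf (g z))[r r0 H]; have [r' r'0 H'] := cg z _ r0.
by exists r' => // z' /H'/H.
Qed.

Lemma ccont_path (F : C -> R) (h : R -> C) : ccontR F ->
  (forall x y, nc (h x - h y) <= `|x - y|) -> continuous (F \o h).
Proof.
move=> cF lh x; apply/cvgrPdist_le => /= k k0.
have [r r0 H] := cF (h x) k k0.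
apply/nbhs_ballP; exists r => //= y xy; rewrite distrC; apply: H.
by rewrite (le_trans (lh _ _))// distrC ltW.
Qed.

Lemma ccont_plane (F : C -> R) : ccontR F -> continuous (fun p : R * R => F (p.1 +i* p.2)).
Proof.
move=> cF [x y]; apply/cvgrPdist_le => /= k k0.
have [r r0 H] := cF (x +i* y) k k0.
exists (ball x (r / 2), ball y (r / 2)) => /=.
  by split; apply: nbhsx_ballx; rewrite divr_gt0.
move=> [x' y'] [/= hx hy]; rewrite distrC; apply: H.
rewrite (le_trans (normc_le_ReIm _))//= [r]splitr lerD// distrC ltW//.
Qed.

Lemma disc_max (F : C -> R) (r : R) : 0 <= r -> ccontR F ->
  exists2 z, nc z <= r & forall z', nc z' <= r -> F z' <= F z.
Proof.
move=> r0 cF.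
pose A := [set p : R * R | nc (p.1 +i* p.2) <= r].
have cn : ccontR nc by apply: (@ccont_normc id) => z k k0; exists k.
have clA : closed A.
  have := @closed_comp _ _ (fun p : R * R => nc (p.1 +i* p.2)) [set x | x <= r].
  apply; last exact: closed_le.
  by move=> p _; exact: ccont_plane.
have cA : compact A.
  apply: (@subclosed_compact _ _ (`[- r, r] `*` `[- r, r])) => //.
    by apply: compact_setX; exact: segment_compact.
  move=> [x y] /= h; split => /=; rewrite in_itv/= -ler_norml.
    exact: le_trans (ler_Re (x +i* y)) h.
  exact: le_trans (ler_Im (x +i* y)) h.
have A0 : A !=set0 by exists (0, 0); rewrite /A /= expr0n/= addr0 sqrtr0.
have [[x y] cAx H] := compact_EVT_max A0 cA (continuous_subspaceT (ccont_plane cF)).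
exists (x +i* y); first by move: cAx; rewrite inE.
by move=> [x' y'] h; apply: (H (x', y')); rewrite inE.
Qed.

Lemma cdiff_shift c z : cdiff (fun w => c + w) z.
Proof. by exists (0 + 1); apply: cderivD; [exact: cderiv_cst|exact: cderiv_id]. Qed.

Lemma cdiff_scale a f z : cdiff f z -> cdiff (fun w => a * f w) z.
Proof. by move=> [D H]; exists (0 * f z + a * D); apply: cderivM => //; exact: cderiv_cst. Qed.

Lemma expc_eq0 w : nc (expc w) = expR (Re w).
Proof.
by rewrite /expc /= !exprMn -mulrDr cos2Dsin2 mulr1 sqrtr_sqr ger0_norm// expR_ge0.
Qed.

(* The change of variable [z = c + exp w] turns the circles centered at [c] into
   vertical segments, and the punctured disc into a half plane; nothing is
   required of [f] at [c] besides continuity. *)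
Lemma mean_value f c (r : R) (th : C) : ccont f -> 0 < r ->
  (forall z, 0 < nc (z - c) <= r -> cdiff f z) ->
  let phi t := Re (th * f (c + (r * cos t) +i* (r * sin t))) in
  prim phi (2 * pi) - prim phi 0 = 2 * pi * Re (th * f c).
Proof.
move=> cf r0 df phi.
pose g w := th * f (c + expc w).
have ce : ccont (@expc R) by move=> z; apply: cdiff_cont_at; exists (expc z); exact: cderiv_expc.
have cce : ccont (fun w => c + expc w).
  by apply: (@ccont_comp (fun w => c + w)) => // z; exact: cdiff_cont_at (cdiff_shift _ _).
have cg : ccont g.
  apply: (@ccont_comp (fun w => th * w)); first exact: ccont_comp cce cf.
  by move=> z; apply: cdiff_cont_at; apply: cdiff_scale; exists 1; exact: cderiv_id.
have dg w : Re w <= ln r -> cdiff g w.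
  move=> wr; apply: cdiff_scale; apply: (@cdiff_comp _ f (fun w => c + expc w)).
    apply: (@cdiff_comp _ (fun w => c + w)); last exact: cdiff_shift.
    by exists (expc w); exact: cderiv_expc.
  apply: df; rewrite addrC addKr expc_eq0 expR_gt0/=.
  by rewrite -[leRHS]lnK ?posrE// ler_expR.
pose u s t := Re (g (s +i* t)); pose v s t := Im (g (s +i* t)).
have cu s : continuous (u s).
  apply: (@ccont_path (Re \o g) (fun t => s +i* t)); first exact: ccont_Re.
  by move=> x y; rewrite (le_trans (normc_le_ReIm _))//= subrr normr0 add0r.
have cv t : continuous (v^~ t).
  apply: (@ccont_path (Im \o g) (fun s => s +i* t)); first exact: ccont_Im.
  by move=> x y; rewrite (le_trans (normc_le_ReIm _))//= subrr normr0 addr0.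
have CR s t : s <= ln r -> cauchy_riemann_at u v s t.
  move=> sr; have [[a b] D] := dg (s +i* t) sr; exists a, b => k k0.
  have [e e0 He] := D k k0; exists (e / 2); first by rewrite divr_gt0.
  move=> s' t' hs ht; have := He (s' +i* t').
  rewrite (le_trans (normc_le_ReIm _)); last by rewrite /= [e]splitr lerD.
  move=> /(_ isT) h.
  have {}h : nc (g (s' +i* t') - g (s +i* t) - (a +i* b) * (s' +i* t' - s +i* t)) <=
             k * (`|s' - s| + `|t' - t|).
    by rewrite (le_trans h)// ler_pM2l// (le_trans (normc_le_ReIm _)).
  by split; [apply: le_trans (le_trans (ler_Re _) h)|apply: le_trans (le_trans (ler_Im _) h)];
    rewrite /u /v; case: (g _) => ? ?; case: (g _) => ? ? /=; rewrite le_eqVlt; apply/orP; left;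
    apply/eqP; congr `|_|; ring.
pose I s := prim (u s) (2 * pi) - prim (u s) 0.
have pi2 : 0 <= 2 * pi :> R by rewrite mulr_ge0// pi_ge0.
have Ieq s : s <= ln r -> I (ln r) = I s.
  move=> sr.
  have := @rect_int0 _ u v cu cv s 0 (ln r - s) (2 * pi) _ pi2 _.
  rewrite subr_ge0 sr => /(_ isT) H.
  have := H (fun s' t' => _); rewrite /rect_int !add0r addrC subrK.
  have -> : v^~ (2 * pi) = v^~ 0.
    apply/funext => x; rewrite /v /g /expc /= mulr_natl cos2pi sin2pi cos0 sin0 //.
  rewrite subrr add0r => h; apply/eqP; rewrite -subr_eq0; apply/eqP; apply: h.
  by move=> x t /andP[_ xr] _; apply: CR.
have Iphi : prim phi (2 * pi) - prim phi 0 = I (ln r).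
  rewrite /I (_ : u (ln r) = phi)//; apply/funext => t.
  by rewrite /u /g /phi /expc /= lnK ?posrE.
rewrite Iphi; apply/eqP; rewrite -subr_eq0 -normr_le0; apply/ler_addgt0Pl => k k0.
rewrite addr0.
have pp : 0 < 2 * pi :> R by rewrite mulr_gt0// pi_gt0.
pose k' := k / (2 * pi).
have k'0 : 0 < k' by rewrite divr_gt0.
have [e e0 He] : exists2 r : R, 0 < r & forall z', nc (z' - c) <= r ->
    nc (th * f z' - th * f c) <= k'.
  have cthf : ccont (fun z => th * f z).
    apply: (@ccont_comp (fun w => th * w)) => // z; apply: cdiff_cont_at.
    by apply: cdiff_scale; exists 1; exact: cderiv_id.
  exact: cthf.
pose s := Num.min (ln r) (ln e).
rewrite (Ieq s) ?ge_min ?lexx//.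
have := @primitive_close _ (prim (u s)) (prim (cst 0)) (u s) (cst 0) 0 (2 * pi)
  (Re (th * f c)) k' pi2 (primP (@cu s)) (primP (@cst_continuous _ _ _)).
have -> : prim (cst 0) (2 * pi) - prim (cst 0) 0 = 0 :> R.
  have := @mean_value_ineq _ (prim (cst 0 : R -> R)) (cst 0) 0 (2 * pi) 0 pi2
    (fun x _ => primP (@cst_continuous _ _ _) x).
  rewrite mul0r => h; apply/eqP; rewrite -normr_le0; apply: h => x _.
  by rewrite normr0.
move=> H; have -> : k = k' * (2 * pi - 0) by rewrite subr0 /k' divfK ?gt_eqF.
have -> : I s - 2 * pi * Re (th * f c) = prim (u s) (2 * pi) - prim (u s) 0 - 0 -
  Re (th * f c) * (2 * pi - 0) by rewrite /I; ring.
apply: H => t _; rewrite /= subr0 /u -raddfB /=.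
apply: le_trans (ler_Re _) _; apply: He; rewrite addrC addKr expc_eq0 /=.
by rewrite -[leRHS]lnK ?posrE// ler_expR ge_min lexx orbT.
Qed.

End MeanValue.

Section MaximumPrinciple.
Variable R : realType.
Local Notation C := R[i].
Local Open Scope complex_scope.
Local Notation nc := (@ComplexField.Normc.normc R).
Local Notation Re := (@complex.Re R).
Local Notation Im := (@complex.Im R).
Implicit Types (f g : C -> C) (z w : C).

Lemma seq_sep (Z : seq C) (c : C) : exists2 r : R, 0 < r &
  forall z, 0 < nc (z - c) <= r -> z \notin Z.
Proof.
elim: Z => [|x Z [r r0 H]]; first by exists 1.
have [xc|xc] := eqVneq x c.
  exists r => // z /andP[z0 zr]; rewrite inE negb_or H ?z0// andbT xc.
  by rewrite -subr_eq0 -normc_gt0.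
exists (Num.min r (nc (x - c) / 2)).
  by rewrite lt_min r0 divr_gt0// normc_gt0 subr_eq0.
move=> z /andP[z0]; rewrite le_min => /andP[zr zx]; rewrite inE negb_or H ?z0// andbT.
apply/eqP => zxE; move: zx z0; rewrite zxE; lra.
Qed.

Lemma maximum_principle f (r M : R) (Z : seq C) : ccont f ->
  (forall z, nc z < r -> z \notin Z -> cdiff f z) ->
  (forall z, nc z = r -> nc (f z) <= M) -> forall z, nc z <= r -> nc (f z) <= M.
Proof.
move=> cf df fM z0 z0r; rewrite leNgt; apply/negP => MF.
have r0 : 0 <= r by rewrite (le_trans (normc_ge0 z0)).
pose eta := (nc (f z0) - M) / (2 * (r ^+ 2 + 1)).
have D0 : 0 < 2 * (r ^+ 2 + 1) by rewrite mulr_gt0// ltr_wpDl// sqr_ge0.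
have eta0 : 0 < eta by rewrite divr_gt0// subr_gt0.
have etar : eta * r ^+ 2 < nc (f z0) - M.
  rewrite /eta mulrAC ltr_pdivrMr// ltr_pM2l ?subr_gt0//.
  have := sqr_ge0 r; lra.
clearbody eta; clear D0.
pose F z := nc (f z) + eta * nc z ^+ 2.
have cF : ccontR F.
  apply: ccontRD; first exact: ccont_normc.
  move=> z k k0.
  pose A := eta * (2 * nc z + 1).
  have A0 : 0 < A by rewrite mulr_gt0// ltr_wpDl// mulr_ge0// normc_ge0.
  exists (Num.min 1 (k / A)); first by rewrite lt_min ltr01 divr_gt0.
  move=> z'; rewrite le_min => /andP[h1 h2].
  have -> : eta * nc z' ^+ 2 - eta * nc z ^+ 2 = (nc z' - nc z) * ((nc z' + nc z) * eta) by ring.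
  rewrite !normrM.
  have -> : k = (k / A) * A by rewrite divfK ?gt_eqF.
  have e1 : `|nc z' - nc z| <= k / A by rewrite (le_trans (ler_dist_normc _ _)).
  have e2 : `|nc z' + nc z| * `|eta| <= A.
    rewrite /A mulrC gtr0_norm// ler_pM2l// ger0_norm ?addr_ge0 ?normc_ge0//.
    have := ler_normcD (z' - z) z; rewrite subrK; lra.
  by apply: ler_pM => //; exact: mulr_ge0.
have [z zr zmax] := disc_max r0 cF.
have z_lt : nc z < r.
  rewrite lt_neqAle zr andbT; apply/eqP => zE.
  have := zmax _ z0r; rewrite /F zE.
  have := fM _ zE; have : 0 <= eta * nc z0 ^+ 2 by rewrite mulr_ge0// ?sqr_ge0 ?ltW.
  lra.
have [e e0 He] := seq_sep Z z.
pose d := Num.min e ((r - nc z) / 2).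
have rz : 0 < (r - nc z) / 2 by rewrite divr_gt0// subr_gt0.
have d0 : 0 < d by rewrite lt_min e0.
have dz w : nc (w - z) <= d -> nc w < r.
  rewrite le_min => /andP[_ h]; have := ler_normcD (w - z) z; rewrite subrK.
  move: z_lt; lra.
have fz0 : f z != 0.
  apply/eqP => fz; have := zmax _ z0r; rewrite /F fz normc0.
  have h1 : eta * nc z ^+ 2 <= eta * r ^+ 2.
    by rewrite ler_pM2l// ler_pXn2r ?nnegrE ?normc_ge0.
  have : 0 <= eta * nc z0 ^+ 2 by rewrite mulr_ge0// ?sqr_ge0 ?ltW.
  have : 0 <= M.
    have := fM (r%:C); rewrite normc_real ger0_norm// => /(_ erefl); apply: le_trans.
    exact: normc_ge0.
  lra.
pose th := (f z)^*%C / (nc (f z))%:C.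
have nf0 : 0 < nc (f z) by rewrite normc_gt0.
have nth1 : nc th = 1.
  rewrite /th normcM normcV normc_real gtr0_norm//.
  have -> : nc (f z)^*%C = nc (f z) by case: (f z) => a b /=; rewrite sqrrN.
  by rewrite divff// gt_eqF.
have thf : Re (th * f z) = nc (f z).
  have -> : th * f z = (nc (f z))%:C.
    rewrite /th mulrAC [_^* * _]mulrC.
    have -> : f z * (f z)^*%C = (nc (f z))%:C * (nc (f z))%:C.
      rewrite -rmorphM /= -expr2 normc_sqr; case: (f z) => a b /=.
      by apply/eqP; rewrite eq_complex /=; apply/andP; split; apply/eqP; ring.
    by rewrite mulfK// -normc_eq0 normc_real normr_eq0 gt_eqF.
  by [].
have := @mean_value R f z d th cf d0; rewrite thf => /(_ _) mv.
pose phi t := Re (th * f (z + (d * cos t) +i* (d * sin t))).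
have cphi : continuous phi.
  have cdz (a b : C) : ccont (fun w => a * w + b).
    move=> w; apply: cdiff_cont_at; exists ((0 * w + a * 1) + 0).
    apply: (@cderivD _ (fun w => a * w)); last exact: cderiv_cst.
    by apply: (@cderivM _ (fun=> a) id); [exact: cderiv_cst|exact: cderiv_id].
  have cthf : ccont (fun w => th * f w + 0) by exact: ccont_comp cf (cdz th 0).
  move=> t; apply/cvgrPdist_le => /= k k0.
  have [b b0 Hb] := ccont_Re cthf (z + (d * cos t) +i* (d * sin t)) k0.
  have /cvgrPdist_le H1 := @continuous_cos R t.
  have /cvgrPdist_le H2 := @continuous_sin R t.
  have bd0 : 0 < b / (2 * d) by rewrite divr_gt0// mulr_gt0.
  near=> t'; have h1 : `|cos t' - cos t| <= b / (2 * d) by rewrite distrC; near: t'; exact: H1.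
  have h2 : `|sin t' - sin t| <= b / (2 * d) by rewrite distrC; near: t'; exact: H2.
  have := Hb (z + (d * cos t') +i* (d * sin t')); rewrite /= !addr0 => h.
  rewrite /phi distrC; apply: h.
  rewrite opprD addrACA subrr add0r (le_trans (normc_le_ReIm _))//=.
  rewrite -!mulrBr !normrM (gtr0_norm d0) [b]splitr.
  have -> : b / 2 = d * (b / (2 * d)) by field; rewrite gt_eqF.
  by apply: lerD; rewrite ler_pM2l.
pose psi t := nc (f z) - eta * d ^+ 2 - 2 * eta * d * (Re z * cos t + Im z * sin t).
have phipsi t : phi t <= psi t.
  have nd : nc ((d * cos t) +i* (d * sin t)) = d.
    by rewrite /= !exprMn -mulrDr cos2Dsin2 mulr1 sqrtr_sqr gtr0_norm.
  set w := (d * cos t) +i* (d * sin t) in nd.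
  have := zmax (z + w); rewrite ltW; last by apply: dz; rewrite addrC addKr nd.
  move=> /(_ isT); rewrite /F !normc_sqr.
  have : phi t <= nc (f (z + w)).
    apply: le_trans (ler_norm _) _; apply: le_trans (ler_Re _) _.
    by rewrite normcM nth1 mul1r.
  rewrite /psi; have := cos2Dsin2 t.
  rewrite {1}/w; case: (z) => a b /=.
  have -> : eta * ((a + d * cos t) ^+ 2 + (b + d * sin t) ^+ 2) =
    eta * (a ^+ 2 + b ^+ 2) + eta * d ^+ 2 * (cos t ^+ 2 + sin t ^+ 2) +
     2 * eta * d * (a * cos t + b * sin t) by ring.
  move=> ->; lra.
pose Psi t := (nc (f z) - eta * d ^+ 2) * t - 2 * eta * d * (Re z * sin t - Im z * cos t).
have dPsi (t : R) : is_derive t 1 Psi (psi t).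
  have -> : Psi = (nc (f z) - eta * d ^+ 2) *: id - (2 * eta * d) *: (Re z *: sin - Im z *: cos).
    by apply/funext.
  apply: is_derive_eq; rewrite /psi [_ *: 1]mulr1; congr (_ - _).
  by rewrite scalerN opprK.
have pp : 0 < 2 * pi :> R by rewrite mulr_gt0// pi_gt0.
have [c _ cE] : exists2 c, 0 <= c <= 2 * pi & (prim phi - Psi) (2 * pi) - (prim phi - Psi) 0 =
    (phi c - psi c) * (2 * pi - 0).
  apply: mvt_segment; first exact: ltW.
  by move=> t _; apply: is_deriveB; exact: primP.
have : (phi c - psi c) * (2 * pi - 0) <= 0.
  rewrite subr0; apply: mulr_le0_ge0; last exact: ltW.
  by rewrite subr_le0.
rewrite -cE !fctE.
have PE : Psi (2 * pi) - Psi 0 = (nc (f z) - eta * d ^+ 2) * (2 * pi).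
  by rewrite /Psi mulr_natl cos2pi sin2pi cos0 sin0; ring.
have : prim phi (2 * pi) - prim phi 0 = 2 * pi * nc (f z).
  apply: mv; move=> w' /andP[w0 wd]; apply: df; first exact: dz.
  by apply: He; rewrite w0 (le_trans wd)// ge_min lexx.
have : 0 < eta * d ^+ 2 * (2 * pi).
  by apply: mulr_gt0 => //; apply: mulr_gt0 => //; exact: exprn_gt0.
by move: PE; clear; lra.
Unshelve. all: by end_near.
Qed.

End MaximumPrinciple.

Section DividedDifferences.
Variable R : realType.
Local Notation C := R[i].
Local Open Scope complex_scope.
Local Notation nc := (@ComplexField.Normc.normc R).
Implicit Types (f g : C -> C) (z w c D : C).

Definition disc_hol f (r : R) (Z : seq C) (M : R) := [/\ ccont f,
  forall z, nc z < r -> z \notin Z -> cdiff f z & forall z, nc z = r -> nc (f z) <= M].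

Lemma disc_hol_le f r Z M : disc_hol f r Z M -> forall z, nc z <= r -> nc (f z) <= M.
Proof. by move=> [cf df fM]; exact: maximum_principle cf df fM. Qed.

Definition divdiff f c D z := if z == c then D else (f z - f c) / (z - c).

Lemma divdiffE f c D z : f z = f c + (z - c) * divdiff f c D z.
Proof.
rewrite /divdiff; case: eqP => [->|/eqP zc]; first by rewrite subrr mul0r addr0.
by rewrite mulrC divfK ?subr_eq0// addrC subrK.
Qed.

Lemma cderiv_near f g z D (r : R) : 0 < r -> (forall w, nc (w - z) <= r -> f w = g w) ->
  cderiv f z D -> cderiv g z D.
Proof.
move=> r0 fg df k k0; have [e e0 H] := df k k0.
exists (Num.min r e); first by rewrite lt_min r0.
move=> w; rewrite le_min => /andP[wr we]; rewrite -fg// -[g z]fg; first exact: H.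
by rewrite subrr normc0 ltW.
Qed.

Lemma divdiff_cdiff f c D z : z != c -> cdiff f z -> cdiff (divdiff f c D) z.
Proof.
move=> zc [D' df].
have d1 : cderiv (fun w => f w + (- f c)) z (D' + 0) by apply: cderivD => //; exact: cderiv_cst.
have d2 : cderiv (fun w => w + - c) z (1 + 0).
  by apply: cderivD; [exact: cderiv_id|exact: cderiv_cst].
have zc0 : z - c != 0 by rewrite subr_eq0.
have d3 := @cderiv_comp _ GRing.inv (fun w => w + - c) z _ _ d2 (cderivV zc0).
have n0 : 0 < nc (z - c) by rewrite normc_gt0.
have n20 : 0 < nc (z - c) / 2 by rewrite divr_gt0.
eexists; apply: (cderiv_near n20 _ (cderivM d1 d3)) => w wz.
rewrite /divdiff; case: eqP => // wc; exfalso.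
by move: wz; rewrite wc normcB; move: n0; clear; lra.
Qed.

Lemma divdiff_ccont f c D : ccont f -> cderiv f c D -> ccont (divdiff f c D).
Proof.
move=> cf df z k k0.
have [->|zc] := eqVneq z c.
  have [r r0 H] := df k k0; exists r => // w /H h.
  rewrite /divdiff eqxx; case: eqP => [_|/eqP wc]; first by rewrite subrr normc0 ltW.
  have w0 : 0 < nc (w - c) by rewrite normc_gt0 subr_eq0.
  rewrite -(ler_pM2r w0) -normcM mulrBl divfK ?subr_eq0//.
have zc0 : z - c != 0 by rewrite subr_eq0.
have n0 : 0 < nc (z - c) by rewrite normc_gt0.
have [r1 r10 H1] : exists2 r : R, 0 < r & forall w, nc (w - (z - c)) <= r ->
    nc (w^-1 - (z - c)^-1) <= Num.min 1 (k / (2 * (nc (f z - f c) + 1))).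
  apply: cdiff_cont_at; first by exists (- (z - c) ^- 2); exact: cderivV.
  by rewrite lt_min ltr01 divr_gt0// mulr_gt0// ltr_wpDl// normc_ge0.
have B0 : 0 < 1 + (nc (z - c))^-1 by rewrite ltr_wpDr// invr_ge0 ltW.
have [r2 r20 H2] := cf z (k / (2 * (1 + (nc (z - c))^-1))) (divr_gt0 k0 (mulr_gt0 (ltr0Sn R 1) B0)).
exists (Num.min (nc (z - c) / 2) (Num.min r1 r2)).
  by rewrite !lt_min r10 r20 divr_gt0.
move=> w; rewrite !le_min => /andP[h0 /andP[h1 /H2 h2]].
have wc : w != c.
  by apply/eqP => wc; move: h0; rewrite wc normcB; lra.
have := H1 (w - c); rewrite opprB addrA subrK => /(_ h1); rewrite le_min => /andP[h3 h4].
rewrite /divdiff (negbTE zc) (negbTE wc).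
have -> : (f w - f c) / (w - c) - (f z - f c) / (z - c) =
  (f w - f z) * ((w - c)^-1 - (z - c)^-1 + (z - c)^-1) + (f z - f c) * ((w - c)^-1 - (z - c)^-1) by ring.
apply: le_trans (ler_normcD _ _) _; rewrite !normcM.
have a1 : nc ((w - c)^-1 - (z - c)^-1 + (z - c)^-1) <= 1 + (nc (z - c))^-1.
  by apply: le_trans (ler_normcD _ _) _; rewrite normcV lerD.
have a2 : nc (f w - f z) * nc ((w - c)^-1 - (z - c)^-1 + (z - c)^-1) <= k / 2.
  apply: le_trans (ler_pM (normc_ge0 _) (normc_ge0 _) h2 a1) _.
  have E (B : R) : 0 < B -> k / (2 * B) * B = k / 2 by move=> B'0; field; rewrite gt_eqF.
  by rewrite E.
have F0 := normc_ge0 (f z - f c).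
have a3 : nc (f z - f c) * nc ((w - c)^-1 - (z - c)^-1) <= k / 2.
  apply: le_trans (ler_wpM2l F0 h4) _.
  rewrite mulrCA ler_pM2l// invfM mulrCA -[leRHS]mulr1 ler_pM2l ?invr_gt0//.
  rewrite ler_pdivrMr ?ltr_wpDl//; lra.
by rewrite [k]splitr lerD.
Qed.

Lemma divdiff_hol f (r M : R) Z c D : disc_hol f r Z M -> nc c < r -> cderiv f c D ->
  disc_hol (divdiff f c D) r (c :: Z) (2 * M / (r - nc c)).
Proof.
move=> Hf cr df; have fM := disc_hol_le Hf; have [cf dfZ _] := Hf; split.
- exact: divdiff_ccont.
- move=> z zr; rewrite inE negb_or => /andP[zc zZ].
  exact: divdiff_cdiff (dfZ _ zr zZ).
move=> z zr; rewrite /divdiff; case: eqP => [zc|/eqP zc]; first by rewrite -zc zr ltxx in cr.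
have rc : 0 < r - nc c by rewrite subr_gt0.
have h : r - nc c <= nc (z - c).
  by rewrite -zr lerBlDr; have := ler_normcD (z - c) c; rewrite subrK.
rewrite normcM normcV ler_pM ?normc_ge0// ?invr_ge0 ?normc_ge0//.
  apply: le_trans (ler_normcB _ _) _; have := fM z; have := fM c.
  rewrite (ltW cr) zr lexx => /(_ isT) h1 /(_ isT) h2; lra.
by rewrite lef_pV2// posrE// (lt_le_trans rc).
Qed.

Lemma disc_hol_ge0 f (r M : R) Z : 0 <= r -> disc_hol f r Z M -> 0 <= M.
Proof.
move=> r0 [_ _ /(_ r%:C)]; rewrite normc_real ger0_norm// => /(_ erefl).
exact: le_trans (normc_ge0 _).
Qed.

(* Lagrange interpolation at points close to the center, with Newton's
   recursive description of the interpolation polynomial: the error decays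
   geometrically in the number of nodes. *)
Lemma interpolation (r x : R) (xs : seq R) : 0 < r -> `|x| <= r / 8 -> uniq xs ->
  (forall y, y \in xs -> `|y| <= r / 8) ->
  exists a : R -> R, forall f M Z, disc_hol f r Z M -> (forall y, y \in xs -> y%:C \notin Z) ->
    nc (f x%:C - \sum_(y <- xs) (a y)%:C * f y%:C) <= M * (4 / 7) ^+ size xs.
Proof.
move=> r0 xr; elim: xs => [_ _|y ys IH].
  exists (fun=> 0) => f M Z Hf _; rewrite big_nil subr0 expr0 mulr1.
  apply: (disc_hol_le Hf); rewrite normc_real; move: xr; lra.
rewrite cons_uniq => /andP[yys uys] ysr.
have [|a Ha] := IH uys; first by move=> u uys'; apply: ysr; rewrite inE uys' orbT.
pose b u := (x - y) * a u / (u - y).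
exists (fun u => if u == y then 1 - \sum_(v <- ys) b v else b u) => f M Z Hf HZ.
have yr : `|y| <= r / 8 by apply: ysr; rewrite inE eqxx.
have ycr : nc y%:C < r by rewrite normc_real; move: yr; lra.
have [_ /(_ _ ycr) + _] := Hf.
rewrite HZ ?inE ?eqxx// => /(_ isT)[D dfD].
have H1 := divdiff_hol Hf ycr dfD.
have {Ha} := Ha _ _ _ H1; set g := divdiff _ _ _ => Ha.
have HN u : u \in ys -> u != y by move=> uy; apply/eqP => uE; rewrite -uE uy in yys.
have -> : f x%:C - \sum_(u <- y :: ys) (if u == y then 1 - \sum_(v <- ys) b v else b u)%:C * f u%:C =
   (x - y)%:C * (g x%:C - \sum_(u <- ys) (a u)%:C * g u%:C).
  rewrite big_cons eqxx (divdiffE f y%:C D x%:C) -/g.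
  have -> : \sum_(u <- ys) (if u == y then 1 - \sum_(v <- ys) b v else b u)%:C * f u%:C =
     \sum_(u <- ys) ((b u)%:C * f y%:C + (x - y)%:C * ((a u)%:C * g u%:C)).
    apply: eq_big_seq => u uy; rewrite (negbTE (HN _ uy)) (divdiffE f y%:C D u%:C) -/g.
    rewrite mulrDr; congr (_ + _); rewrite mulrA -!rmorphB -rmorphM /= mulrA -rmorphM /=.
    by rewrite /b divfK// subr_eq0 HN.
  rewrite big_split/= -mulr_suml -mulr_sumr rmorphB rmorph_sum/= rmorph1 -rmorphB.
  ring.
have hh : nc (x - y)%:C <= r / 4.
  by rewrite normc_real (le_trans (ler_normB _ _))//; move: xr yr; lra.
have M0 := disc_hol_ge0 (ltW r0) Hf.
rewrite normcM /=.
have yb : 7 / 8 * r <= r - nc y%:C by rewrite normc_real; move: yr; lra.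
have r78 : 0 < 7 / 8 * r by rewrite mulr_gt0.
apply: le_trans (ler_pM (normc_ge0 _) (normc_ge0 _) hh (Ha _)) _.
  move=> u uy; rewrite inE negb_or; apply/andP; split; last by rewrite HZ// inE uy orbT.
  by rewrite (inj_eq (@complexI _)) HN.
have -> : M * (4 / 7) ^+ (size ys).+1 = r / 4 * (2 * M / (7 / 8 * r) * (4 / 7) ^+ size ys).
  by rewrite exprS; field; rewrite gt_eqF.
rewrite ler_pM2l ?divr_gt0// ler_wpM2r ?exprn_ge0// ler_wpM2l ?mulr_ge0//.
by rewrite lef_pV2 ?posrE// (lt_le_trans r78).
Qed.

Lemma disc_hol_lip f (r M : R) D : 0 < r -> disc_hol f r [::] M -> cderiv f 0 D ->
  nc D <= 2 * M / r /\ forall h, nc h <= r -> nc (f h - f 0) <= 2 * M / r * nc h.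
Proof.
move=> r0 Hf df; have n0r : nc 0 < r by rewrite normc0.
have H1 := divdiff_hol Hf n0r df; rewrite normc0 subr0 in H1.
have := disc_hol_le H1; set g := divdiff _ _ _ => gM; split.
  by have := gM 0; rewrite /g /divdiff eqxx; apply; rewrite ltW.
move=> h hr; rewrite (divdiffE f 0 D h) addrC addKr subr0 normcM mulrC.
by rewrite ler_wpM2r ?normc_ge0// gM.
Qed.

Lemma disc_hol_taylor2 f (r M : R) D : 0 < r -> disc_hol f r [::] M -> cderiv f 0 D ->
  forall h, nc h <= r / 2 -> nc (f h - f 0 - D * h) <= 8 * M / r ^+ 2 * nc h ^+ 2.
Proof.
move=> r0 Hf df h hr; have n0r : nc 0 < r by rewrite normc0.
have H1 := divdiff_hol Hf n0r df; rewrite normc0 subr0 in H1.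
have [->|h0] := eqVneq h 0.
  by rewrite mulr0 subrr subr0 normc0 expr0n mulr0.
have hlt : nc h < r by rewrite (le_lt_trans hr)// ltr_pdivrMr// ltr_pMr ?ltr1n.
have [_ /(_ _ hlt) + _] := H1.
rewrite inE h0 => /(_ isT)[D' dg].
have H2 := divdiff_hol H1 hlt dg.
have := disc_hol_le H2 (ltW n0r : nc 0 <= r).
rewrite {1}/divdiff eq_sym (negbTE h0) {1}/divdiff eqxx sub0r.
have M0 := disc_hol_ge0 (ltW r0) Hf.
set g := divdiff f 0 D => H.
have h00 : 0 < nc h by rewrite normc_gt0.
have E : f h - f 0 - D * h = (D - g h) / - h * h ^+ 2.
  have -> : f h = f 0 + (h - 0) * g h by exact: divdiffE.
  by field.
rewrite E normcM.
have -> : nc (h ^+ 2) = nc h ^+ 2 by rewrite !expr2 normcM.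
rewrite ler_wpM2r ?exprn_ge0 ?normc_ge0//.
apply: le_trans H _.
have -> : 8 * M / r ^+ 2 = 2 * (2 * M / r) / (r / 2) by field; rewrite gt_eqF.
rewrite ler_wpM2l//; first by rewrite !mulr_ge0// invr_ge0 ltW.
by rewrite lef_pV2 ?posrE ?subr_gt0// ?divr_gt0//; move: hr; lra.
Qed.

End DividedDifferences.

(** * Entire maps between normed spaces *)

Section ComplexNormedModules.
Variable R : realType.
Local Notation C := R[i].
Local Open Scope complex_scope.
Local Notation nc := (@ComplexField.Normc.normc R).
Local Notation Re := (@complex.Re R).

Lemma subrBACA (V : zmodType) (a b c d : V) : a - b - (c - d) = a - c - (b - d).
Proof. by rewrite !opprD addrACA. Qed.

Definition rnorm (V : normedModType C) (v : V) : R := Re `|v|.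

Section Rnorm.
Variable V : normedModType C.
Implicit Types (v w : V).

Lemma rnormE v : `|v| = (rnorm v)%:C.
Proof.
rewrite /rnorm; have : 0 <= `|v| by [].
by rewrite lecE; case: (`|v|) => a b /= /andP[/eqP-> _].
Qed.

Lemma rnorm_ge0 v : 0 <= rnorm v.
Proof. by rewrite -ler0c -rnormE. Qed.

Lemma ler_rnormD v w : rnorm (v + w) <= rnorm v + rnorm w.
Proof. by have := ler_normD v w; rewrite !rnormE -rmorphD lecR. Qed.

Lemma rnormZ (a : C) v : rnorm (a *: v) = nc a * rnorm v.
Proof. by have := normrZ a v; rewrite !rnormE normcE -rmorphM => /complexI. Qed.

Lemma rnormN v : rnorm (- v) = rnorm v.
Proof. by rewrite /rnorm normrN. Qed.

Lemma rnorm0 : rnorm (0 : V) = 0. Proof. by rewrite /rnorm normr0. Qed.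

Lemma rnorm_eq0 v : (rnorm v == 0) = (v == 0).
Proof. by rewrite -(inj_eq (@complexI R)) -rnormE normr_eq0. Qed.

Lemma rnorm_gt0 v : (0 < rnorm v) = (v != 0).
Proof. by rewrite lt_def rnorm_eq0 rnorm_ge0 andbT. Qed.

Lemma rnormB v w : rnorm (v - w) = rnorm (w - v).
Proof. by rewrite -rnormN opprB. Qed.

Lemma ler_rnormB v w : rnorm (v - w) <= rnorm v + rnorm w.
Proof. by rewrite (le_trans (ler_rnormD _ _))// rnormN. Qed.

End Rnorm.

Lemma rnorm_pair (V W : normedModType C) (x : V * W) :
  rnorm x = Num.max (rnorm x.1) (rnorm x.2).
Proof.
rewrite /rnorm prod_normE /= !rnormE /=.
have [h|h] := leP (rnorm x.1) (rnorm x.2).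
  by rewrite max_r ?lecR.
by rewrite max_l ?lecR// ltW.
Qed.

Lemma rnorm_complex (z : C^o) : rnorm z = nc z.
Proof. by rewrite /rnorm normcE. Qed.

Lemma nbhs_rnorm (V : normedModType C) (z : V) (P : set V) :
  (\forall x \near z, P x) <-> exists2 r : R, 0 < r & forall x, rnorm (x - z) <= r -> P x.
Proof.
split=> [/nbhs_ballP[e /= e0 H]|[r r0 H]].
  have [a a0 ae] : exists2 a : R, 0 < a & e = a%:C.
    by move: e0; rewrite ltcE; case: (e) => a b /= /andP[/eqP-> a0]; exists a.
  exists (a / 2); first by rewrite divr_gt0.
  move=> x xz; apply: H; rewrite -ball_normE /= distrC rnormE ae ltcR (le_lt_trans xz)//.
  by rewrite ltr_pdivrMr// ltr_pMr// ltr1n.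
apply/nbhs_ballP; exists r%:C; first by rewrite /= ltcR.
move=> x; rewrite -ball_normE /= distrC rnormE ltcR => h; apply: H; exact: ltW.
Qed.

Lemma rcontinuousP (V W : normedModType C) (f : V -> W) (z : V) :
  {for z, continuous f} <-> forall k : R, 0 < k -> exists2 r : R, 0 < r &
    forall x, rnorm (x - z) <= r -> rnorm (f x - f z) <= k.
Proof.
split=> [cf k k0|H].
  have k0' : 0 < k%:C by rewrite ltcR.
  have /cvgrPdist_le/(_ _ k0')/nbhs_rnorm[r r0 h] := cf.
  by exists r => // x /h /=; rewrite rnormB rnormE lecR.
apply/cvgrPdist_le => e e0.
have [a a0 ->] : exists2 a : R, 0 < a & e = a%:C.
  by move: e0; rewrite ltcE; case: (e) => a b /= /andP[/eqP-> a0]; exists a.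
apply/nbhs_rnorm; have [r r0 h] := H a a0; exists r => // x /h.
by rewrite rnormB rnormE lecR.
Qed.

Lemma diff_rbounded (V W : normedModType C) (f : V -> W) z : differentiable f z ->
  exists2 K : R, 0 < K & forall h, rnorm ('d f z h) <= K * rnorm h.
Proof.
move=> df; have [k k0 H] := linear_lipschitz (diff_continuous df).
have [a a0 ke] : exists2 a : R, 0 < a & k = a%:C.
  by move: k0; rewrite ltcE; case: (k) => a b /= /andP[/eqP-> a0]; exists a.
by exists a => // h; have := H h; rewrite ke !rnormE -rmorphM lecR.
Qed.

Lemma diff_reps (V W : normedModType C) (f : V -> W) z : differentiable f z ->
  forall k : R, 0 < k -> exists2 r : R, 0 < r &
    forall x, rnorm (x - z) <= r -> rnorm (f x - f z - 'd f z (x - z)) <= k * rnorm (x - z).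
Proof.
move=> df k k0; have k0' : 0 < k%:C by rewrite ltcR.
have := diff_locally df => /eqaddoP /(_ _ k0').
move=> /nbhs_rnorm[r r0 H]; exists r => // x xz.
have := H (x - z); rewrite subr0 => /(_ xz).
by rewrite !fctE/= subrK opprD addrA !rnormE -rmorphM lecR.
Qed.

Lemma reps_differentiable (V W : normedModType C) (f : V -> W) (L : V -> W) z :
  linear L -> (exists K : R, forall h, rnorm (L h) <= K * rnorm h) ->
  (forall k : R, 0 < k -> exists2 r : R, 0 < r &
    forall x, rnorm (x - z) <= r -> rnorm (f x - f z - L (x - z)) <= k * rnorm (x - z)) ->
  differentiable f z /\ forall h, 'd f z h = L h.
Proof.
move=> Ll [K LK] H.
pose L' : {linear V -> W} := HB.pack L (GRing.isLinear.Build _ _ _ _ L Ll).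
have K0 : 0 < Num.max K 0 + 1 by rewrite ltr_wpDl// le_max lexx orbT.
have cL : continuous L'.
  move=> x; apply/rcontinuousP => k k0.
  exists (k / (Num.max K 0 + 1)); first by rewrite divr_gt0.
  move=> y yx; rewrite -raddfB /=; apply: le_trans (LK _) _.
  have -> : k = (Num.max K 0 + 1) * (k / (Num.max K 0 + 1)) by rewrite mulrC divfK ?gt_eqF.
  apply: le_trans (_ : (Num.max K 0 + 1) * rnorm (y - x) <= _); last by rewrite ler_pM2l.
  by rewrite ler_wpM2r ?rnorm_ge0// ler_wpDr// le_max lexx.
have E : f \o shift z = cst (f z) + L' +o_ 0 id.
  apply/eqaddoP => e e0.
  have [a a0 ->] : exists2 a : R, 0 < a & e = a%:C.
    by move: e0; rewrite ltcE; case: (e) => a b /= /andP[/eqP-> a0]; exists a.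
  apply/nbhs_rnorm; have [r r0 h] := H a a0; exists r => // x; rewrite subr0 => xr.
  have := h (x + z); rewrite addrK => /(_ xr).
  by rewrite !fctE/= opprD addrA !rnormE -rmorphM lecR.
have dE := diff_unique cL E; split; last by move=> h; rewrite dE.
by apply/diff_locallyP; rewrite dE.
Qed.

(* Coordinate functionals: they reduce vector valued estimates to the scalar
   one variable ones. *)
Definition coordf (W : normedModType C) (l : W -> C) :=
  (forall a x y, l (a *: x + y) = a * l x + l y) /\ forall x, nc (l x) <= rnorm x.

Definition coord_norming (W : normedModType C) :=
  forall (w : W) (K : R), 0 <= K -> (forall l, @coordf W l -> nc (l w) <= K) -> rnorm w <= K.

Section Coordf.
Variables (W : normedModType C) (l : W -> C).
Hypothesis cl : coordf l.

Lemma coordfD x y : l (x + y) = l x + l y.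
Proof. by have := cl.1 1 x y; rewrite scale1r mul1r. Qed.

Lemma coordf0 : l 0 = 0.
Proof. by apply/eqP; rewrite -(inj_eq (addrI (l 0))) -coordfD !addr0. Qed.

Lemma coordfZ a x : l (a *: x) = a * l x.
Proof. by have := cl.1 a x 0; rewrite addr0 coordf0 addr0. Qed.

Lemma coordfB x y : l (x - y) = l x - l y.
Proof. by rewrite coordfD -scaleN1r coordfZ mulN1r. Qed.

End Coordf.

Lemma coord_norming_complex : coord_norming C^o.
Proof.
by move=> w K _ /(_ id); rewrite rnorm_complex; apply; split => // x; rewrite rnorm_complex.
Qed.

Lemma rnorm_coord m n (w : 'M[C]_(m, n)) i j : nc (w i j) <= rnorm w.
Proof.
have : `|w i j| <= mx_norm w.
  by rewrite mx_normE -[leLHS]nngE num_le; exact: (le_bigmax _ _ (i, j)).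
by rewrite normcE -[mx_norm w]/(`|w|) rnormE lecR.
Qed.

Lemma rnorm_mx_le m n (w : 'M[C]_(m, n)) (K : R) : 0 <= K ->
  (forall i j, nc (w i j) <= K) -> rnorm w <= K.
Proof.
move=> K0 H; have [w0|w0] := eqVneq (mx_norm w) 0.
  by rewrite (mx_norm_eq0 w0) rnorm0.
have [[i j] /= E] := mx_norm_neq0 w0.
by have := rnormE w; rewrite -[`|w|]/(mx_norm w) E normcE => /complexI <-.
Qed.

Lemma coordf_mx m n i j : @coordf 'M[C]_(m, n) (fun w => w i j).
Proof. by split=> [a x y|w]; [rewrite !mxE|exact: rnorm_coord]. Qed.

Lemma coord_norming_mx m n : coord_norming 'M[C]_(m, n).
Proof.
by move=> w K K0 H; apply: rnorm_mx_le => // i j; exact: H (coordf_mx i j).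
Qed.

Lemma coordf_fst (V W : normedModType C) (l : V -> C) : coordf l ->
  @coordf (V * W)%type (fun x => l x.1).
Proof.
move=> [h1 h2]; split=> [a x y|x]; first exact: h1.
by rewrite rnorm_pair le_max h2.
Qed.

Lemma coordf_snd (V W : normedModType C) (l : W -> C) : coordf l ->
  @coordf (V * W)%type (fun x => l x.2).
Proof.
move=> [h1 h2]; split=> [a x y|x]; first exact: h1.
by rewrite rnorm_pair le_max h2 orbT.
Qed.

Lemma coord_norming_pair (V W : normedModType C) : coord_norming V ->
  coord_norming W -> coord_norming (V * W)%type.
Proof.
move=> nV nW w K K0 H; rewrite rnorm_pair ge_max; apply/andP; split.
  by apply: nV => // l cl; exact: (H _ (coordf_fst W cl)).
by apply: nW => // l cl; exact: (H _ (coordf_snd V cl)).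
Qed.

Section EntireEstimates.
Variables V W : normedModType C.
Variable f : V -> W.
Hypothesis df : forall x, differentiable f x.

Lemma line_cderiv l z u (a : C) : coordf l ->
  cderiv (fun a => l (f (z + a *: u))) a (l ('d f (z + a *: u) u)).
Proof.
move=> cl k k0; set y := z + a *: u.
have u0 : 0 < rnorm u + 1 by rewrite ltr_wpDl// rnorm_ge0.
have [r r0 H] := diff_reps (df y) (divr_gt0 k0 u0).
exists (r / (rnorm u + 1)); first by rewrite divr_gt0.
move=> b ba; have E : z + b *: u - y = (b - a) *: u by rewrite /y scalerBl opprD addrACA subrr add0r.
have ub : rnorm (z + b *: u - y) <= nc (b - a) * (rnorm u + 1).
  by rewrite E rnormZ ler_wpM2l ?normc_ge0// lerDl.
have := H (z + b *: u); rewrite (le_trans ub); last by rewrite -ler_pdivlMr.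
move=> /(_ isT) h.
have -> : l (f (z + b *: u)) - l (f y) - l ('d f y u) * (b - a) =
    l (f (z + b *: u) - f y - 'd f y (z + b *: u - y)).
  have dE : 'd f y ((b - a) *: u) = (b - a) *: 'd f y u by rewrite linearZ.
  by rewrite E dE (coordfB cl) (coordfZ cl) (coordfB cl) [l _ * _]mulrC.
apply: le_trans (cl.2 _) _; apply: le_trans h _.
have -> : k * nc (b - a) = k / (rnorm u + 1) * (nc (b - a) * (rnorm u + 1)).
  by field; rewrite gt_eqF.
by rewrite ler_pM2l ?divr_gt0.
Qed.

Lemma line_cdiff l z u (a : C) : coordf l -> cdiff (fun a => l (f (z + a *: u))) a.
Proof. by move=> cl; eexists; exact: line_cderiv. Qed.

Lemma line_disc_hol l z u (r M : R) : coordf l ->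
  (forall x, rnorm (x - z) <= r * rnorm u -> rnorm (f x) <= M) ->
  disc_hol (fun a => l (f (z + a *: u))) r [::] M.
Proof.
move=> cl fM; split.
- by move=> a; apply: cdiff_cont_at; exact: line_cdiff.
- by move=> a _ _; exact: line_cdiff.
- move=> a ar; apply: le_trans (cl.2 _) _; apply: fM.
  by rewrite addrAC subrr add0r rnormZ ar.
Qed.

Hypothesis nW : coord_norming W.

Lemma entire_lip z (r M : R) : 0 < r -> (forall x, rnorm (x - z) <= r -> rnorm (f x) <= M) ->
  forall x y, rnorm (x - z) <= r / 2 -> rnorm (y - z) <= r / 2 ->
  rnorm (f x - f y) <= 4 * M / r * rnorm (x - y).
Proof.
move=> r0 fM x y xr yr.
have M0 : 0 <= M by rewrite (le_trans (rnorm_ge0 (f z)))// fM// subrr rnorm0 ltW.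
have [->|xy] := eqVneq x y; first by rewrite !subrr !rnorm0 mulr0.
have d0 : 0 < rnorm (x - y) by rewrite rnorm_gt0 subr_eq0.
have [h|h] := leP (rnorm (x - y)) (r / 2); last first.
  have fx : rnorm (f x) <= M by apply: fM; move: xr; lra.
  have fy : rnorm (f y) <= M by apply: fM; move: yr; lra.
  apply: le_trans (ler_rnormB _ _) _; apply: le_trans (lerD fx fy) _.
  have -> : M + M = 4 * M / r * (r / 2) by field; rewrite gt_eqF.
  by rewrite ler_wpM2l ?divr_ge0 ?mulr_ge0 ?(ltW r0) ?(ltW h).
apply: nW; first by rewrite !mulr_ge0 ?invr_ge0 ?rnorm_ge0 ?(ltW r0).
move=> l cl; pose rho := r / 2 / rnorm (x - y).
have rho0 : 0 < rho by rewrite !divr_gt0.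
have H : disc_hol (fun a => l (f (y + a *: (x - y)))) rho [::] M.
  apply: line_disc_hol => // w; rewrite /rho divfK ?gt_eqF// => hw; apply: fM.
  have -> : w - z = (w - y) + (y - z) by rewrite addrA subrK.
  by apply: le_trans (ler_rnormD _ _) _; rewrite [r]splitr lerD.
have dl := @line_cderiv l y (x - y) 0 cl.
have [_ /(_ 1)] := disc_hol_lip rho0 H dl.
have E1 : y + (x - y) = x by rewrite addrC subrK.
rewrite normc1 scale1r scale0r addr0 E1 -coordfB// mulr1.
have -> : 2 * M / rho = 4 * M / r * rnorm (x - y).
  by rewrite /rho; field; rewrite !gt_eqF.
by apply; rewrite /rho ler_pdivlMr// mul1r.
Qed.

Lemma entire_taylor2 z (r M : R) : 0 < r -> (forall x, rnorm (x - z) <= r -> rnorm (f x) <= M) ->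
  forall x, rnorm (x - z) <= r / 2 ->
  rnorm (f x - f z - 'd f z (x - z)) <= 8 * M / r ^+ 2 * rnorm (x - z) ^+ 2.
Proof.
move=> r0 fM x xr.
have M0 : 0 <= M by rewrite (le_trans (rnorm_ge0 (f z)))// fM// subrr rnorm0 ltW.
have [->|xz] := eqVneq x z; first by rewrite !subrr linear0 subr0 !rnorm0 expr0n mulr0.
have d0 : 0 < rnorm (x - z) by rewrite rnorm_gt0 subr_eq0.
apply: nW; first by rewrite !mulr_ge0 ?invr_ge0 ?exprn_ge0 ?rnorm_ge0 ?(ltW r0).
move=> l cl; pose rho := r / rnorm (x - z).
have rho0 : 0 < rho by rewrite !divr_gt0.
have H : disc_hol (fun a => l (f (z + a *: (x - z)))) rho [::] M.
  by apply: line_disc_hol => // w; rewrite /rho divfK ?gt_eqF//; exact: fM.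
have dl := @line_cderiv l z (x - z) 0 cl.
have := disc_hol_taylor2 rho0 H dl (h := 1).
have E1 : z + (x - z) = x by rewrite addrC subrK.
rewrite normc1 scale1r scale0r addr0 E1 mulr1 -!coordfB// expr1n mulr1.
have -> : 8 * M / rho ^+ 2 = 8 * M / r ^+ 2 * rnorm (x - z) ^+ 2.
  by rewrite /rho; field; rewrite !gt_eqF.
by apply; rewrite ler_pdivlMr// mul1r /rho ler_pdivlMr// mulrC -ler_pdivlMr.
Qed.

Lemma entire_diff_le z (r M : R) : 0 < r -> (forall x, rnorm (x - z) <= r -> rnorm (f x) <= M) ->
  forall h, rnorm ('d f z h) <= 2 * M / r * rnorm h.
Proof.
move=> r0 fM h.
have M0 : 0 <= M by rewrite (le_trans (rnorm_ge0 (f z)))// fM// subrr rnorm0 ltW.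
have [->|h0] := eqVneq h 0; first by rewrite linear0 !rnorm0 mulr0.
have d0 : 0 < rnorm h by rewrite rnorm_gt0.
apply: nW; first by rewrite !mulr_ge0 ?invr_ge0 ?rnorm_ge0 ?(ltW r0).
move=> l cl; pose rho := r / rnorm h.
have rho0 : 0 < rho by rewrite !divr_gt0.
have H : disc_hol (fun a => l (f (z + a *: h))) rho [::] M.
  by apply: line_disc_hol => // w; rewrite /rho divfK ?gt_eqF//; exact: fM.
have dl := @line_cderiv l z h 0 cl.
have [+ _] := disc_hol_lip rho0 H dl.
rewrite scale0r addr0 (_ : 2 * M / rho = 2 * M / r * rnorm h)//.
by rewrite /rho; field; rewrite !gt_eqF.
Qed.

Lemma entire_locally_bounded z : exists2 r : R, 0 < r &
  exists M : R, forall x, rnorm (x - z) <= r -> rnorm (f x) <= M.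
Proof.
have /rcontinuousP/(_ 1 ltr01)[r r0 H] := differentiable_continuous (df z).
exists r => //; exists (rnorm (f z) + 1) => x /H h.
by rewrite -[f x](subrK (f z)); apply: le_trans (ler_rnormD _ _) _; rewrite addrC lerD.
Qed.

End EntireEstimates.

(* Differentiability at one point is strict differentiability, because the
   remainder is itself entire and Cauchy's estimate applies to it. *)
Lemma entire_strict_diff (V W : normedModType C) (f : V -> W) z :
  coord_norming W -> (forall x, differentiable f x) ->
  forall k : R, 0 < k -> exists2 r : R, 0 < r & forall x y,
    rnorm (x - z) <= r -> rnorm (y - z) <= r ->
    rnorm (f x - f y - 'd f z (x - y)) <= k * rnorm (x - y).
Proof.
move=> nW df k k0; have k40 : 0 < k / 4 by rewrite divr_gt0.
have [r r0 H] := diff_reps (df z) k40.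
exists (r / 2); first by rewrite divr_gt0.
move=> x y xr yr.
pose g w := f w - 'd f z w - (f z - 'd f z z).
have dg w : differentiable g w.
  apply: differentiableB; last exact: differentiable_cst.
  apply: differentiableB => //; apply: linear_differentiable.
  exact: diff_continuous.
have gM w : rnorm (w - z) <= r -> rnorm (g w) <= k / 4 * r.
  move=> wr; have -> : g w = f w - f z - 'd f z (w - z).
    by rewrite linearB /g subrBACA.
  by apply: le_trans (H _ wr) _; rewrite ler_pM2l.
have := entire_lip dg nW r0 gM xr yr.
have -> : g x - g y = f x - f y - 'd f z (x - y).
  have -> : 'd f z (x - y) = 'd f z x - 'd f z y by rewrite linearB.
  by rewrite /g subrBACA subrr subr0 subrBACA.
by congr (_ <= _ * _); field; rewrite gt_eqF.
Qed.

End ComplexNormedModules.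

Section Gradient.
Variable R : realType.
Local Notation C := R[i].
Local Open Scope complex_scope.
Local Notation nc := (@ComplexField.Normc.normc R).
Local Notation Re := (@complex.Re R).
Local Notation Im := (@complex.Im R).

Lemma ler_of_small (x A rho : R) : 0 < rho -> 0 <= A ->
  (forall l, 0 < l <= rho -> x <= A * l) -> x <= 0.
Proof.
move=> rho0 A0 H; rewrite leNgt; apply/negP => x0.
have A1 : 0 < A + 1 by rewrite ltr_wpDl.
have := H (Num.min rho (x / (2 * (A + 1)))).
rewrite lt_min rho0 divr_gt0 ?mulr_gt0// ge_min lexx => /(_ isT).
have : A * Num.min rho (x / (2 * (A + 1))) <= (A + 1) * (x / (2 * (A + 1))).
  by rewrite ler_pM// ?lerDl ?le_min ?ge_min ?lexx ?orbT// (ltW rho0) divr_ge0 ?mulr_ge0 ?ltW.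
have -> : (A + 1) * (x / (2 * (A + 1))) = x / 2 by field; rewrite gt_eqF.
lra.
Qed.

Lemma limit_of_slopes (u : R -> R) (rho Q : R) : 0 < rho ->
  (forall l m, 0 < l <= rho -> 0 < m <= rho -> `|u l - u m| <= Q * (l + m)) ->
  exists a, forall l, 0 < l <= rho -> `|u l - a| <= Q * l.
Proof.
move=> rho0 H; pose A := [set u l - Q * l | l in [set l | 0 < l <= rho]].
have ub m : 0 < m <= rho -> ubound A (u m + Q * m).
  move=> mr _ [l /= lr <-]; have := H l m lr mr; rewrite ler_norml => /andP[_]; lra.
have rr : 0 < rho <= rho by rewrite rho0 lexx.
have A0 : A !=set0 by exists (u rho - Q * rho); exists rho.
exists (sup A) => l lr; rewrite ler_distl; apply/andP; split.
  by rewrite lerBlDr; apply: ge_sup => //; exact: ub.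
have : u l - Q * l <= sup A.
  by apply: ub_le_sup; [exists (u rho + Q * rho); exact: ub|exists l].
lra.
Qed.

Lemma limit_of_slopesC (u : R -> C) (rho Q : R) : 0 < rho ->
  (forall l m, 0 < l <= rho -> 0 < m <= rho -> nc (u l - u m) <= Q * (l + m)) ->
  exists a, forall l, 0 < l <= rho -> nc (u l - a) <= 2 * Q * l.
Proof.
move=> rho0 H.
have [|a Ha] := @limit_of_slopes (Re \o u) rho Q rho0.
  by move=> l m lr mr; apply: le_trans (H l m lr mr); rewrite /= -raddfB; exact: ler_Re.
have [|b Hb] := @limit_of_slopes (Im \o u) rho Q rho0.
  by move=> l m lr mr; apply: le_trans (H l m lr mr); rewrite /= -raddfB; exact: ler_Im.
exists (a +i* b) => l lr; apply: le_trans (normc_le_ReIm _) _.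
have -> : 2 * Q * l = Q * l + Q * l by ring.
by apply: lerD; rewrite raddfB/=; [exact: Ha|exact: Hb].
Qed.

Lemma entire_diffB_le (V W : normedModType C) (f g : V -> W) z (r M : R) :
  (forall x, differentiable f x) -> (forall x, differentiable g x) -> coord_norming W ->
  0 < r -> (forall x, rnorm (x - z) <= r -> rnorm (f x - g x) <= M) ->
  forall h, rnorm ('d f z h - 'd g z h) <= 2 * M / r * rnorm h.
Proof.
move=> df dg nW r0 fgM h.
have d x : differentiable (f - g) x by exact: differentiableB.
have E : 'd (f - g) z h = 'd f z h - 'd g z h.
  exact: (congr1 (fun F : V -> W => F h) (diffB (df z) (dg z))).
have H := entire_diff_le d nW r0 fgM h.
by rewrite E in H.
Qed.

Variables (V : normedModType C) (G : V -> C^o).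
Hypothesis dG : forall x, differentiable G x.
Variable e : V.

(* The difference quotients of G in the direction e are entire and converge
   locally uniformly; by Cauchy's estimate so do their differentials. *)
Lemma differentiable_partial (z0 : V) : differentiable (fun z => 'd G z e : C^o) z0.
Proof.
pose w z : C^o := 'd G z e.
have nC := @coord_norming_complex R.
have [r r0 [M GM]] := entire_locally_bounded dG z0.
have M0 : 0 <= M by rewrite (le_trans (rnorm_ge0 (G z0)))// GM// subrr rnorm0 ltW.
pose E := rnorm e + 1.
have E0 : 0 < E by rewrite ltr_wpDl// rnorm_ge0.
pose rho := r / (4 * E).
have rho0 : 0 < rho by rewrite divr_gt0// mulr_gt0.
have r2 : 0 < r / 2 by rewrite divr_gt0.
have GMz z : rnorm (z - z0) <= r / 2 -> forall x, rnorm (x - z) <= r / 2 -> rnorm (G x) <= M.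
  move=> zr x xr; apply: GM; have -> : x - z0 = (x - z) + (z - z0) by rewrite addrA subrK.
  by apply: le_trans (ler_rnormD _ _) _; rewrite [r]splitr lerD.
have le_e (l : R) : 0 < l <= rho -> rnorm (l%:C *: e) <= r / 4.
  move=> /andP[l0 lr]; rewrite rnormZ normc_real gtr0_norm//.
  apply: le_trans (_ : rho * E <= _).
    by rewrite ler_pM ?rnorm_ge0 ?(ltW l0)// lerDl.
  by rewrite /rho le_eqVlt; apply/orP; left; apply/eqP; field; rewrite gt_eqF.
pose wl (l : R) z : C^o := (l%:C)^-1 *: (G (z + l%:C *: e) - G z).
have dwl l z : differentiable (wl l) z.
  apply: (@differentiableZ _ _ _ (fun z => G (z + l%:C *: e) - G z)).
  apply: (@differentiableB _ _ _ (fun z => G (z + l%:C *: e)) G) => //.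
  apply: (@differentiable_comp _ _ _ _ (fun z => z + l%:C *: e) G) => //.
pose K := 8 * M / (r / 2) ^+ 2 * E ^+ 2.
have K0 : 0 <= K by rewrite !mulr_ge0// ?invr_ge0// ?exprn_ge0// ltW.
have wK (l : R) z : 0 < l <= rho -> rnorm (z - z0) <= r / 2 -> rnorm (wl l z - w z) <= K * l.
  move=> lr zr; have l0 : 0 < l by case/andP: lr.
  have lC : l%:C != 0 by rewrite -normc_eq0 normc_real normr_eq0 gt_eqF.
  have := entire_taylor2 dG nC r2 (GMz z zr) (x := z + l%:C *: e).
  have -> : z + l%:C *: e - z = l%:C *: e by rewrite addrC addKr.
  move=> H.
  have {}H : rnorm (G (z + l%:C *: e) - G z - 'd G z (l%:C *: e)) <=
    8 * M / (r / 2) ^+ 2 * rnorm (l%:C *: e) ^+ 2.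
    by apply: H; have := le_e l lr; lra.
  have -> : wl l z - w z = (l%:C)^-1 *: (G (z + l%:C *: e) - G z - 'd G z (l%:C *: e)).
    by rewrite linearZ [in RHS]scalerBr scalerA mulVf// scale1r.
  rewrite rnormZ normcV normc_real gtr0_norm// mulrC ler_pdivrMr//.
  apply: le_trans H _; rewrite rnormZ normc_real gtr0_norm// [(l * _) ^+ 2]exprMn.
  have -> : K * l * l = 8 * M / (r / 2) ^+ 2 * (l ^+ 2 * E ^+ 2) by rewrite /K; ring.
  rewrite ler_wpM2l//; first by rewrite !mulr_ge0// ?invr_ge0// ?exprn_ge0// ltW.
  rewrite ler_pM2l ?exprn_gt0// ler_pXn2r ?nnegrE ?rnorm_ge0 ?(ltW E0)//.
  by rewrite lerDl.
clearbody wl.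
have A0 : 0 <= 2 * M / (r / 2) by apply: divr_ge0; [exact: mulr_ge0|exact: ltW].
pose M' := 2 * M / (r / 2) * E + K * rho.
have M'0 : 0 <= M'.
  by apply: addr_ge0; apply: mulr_ge0 => //; rewrite ?(ltW E0) ?(ltW rho0).
have wM (l : R) z : 0 < l <= rho -> rnorm (z - z0) <= r / 2 -> rnorm (wl l z) <= M'.
  move=> lr zr; have -> : wl l z = (wl l z - w z) + w z by rewrite subrK.
  apply: le_trans (ler_rnormD _ _) _; rewrite addrC lerD//.
    apply: le_trans (entire_diff_le dG nC r2 (GMz z zr) e) _.
    by apply: ler_wpM2l => //; rewrite lerDl.
  by apply: le_trans (wK _ _ lr zr) _; rewrite ler_wpM2l//; case/andP: lr.
have DC (l m : R) h : 0 < l <= rho -> 0 < m <= rho ->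
    nc ('d (wl l) z0 h - 'd (wl m) z0 h) <= (4 * K / r * rnorm h) * (l + m).
  move=> lr mr.
  have b x : rnorm (x - z0) <= r / 2 -> rnorm (wl l x - wl m x) <= K * (l + m).
    move=> xr; have -> : wl l x - wl m x = (wl l x - w x) - (wl m x - w x).
      by rewrite subrBACA subrr subr0.
    by apply: le_trans (ler_rnormB _ _) _; rewrite mulrDr lerD// wK.
  have := entire_diffB_le (dwl l) (dwl m) nC r2 b h; rewrite rnorm_complex => H.
  apply: le_trans H _; rewrite le_eqVlt; apply/orP; left; apply/eqP.
  by field; rewrite gt_eqF.
have /choice[L HL] : forall h, exists a : C, forall l : R, 0 < l <= rho ->
    nc ('d (wl l) z0 h - a) <= 2 * (4 * K / r * rnorm h) * l.
  by move=> h; apply: limit_of_slopesC => // l m lr mr; exact: DC.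
pose Q := 8 * K / r.
have Q0 : 0 <= Q by apply: divr_ge0; [exact: mulr_ge0|exact: ltW].
have {}HL h (l : R) : 0 < l <= rho -> nc ('d (wl l) z0 h - L h) <= Q * rnorm h * l.
  by move=> /(HL h); congr (_ <= _); rewrite /Q; ring.
have Llin : linear (L : V -> C^o).
  move=> a h h'; apply/eqP; rewrite -subr_eq0 -normc_eq0 eq_le normc_ge0 andbT.
  pose N := Q * rnorm (a *: h + h') + nc a * (Q * rnorm h) + Q * rnorm h'.
  have qh (k : V) : 0 <= Q * rnorm k by apply: mulr_ge0 => //; exact: rnorm_ge0.
  have N0 : 0 <= N.
    by apply: addr_ge0 => //; apply: addr_ge0 => //; apply: mulr_ge0 => //; exact: normc_ge0.
  apply: (ler_of_small rho0 N0) => l lr.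
  have e1 := HL (a *: h + h') l lr; have e2 := HL h l lr; have e3 := HL h' l lr.
  have -> : L (a *: h + h') - (a *: (L h : C^o) + L h') =
     - ('d (wl l) z0 (a *: h + h') - L (a *: h + h')) + a * ('d (wl l) z0 h - L h) +
       ('d (wl l) z0 h' - L h').
    have -> : 'd (wl l) z0 (a *: h + h') = a * ('d (wl l) z0 h : C) + ('d (wl l) z0 h' : C).
      exact: linearP.
    have -> : a *: (L h : C^o) + L h' = a * L h + L h' by [].
    by ring.
  apply: le_trans (ler_normcD _ _) _; rewrite /N !mulrDl; apply: lerD => //.
  apply: le_trans (ler_normcD _ _) _; apply: lerD; first by rewrite normcN.
  by rewrite normcM -mulrA ler_wpM2l ?normc_ge0.
have rr : 0 < rho <= rho by rewrite rho0 lexx.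
have Lb : exists K : R, forall h, rnorm (L h : C^o) <= K * rnorm h.
  exists (2 * M' / (r / 2) + Q * rho) => h.
  have -> : (L h : C^o) = 'd (wl rho) z0 h - ('d (wl rho) z0 h - L h) by rewrite opprB addrC subrK.
  apply: le_trans (ler_rnormB _ _) _; rewrite mulrDl lerD//.
    by apply: entire_diff_le => // x; exact: wM.
  by rewrite rnorm_complex mulrAC; exact: HL.
pose P := 8 * M' / (r / 2) ^+ 2.
have P0 : 0 <= P by apply: divr_ge0; [exact: mulr_ge0|rewrite exprn_ge0// ltW].
have T x : rnorm (x - z0) <= r / 2 / 2 -> rnorm (w x - w z0 - L (x - z0)) <= P * rnorm (x - z0) ^+ 2.
  move=> xr; rewrite -subr_le0.
  have N0 : 0 <= K + K + Q * rnorm (x - z0) by rewrite !addr_ge0// mulr_ge0// rnorm_ge0.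
  apply: (ler_of_small rho0 N0) => l lr.
  have xr2 : rnorm (x - z0) <= r / 2 by move: xr r2; lra.
  have zr2 : rnorm (z0 - z0) <= r / 2 by rewrite subrr rnorm0 ltW.
  have := entire_taylor2 (dwl l) nC r2 (fun y => wM l y lr) xr.
  have := wK l x lr xr2; have := wK l z0 lr zr2; have := HL (x - z0) l lr.
  rewrite !rnorm_complex -/P => e1 e2 e3 e4.
  have -> : w x - w z0 - L (x - z0) = - (wl l x - w x) + (wl l z0 - w z0)
     + ('d (wl l) z0 (x - z0) - L (x - z0)) + (wl l x - wl l z0 - 'd (wl l) z0 (x - z0)) by ring.
  have := ler_normcD (- (wl l x - w x) + (wl l z0 - w z0) + ('d (wl l) z0 (x - z0) - L (x - z0)))
    (wl l x - wl l z0 - 'd (wl l) z0 (x - z0)).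
  have := ler_normcD (- (wl l x - w x) + (wl l z0 - w z0)) ('d (wl l) z0 (x - z0) - L (x - z0)).
  have := ler_normcD (- (wl l x - w x)) (wl l z0 - w z0).
  rewrite normcN; move: e1 e2 e3 e4; rewrite -!lerBlDr; clear; lra.
apply: (@reps_differentiable _ _ _ w L z0 Llin Lb _).1 => k k0.
have P1 : 0 < P + 1 by rewrite ltr_wpDl.
exists (Num.min (r / 2 / 2) (k / (P + 1))); first by rewrite lt_min !divr_gt0.
move=> x; rewrite le_min => /andP[h1 h2]; apply: le_trans (T x h1) _.
rewrite expr2 mulrA ler_wpM2r ?rnorm_ge0//.
have -> : k = (P + 1) * (k / (P + 1)) by rewrite mulrC divfK ?gt_eqF.
by rewrite ler_pM ?rnorm_ge0// lerDl.
Qed.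

End Gradient.

Section RealComplexVectors.
Variable R : realType.
Local Notation C := R[i].
Local Open Scope complex_scope.
Local Notation nc := (@ComplexField.Normc.normc R).
Local Notation Re := (@complex.Re R).
Local Notation Im := (@complex.Im R).

Lemma mx_coord_le (K : numFieldType) m n (w : 'M[K]_(m, n)) i j : `|w i j| <= `|w|.
Proof.
have : `|w i j| <= mx_norm w by rewrite mx_normE -[leLHS]nngE num_le; exact: (le_bigmax _ _ (i, j)).
by [].
Qed.

Lemma mx_norm_le (K : numFieldType) m n (w : 'M[K]_(m, n)) (c : K) : 0 <= c ->
  (forall i j, `|w i j| <= c) -> `|w| <= c.
Proof.
move=> c0 H; have [w0|w0] := eqVneq (mx_norm w) 0.
  by rewrite (mx_norm_eq0 w0) normr0.
by have [[i j] /= E] := mx_norm_neq0 w0; rewrite [`|w|]E.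
Qed.

Section Vectors.
Variable d : nat.
Implicit Types (u w q : 'rV[R]_d).

Definition cplx u w : 'rV[C]_d := \row_j (u 0 j +i* w 0 j).
Definition Rev (p : 'rV[C]_d) : 'rV[R]_d := map_mx Re p.
Definition Imv (p : 'rV[C]_d) : 'rV[R]_d := map_mx Im p.

Lemma cplx_ReIm p : cplx (Rev p) (Imv p) = p.
Proof. by apply/rowP => j; rewrite !mxE; case: (p 0 j). Qed.

Lemma norm_Rev p : `|Rev p| <= rnorm p.
Proof.
apply: mx_norm_le => [|i j]; first exact: rnorm_ge0.
by rewrite mxE; apply: le_trans (ler_Re _) (rnorm_coord _ _ _).
Qed.

Lemma norm_Imv p : `|Imv p| <= rnorm p.
Proof.
apply: mx_norm_le => [|i j]; first exact: rnorm_ge0.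
by rewrite mxE; apply: le_trans (ler_Im _) (rnorm_coord _ _ _).
Qed.

Lemma rnorm_cplxB u w u' w' : rnorm (cplx u w - cplx u' w') <= `|u - u'| + `|w - w'|.
Proof.
apply: rnorm_mx_le => [|i j]; first exact: addr_ge0.
rewrite !mxE; apply: le_trans (normc_le_ReIm _) _ => /=; apply: lerD.
  by have := mx_coord_le (u - u') 0 j; rewrite !mxE.
by have := mx_coord_le (w - w') 0 j; rewrite !mxE.
Qed.

Lemma rnorm_complexify q : rnorm (complexify q) = `|q|.
Proof.
apply/eqP; rewrite eq_le; apply/andP; split.
  by apply: rnorm_mx_le => // i j; rewrite mxE normc_real mx_coord_le.
apply: mx_norm_le => [|i j]; first exact: rnorm_ge0.
by have := rnorm_coord (complexify q) i j; rewrite mxE normc_real.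
Qed.

Lemma complexifyD q u : complexify (q + u) = complexify q + complexify u.
Proof. exact: map_mxD. Qed.

Lemma complexifyB q u : complexify (q - u) = complexify q - complexify u.
Proof. exact: map_mxB. Qed.

Lemma complexifyZ (a : R) u : complexify (a *: u) = a%:C *: complexify u.
Proof. exact: map_mxZ. Qed.

Lemma complexify0 : complexify (0 : 'rV[R]_d) = 0.
Proof. exact: map_mx0. Qed.

Lemma complexify_inj : injective (@complexify R d).
Proof. by move=> u w /rowP H; apply/rowP => j; have := H j; rewrite !mxE => -[]. Qed.

Lemma complexify_intv (k : 'rV[int]_d) : complexify (intv R k) = intv C k.
Proof. by apply/rowP => j; rewrite !mxE rmorph_int. Qed.

Lemma Rev_complexify q : Rev (complexify q) = q.
Proof. by apply/rowP => j; rewrite !mxE. Qed.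

Lemma cplx_Re_complexify (p : 'rV[C]_d) : Imv p = 0 -> complexify (Rev p) = p.
Proof.
move=> H; apply/rowP => j; have /rowP/(_ j) := H; rewrite !mxE.
by case: (p 0 j) => a b /= ->.
Qed.

Lemma segment_box_compact (r : R) : compact [set v : 'rV[R]_d | `|v| <= r].
Proof.
have [r0|r0] := ltP r 0.
  rewrite (_ : [set _ | _] = set0); first exact: compact0.
  rewrite predeqE => v; split => //= h.
  by have := lt_le_trans (le_lt_trans h r0) (normr_ge0 v); rewrite ltxx.
rewrite (_ : [set _ | _] = [set v : 'rV[R]_d | forall i, `[- r, r]%classic (v ord0 i)]).
  by apply: (@rV_compact R d (fun=> `[- r, r]%classic)) => i; exact: segment_compact.
rewrite predeqE => v; split => /= [h i|h].
  by rewrite /= in_itv/= -ler_norml; exact: le_trans (mx_coord_le _ _ _) h.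
apply: mx_norm_le => // i j; rewrite ord1 ler_norml.
by have := h j; rewrite /= in_itv.
Qed.

Definition rcont (V : normedModType C) (F : V -> R) := forall z (k : R), 0 < k ->
  exists2 r : R, 0 < r & forall z', rnorm (z' - z) <= r -> `|F z' - F z| <= k.

Lemma rcont_cplx (F : 'rV[C]_d -> R) : rcont F ->
  continuous (fun x : 'rV[R]_d * 'rV[R]_d => F (cplx x.1 x.2)).
Proof.
move=> cF [u w]; apply/cvgrPdist_le => /= k k0.
have [r r0 H] := cF (cplx u w) k k0.
exists (ball u (r / 2), ball w (r / 2)) => /=.
  by split; apply: nbhsx_ballx; rewrite divr_gt0.
move=> [u' w'] [/= hu hw]; rewrite distrC; apply: H.
apply: le_trans (rnorm_cplxB _ _ _ _) _; rewrite [r]splitr lerD// ltW//.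
  by move: hu; rewrite -ball_normE /= distrC.
by move: hw; rewrite -ball_normE /= distrC.
Qed.

Lemma ler_dist_rnorm (V : normedModType C) (x y : V) : `|rnorm x - rnorm y| <= rnorm (x - y).
Proof.
rewrite ler_norml; apply/andP; split.
  by rewrite lerNl opprB lerBlDr rnormB; have := ler_rnormD (y - x) x; rewrite subrK.
by rewrite lerBlDr; have := ler_rnormD (x - y) y; rewrite subrK.
Qed.

Lemma complex_ball_min (F : 'rV[C]_d -> R) (p0 : 'rV[C]_d) (r : R) : 0 <= r -> rcont F ->
  exists2 p, rnorm (p - p0) <= r & forall p', rnorm (p' - p0) <= r -> F p <= F p'.
Proof.
move=> r0 cF; pose N (p : 'rV[C]_d) := rnorm (p - p0).
have cN : rcont N.
  move=> z k k0; exists k => // z' h; apply: le_trans (ler_dist_rnorm _ _) _.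
  by rewrite subrBACA subrr subr0.
pose A := [set x : 'rV[R]_d * 'rV[R]_d | N (cplx x.1 x.2) <= r].
have clA : closed A.
  have := @closed_comp _ _ (fun x : 'rV[R]_d * 'rV[R]_d => N (cplx x.1 x.2)) [set x | x <= r].
  by apply; [move=> p _; exact: rcont_cplx|exact: closed_le].
have cA : compact A.
  pose B := [set v : 'rV[R]_d | `|v| <= r + rnorm p0].
  apply: (@subclosed_compact _ _ (B `*` B)) => //.
    by apply: compact_setX; exact: segment_box_compact.
  move=> [u w] /= h.
  have pr : rnorm (cplx u w) <= r + rnorm p0.
    by have := ler_rnormD (cplx u w - p0) p0; rewrite subrK => h'; apply: le_trans h' _; rewrite lerD.
  have eu : Rev (cplx u w) = u by apply/rowP => j; rewrite !mxE.
  have ew : Imv (cplx u w) = w by apply/rowP => j; rewrite !mxE.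
  have := le_trans (norm_Rev _) pr; have := le_trans (norm_Imv _) pr.
  by rewrite eu ew.
have A0 : A !=set0 by exists (Rev p0, Imv p0); rewrite /A /= cplx_ReIm /N subrr rnorm0.
have [[u w] cAx H] := compact_EVT_min A0 cA (continuous_subspaceT (rcont_cplx cF)).
exists (cplx u w); first by move: cAx; rewrite inE.
move=> p h; have := H (Rev p, Imv p); rewrite inE /A /= cplx_ReIm; exact.
Qed.

End Vectors.

Lemma mulmx_rnorm_le m n (A : 'M[C]_(m, n)) : exists2 K : R, 0 < K &
  forall y : 'rV[C]_m, rnorm (y *m A) <= K * rnorm y.
Proof.
pose K := \sum_(i < m) \sum_(j < n) nc (A i j) + 1.
have S0 : 0 <= \sum_(i < m) \sum_(j < n) nc (A i j).
  by apply: sumr_ge0 => i _; apply: sumr_ge0 => j _; exact: normc_ge0.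
exists K => [|y]; first by rewrite ltr_wpDl.
have K0 : 0 <= K * rnorm y by rewrite mulr_ge0 ?rnorm_ge0// addr_ge0.
apply: rnorm_mx_le => // i j; rewrite mxE ord1.
have nsum (f : 'I_m -> C) : nc (\sum_i f i) <= \sum_i nc (f i).
  elim/big_rec2: _ => [|k a b _ h]; first by rewrite normc0.
  by apply: le_trans (ler_normcD _ _) _; rewrite lerD.
apply: le_trans (nsum _) _.
apply: le_trans (_ : \sum_k nc (A k j) * rnorm y <= _).
  by apply: ler_sum => k _; rewrite normcM mulrC ler_wpM2l ?normc_ge0 ?rnorm_coord.
rewrite -mulr_suml ler_wpM2r ?rnorm_ge0// ler_wpDr// ler_sum// => k _.
rewrite (bigD1 j)//= lerDl; apply: sumr_ge0 => l _; exact: normc_ge0.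
Qed.

Lemma linear_inverse d (B : {linear 'rV[C]_d -> 'rV[C]_d}) :
  (forall x, B x = 0 -> x = 0) ->
  exists A : 'M[C]_d, (forall y, B (y *m A) = y) /\ (forall x, B x *m A = x).
Proof.
move=> injB; pose M := lin1_mx B.
have BE x : B x = x *m M by rewrite mul_rV_lin1.
have uM : M \in unitmx.
  rewrite -row_free_unit -kermx_eq0; apply/eqP/row_matrixP => i; rewrite row0.
  apply: injB; rewrite BE -row_mul mulmx_ker row0 //.
exists (invmx M); split => x; first by rewrite BE mulmxKV.
by rewrite BE mulmxK.
Qed.

Section ImplicitFunction.
Variables (V : normedModType C) (d : nat).
Local Notation X := 'rV[C]_d.
Let VX : normedModType C := (V * X)%type.
Variable Phi : VX -> X.
Hypothesis dPhi : forall z, differentiable Phi z.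
Variables (v0 : V) (p0 : X).
Hypothesis Phi0 : Phi (v0, p0) = 0.
Hypothesis inj0 : forall x : X, 'd Phi ((v0, p0) : VX) (0, x) = 0 -> x = 0.

Lemma linear_snd (z : VX) : linear (fun x : X => 'd Phi z (0, x)).
Proof.
move=> a x y; rewrite -linearP; congr ('d Phi z _).
by congr pair => /=; rewrite scaler0 addr0.
Qed.

Lemma partial_inverse z : (forall x : X, 'd Phi z (0, x) = 0 -> x = 0) ->
  exists A : 'M[C]_d, (forall y, 'd Phi z (0, y *m A) = y) /\
    (forall x, 'd Phi z (0, x) *m A = x).
Proof.
move=> inj.
pose B : {linear X -> X} := HB.pack (fun x : X => 'd Phi z (0, x))
  (GRing.isLinear.Build _ _ _ _ (fun x : X => 'd Phi z (0, x)) (linear_snd z)).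
exact: (@linear_inverse d B).
Qed.

Lemma rnorm_pair0 (x : X) : rnorm ((0, x) : VX) = rnorm x.
Proof. by rewrite rnorm_pair rnorm0 max_r// rnorm_ge0. Qed.

Theorem implicit_function : exists r rho L : R, exists Y : V -> X, [/\ 0 < r, 0 < rho & 0 < L] /\
  [/\ forall v, rnorm (v - v0) <= rho -> rnorm (Y v - p0) <= r /\ Phi (v, Y v) = 0,
      forall v p, rnorm (v - v0) <= rho -> rnorm (p - p0) <= r -> Phi (v, p) = 0 -> p = Y v,
      forall v v', rnorm (v - v0) <= rho -> rnorm (v' - v0) <= rho ->
        rnorm (Y v - Y v') <= L * rnorm (v - v')
    & forall v u j, rnorm (v - v0) < rho -> cdiff (fun s => Y (v + s *: u) 0 j) 0].
Proof.
have [A [BA AB]] := partial_inverse inj0.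
have [K K0 AK] := mulmx_rnorm_le A.
pose c0 := K^-1; have c00 : 0 < c0 by rewrite invr_gt0.
have c20 : 0 < c0 / 2 by rewrite divr_gt0.
have Blow x : c0 * rnorm x <= rnorm ('d Phi ((v0, p0) : VX) (0, x)).
  by rewrite /c0 mulrC ler_pdivrMr// mulrC -{1}[x]AB.
have nX := @coord_norming_mx R 1 d.
have [r r0 H] := entire_strict_diff ((v0, p0) : VX) nX dPhi c20.
have [T T0 DT] := diff_rbounded (dPhi (v0, p0)).
have ballE (v : V) (p : X) a : rnorm (v - v0) <= a -> rnorm (p - p0) <= a ->
    rnorm ((v, p) - (v0, p0) : VX) <= a.
  by move=> h1 h2; rewrite rnorm_pair /= ge_max h1.
pose L0 := T + c0 / 2.
have L00 : 0 < L0 by rewrite addr_gt0.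
have lip (z z' : VX) : rnorm (z - (v0, p0)) <= r -> rnorm (z' - (v0, p0)) <= r ->
    rnorm (Phi z - Phi z') <= L0 * rnorm (z - z').
  move=> zr z'r; have := H _ _ zr z'r; have := DT (z - z').
  have -> : Phi z - Phi z' = (Phi z - Phi z' - 'd Phi ((v0, p0) : VX) (z - z')) + 'd Phi ((v0, p0) : VX) (z - z').
    by rewrite subrK.
  move=> h1 h2; apply: le_trans (ler_rnormD _ _) _; rewrite addrK in h2 *.
  by rewrite /L0 mulrDl addrC lerD.
have low (v : V) (p p' : X) : rnorm (v - v0) <= r -> rnorm (p - p0) <= r -> rnorm (p' - p0) <= r ->
    c0 / 2 * rnorm (p - p') <= rnorm (Phi (v, p) - Phi (v, p')).
  move=> vr pr p'r; have := H _ _ (ballE _ _ _ vr pr) (ballE _ _ _ vr p'r).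
  have -> : (v, p) - (v, p') = (0, p - p') by congr pair; rewrite /= subrr.
  rewrite rnorm_pair0 => h; have := Blow (p - p').
  set a := Phi _ - _ in h *; set b := 'd Phi _ _ in h * => h'.
  have := ler_rnormB a (a - b); rewrite opprB addrC subrK => h''.
  have := le_trans h' h''; rewrite -lerBlDr => h3.
  apply: le_trans (_ : c0 * rnorm (p - p') - c0 / 2 * rnorm (p - p') <= _).
    by rewrite (_ : _ - _ = c0 / 2 * rnorm (p - p'))//; field.
  by apply: le_trans h3; rewrite lerB.
pose rho := Num.min r (c0 * r / (16 * L0)).
have rho0 : 0 < rho by rewrite lt_min r0 divr_gt0 ?mulr_gt0.
have rr : 0 < r / 2 by rewrite divr_gt0.
have r2le : r / 2 <= r by rewrite ler_pdivrMr// ler_pMr// ler1n.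
have ex v : exists Yv : X, rnorm (v - v0) <= rho -> rnorm (Yv - p0) <= r / 2 /\ Phi (v, Yv) = 0.
  have [vr|vr] := leP (rnorm (v - v0)) rho; last by exists 0.
  have vrr : rnorm (v - v0) <= r by rewrite (le_trans vr)// ge_min lexx.
  have cF : rcont (fun p : X => rnorm (Phi (v, p))).
    move=> p k k0; have /rcontinuousP/(_ k k0)[e e0 He] := differentiable_continuous (dPhi (v, p)).
    exists e => // p' h; apply: le_trans (ler_dist_rnorm _ _) _; apply: He.
    by rewrite rnorm_pair /= subrr rnorm0 ge_max h ltW.
  have [p pr pmin] := complex_ball_min p0 (ltW rr) cF.
  exists p => _; split=> //.
  have p0r : rnorm (p0 - p0) <= r by rewrite subrr rnorm0 ltW.
  have small : rnorm (Phi (v, p0)) <= c0 * r / 16.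
    have v0r : rnorm (v0 - v0) <= r by rewrite subrr rnorm0 ltW.
    have := lip _ _ (ballE _ _ _ vrr p0r) (ballE _ _ _ v0r p0r).
    rewrite Phi0 subr0 => h; apply: le_trans h _.
    have -> : c0 * r / 16 = L0 * (c0 * r / (16 * L0)) by field; rewrite gt_eqF.
    rewrite ler_pM2l// rnorm_pair /= subrr rnorm0 ge_max (le_trans vr) ?ge_min ?lexx ?orbT//.
    by rewrite ltW// divr_gt0 ?mulr_gt0.
  have pint : rnorm (p - p0) < r / 2.
    rewrite lt_neqAle pr andbT; apply/eqP => E.
    have pr' : rnorm (p - p0) <= r by rewrite E.
    have := low v p p0 vrr pr' p0r; rewrite E.
    have := ler_rnormB (Phi (v, p)) (Phi (v, p0)).
    have := pmin p0; rewrite subrr rnorm0 ltW// => /(_ isT).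
    have : 0 < c0 * r by rewrite mulr_gt0.
    move: small; lra.
  set y := Phi (v, p).
  have [//|y0] := eqVneq y 0; exfalso.
  have y1 : 0 < rnorm y by rewrite rnorm_gt0.
  pose gap := r / 2 - rnorm (p - p0).
  have gap0 : 0 < gap by rewrite subr_gt0.
  pose s := Num.min 1 (gap / (K * rnorm y)).
  have s0 : 0 < s by rewrite lt_min ltr01 divr_gt0// mulr_gt0.
  have s1 : s <= 1 by rewrite ge_min lexx.
  pose eta := - (s%:C *: (y *m A)).
  have etaK : rnorm eta <= s * (K * rnorm y).
    by rewrite /eta rnormN rnormZ normc_real gtr0_norm// ler_pM2l.
  have etagap : rnorm eta <= gap.
    apply: le_trans etaK _; rewrite -ler_pdivlMr ?mulr_gt0//.
    by rewrite /s ge_min lexx orbT.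
  have pe : rnorm (p + eta - p0) <= r / 2.
    rewrite addrAC; apply: le_trans (ler_rnormD _ _) _.
    by rewrite -lerBrDl.
  have := pmin _ pe; rewrite leNgt => /negP; apply; rewrite -/y.
  have w1 (a : X) : rnorm (a - p0) <= r / 2 -> rnorm (a - p0) <= r by move=> /le_trans; exact.
  have := H _ _ (ballE _ _ _ vrr (w1 _ pe)) (ballE _ _ _ vrr (w1 _ pr)).
  have -> : (v, p + eta) - (v, p) = (0, eta) by congr pair; rewrite /= ?subrr// addrC addKr.
  rewrite rnorm_pair0 -/y.
  have -> : 'd Phi ((v0, p0) : VX) (0, eta) = - (s%:C *: y).
    have -> : (0, eta) = - (s%:C *: ((0 : V), y *m A)) by congr pair; rewrite /= ?scaler0 ?oppr0.
    by rewrite linearN linearZ /= BA.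
  set a := Phi _ => h.
  have -> : a = (a - y - - (s%:C *: y)) + (1 - s)%:C *: y.
    by rewrite rmorphB scalerBl scale1r opprK -addrA (addrC _ (y - _)) subrK subrK.
  apply: le_lt_trans (ler_rnormD _ _) _.
  rewrite rnormZ normc_real ger0_norm ?subr_ge0//.
  apply: le_lt_trans (lerD h (lexx _)) _.
  have : c0 / 2 * rnorm eta <= c0 / 2 * (s * (K * rnorm y)) by rewrite ler_pM2l.
  have -> : c0 / 2 * (s * (K * rnorm y)) = s * rnorm y / 2 by rewrite /c0; field; rewrite gt_eqF.
  have : 0 < s * rnorm y by rewrite mulr_gt0.
  lra.
have /choice[Y HY] := ex.
have rhor v : rnorm (v - v0) <= rho -> rnorm (v - v0) <= r.
  by move=> /le_trans; apply; rewrite ge_min lexx.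
have r2r (p : X) : rnorm (p - p0) <= r / 2 -> rnorm (p - p0) <= r by move=> /le_trans; exact.
have lipY v v' : rnorm (v - v0) <= rho -> rnorm (v' - v0) <= rho ->
    rnorm (Y v - Y v') <= 2 * L0 / c0 * rnorm (v - v').
  move=> vr v'r; have [a1 b1] := HY v vr; have [a2 b2] := HY v' v'r.
  have := low v _ _ (rhor _ vr) (r2r _ a1) (r2r _ a2).
  rewrite b1 sub0r rnormN => h.
  have := lip _ _ (ballE _ _ _ (rhor _ vr) (r2r _ a2)) (ballE _ _ _ (rhor _ v'r) (r2r _ a2)).
  rewrite b2 subr0 rnorm_pair /= subrr rnorm0 max_l ?rnorm_ge0// => h'.
  have := le_trans h h'; rewrite mulrC -ler_pdivlMr// => h''; apply: le_trans h'' _.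
  by rewrite le_eqVlt; apply/orP; left; apply/eqP; field; rewrite gt_eqF.
have Ly0 : 0 < 2 * L0 / c0 by apply: divr_gt0 => //; exact: mulr_gt0.
exists (r / 2), rho, (2 * L0 / c0), Y; split; split => //.
- move=> v p vr pr Pvp; have [a b] := HY v vr.
  have := low v p (Y v) (rhor _ vr) (r2r _ pr) (r2r _ a).
  rewrite Pvp b subr0 rnorm0 pmulr_rle0// => h.
  by apply/eqP; rewrite -subr_eq0 -rnorm_eq0 eq_le h rnorm_ge0.
move=> v u j vr.
have vr' := ltW vr; have [a1 b1] := HY v vr'.
pose z1 : VX := (v, Y v).
have inj1 (x : X) : 'd Phi z1 (0, x) = 0 -> x = 0.
  move=> Bx; apply/eqP; rewrite -rnorm_eq0 -[_ == 0]negbK; apply/negP => x0.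
  have {}x0 : 0 < rnorm x by rewrite lt_def x0 rnorm_ge0.
  have c40 : 0 < c0 / 4 by rewrite divr_gt0.
  have [e e0 He] := diff_reps (dPhi z1) c40.
  pose t := Num.min e (r / 2) / rnorm x.
  have m0 : 0 < Num.min e (r / 2) by rewrite lt_min e0.
  have t0 : 0 < t by rewrite divr_gt0.
  have tx : rnorm (t%:C *: x) = Num.min e (r / 2).
    by rewrite rnormZ normc_real gtr0_norm// /t divfK// gt_eqF.
  have := He (v, Y v + t%:C *: x).
  have -> : (v, Y v + t%:C *: x) - z1 = (0, t%:C *: x) by congr pair; rewrite /= ?subrr// addrC addKr.
  rewrite rnorm_pair0 tx ge_min lexx => /(_ isT).
  have -> : 'd Phi z1 (0, t%:C *: x) = 0.
    have -> : (0, t%:C *: x) = t%:C *: ((0 : V), x) by congr pair; rewrite /= scaler0.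
    by rewrite linearZ /= Bx scaler0.
  rewrite subr0 /z1.
  have := low v (Y v + t%:C *: x) (Y v) (rhor _ vr') _ (r2r _ a1).
  have -> : Y v + t%:C *: x - Y v = t%:C *: x by rewrite addrC addKr.
  rewrite tx => h1 h2.
  have := h1 _; rewrite addrAC => {}h1.
  have := le_trans (h1 (le_trans (ler_rnormD _ _) _)) h2.
  rewrite tx => h3.
  have : c0 / 2 * Num.min e (r / 2) <= c0 / 4 * Num.min e (r / 2).
    apply: h3; rewrite [leRHS]splitr; apply: lerD => //.
    by rewrite ge_min lexx orbT.
  rewrite ler_pM2r// ler_pM2l// lef_pV2 ?posrE// ler_nat.
by [].
have [A1 [BA1 AB1]] := partial_inverse inj1.
have [K1 K10 AK1] := mulmx_rnorm_le A1.
pose D : X := - ('d Phi z1 (u, 0) *m A1).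
exists (D 0 j) => k k0.
pose LL := 2 * L0 / c0 * (rnorm u + 1) + (rnorm u + 1).
have u1 : 0 < rnorm u + 1 by rewrite ltr_wpDl// rnorm_ge0.
have LL0 : 0 < LL by apply: addr_gt0 => //; exact: mulr_gt0.
have k'0 : 0 < k / (K1 * LL) by rewrite divr_gt0 ?mulr_gt0.
have [e e0 He] := diff_reps (dPhi z1) k'0.
exists (Num.min (e / LL) ((rho - rnorm (v - v0)) / (rnorm u + 1))).
  by rewrite lt_min !divr_gt0// subr_gt0.
move=> s; rewrite subr0 le_min scale0r addr0 => /andP[s1 s2].
have su : rnorm (s *: u) <= nc s * (rnorm u + 1) by rewrite rnormZ ler_wpM2l ?normc_ge0// lerDl.
have vs : rnorm (v + s *: u - v0) <= rho.
  rewrite addrAC; apply: le_trans (ler_rnormD _ _) _.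
  have := le_trans su (_ : _ <= rho - rnorm (v - v0)); rewrite -ler_pdivlMr// => /(_ s2).
  lra.
set dx := Y (v + s *: u) - Y v.
have dxL : rnorm dx <= 2 * L0 / c0 * (nc s * (rnorm u + 1)).
  have := lipY _ _ vs vr'; rewrite [v + _ - v]addrAC subrr add0r => h; apply: le_trans h _.
  by rewrite ler_pM2l.
have [_ b2] := HY _ vs.
have := He (v + s *: u, Y (v + s *: u)).
have -> : (v + s *: u, Y (v + s *: u)) - z1 = (s *: u, dx).
  by congr pair; rewrite /= addrAC subrr add0r.
have zs : rnorm ((s *: u, dx) : VX) <= LL * nc s.
  rewrite rnorm_pair ge_max /= /LL mulrDl; apply/andP; split.
    rewrite (le_trans su)// [leRHS]addrC mulrC lerDl.
    by apply: mulr_ge0 (normc_ge0 _); apply: mulr_ge0; exact: ltW.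
  rewrite (le_trans dxL)// [nc s * _]mulrC mulrA lerDl.
  by apply: mulr_ge0 (normc_ge0 _); exact: ltW.
rewrite (le_trans zs); last by rewrite mulrC -ler_pdivlMr.
move=> /(_ isT); rewrite b2 b1 subrr sub0r rnormN => h.
have E : dx - s *: D = 'd Phi z1 (s *: u, dx) *m A1.
  have -> : (s *: u, dx) = s *: (u, 0) + (0, dx) by congr pair; rewrite /= ?scaler0 ?addr0 ?add0r.
  have -> : 'd Phi z1 (s *: ((u, 0) : VX) + ((0, dx) : VX)) =
     s *: 'd Phi z1 (u, 0) + 'd Phi z1 (0, dx) by rewrite linearP.
  by rewrite mulmxDl AB1 /D scalerN opprK addrC scalemxAl.
have -> : Y (v + s *: u) 0 j - Y v 0 j - D 0 j * s = (dx - s *: D) 0 j.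
  by rewrite !mxE [s * _]mulrC.
apply: le_trans (rnorm_coord _ _ _) _; rewrite E; apply: le_trans (AK1 _) _.
have -> : k * nc s = K1 * (k / (K1 * LL) * (LL * nc s)) by field; rewrite !gt_eqF.
rewrite (ler_pM2l K10); exact: le_trans h (ler_wpM2l (ltW k'0) zs).
Qed.

End ImplicitFunction.

End RealComplexVectors.

(** * Potentials of Lipschitz Lagrangian graphs *)

Section DotProduct.
Variables (R : realType) (d : nat).
Implicit Types (u v w : 'rV[R]_d) (a : R).

Lemma dotpDl u v w : dotp (u + v) w = dotp u w + dotp v w.
Proof. by rewrite /dotp -big_split; apply: eq_bigr => i _; rewrite mxE mulrDl. Qed.

Lemma dotpC u v : dotp u v = dotp v u.
Proof. by apply: eq_bigr => i _; rewrite mulrC. Qed.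

Lemma dotpDr u v w : dotp u (v + w) = dotp u v + dotp u w.
Proof. by rewrite dotpC dotpDl !(dotpC u). Qed.

Lemma dotpZl a u v : dotp (a *: u) v = a * dotp u v.
Proof. by rewrite /dotp mulr_sumr; apply: eq_bigr => i _; rewrite mxE mulrA. Qed.

Lemma dotpZr a u v : dotp u (a *: v) = a * dotp u v.
Proof. by rewrite dotpC dotpZl dotpC. Qed.

Lemma dotpNl u v : dotp (- u) v = - dotp u v.
Proof. by rewrite -scaleN1r dotpZl mulN1r. Qed.

Lemma dotpNr u v : dotp u (- v) = - dotp u v.
Proof. by rewrite dotpC dotpNl dotpC. Qed.

Lemma dotpBl u v w : dotp (u - v) w = dotp u w - dotp v w.
Proof. by rewrite dotpDl dotpNl. Qed.

Lemma dotpBr u v w : dotp u (v - w) = dotp u v - dotp u w.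
Proof. by rewrite dotpDr dotpNr. Qed.

Lemma dotp0l u : dotp 0 u = 0.
Proof. by rewrite -(scale0r 0) dotpZl mul0r. Qed.

Lemma dotp0r u : dotp u 0 = 0.
Proof. by rewrite dotpC dotp0l. Qed.

Lemma norm_dotp u v : `|dotp u v| <= d%:R * `|u| * `|v|.
Proof.
apply: le_trans (ler_norm_sum _ _ _) _.
apply: le_trans (_ : \sum_(i < d) `|u| * `|v| <= _).
  by apply: ler_sum => i _; rewrite normrM ler_pM// mx_coord_le.
by rewrite sumr_const card_ord -[X in X <= _]mulr_natl mulrA.
Qed.

Lemma dotp_sqr_ge u : `|u| ^+ 2 <= dotp u u.
Proof.
have [u0|u0] := eqVneq (mx_norm u) 0.
  by rewrite (mx_norm_eq0 u0) normr0 expr0n dotp0l.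
have [[i j] /= E] := mx_norm_neq0 u0.
rewrite [`|u|]E -normrX ger0_norm ?sqr_ge0// ord1 /dotp (bigD1 j)//= -expr2 lerDl.
by apply: sumr_ge0 => k _; rewrite -expr2 sqr_ge0.
Qed.

Lemma dotp_ge0 u : 0 <= dotp u u.
Proof. by apply: le_trans (dotp_sqr_ge u); rewrite sqr_ge0. Qed.

Lemma dotp_eq0 u : dotp u u <= 0 -> u = 0.
Proof.
move=> h; apply/eqP; rewrite -normr_eq0 -sqrf_eq0 eq_le sqr_ge0 andbT.
exact: le_trans (dotp_sqr_ge u) h.
Qed.

Lemma dotp_continuous (T : topologicalType) (f g : T -> 'rV[R]_d) :
  continuous f -> continuous g -> continuous (fun x => dotp (f x) (g x)).
Proof.
move=> cf cg x; rewrite /dotp /continuous_at.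
have : forall s : seq 'I_d, \sum_(i <- s) f y 0 i * g y 0 i @[y --> x] --> \sum_(i <- s) f x 0 i * g x 0 i.
  elim=> [|i s IH].
    by under eq_fun do rewrite big_nil; rewrite big_nil; exact: cvg_cst.
  under eq_fun do rewrite big_cons; rewrite big_cons; apply: cvgD => //; apply: cvgM.
    by apply: (@continuous_comp _ _ _ f (fun M : 'rV[R]_d => M 0 i) x (cf x)); exact: coord_continuous.
  by apply: (@continuous_comp _ _ _ g (fun M : 'rV[R]_d => M 0 i) x (cg x)); exact: coord_continuous.
by apply.
Qed.

End DotProduct.

Section Plateau.
Variable R : realType.

Lemma plateau_ex : exists psi dpsi : R -> R, [/\ forall x : R, is_derive x 1 psi (dpsi x),
  continuous dpsi, forall x, x <= - (1/2) -> psi x = 0 /\ dpsi x = 0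
  & forall x, 1/2 <= x -> psi x = 1 /\ dpsi x = 0].
Proof.
pose phi (x : R) := Num.max 0 (1/4 - x ^+ 2).
have cphi : continuous phi.
  move=> x; apply: (@continuous_max _ _ (fun=> 0) (fun x : R => 1/4 - x ^+ 2)); first exact: cst_continuous.
  apply: (@cvgB _ R^o _ _ _ (fun=> 1/4) (fun x : R => x ^+ 2)); first exact: cvg_cst.
  exact: exprn_continuous.
have phi0 x : 1/2 <= `|x| -> phi x = 0.
  move=> h; rewrite /phi max_l// subr_le0 -[x ^+ 2]ger0_norm ?sqr_ge0// normrX.
  have -> : (1/4 : R) = (1/2) ^+ 2 by field.
  by rewrite ler_pXn2r ?nnegrE.
have D := primP cphi.
pose c := prim phi (1/2) - prim phi (- (1/2)).
have l4 : - (1/4) <= 1/4 :> R by lra.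
have [x xr xE] := @mvt_segment R (prim phi) phi (- (1/4)) (1/4) l4 (fun x _ => D x).
have mono a b : a <= b -> prim phi a <= prim phi b.
  move=> ab; have [e _ E] := @mvt_segment R (prim phi) phi a b ab (fun x _ => D x).
  by rewrite -subr_ge0 E mulr_ge0 ?subr_ge0// /phi le_max lexx.
have c0 : 0 < c.
  have : 0 < prim phi (1/4) - prim phi (- (1/4)).
    rewrite xE; apply: mulr_gt0; last by rewrite opprK; lra.
    rewrite /phi lt_max; apply/orP; right; rewrite subr_gt0.
    have : x ^+ 2 <= (1/4) ^+ 2.
      rewrite -[x ^+ 2]ger0_norm ?sqr_ge0// normrX ler_pXn2r ?nnegrE//.
      by rewrite ler_norml.
    lra.
  have h1 : prim phi (- (1/2)) <= prim phi (- (1/4)) by apply: mono; lra.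
  have h2 : prim phi (1/4) <= prim phi (1/2) by apply: mono; lra.
  by move: h1 h2; rewrite /c; lra.
have flat a b : a <= b -> (forall x, a <= x <= b -> phi x = 0) -> prim phi a = prim phi b.
  move=> ab H; have [e eab E] := @mvt_segment R (prim phi) phi a b ab (fun x _ => D x).
  by move/eqP: E; rewrite (H e eab) mul0r subr_eq0 => /eqP.
exists (fun x => c^-1 * (prim phi x - prim phi (- (1/2)))), (fun x => c^-1 * phi x); split.
- move=> y.
  have -> : (fun x => c^-1 * (prim phi x - prim phi (- (1/2)))) =
     c^-1 *: (prim phi - cst (prim phi (- (1/2)))) by apply/funext.
  by have Dy := D y; apply: is_derive_eq; rewrite subr0.
- by move=> y; apply: cvgM; [exact: cvg_cst|exact: cphi].
- move=> y yh; rewrite phi0 ?mulr0; last by rewrite lerNr in yh; rewrite ler_normr yh orbT.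
  split=> //; rewrite (flat y (- (1/2)))// ?subrr ?mulr0// => z /andP[z1 z2]; apply: phi0.
  by rewrite lerNr in z2; rewrite ler_normr z2 orbT.
move=> y yh; rewrite phi0 ?mulr0; last by rewrite ler_normr yh.
split=> //; rewrite -(flat (1/2) y)//; first by rewrite -/c mulVf// gt_eqF.
by move=> z /andP[z1 z2]; apply: phi0; rewrite ler_normr z1.
Qed.

Lemma cos_ge_half (x : R) : `|x| <= pi / 4 -> 1/2 <= cos x.
Proof.
rewrite ler_norml => /andP[h1 h2].
have pE : pi / 2 = pi / 4 + pi / 4 :> R by field.
have c2 : 0 <= cos (x *+ 2).
  by apply: cos_ge0_pihalf; rewrite mulr2n pE opprD !lerD.
have c1 : 0 <= cos x.
  have p4 : pi / 4 <= pi / 2 :> R by rewrite pE lerDl divr_ge0// pi_ge0.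
  apply: cos_ge0_pihalf; rewrite (le_trans h2)// andbT (le_trans _ h1)//.
  by rewrite lerN2.
rewrite leNgt; apply/negP => c3.
have : cos x ^+ 2 < (1/2) ^+ 2 by rewrite ltr_pXn2r ?nnegrE.
move: c2; rewrite cos_mulr2n mulr2n; lra.
Qed.

End Plateau.

Lemma eps_is_derive1 (R : realType) (f : R -> R) (x df : R) :
  (forall k : R, 0 < k -> exists2 r : R, 0 < r &
    forall x', `|x' - x| <= r -> `|f x' - f x - df * (x' - x)| <= k * `|x' - x|) ->
  is_derive x 1 f df.
Proof.
move=> H.
have cv : (fun h : R => h^-1 *: (f (h *: (1 : R) + x) - f x)) @ (0 : R)^' --> df.
  apply/cvgrPdist_le => k k0; have [r r0 Hr] := H k k0.
  have N : \forall h \near (0 : R)^', `|h| <= r /\ h != 0.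
    near=> h; split; last by near: h; exact: nbhs_dnbhs_neq.
    near: h; apply: nbhs_dnbhs.
    by near=> h; rewrite ltW// -[h]subr0 -normrN opprB; near: h; exact: nbhs0_lt.
  near=> h; have [hr h0] : `|h| <= r /\ h != 0 by near: h; exact: N.
  have := Hr (h *: (1 : R) + x); rewrite addrK [h *: 1]mulr1 => /(_ hr) h1.
  rewrite -(ler_pM2l (_ : 0 < `|h|)) ?normr_gt0// -normrM mulrBr [h^-1 *: _]/(h^-1 * _).
  by rewrite mulrA divff// mul1r distrC [h * df]mulrC [_ * k]mulrC.
by split; [apply/cvg_ex; exists df|apply: cvg_lim].
Unshelve. all: by end_near. Qed.

Lemma diff_eps (R : realType) (V W : normedModType R) (f : V -> W) z :
  differentiable f z -> forall k : R, 0 < k -> exists2 r : R, 0 < r &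
    forall x, `|x - z| <= r -> `|f x - f z - 'd f z (x - z)| <= k * `|x - z|.
Proof.
move=> df k k0; have := diff_locally df => /eqaddoP /(_ _ k0).
move=> /nbhs_ballP[r r0 H]; exists (r / 2) => [|x xz]; first exact: divr_gt0.
have := H (x - z); rewrite -ball_normE /= sub0r normrN !fctE /= subrK opprD addrA; apply.
by rewrite (le_lt_trans xz)// ltr_pdivrMr// ltr_pMr// ltr1n.
Qed.

Section Potential.
Variables (R : realType) (d : nat).
Local Notation E := 'rV[R]_d.
Variable gamma : E -> E.
Hypothesis cgamma : continuous gamma.

Definition line_form (q v : E) (s : R) := dotp (gamma (q + s *: v)) v.

Lemma line_continuous (q v : E) : continuous (fun s : R => q + s *: v).
Proof. by move=> s; apply: cvgD; [exact: cvg_cst|exact: scalel_continuous]. Qed.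

Lemma line_form_continuous (q v : E) : continuous (line_form q v).
Proof.
apply: dotp_continuous; last exact: cst_continuous.
by move=> s; apply: continuous_comp; [exact: line_continuous|exact: cgamma].
Qed.

Definition line_int (q v : E) := prim (line_form q v) 1 - prim (line_form q v) 0.

Lemma curve_diff (k dk : R -> R) (w : E) (x : R) : is_derive x 1 k (dk x) ->
  is_diff x (fun t => k t *: w) (fun h => (h * dk x) *: w).
Proof.
move=> dkx; have dk1 : differentiable k x by apply/derivable1_diffP; case: dkx.
apply: DiffDef; first exact: differentiableZl.
rewrite diffZl//; apply/funext => h; congr (_ *: _).
have <- : 'd k x 1 = dk x by rewrite -deriveE// derive_val.
by rewrite -[in LHS](mulr1 h) -[h * 1]/(h *: (1 : R)) linearZ.
Qed.

Hypothesis lag : lagrangian gamma.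

(* The C^1 loop t |-> al (q + be v) runs along the sides of the triangle with
   vertices 0, q, q + v, stopping at the corners. *)
Lemma triangle q v : line_int 0 (q + v) - line_int 0 q = line_int q v.
Proof.
have [psi [dpsi [D cD psi0 psi1]]] := plateau_ex R.
pose th (t : R) := 2 * pi * t.
have dth (t : R) : is_derive t 1 th (2 * pi).
  have -> : th = (2 * pi) *: id by apply/funext.
  by apply: is_derive_eq; rewrite [_ *: 1]mulr1.
pose al := psi \o (cos \o th); pose be := psi \o (sin \o th).
pose dal t := dpsi (cos (th t)) * (- sin (th t) * (2 * pi)).
pose dbe t := dpsi (sin (th t)) * (cos (th t) * (2 * pi)).
have alD (t : R) : is_derive t 1 al (dal t).
  exact: (@is_derive1_comp _ psi (cos \o th)).
have beD (t : R) : is_derive t 1 be (dbe t).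
  exact: (@is_derive1_comp _ psi (sin \o th)).
have cth : continuous th by move=> t; exact: is_derive_continuous (dth t).
have cal : continuous al by move=> t; exact: is_derive_continuous (alD t).
have cbe : continuous be by move=> t; exact: is_derive_continuous (beD t).
have ccos : continuous (fun t => cos (th t)).
  by move=> t; apply: (@continuous_comp _ _ _ th cos); [exact: cth|exact: continuous_cos].
have csin : continuous (fun t => sin (th t)).
  by move=> t; apply: (@continuous_comp _ _ _ th sin); [exact: cth|exact: continuous_sin].
have cdal : continuous dal.
  move=> t; apply: cvgM.
    by apply: (@continuous_comp _ _ _ (fun t => cos (th t)) dpsi); [exact: ccos|exact: cD].
  by apply: cvgM; [apply: cvgN; exact: csin|exact: cvg_cst].
have cdbe : continuous dbe.
  move=> t; apply: cvgM.
    by apply: (@continuous_comp _ _ _ (fun t => sin (th t)) dpsi); [exact: csin|exact: cD].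
  by apply: cvgM; [exact: ccos|exact: cvg_cst].
pose ab t := al t * be t; pose dab t := al t * dbe t + be t * dal t.
have abD (t : R) : is_derive t 1 ab (dab t).
  by have a1 := alD t; have a2 := beD t; exact: is_deriveM.
have cdab : continuous dab.
  by move=> t; apply: cvgD; apply: cvgM; [exact: cal|exact: cdbe|exact: cbe|exact: cdal].
pose nu t : E := al t *: q + ab t *: v.
pose dnu t : E := dal t *: q + dab t *: v.
have nuD (t : R) : is_diff t nu (fun h => h *: dnu t).
  have h1 := curve_diff q (alD t); have h2 := curve_diff v (abD t).
  apply: is_diff_eq; apply/funext => h /=.
  by rewrite /dnu scalerDr !scalerA.
have nud t : differentiable nu t by have [] := nuD t.
have cdnu : continuous dnu.
  move=> t; apply: cvgD; apply: cvgZr_tmp; [exact: cdal|exact: cdab].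
have C1nu : C1 nu.
  split=> [t|h]; first exact: nud.
  have -> : (fun x => 'd nu x h) = (fun x => h *: dnu x).
    by apply/funext => x; rewrite diff_val.
  by move=> t; apply: cvgZl_tmp; exact: cdnu.
have dnuE t : derive1 nu t = dnu t.
  by rewrite derive1E' ?diff_val ?scale1r.
have nu1 t : nu (t + 1) = nu t.
  rewrite /nu /ab /al /be /= /th mulrDr mulr1.
  by rewrite mulr_natl sinD2pi cosD2pi.
pose f t := dotp (gamma (nu t)) (dnu t).
have cnu : continuous nu by move=> t; exact: differentiable_continuous (nud t).
have cf : continuous f.
  apply: dotp_continuous; last exact: cdnu.
  by move=> t; apply: continuous_comp; [exact: cnu|exact: cgamma].
have Fi := primP cf; have I0 := lag C1nu nu1.
have {}I0 : prim f 1 - prim f 0 = 0.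
  rewrite -(Rintegral_primitive cf Fi) -[RHS]I0; congr (Rintegral _ _ _).
  by apply/funext => t; rewrite /f dnuE.
have phase (a b : R) (q0 w : E) (s ds : R -> R) : a <= b -> (forall t : R, is_derive t 1 s (ds t)) ->
    (forall t, a <= t <= b -> nu t = q0 + s t *: w /\ dnu t = ds t *: w) ->
    prim f b - prim f a = prim (line_form q0 w) (s b) - prim (line_form q0 w) (s a).
  move=> leab sD H; rewrite -[prim _ (s b)]/((prim (line_form q0 w) \o s) b).
  rewrite -[prim _ (s a)]/((prim (line_form q0 w) \o s) a).
  apply: (@eq_of_derive _ _ _ f) => // t tab.
  have [e1 e2] := H t tab.
  have -> : f t = line_form q0 w (s t) * ds t.
    by rewrite /f /line_form e1 e2 dotpZr mulrC.
  have dP := primP (@line_form_continuous q0 w).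
  exact: (@is_derive1_comp _ (prim (line_form q0 w)) s).
have p0 : 0 < 2 * pi :> R by rewrite mulr_gt0// pi_gt0.
(* [c] is the midpoint of the interval, in units of a quarter turn *)
have around (c t : R) : `|t - c| <= 1/8 -> `|th t - th c| <= pi / 4.
  move=> h; rewrite /th -mulrBr normrM gtr0_norm//.
  have -> : pi / 4 = 2 * pi * (1/8) :> R by field.
  by rewrite ler_pM2l.
have close (c a b t : R) : c - 1/8 <= a -> b <= c + 1/8 -> a <= t <= b -> `|t - c| <= 1/8.
  by move=> h1 h2 /andP[h3 h4]; rewrite ler_norml; apply/andP; split; lra.
have A (t : R) : 0 <= t <= 1/8 -> al t = 1 /\ dal t = 0.
  move=> tr; have [|] := psi1 (cos (th t)).
    by apply: cos_ge_half; have := around 0 t (close 0 _ _ _ _ _ tr); rewrite {2}/th mulr0 subr0; apply; lra.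
  by move=> h1 h2; rewrite /dal h2 mul0r.
have B t : 1/8 <= t <= 3/8 -> be t = 1 /\ dbe t = 0.
  move=> tr; have [|] := psi1 (sin (th t)).
    rewrite -cosBpihalf; apply: cos_ge_half.
    have -> : pi / 2 = th (1/4) by rewrite /th; field.
    by apply: around; apply: close tr; lra.
  by move=> h1 h2; rewrite /dbe h2 mul0r.
have C t : 3/8 <= t <= 5/8 -> al t = 0 /\ dal t = 0.
  move=> tr; have [|] := psi0 (cos (th t)).
    have -> : th t = th t - pi + pi by rewrite subrK.
    rewrite cosDpi lerN2; apply: cos_ge_half.
    rewrite [X in _ - X](_ : pi = th (1/2)); last by rewrite /th; field.
    by apply: around; apply: close tr; lra.
  by move=> h1 h2; rewrite /dal h2 mul0r.
have Dd t : 5/8 <= t <= 7/8 -> be t = 0 /\ dbe t = 0.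
  move=> tr; have [|] := psi0 (sin (th t)).
    rewrite -cosBpihalf.
    have -> : th t - pi / 2 = th t - th (3/4) + pi by rewrite /th; field.
    rewrite cosDpi lerN2; apply: cos_ge_half.
    by apply: around; apply: close tr; lra.
  by move=> h1 h2; rewrite /dbe h2 mul0r.
have Ee t : 7/8 <= t <= 1 -> al t = 1 /\ dal t = 0.
  move=> tr; have [|] := psi1 (cos (th t)).
    have -> : th t = th t - th 1 + pi *+ 2 by rewrite /th; ring.
    rewrite cosD2pi; apply: cos_ge_half.
    by apply: around; apply: close tr; lra.
  by move=> h1 h2; rewrite /dal h2 mul0r.
have e1 := @phase 0 (1/8) q v be dbe _ beD _.
have e2 := @phase (1/8) (3/8) 0 (q + v) al dal _ alD _.
have e3 := @phase (3/8) (5/8) 0 0 al dal _ alD _.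
have e4 := @phase (5/8) (7/8) 0 q al dal _ alD _.
have e5 := @phase (7/8) 1 q v be dbe _ beD _.
have {}e1 := e1 ltac:(lra) (fun t tr => ltac:(have [a1 a2] := A t tr; rewrite /nu /dnu /ab /dab a1 a2 scale1r !mul1r mulr0 addr0 scale0r add0r; split; reflexivity)).
have {}e2 := e2 ltac:(lra) (fun t tr => ltac:(have [a1 a2] := B t tr; rewrite /nu /dnu /ab /dab a1 a2 mulr1 mulr0 mul1r !add0r !scalerDr; split; reflexivity)).
have {}e3 := e3 ltac:(lra) (fun t tr => ltac:(have [a1 a2] := C t tr; rewrite /nu /dnu /ab /dab a1 a2 !mul0r mulr0 !addr0 !scale0r !addr0; split; reflexivity)).
have {}e4 := e4 ltac:(lra) (fun t tr => ltac:(have [a1 a2] := Dd t tr; rewrite /nu /dnu /ab /dab a1 a2 !mul0r mulr0 !addr0 !scale0r !addr0 add0r; split; reflexivity)).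
have {}e5 := e5 ltac:(lra) (fun t tr => ltac:(have [a1 a2] := Ee t tr; rewrite /nu /dnu /ab /dab a1 a2 scale1r !mul1r mulr0 addr0 scale0r add0r; split; reflexivity)).
have bE1 := (B (1/8) ltac:(apply/andP; split; lra)).1.
have aE1 := (A (1/8) ltac:(apply/andP; split; lra)).1.
have aE2 := (C (3/8) ltac:(apply/andP; split; lra)).1.
have aE3 := (C (5/8) ltac:(apply/andP; split; lra)).1.
have aE4 := (Ee (7/8) ltac:(apply/andP; split; lra)).1.
have bE4 := (Dd (7/8) ltac:(apply/andP; split; lra)).1.
have bE5 : be 1 = be 0 by rewrite /be /= /th mulr1 mulr0 mulr_natl sin2pi sin0.
rewrite bE1 in e1; rewrite aE1 aE2 in e2; rewrite aE2 aE3 in e3; rewrite aE3 aE4 in e4.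
rewrite bE4 bE5 in e5.
rewrite /line_int; move: e1 e2 e3 e4 e5 I0; clear; lra.
Qed.

Lemma line_int_mvt q v : exists2 c, 0 <= c <= 1 & line_int q v = dotp (gamma (q + c *: v)) v.
Proof.
have D := primP (line_form_continuous (q := q) (v := v)).
have [c c01 E1] := mvt_segment ler01 (fun x _ => D x).
by exists c => //; rewrite /line_int E1 subr0 mulr1.
Qed.

Lemma line_int_periodic (k : 'rV[int]_d) q v : Defs.periodic gamma ->
  line_int (q + intv R k) v = line_int q v.
Proof.
move=> pg; rewrite /line_int; congr (prim _ 1 - prim _ 0);
  by apply/funext => s; rewrite /line_form addrAC pg.
Qed.

Lemma lagrangian_potential : exists2 U : E -> R, U 0 = 0 &
  forall q v, U (q + v) - U q = line_int q v.
Proof.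
exists (line_int 0); last exact: triangle.
by have [c _ ->] := line_int_mvt 0 0; rewrite dotp0r.
Qed.

Lemma potential_lagrangian (U : E -> R) (C : R) :
  (forall q v, `|v| <= 1 -> `|U (q + v) - U q - dotp (gamma q) v| <= C * `|v| ^+ 2) ->
  lagrangian gamma.
Proof.
move=> H nu [dnu cdnu] nu1.
have cnu : continuous nu by move=> t; exact: differentiable_continuous.
pose f t := dotp (gamma (nu t)) ('d nu t 1).
have cf : continuous f.
  apply: dotp_continuous; last exact: cdnu.
  by move=> t; apply: continuous_comp; [exact: cnu|exact: cgamma].
have -> : (fun t => dotp (gamma (nu t)) (derive1 nu t)) = f.
  by apply/funext => t; rewrite derive1E'.
suff D t : is_derive t (1 : R) (U \o nu) (f t).
  by rewrite (Rintegral_primitive cf D) /= -(nu1 0) add0r subrr.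
apply: eps_is_derive1 => k k0.
set q := nu t; set w := 'd nu t 1.
pose M := `|w| + 1; have M0 : 0 < M by rewrite ltr_wpDl.
pose B := d%:R * `|gamma q| + 1.
have B0 : 0 < B by rewrite ltr_wpDl// mulr_ge0.
pose D := `|C| * M ^+ 2 + 1.
have D0 : 0 < D by rewrite ltr_wpDl// mulr_ge0// sqr_ge0.
have e0 : 0 < Num.min 1 (k / (2 * B)) by rewrite lt_min ltr01 divr_gt0// mulr_gt0.
have [r r0 Hr] := diff_eps (dnu t) e0.
exists (Num.min r (Num.min M^-1 (k / (2 * D)))).
  by rewrite !lt_min r0 invr_gt0 M0/= divr_gt0// mulr_gt0.
move=> t'; rewrite !le_min => /and3P[h1 h2 h3].
have := Hr t' h1.
have -> : 'd nu t (t' - t) = (t' - t) *: w.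
  by rewrite -[X in 'd nu t X]mulr1 -[_ * 1]/((t' - t) *: (1 : R)) linearZ.
set v := nu t' - nu t => h4.
have vM : `|v| <= M * `|t' - t|.
  have -> : v = (v - (t' - t) *: w) + (t' - t) *: w by rewrite subrK.
  apply: le_trans (ler_normD _ _) _; rewrite normrZ /M mulrDl mul1r addrC [`|w| * _]mulrC lerD//.
  apply: le_trans h4 _; apply: ler_piMl => //.
  by rewrite ge_min lexx.
have v1 : `|v| <= 1.
  by apply: le_trans vM _; rewrite -ler_pdivlMl// mulr1.
have h5 := H q v v1; rewrite (_ : q + v = nu t') in h5; last by rewrite /v /q addrC subrK.
have -> : (U \o nu) t' - (U \o nu) t - f t * (t' - t) =
   (U (nu t') - U q - dotp (gamma q) v) + dotp (gamma q) (v - (t' - t) *: w).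
  by rewrite [dotp _ (_ - _ *: _)]dotpBr dotpZr /f -/q -/w /=; ring.
apply: le_trans (ler_normD _ _) _.
have h6 : `|U (nu t') - U q - dotp (gamma q) v| <= k / 2 * `|t' - t|.
  apply: le_trans h5 _; apply: le_trans (_ : `|C| * `|v| ^+ 2 <= _).
    by apply: ler_wpM2r; [exact: sqr_ge0|exact: ler_norm].
  apply: le_trans (_ : `|C| * (M * `|t' - t|) ^+ 2 <= _).
    apply: ler_wpM2l => //; rewrite ler_pXn2r ?nnegrE//.
    by rewrite mulr_ge0// ltW.
  have -> : `|C| * (M * `|t' - t|) ^+ 2 = `|C| * M ^+ 2 * `|t' - t| * `|t' - t| by ring.
   apply: ler_wpM2r => //.
  apply: le_trans (_ : D * `|t' - t| <= _).
    by apply: ler_wpM2r => //; rewrite /D; lra.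
  rewrite -ler_pdivlMl//; apply: le_trans h3 _.
  by rewrite le_eqVlt; apply/orP; left; apply/eqP; field; rewrite gt_eqF.
have h7 : `|dotp (gamma q) (v - (t' - t) *: w)| <= k / 2 * `|t' - t|.
  apply: le_trans (norm_dotp _ _) _.
  apply: le_trans (_ : B * `|v - (t' - t) *: w| <= _).
    by apply: ler_wpM2r => //; rewrite /B; lra.
  rewrite -ler_pdivlMl//; apply: le_trans h4 _.
  rewrite mulrA; apply: ler_wpM2r => //.
  apply: le_trans (_ : k / (2 * B) <= _); first by rewrite ge_min lexx orbT.
  by rewrite le_eqVlt; apply/orP; left; apply/eqP; field; rewrite gt_eqF.
by apply: le_trans (lerD h6 h7) _; rewrite -mulrDl -splitr.
Qed.

End Potential.

(** * Action and calibration *)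

Lemma cvg_pair_for (X Y Z : topologicalType) (f : X -> Y) (g : X -> Z) (x : X) :
  {for x, continuous f} -> {for x, continuous g} -> {for x, continuous (fun x => (f x, g x))}.
Proof.
move=> cf cg A [[B1 B2] [/= h1 h2] H].
have {}h1 : nbhs x (f @^-1` B1) by exact: cf.
have {}h2 : nbhs x (g @^-1` B2) by exact: cg.
by apply: filterS (filterI h1 h2) => y [? ?]; exact: (H (f y, g y)).
Qed.

Lemma lip_continuous (R : realType) (V W : normedModType R) (f : V -> W) (B : R) :
  (forall x y, `|f x - f y| <= B * `|x - y|) -> continuous f.
Proof.
move=> H x; apply/cvgrPdist_le => e e0.
have B0 : 0 < `|B| + 1 by rewrite ltr_wpDl.
near=> y; apply: le_trans (H _ _) _; apply: le_trans (_ : (`|B| + 1) * `|x - y| <= _).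
  by apply: ler_wpM2r => //; apply: le_trans (ler_norm _) _; rewrite lerDl.
rewrite -ler_pdivlMl//; near: y; apply: cvgr_dist_le => //.
by rewrite mulr_gt0// invr_gt0.
Unshelve. all: by end_near. Qed.

Section PeriodicFunctions.
Variable R : realType.

Lemma flat_curve (g : R -> R) (K C tau rho : R) : 0 <= C -> 0 <= tau -> 0 < rho ->
  (forall s t, 0 <= s -> s <= t -> t <= tau -> t - s <= rho -> `|g t - g s| <= K * (t - s) + C * (t - s) ^+ 2) ->
  `|g tau - g 0| <= K * tau.
Proof.
move=> C0 tau0 rho0 H; apply/ler_addgt0Pr => e e0.
have t1 : 0 <= C * tau ^+ 2 / e by rewrite divr_ge0 ?mulr_ge0 ?sqr_ge0// ltW.
have t2 : 0 <= tau / rho by rewrite divr_ge0// ltW.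
pose N := (Num.truncn (C * tau ^+ 2 / e + tau / rho)).+1.
have N0 : 0 < N%:R :> R by rewrite ltr0n.
have HN' : C * tau ^+ 2 / e + tau / rho < N%:R by exact: truncnS_gt.
have HN : C * tau ^+ 2 / e < N%:R by apply: le_lt_trans HN'; rewrite lerDl.
have HN2 : tau / rho < N%:R by apply: le_lt_trans HN'; rewrite lerDr.
pose h := tau / N%:R.
have h0 : 0 <= h by apply: divr_ge0 => //; exact: ltW.
have step i : (i <= N)%N -> `|g (i%:R * h) - g 0| <= i%:R * (K * h + C * h ^+ 2).
  elim: i => [_|i IH iN]; first by rewrite !mul0r subrr normr0.
  have -> : g (i.+1%:R * h) - g 0 = (g (i.+1%:R * h) - g (i%:R * h)) + (g (i%:R * h) - g 0) by ring.
  apply: le_trans (ler_normD _ _) _.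
  have -> : i.+1%:R * (K * h + C * h ^+ 2) = (K * h + C * h ^+ 2) + i%:R * (K * h + C * h ^+ 2).
    by rewrite -[i.+1]addn1 natrD; ring.
  apply: lerD; last exact: IH (ltnW iN).
  have E1 : i.+1%:R * h - i%:R * h = h by rewrite -mulrBl -natrB// subSnn mul1r.
  have := H (i%:R * h) (i.+1%:R * h); rewrite E1; apply.
  - exact: mulr_ge0.
  - by apply: ler_wpM2r => //; rewrite ler_nat.
  - have -> : tau = N%:R * h by rewrite /h mulrC divfK// gt_eqF.
    by apply: ler_wpM2r => //; rewrite ler_nat.
  - by rewrite /h ler_pdivrMr// mulrC -ler_pdivrMr// ltW.
have := step N (leqnn _).
have -> : N%:R * h = tau by rewrite /h mulrC divfK// gt_eqF.
move=> h1; apply: le_trans h1 _.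
have -> : N%:R * (K * h + C * h ^+ 2) = K * (N%:R * h) + C * (N%:R * h) ^+ 2 / N%:R.
  by field; rewrite gt_eqF.
have -> : N%:R * h = tau by rewrite /h mulrC divfK// gt_eqF.
rewrite lerD2l ler_pdivrMr// -ler_pdivrMl// mulrC; exact: ltW.
Qed.

Variable d : nat.
Local Notation E := 'rV[R]_d.

Lemma floor_reduction (q : E) : exists k : 'rV[int]_d, `|q + intv R k| <= 1.
Proof.
exists (\row_j - Num.floor (q 0 j)); apply: mx_norm_le => // i j.
rewrite ord1 !mxE.
have /andP[h1 h2] := floor_itv (q 0 j).
have -> : (- Num.floor (q 0 j))%:~R = - (Num.floor (q 0 j))%:~R :> R by rewrite mulrNz.
move: h1 h2; rewrite -[Num.floor _ + 1]/(Num.floor (q 0 j) + 1%:Z) intrD => h1 h2.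
rewrite ger0_norm; first by rewrite lerBlDr addrC ltW.
by rewrite subr_ge0.
Qed.

Lemma periodic_bounded (f : E -> R) : continuous f ->
  (forall q (k : 'rV[int]_d), f (q + intv R k) = f q) -> exists M, forall q, f q <= M.
Proof.
move=> cf pf.
have A0 : [set v : E | `|v| <= 1] !=set0 by exists 0; rewrite /= normr0.
have [c _ H] := compact_EVT_max A0 (@segment_box_compact _ _ 1) (continuous_subspaceT cf).
exists (f c) => q; have [k hk] := floor_reduction q.
by rewrite -(pf q k); apply: H; rewrite inE.
Qed.

End PeriodicFunctions.

Section Action.
Variables (R : realType) (d : nat).
Local Notation E := 'rV[R]_d.

Lemma unit_vector : (0 < d)%N -> exists u : E, `|u| = 1.
Proof.
move=> d0; exists (const_mx 1); apply/eqP; rewrite eq_le; apply/andP; split.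
  by apply: mx_norm_le => // i j; rewrite mxE normr1.
by have := mx_coord_le (const_mx 1 : E) 0 (Ordinal d0); rewrite mxE normr1.
Qed.

(* [a] and [b] are the partial gradients of the generating function [S] of the
   lift [T]; the constants are kept explicit in order to be uniform in families. *)
Record twist_data (c0 C0 : R) (Cq Kb : R -> R) (S : E -> E -> R) (a b : E -> E -> E)
  (T : E * E -> E * E) : Prop := TwistData {
  td_periodic : forall (k : 'rV[int]_d) q Q, S (q + intv R k) (Q + intv R k) = S q Q;
  td_continuous : continuous (fun z : E * E => S z.1 z.2);
  td_coercive : forall q Q, c0 * `|Q - q| ^+ 2 - C0 <= S q Q;
  td_c0 : 0 < c0;
  td_quad : forall D q Q u v, `|Q - q| <= D -> `|u| <= 1 -> `|v| <= 1 ->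
    `|S (q + u) (Q + v) - S q Q - dotp (a q Q) u - dotp (b q Q) v|
      <= Cq D * (`|u| + `|v|) ^+ 2;
  td_bound : forall D q Q, `|Q - q| <= D -> `|a q Q| <= Kb D /\ `|b q Q| <= Kb D;
  td_map : forall z z', T z = z' <-> z.2 = - a z.1 z'.1 /\ z'.2 = b z.1 z'.1 }.

Definition action (S : E -> E -> R) (n : nat) (y : nat -> E) :=
  \sum_(i < n) S (y i) (y i.+1).

Variables (c0 C0 : R) (Cq Kb : R -> R) (S : E -> E -> R) (a b : E -> E -> E).
Variable T : E * E -> E * E.
Hypothesis td : twist_data c0 C0 Cq Kb S a b T.

Local Notation W := (action S).

Lemma Cq_ge0 D : 0 <= D -> (0 < d)%N -> 0 <= Cq D.
Proof.
move=> D0 d0.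
have [u u1] := unit_vector d0.
have := @td_quad _ _ _ _ _ _ _ _ td D 0 0 u 0.
rewrite subrr normr0 u1 => /(_ D0 (lexx _) ler01).
by rewrite !addr0 expr1n mulr1; apply: le_trans.
Qed.

Lemma action_quad n (D : R) (y u : nat -> E) :
  (forall i, (i < n)%N -> `|y i.+1 - y i| <= D) -> (forall i, (i <= n)%N -> `|u i| <= 1) ->
  `|W n (fun i => y i + u i) - W n y -
    \sum_(i < n) (dotp (a (y i) (y i.+1)) (u i) + dotp (b (y i) (y i.+1)) (u i.+1))|
  <= Cq D * \sum_(i < n) (`|u i| + `|u i.+1|) ^+ 2.
Proof.
move=> yD u1; rewrite /action -!sumrB mulr_sumr.
apply: le_trans (ler_norm_sum _ _ _) _; apply: ler_sum => i _.
rewrite opprD addrA; apply: td_quad td _ _ _ _ _ _ _ _.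
- exact: yD.
- by apply: u1; exact: ltnW.
- exact: u1.
Qed.

Definition xo (z : E * E) i := (iter i T z).1.
Definition po (z : E * E) i := (iter i T z).2.

Lemma poE z i : po z i = - a (xo z i) (xo z i.+1) /\ po z i.+1 = b (xo z i) (xo z i.+1).
Proof. by apply/(td_map td (iter i T z) (iter i.+1 T z)); rewrite iterS. Qed.

Lemma orbit_action_quad n (D : R) z (u : nat -> E) :
  (forall i, (i < n)%N -> `|xo z i.+1 - xo z i| <= D) -> (forall i, (i <= n)%N -> `|u i| <= 1) ->
  `|W n (fun i => xo z i + u i) - W n (xo z) - (dotp (po z n) (u n) - dotp (po z 0) (u 0))|
  <= Cq D * \sum_(i < n) (`|u i| + `|u i.+1|) ^+ 2.
Proof.
move=> yD u1; have := action_quad yD u1; congr (_ <= _).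
congr (`| _ - _ |).
rewrite -(telescope_sumr (fun i => dotp (po z i) (u i)) (leq0n n)) big_mkord.
apply: eq_bigr => i _; have [e1 e2] := poE z i.
by rewrite e2 e1 dotpNl opprK addrC.
Qed.

Section Minimiser.
Variables (n : nat) (U V : E -> R) (al be : E -> E) (y : nat -> E) (CU : R).
Hypothesis d0 : (0 < d)%N.
Hypothesis quadU : forall q v, `|v| <= 1 -> `|U (q + v) - U q - dotp (al q) v| <= CU * `|v| ^+ 2.
Hypothesis quadV : forall q v, `|v| <= 1 -> `|V (q + v) - V q - dotp (be q) v| <= CU * `|v| ^+ 2.
Hypothesis miny : forall y', U (y 0%N) + W n y - V (y n) <= U (y' 0%N) + W n y' - V (y' n).

Lemma minimiser_orbit : iter n T (y 0%N, al (y 0%N)) = (y n, be (y n)) /\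
  forall i, (i <= n)%N -> xo (y 0%N, al (y 0%N)) i = y i.
Proof.
pose be_ i := b (y i) (y i.+1); pose al_ i := a (y i) (y i.+1).
pose pi i := if i is i.+1 then be_ i else al (y 0%N).
pose w i := if (i < n)%N then pi i + al_ i else pi n - be (y n).
pose D := \sum_(i < n) `|y i.+1 - y i|.
have yD i : (i < n)%N -> `|y i.+1 - y i| <= D.
  by move=> lin; rewrite /D (bigD1 (Ordinal lin))//= lerDl sumr_ge0.
have D0 : 0 <= D by apply: sumr_ge0.
have Cq0 := Cq_ge0 D0 d0.
pose B := \sum_(i < n.+1) `|w i| + 1.
have B0 : 0 < B by rewrite ltr_wpDl// sumr_ge0.
have wB i : (i <= n)%N -> `|w i| <= B.
  move=> lin; rewrite /B (bigD1 (Ordinal (lin : (i < n.+1)%N)))//= -addrA lerDl.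
  by rewrite addr_ge0// sumr_ge0.
have CU0 : 0 <= CU.
  have [u u1] := unit_vector d0.
  by have := quadU 0 (v := u); rewrite u1 expr1n mulr1 => /(_ (lexx _)); apply: le_trans.
pose N := \sum_(i < n) dotp (w i) (w i) + dotp (w n) (w n).
pose A := Cq D * \sum_(i < n) (`|w i| + `|w i.+1|) ^+ 2 + 2 * CU * B ^+ 2.
have A0 : 0 <= A.
  apply: addr_ge0; apply: mulr_ge0 => //; last exact: sqr_ge0.
    by apply: sumr_ge0 => i _; exact: sqr_ge0.
  exact: mulr_ge0.
have key : N <= 0.
  have Bi0 : 0 < B^-1 by rewrite invr_gt0.
  apply: (ler_of_small Bi0 A0) => t /andP[t0 tB].
  pose u i := - t *: w i.
  have nu i : `|u i| = t * `|w i| by rewrite normrZ normrN gtr0_norm.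
  have u1 i : (i <= n)%N -> `|u i| <= 1.
    move=> lin; rewrite nu; apply: le_trans (_ : B^-1 * B <= 1); last by rewrite mulVf// gt_eqF.
    by apply: ler_pM => //; [exact: ltW|exact: wB].
  have h1 := action_quad yD u1.
  have h2 := quadU (y 0%N) (u1 0%N (leq0n _)).
  have h3 := quadV (y n) (u1 n (leqnn _)).
  have h4 := miny (fun i => y i + u i).
  have uB i : (i <= n)%N -> CU * `|u i| ^+ 2 <= t ^+ 2 * (CU * B ^+ 2).
    move=> lin; rewrite nu exprMn mulrCA; apply: ler_wpM2l; first exact: sqr_ge0.
    by apply: ler_wpM2l => //; rewrite ler_pXn2r ?nnegrE// ?wB// ltW.
  have hu : Cq D * \sum_(i < n) (`|u i| + `|u i.+1|) ^+ 2 =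
      t ^+ 2 * (Cq D * \sum_(i < n) (`|w i| + `|w i.+1|) ^+ 2).
    rewrite [RHS]mulrCA; congr (_ * _); rewrite mulr_sumr; apply: eq_bigr => i _.
    by rewrite !nu -mulrDr exprMn.
  have hL : dotp (al (y 0%N)) (u 0%N) + \sum_(i < n) (dotp (a (y i) (y i.+1)) (u i) +
     dotp (b (y i) (y i.+1)) (u i.+1)) - dotp (be (y n)) (u n) = - t * N.
    have E1 : \sum_(i < n) (dotp (a (y i) (y i.+1)) (u i) + dotp (b (y i) (y i.+1)) (u i.+1)) =
        \sum_(i < n) (- t * dotp (w i) (w i)) + (dotp (pi n) (u n) - dotp (pi 0%N) (u 0%N)).
      rewrite -(telescope_sumr (fun i => dotp (pi i) (u i)) (leq0n n)) big_mkord -big_split /=.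
      apply: eq_bigr => i _; rewrite -dotpZr -/(u i) /w ltn_ord dotpDl /al_ /be_; ring.
    rewrite E1 /N mulrDr mulr_sumr.
    have -> : - t * dotp (w n) (w n) = dotp (pi n) (u n) - dotp (be (y n)) (u n).
      by rewrite -dotpBl -dotpZr -/(u n) {1}/w ltnn.
    by rewrite [pi 0%N]/=; ring.
  move: h1 h2 h3; rewrite hu !ler_norml => /andP[_ h1] /andP[_ h2] /andP[h3 _].
  have g2 := uB 0%N (leq0n _); have g3 := uB n (leqnn _).
  have tN : t * N <= t ^+ 2 * A by rewrite /A; lra.
  by move: tN; rewrite expr2 -mulrA ler_pM2l// mulrC.
have w0 i : (i <= n)%N -> w i = 0.
  move=> lin; apply: dotp_eq0; apply: le_trans key; rewrite /N.
  have [iltn|] := ltnP i n.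
    rewrite (bigD1 (Ordinal iltn))//= -addrA lerDl addr_ge0 ?dotp_ge0//.
    by apply: sumr_ge0 => j _; exact: dotp_ge0.
  move=> nlei; have -> : i = n by apply/eqP; rewrite eqn_leq lin.
  by rewrite lerDr; apply: sumr_ge0 => j _; exact: dotp_ge0.
have orb i : (i <= n)%N -> iter i T (y 0%N, al (y 0%N)) = (y i, pi i).
  elim: i => [//|i IH lin]; rewrite iterS IH; last exact: ltnW.
  apply/(td_map td) => /=; split=> //.
  have := w0 i (ltnW lin); rewrite /w lin => /eqP; rewrite addr_eq0 => /eqP -> //.
split=> [|i lin]; last by rewrite /xo orb.
rewrite orb//; congr (_, _).
by have := w0 n (leqnn _); rewrite /w ltnn => /eqP; rewrite subr_eq0 => /eqP.
Qed.

End Minimiser.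
End Action.

Section Calibration.
Variables (R : realType) (d : nat).
Local Notation E := 'rV[R]_d.
Variables (c0 C0 : R) (Cq Kb : R -> R) (S : E -> E -> R) (a b : E -> E -> E).
Variable T : E * E -> E * E.
Hypothesis td : twist_data c0 C0 Cq Kb S a b T.
Variables (n : nat) (m : 'rV[int]_d).
Hypothesis n0 : (0 < n)%N.
Hypothesis d0 : (0 < d)%N.

Local Notation W := (action S n).

Lemma action_shift (k : 'rV[int]_d) y : W (fun i => y i + intv R k) = W y.
Proof. by apply: eq_bigr => i _; rewrite (td_periodic td). Qed.

Lemma eq_action y y' : (forall i, (i <= n)%N -> y i = y' i) -> W y = W y'.
Proof. by move=> H; apply: eq_bigr => i _; rewrite !H// ltnW. Qed.

Lemma path_bound (y : nat -> E) j (D : R) : (forall i, (i < j)%N -> `|y i.+1 - y i| <= D) ->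
  `|y j - y 0%N| <= j%:R * D.
Proof.
elim: j => [_|j IH H]; first by rewrite subrr normr0 mul0r.
have -> : y j.+1 - y 0%N = (y j.+1 - y j) + (y j - y 0%N) by rewrite addrA subrK.
apply: le_trans (ler_normD _ _) _; rewrite -[j.+1]add1n natrD mulrDl mul1r.
by apply: lerD; [exact: H|apply: IH => i ij; apply: H; exact: ltnW].
Qed.

Lemma path_sum (y : nat -> E) j : `|y j - y 0%N| <= \sum_(i < j) `|y i.+1 - y i|.
Proof.
elim: j => [|j IH]; first by rewrite subrr normr0 big_ord0.
have -> : y j.+1 - y 0%N = (y j - y 0%N) + (y j.+1 - y j) by rewrite [RHS]addrC addrA subrK.
by rewrite big_ord_recr /=; apply: le_trans (ler_normD _ _) _; rewrite lerD2r.
Qed.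

Section Minimum.
Local Notation Y := (prod_topology (fun _ : nat => E)).
Variables (U : E -> R) (M : R).
Hypothesis cU : continuous U.
Hypothesis M0 : 0 <= M.
Hypothesis lipU : forall q v, `|U (q + v) - U q| <= M * `|v|.
Hypothesis shiftU : forall (k : 'rV[int]_d) q q',
  U (q + intv R k) - U q = U (q' + intv R k) - U q'.

Local Notation Psi := (fun y : nat -> E => U (y 0%N) + W y - U (y n - intv R m)).

Lemma Psi_coercive y j : (j < n)%N ->
  c0 / 2 * `|y j.+1 - y j| ^+ 2 - n%:R * (C0 + M ^+ 2 / (2 * c0)) - M * `|intv R m| <= Psi y.
Proof.
move=> jn; have c00 := td_c0 td.
pose s i := `|y i.+1 - y i|; pose K0 := C0 + M ^+ 2 / (2 * c0).
have h1 : \sum_(i < n) (c0 * s i ^+ 2 - C0) <= W y.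
  by apply: ler_sum => i _; exact: (td_coercive td).
have h2 : - (M * (\sum_(i < n) s i + `|intv R m|)) <= U (y 0%N) - U (y n - intv R m).
  have := lipU (y n - intv R m) (y 0%N - (y n - intv R m)).
  rewrite [_ + (y 0%N - _)]addrC subrK ler_norml => /andP[h _]; apply: le_trans h.
  rewrite lerN2; apply: ler_wpM2l => //.
  rewrite opprB addrC -addrA addrC; apply: le_trans (ler_normD _ _) _.
  by rewrite addrC distrC lerD2r; exact: path_sum.
have h3 : \sum_(i < n) (c0 / 2 * s i ^+ 2 - K0) <= \sum_(i < n) (c0 * s i ^+ 2 - C0) - M * \sum_(i < n) s i.
  rewrite mulr_sumr -sumrB; apply: ler_sum => i _.
  have : 0 <= c0 / 2 * (s i - M / c0) ^+ 2 by apply: mulr_ge0; [lra|exact: sqr_ge0].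
  have -> : c0 / 2 * (s i - M / c0) ^+ 2 = c0 / 2 * s i ^+ 2 - M * s i + M ^+ 2 / (2 * c0).
    by field; rewrite gt_eqF.
  by rewrite /K0; lra.
have h4 : c0 / 2 * s j ^+ 2 - n%:R * K0 <= \sum_(i < n) (c0 / 2 * s i ^+ 2 - K0).
  rewrite big_split /= sumrN sumr_const card_ord -[K0 *+ n]mulr_natl lerD2r.
  rewrite (bigD1 (Ordinal jn)) //= lerDl; apply: sumr_ge0 => i _.
  by apply: mulr_ge0; [lra|exact: sqr_ge0].
rewrite -/(s j) -/K0; lra.
Qed.

Lemma continuous_action (X : topologicalType) (y : X -> nat -> E) j :
  (forall i, continuous (fun x => y x i)) -> continuous (fun x => action S j (y x)).
Proof.
move=> cy; elim: j => [|j IH] x.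
  have -> : (fun x => action S 0 (y x)) = cst 0 by apply/funext => g; rewrite /action big_ord0.
  exact: cst_continuous.
have -> : (fun x => action S j.+1 (y x)) = (fun x => action S j (y x) + S (y x j) (y x j.+1)).
  by apply/funext => g; rewrite /action big_ord_recr.
apply: cvgD; first exact: IH.
apply: (@continuous_comp _ _ _ (fun x => (y x j, y x j.+1)) (fun z : E * E => S z.1 z.2));
  last exact: (td_continuous td).
by apply: cvg_pair_for; exact: cy.
Qed.

Lemma continuous_Psi (X : topologicalType) (y : X -> nat -> E) :
  (forall i, continuous (fun x => y x i)) -> continuous (fun x => Psi (y x)).
Proof.
move=> cy x; apply: cvgB.
  apply: cvgD; last exact: continuous_action.
  by apply: (@continuous_comp _ _ _ (fun x => y x 0%N) U); [exact: cy|exact: cU].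
apply: (@continuous_comp _ _ _ (fun x => y x n - intv R m) U); last exact: cU.
by apply: cvgB; [exact: cy|exact: cvg_cst].
Qed.

Lemma Psi_min : exists y, forall y', Psi y <= Psi y'.
Proof.
have c00 := td_c0 td.
pose X := Psi (fun=> 0) + n%:R * (C0 + M ^+ 2 / (2 * c0)) + M * `|intv R m|.
pose D := 1 + 2 * `|X| / c0.
have D1 : 1 <= D by rewrite lerDl divr_ge0 ?mulr_ge0// ltW.
have HD : X <= c0 / 2 * D ^+ 2.
  apply: le_trans (ler_norm _) _.
  apply: le_trans (_ : c0 / 2 * D <= _).
    have -> : c0 / 2 * D = c0 / 2 + `|X| by rewrite /D; field; rewrite gt_eqF.
    by rewrite lerDr; lra.
  rewrite ler_pM2l; last by rewrite divr_gt0.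
  by rewrite expr2 ler_peMl// (le_trans ler01).
pose r := 1 + n%:R * D.
have r0 : 0 <= r by rewrite addr_ge0// mulr_ge0// (le_trans ler01).
pose K : set (Y) := [set f | forall i, [set v : E | `|v| <= r] (f i)].
have cK : compact K.
  apply: (@tychonoff nat (fun _ => E) (fun _ => [set v : E | `|v| <= r])) => i.
  exact: segment_box_compact.
have K0 : K !=set0 by exists (fun=> 0) => i /=; rewrite normr0.
have cp i : continuous (fun f : Y => f i).
  exact: (@proj_continuous nat (fun _ => E) i).
have cPsi : continuous (Psi : Y -> R) by exact: (@continuous_Psi Y id).
have [y yK H] := compact_EVT_min K0 cK (continuous_subspaceT cPsi).
exists y => y'.
have [k hk] := floor_reduction (y' 0%N).
pose y'' i := if (i <= n)%N then y' i + intv R k else 0.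
have <- : Psi y'' = Psi y'.
  rewrite /y'' leq0n leqnn -[W y'](action_shift k).
  have -> : W (fun i => if (i <= n)%N then y' i + intv R k else 0) = W (fun i => y' i + intv R k).
    by apply: eq_action => i ->.
  have -> : y' n + intv R k - intv R m = (y' n - intv R m) + intv R k by rewrite addrAC.
  by have := shiftU k (y' 0%N) (y' n - intv R m); lra.
have [all|] := pselect (forall i, (i < n)%N -> `|y'' i.+1 - y'' i| <= D).
  apply: H; rewrite inE /K /= => i; rewrite {1}/y''; case: ifP => [lin|_]; last by rewrite normr0.
  have -> : y' i + intv R k = (y'' i - y'' 0%N) + y'' 0%N by rewrite subrK /y'' lin.
  apply: le_trans (ler_normD _ _) _; rewrite addrC; apply: lerD.
    by rewrite /y'' leq0n.
  apply: le_trans (path_bound (D := D) _) _.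
    by move=> j ji; apply: all; exact: leq_trans lin.
  by apply: ler_wpM2r; [exact: le_trans ler01 D1|rewrite ler_nat].
move=> /existsNP[j /not_implyP[jn /negP]]; rewrite -ltNge => jD.
have h0 : Psi y <= Psi (fun=> 0) by apply: H; rewrite inE => i /=; rewrite normr0.
apply: le_trans h0 _; apply: le_trans (Psi_coercive y'' jn).
have : c0 / 2 * D ^+ 2 <= c0 / 2 * `|y'' j.+1 - y'' j| ^+ 2.
  apply: ler_wpM2l; first by apply: divr_ge0 => //; exact: ltW.
  by rewrite ler_pXn2r ?nnegrE//; [exact: ltW|exact: le_trans ler01 D1].
by move: HD; rewrite /X; lra.
Qed.

End Minimum.

Definition lip_lag_graph (gamma : E -> E) := [/\ continuous gamma, Defs.periodic gamma,
  lagrangian gamma, exists2 L, 0 <= L & forall q v, `|gamma (q + v) - gamma q| <= L * `|v|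
  & periodic_graph T m n gamma].

Definition calibrated (gamma : E -> E) (U : E -> R) (w : R) :=
  [/\ forall y, U (y n - intv R m) + w <= U (y 0%N) + W y,
      forall q, W (xo T (q, gamma q)) = w
    & forall y, U (y 0%N) + W y = U (y n - intv R m) + w -> y 1%N = xo T (y 0%N, gamma (y 0%N)) 1].

Hypothesis lipT : forall M, exists L, forall z z', `|z| <= M -> `|z'| <= M ->
  `|T z - T z'| <= L * `|z - z'|.

Lemma lip_iter M j : exists2 L, 0 <= L & forall z z', `|z| <= M -> `|z'| <= M ->
  `|iter j T z - iter j T z'| <= L * `|z - z'|.
Proof.
elim: j => [|j [L L0 IH]]; first by exists 1 => // z z' _ _; rewrite mul1r.
pose B := L * (2 * `|M|) + `|iter j T (0, 0)|.
have bnd z : `|z| <= M -> `|iter j T z| <= B.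
  move=> zM; have M0 : 0 <= M by apply: le_trans zM.
  have -> : iter j T z = (iter j T z - iter j T (0, 0)) + iter j T (0, 0) by rewrite subrK.
  apply: le_trans (ler_normD _ _) _; rewrite lerD2r.
  have n00 : `|(0, 0) : E * E| = 0 by rewrite prod_normE /= normr0 maxxx.
  apply: le_trans (IH _ _ zM _) _; first by rewrite n00.
  apply: ler_wpM2l => //; apply: le_trans (ler_normB _ _) _.
  by rewrite n00 addr0 (ger0_norm M0); lra.
have [L' HL'] := lipT B; exists (`|L'| * L) => [|z z' zM z'M]; first exact: mulr_ge0.
rewrite !iterS; apply: le_trans (HL' _ _ (bnd _ zM) (bnd _ z'M)) _.
apply: le_trans (_ : `|L'| * `|iter j T z - iter j T z'| <= _).
  by apply: ler_wpM2r => //; exact: ler_norm.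
by rewrite -mulrA; apply: ler_wpM2l => //; exact: IH.
Qed.

Lemma lip_iter_upto M : exists2 L, 0 <= L & forall j, (j <= n)%N -> forall z z',
  `|z| <= M -> `|z'| <= M -> `|iter j T z - iter j T z'| <= L * `|z - z'|.
Proof.
elim: n => [|k [L L0 IH]].
  have [L L0 H] := lip_iter M 0; exists L => // j; rewrite leqn0 => /eqP ->; exact: H.
have [L' L'0 H'] := lip_iter M k.+1; exists (L + L') => [|j]; first exact: addr_ge0.
rewrite leq_eqVlt => /orP[/eqP ->|jk] z z' h h'; rewrite mulrDl.
  by apply: le_trans (H' _ _ h h') _; rewrite lerDr mulr_ge0.
by apply: le_trans (IH _ jk _ _ h h') _; rewrite lerDl mulr_ge0.
Qed.

Lemma norm_fst (z : E * E) : `|z.1| <= `|z|.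
Proof. by rewrite prod_normE /= le_max lexx. Qed.

Lemma norm_snd (z : E * E) : `|z.2| <= `|z|.
Proof. by rewrite prod_normE /= le_max lexx orbT. Qed.

Lemma norm_pairE (z : E * E) : `|z| = Num.max `|z.1| `|z.2|.
Proof. by rewrite prod_normE. Qed.

Section LipschitzLagrangianGraphs.
Variable gamma : E -> E.
Hypothesis gg : lip_lag_graph gamma.

Let cg : continuous gamma. Proof. by case: gg. Qed.
Let pg : Defs.periodic gamma. Proof. by case: gg. Qed.
Let og : periodic_graph T m n gamma. Proof. by case: gg. Qed.

Lemma graph_bounded : exists2 M, 0 <= M & forall q, `|gamma q| <= M.
Proof.
have cn : continuous (fun q => `|gamma q|).
  by move=> q; apply: continuous_comp; [exact: cg|exact: norm_continuous].
have [M HM] := periodic_bounded cn (fun q k => congr1 (fun x => `|x|) (pg q k)).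
by exists M => //; exact: le_trans (HM 0).
Qed.

Lemma graph_action_flat M : exists2 C, 0 <= C & exists2 rho, 0 < rho &
  forall q v, `|q| <= M -> `|v| <= rho ->
  `|W (xo T (q + v, gamma (q + v))) - W (xo T (q, gamma q))| <= C * `|v| ^+ 2.
Proof.
case: gg => _ _ _ [L L0 lipg] _.
have [Mg Mg0 HMg] := graph_bounded.
pose M' := `|M| + 1 + Mg.
have [L' L'0 HL'] := lip_iter_upto M'.
pose Lam := L' * (1 + L) + 1.
have Lam0 : 0 < Lam by rewrite ltr_wpDl// mulr_ge0// addr_ge0.
pose D := \sum_(i < n) (L' * (2 * M') + `|xo T (0, 0) i.+1 - xo T (0, 0) i|) + 2 * (L' * M').
have M'0 : 0 <= M' by rewrite !addr_ge0.
have D0 : 0 <= D.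
  apply: addr_ge0; last by rewrite !mulr_ge0.
  by apply: sumr_ge0 => i _; rewrite addr_ge0// !mulr_ge0.
exists (Cq D * (n%:R * (4 * Lam ^+ 2))).
  apply: mulr_ge0; [exact: (Cq_ge0 td)|apply: mulr_ge0 => //; apply: mulr_ge0 => //; exact: sqr_ge0].
exists (Num.min 1 Lam^-1) => [|q v qM]; first by rewrite lt_min ltr01 invr_gt0.
rewrite le_min => /andP[v1 vL].
have inM q' : `|q'| <= `|M| + 1 -> `|(q', gamma q')| <= M'.
  move=> h; rewrite norm_pairE ge_max /=; apply/andP; split.
    by apply: le_trans h _; rewrite lerDl.
  by apply: le_trans (HMg _) _; rewrite lerDr addr_ge0.
have qM1 : `|(q, gamma q)| <= M'.
  by apply: inM; apply: le_trans qM _; apply: le_trans (ler_norm _) _; rewrite lerDl.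
have qM2 : `|(q + v, gamma (q + v))| <= M'.
  apply: inM; apply: le_trans (ler_normD _ _) _; apply: lerD => //.
  by apply: le_trans qM _; exact: ler_norm.
pose u i := xo T (q + v, gamma (q + v)) i - xo T (q, gamma q) i.
have uL i : (i <= n)%N -> `|u i| <= Lam * `|v|.
  move=> lin; have h := HL' i lin _ _ qM2 qM1.
  apply: le_trans (norm_fst (iter i T (q + v, gamma (q + v)) - iter i T (q, gamma q))) _.
  apply: le_trans h _.
  apply: le_trans (_ : L' * ((1 + L) * `|v|) <= _); last first.
    by rewrite mulrA; apply: ler_wpM2r => //; rewrite lerDl.
  apply: ler_wpM2l => //; rewrite norm_pairE /= ge_max addrAC subrr add0r mulrDl mul1r.
  rewrite lerDl mulr_ge0//=; apply: le_trans (lipg _ _) _.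
  by rewrite lerDr.
have u1 i : (i <= n)%N -> `|u i| <= 1.
  move=> lin; apply: le_trans (uL i lin) _; rewrite -ler_pdivlMl// mulr1; exact: vL.
have xD i : (i < n)%N -> `|xo T (q, gamma q) i.+1 - xo T (q, gamma q) i| <= D.
  move=> lin.
  have n00 : `|(0, 0) : E * E| = 0 by rewrite norm_pairE /= normr0 maxxx.
  have b00 : `|(0, 0) : E * E| <= M' by rewrite n00.
  have b0 j : (j <= n)%N -> `|xo T (q, gamma q) j - xo T (0, 0) j| <= L' * M'.
    move=> jn; apply: le_trans (norm_fst (iter j T (q, gamma q) - iter j T (0, 0))) _.
    apply: le_trans (HL' j jn _ _ qM1 b00) _; apply: ler_wpM2l => //.
    by apply: le_trans (ler_normB _ _) _; rewrite n00 addr0.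
  have -> : xo T (q, gamma q) i.+1 - xo T (q, gamma q) i =
     (xo T (0, 0) i.+1 - xo T (0, 0) i) + ((xo T (q, gamma q) i.+1 - xo T (0, 0) i.+1) -
      (xo T (q, gamma q) i - xo T (0, 0) i)).
    by rewrite subrBACA [RHS]addrC subrK.
  apply: le_trans (ler_normD _ _) _; apply: lerD.
    rewrite (bigD1 (Ordinal lin)) //= [L' * _ + _]addrC -!addrA lerDl addr_ge0 ?mulr_ge0//.
    by apply: sumr_ge0 => j _; rewrite addr_ge0 ?mulr_ge0.
  apply: le_trans (ler_normB _ _) _; rewrite mulr_natl mulr2n; apply: lerD.
    exact: b0.
  by apply: b0; exact: ltnW.
have := orbit_action_quad td xD u1.
have -> : W (fun i => xo T (q, gamma q) i + u i) = W (xo T (q + v, gamma (q + v))).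
  by apply: eq_action => i _; rewrite /u addrC subrK.
have -> : dotp (po T (q, gamma q) n) (u n) - dotp (po T (q, gamma q) 0) (u 0%N) = 0.
  have un : u n = v by rewrite /u /xo !og /= opprD addrACA subrr addr0 [q + v]addrC addrK.
  by rewrite un /po og /u /xo /= [q + v]addrC addrK subrr.
rewrite subr0 => h; apply: le_trans h _; rewrite -mulrA; apply: ler_wpM2l; first exact: (Cq_ge0 td).
apply: le_trans (_ : \sum_(i < n) (2 * (Lam * `|v|)) ^+ 2 <= _).
  apply: ler_sum => i _; rewrite ler_pXn2r ?nnegrE ?addr_ge0 ?mulr_ge0//; last exact: ltW.
  by rewrite mulr_natl mulr2n; apply: lerD; apply: uL => //; exact: ltnW.
rewrite sumr_const card_ord -[X in X <= _]mulr_natl le_eqVlt; apply/orP; left; apply/eqP; ring.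
Qed.

Lemma graph_action_const q : W (xo T (q, gamma q)) = W (xo T (0, gamma 0)).
Proof.
have [C C0' [rho rho0 H]] := graph_action_flat `|q|.
pose g (t : R) := W (xo T (t *: q, gamma (t *: q))).
have B0 : 0 < `|q| + 1 by rewrite ltr_wpDl.
have := @flat_curve R g 0 (C * `|q| ^+ 2) 1 (rho / (`|q| + 1)).
have a1 : 0 <= C * `|q| ^+ 2 by rewrite mulr_ge0// sqr_ge0.
have a2 : 0 < rho / (`|q| + 1) by rewrite divr_gt0.
move=> /(_ a1 ler01 a2) h.
have : `|g 1 - g 0| <= 0 * 1.
  apply: h => s t s0 st t1 str; rewrite mul0r add0r.
  have ts0 : 0 <= t - s by rewrite subr_ge0.
  have := H (s *: q) ((t - s) *: q); rewrite -scalerDl [s + _]addrC subrK !normrZ (ger0_norm ts0).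
  rewrite exprMn [_ ^+ 2 * _]mulrC mulrA; apply.
    by rewrite ger0_norm// ler_piMl// (le_trans st).
  apply: le_trans (_ : rho / (`|q| + 1) * (`|q| + 1) <= _); last by rewrite divfK// gt_eqF.
  by apply: ler_pM => //; rewrite lerDl.
by rewrite mul0r normr_le0 subr_eq0 /g scale1r scale0r => /eqP.
Qed.

Lemma graph_potential : exists U : E -> R, exists2 M : R, 0 <= M & exists2 C : R, 0 <= C &
  [/\ U 0 = 0, continuous U, forall q v, `|U (q + v) - U q| <= M * `|v|,
    forall (k : 'rV[int]_d) q q', U (q + intv R k) - U q = U (q' + intv R k) - U q'
    & forall q v, `|U (q + v) - U q - dotp (gamma q) v| <= C * `|v| ^+ 2].
Proof.
case: gg => _ _ lag [L L0 lipg] _.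
have [Mg Mg0 HMg] := graph_bounded.
have [U U0 HU] := lagrangian_potential cg lag.
have lipU q v : `|U (q + v) - U q| <= d%:R * Mg * `|v|.
  rewrite HU; have [c _ ->] := line_int_mvt cg q v.
  by apply: le_trans (norm_dotp _ _) _; apply: ler_wpM2r => //; apply: ler_wpM2l.
exists U, (d%:R * Mg); first exact: mulr_ge0.
exists (d%:R * L); first exact: mulr_ge0.
split=> //.
- apply: (@lip_continuous _ _ _ U (d%:R * Mg)) => x y.
  by have := lipU y (x - y); rewrite subrKC.
- move=> k q q'.
  have h1 := HU q' (q - q'); have h2 := HU (q' + intv R k) (q - q').
  rewrite line_int_periodic// in h2.
  rewrite subrKC in h1; rewrite [q' + _ + _]addrAC subrKC in h2; lra.
- move=> q v; rewrite HU; have [c /andP[c0' c1] ->] := line_int_mvt cg q v.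
  rewrite -dotpBl; apply: le_trans (norm_dotp _ _) _.
  have -> : d%:R * L * `|v| ^+ 2 = d%:R * (L * `|v|) * `|v| by ring.
  apply: ler_wpM2r => //; apply: ler_wpM2l => //; apply: le_trans (lipg _ _) _.
  by apply: ler_wpM2l => //; rewrite normrZ ger0_norm// ler_piMl.
Qed.

Lemma calibration : exists U : E -> R, exists2 w : R, calibrated gamma U w & U 0 = 0.
Proof.
have [U [M M0 [C C0' [U0 cU lipU shU quadU]]]] := graph_potential.
have qU q v : `|v| <= 1 -> `|U (q + v) - U q - dotp (gamma q) v| <= C * `|v| ^+ 2 by move=> _.
have qV q v : `|v| <= 1 -> `|U (q + v - intv R m) - U (q - intv R m) -
    dotp (gamma (q - intv R m)) v| <= C * `|v| ^+ 2.
  by move=> _; rewrite [q + v - _]addrAC; exact: quadU.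
pose w := W (xo T (0, gamma 0)).
have minorb y : (forall y', U (y 0%N) + W y - U (y n - intv R m) <=
    U (y' 0%N) + W y' - U (y' n - intv R m)) ->
  [/\ U (y 0%N) + W y - U (y n - intv R m) = w & y 1%N = xo T (y 0%N, gamma (y 0%N)) 1].
  move=> miny.
  have [h1 h2] := minimiser_orbit (V := fun q => U (q - intv R m))
    (be := fun q => gamma (q - intv R m)) td d0 qU qV miny.
  split; last by rewrite h2.
  have : iter n T (y 0%N, gamma (y 0%N)) = (y 0%N + intv R m, gamma (y 0%N)) by exact: og.
  rewrite h1 => -[-> _]; rewrite addrK addrAC subrr add0r /w -(graph_action_const (y 0%N)).
  by apply: eq_action => i lin; rewrite h2.
have [y miny] := Psi_min cU M0 lipU shU.
have [yw _] := minorb y miny.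
exists U, w => //; split.
- by move=> y'; have := miny y'; rewrite yw; lra.
- exact: graph_action_const.
- move=> y' e; apply: (minorb y' _).2.
  by move=> y''; have := miny y''; rewrite yw; lra.
Qed.

End LipschitzLagrangianGraphs.
End Calibration.

Section LipschitzOfQuadratic.
Variables (R : realType) (d : nat).
Local Notation E := 'rV[R]_d.

Lemma dotp_evec (x : E) j : dotp x (evec R j) = x 0 j.
Proof.
rewrite /dotp (bigD1 j) //= big1 => [|i ij]; first by rewrite addr0 mxE !eqxx mulr1.
by rewrite mxE (negbTE ij) andbF mulr0.
Qed.

Lemma norm_evec_le (j : 'I_d) : `|evec R j| <= 1.
Proof. by apply: mx_norm_le => // i k; rewrite mxE; case: (_ && _); rewrite ?normr1 ?normr0. Qed.

Lemma lip_of_quad (U : E -> R) (gamma : E -> E) (C : R) : 0 <= C ->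
  (forall q v, `|v| <= 1 -> `|U (q + v) - U q - dotp (gamma q) v| <= C * `|v| ^+ 2) ->
  forall q v, `|v| <= 1/2 -> `|gamma (q + v) - gamma q| <= 6 * C * `|v|.
Proof.
move=> C0 H q v v2; apply: mx_norm_le => [|i j]; first by rewrite !mulr_ge0.
rewrite ord1 {i} mxE [(- gamma q) 0 j]mxE.
have [v0|v0] := eqVneq v 0; first by rewrite v0 addr0 subrr !normr0 mulr0.
have v0' : 0 < `|v| by rewrite normr_gt0.
pose w : E := `|v| *: evec R j.
have wv : `|w| <= `|v| by rewrite normrZ normr_id ler_piMr// norm_evec_le.
have v1 : `|v| <= 1 by lra.
have v1' : 2 * `|v| <= 1 by lra.
have h1 := H (q + v) w (le_trans wv v1).
have h2 := H q v v1.
have vw : `|v + w| <= 2 * `|v|.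
  by apply: le_trans (ler_normD _ _) _; rewrite mulr_natl mulr2n lerD2l.
have h3 := H q (v + w) (le_trans vw v1').
have c1 : C * `|w| ^+ 2 <= C * `|v| ^+ 2 by apply: ler_wpM2l => //; rewrite ler_pXn2r ?nnegrE.
have c2 : C * `|v + w| ^+ 2 <= C * (4 * `|v| ^+ 2).
  apply: ler_wpM2l => //; have -> : 4 * `|v| ^+ 2 = (2 * `|v|) ^+ 2 by ring.
  by rewrite ler_pXn2r ?nnegrE// mulr_ge0.
rewrite dotpDr !addrA in h3; rewrite !dotpZr !dotp_evec in h1 h3.
rewrite -(ler_pM2l v0') -[X in X * `|gamma _ _ _ - _|]normr_id -normrM.
have -> : `|v| * (6 * C * `|v|) = 6 * (C * `|v| ^+ 2) by ring.
move: h1 h2 h3 c1 c2; rewrite !ler_norml => /andP[? ?] /andP[? ?] /andP[? ?] ? ?.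
by apply/andP; split; lra.
Qed.

End LipschitzOfQuadratic.

Section UniformEstimates.
Variables (R : realType) (d : nat).
Local Notation E := 'rV[R]_d.
Variables (c0 C0 : R) (Cq Kb : R -> R) (S : E -> E -> R) (a b : E -> E -> E).
Variable T : E * E -> E * E.
Hypothesis td : twist_data c0 C0 Cq Kb S a b T.
Variables (n : nat) (m : 'rV[int]_d).
Hypothesis n0 : (0 < n)%N.
Hypothesis d0 : (0 < d)%N.
Hypothesis lipT : forall M, exists L, forall z z', `|z| <= M -> `|z'| <= M ->
  `|T z - T z'| <= L * `|z - z'|.

Local Notation W := (action S n).
Local Notation lip_lag_graph := (lip_lag_graph T n m).
Local Notation calibrated := (calibrated S T n m).

Lemma graph_calibration gamma : lip_lag_graph gamma ->
  exists U : E -> R, exists2 w : R, calibrated gamma U w & U 0 = 0.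
Proof. exact: (calibration td n0 d0 lipT). Qed.

Lemma graph_unique gamma gamma' : lip_lag_graph gamma -> lip_lag_graph gamma' -> gamma =1 gamma'.
Proof.
have le_w g g' : lip_lag_graph g -> lip_lag_graph g' -> forall U U' w w', calibrated g U w ->
    calibrated g' U' w' -> w <= w'.
  move=> _ [_ _ _ _ og'] U U' w w' [c1 _ _] [_ c2 _].
  have := c1 (xo T (0, g' 0)); rewrite c2 /xo og' /= addrK lerD2l; exact.
move=> gg gg' q.
have [U [w cw _]] := graph_calibration gg; have [U' [w' cw' _]] := graph_calibration gg'.
have e : w = w' by apply/eqP; rewrite eq_le (le_w _ _ gg gg' _ _ _ _ cw cw') (le_w _ _ gg' gg _ _ _ _ cw' cw).
have [_ _ c3] := cw; have [_ c2 _] := cw'; have [_ _ _ _ og'] := gg'.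
have := c3 (xo T (q, gamma' q)); rewrite c2 e /xo og' /= addrK => /(_ erefl) h.
have [e1 _] := poE td (q, gamma q) 0; have [e2 _] := poE td (q, gamma' q) 0.
move: e1 e2; rewrite /po /xo /= => -> ->; by rewrite h.
Qed.

Definition linear_path (i : nat) : E := (i%:R / n%:R) *: intv R m.

Lemma graph_step gamma (D : R) : lip_lag_graph gamma -> 0 <= D ->
  W linear_path + n%:R * `|C0| <= c0 * D ^+ 2 ->
  forall q j, (j < n)%N -> `|xo T (q, gamma q) j.+1 - xo T (q, gamma q) j| <= D.
Proof.
move=> gg D0 HD q j jn; have c00 := td_c0 td.
have [U [w [c1 c2 _] _]] := graph_calibration gg.
have wl : w <= W linear_path.
  have := c1 linear_path; rewrite /linear_path divff ?pnatr_eq0 -?lt0n//.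
  by rewrite mul0r scale1r scale0r subrr lerD2l.
pose s i := `|xo T (q, gamma q) i.+1 - xo T (q, gamma q) i|.
have h1 : \sum_(i < n) (c0 * s i ^+ 2 - C0) <= w.
  by rewrite -(c2 q); apply: ler_sum => i _; exact: (td_coercive td).
have h2 : c0 * s j ^+ 2 <= \sum_(i < n) c0 * s i ^+ 2.
  rewrite (bigD1 (Ordinal jn)) //= lerDl; apply: sumr_ge0 => i _.
  by apply: mulr_ge0; [exact: ltW|exact: sqr_ge0].
rewrite big_split /= sumrN sumr_const card_ord -[C0 *+ n]mulr_natl in h1.
have h3 : n%:R * C0 <= n%:R * `|C0| by apply: ler_wpM2l => //; exact: ler_norm.
have : c0 * s j ^+ 2 <= c0 * D ^+ 2 by lra.
have s0 : 0 <= s j by exact: normr_ge0.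
by rewrite ler_pM2l// ler_pXn2r ?nnegrE.
Qed.

Section Bounds.
Variables (gamma : E -> E) (D : R).
Hypothesis gg : lip_lag_graph gamma.
Hypothesis D0 : 0 <= D.
Hypothesis HD : W linear_path + n%:R * `|C0| <= c0 * D ^+ 2.

Lemma graph_norm q : `|gamma q| <= Kb D.
Proof.
have [e _] := poE td (q, gamma q) 0.
have -> : gamma q = - a (xo T (q, gamma q) 0) (xo T (q, gamma q) 1) by rewrite -e.
by rewrite normrN; apply: (td_bound td _).1; exact: graph_step.
Qed.

Lemma calibrated_quad U w : calibrated gamma U w ->
  forall q v, `|v| <= 1 -> `|U (q + v) - U q - dotp (gamma q) v| <= Cq D * `|v| ^+ 2.
Proof.
case: gg => _ _ _ _ og [c1 c2 _] q v v1.
have xD := graph_step gg D0 HD q.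
pose x := xo T (q, gamma q).
have xn : x n = q + intv R m by rewrite /x /xo og.
have px0 : po T (q, gamma q) 0 = gamma q by [].
have pxn : po T (q, gamma q) n = gamma q by rewrite /po og.
have [n' en] : exists n', n = n'.+1 by exists n.-1; rewrite prednK.
rewrite ler_norml; apply/andP; split.
  pose u i : E := if i == 0%N then v else 0.
  have u1 i : (i <= n)%N -> `|u i| <= 1 by move=> _; rewrite /u; case: eqP; rewrite ?normr0.
  have h1 := orbit_action_quad td xD u1; have h2 := c1 (fun i => x i + u i).
  rewrite pxn px0 c2 in h1.
  have un : u n = 0 by rewrite /u en.
  have us : \sum_(i < n) (`|u i| + `|u i.+1|) ^+ 2 = `|v| ^+ 2.
    rewrite en big_ord_recl big1 ?addr0 => [|i _]; first by rewrite /u /= normr0 addr0.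
    by rewrite /u /= normr0 addr0 expr0n.
  rewrite us un dotp0r sub0r [u 0%N]/= in h1; rewrite xn un addr0 addrK [u 0%N]/= [x 0%N]/= in h2.
  move: h1; rewrite ler_norml => /andP[_ h1]; move: h1 h2; rewrite -/x; lra.
pose u i : E := if i == n then v else 0.
have u1 i : (i <= n)%N -> `|u i| <= 1 by move=> _; rewrite /u; case: eqP; rewrite ?normr0.
have h1 := orbit_action_quad td xD u1; have h2 := c1 (fun i => x i + u i).
rewrite pxn px0 c2 in h1.
have un : u n = v by rewrite /u eqxx.
have u0 : u 0%N = 0 by rewrite /u en.
have us : \sum_(i < n) (`|u i| + `|u i.+1|) ^+ 2 = `|v| ^+ 2.
  rewrite en big_ord_recr big1 ?add0r => [|i _] /=.
    by rewrite /u en eqxx /= (ltn_eqF (ltnSn n')) normr0 !add0r.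
  rewrite /u en eqSS !ltn_eqF ?normr0 ?addr0 ?expr0n// /= ltnS ltnW//; exact: ltn_ord.
rewrite us un u0 dotp0r subr0 in h1; rewrite xn un u0 addr0 addrAC addrK [x 0%N]/= in h2.
move: h1; rewrite ler_norml => /andP[_ h1]; move: h1 h2; rewrite -/x; lra.
Qed.

Lemma graph_lip q v : `|gamma (q + v) - gamma q| <= (6 * Cq D + 4 * Kb D) * `|v|.
Proof.
have [U [w cw _]] := graph_calibration gg.
have Cq0 := Cq_ge0 td D0 d0.
have K0 : 0 <= Kb D by apply: le_trans (graph_norm 0).
have [v1|v1] := leP `|v| (1/2).
  apply: le_trans (lip_of_quad Cq0 (calibrated_quad cw) q v1) _.
  by apply: ler_wpM2r => //; rewrite lerDl mulr_ge0.
apply: le_trans (ler_normB _ _) _; apply: le_trans (lerD (graph_norm _) (graph_norm _)) _.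
rewrite mulrDl; apply: le_trans (_ : 4 * Kb D * `|v| <= _).
  apply: le_trans (_ : 4 * Kb D * (1/2) <= _); first by lra.
  by apply: ler_wpM2l; [rewrite mulr_ge0|exact: ltW].
by rewrite lerDr mulr_ge0// mulr_ge0.
Qed.

End Bounds.

Lemma graph_step_bound : exists2 D, 0 <= D & W linear_path + n%:R * `|C0| <= c0 * D ^+ 2.
Proof.
have c00 := td_c0 td; pose X := W linear_path + n%:R * `|C0|.
exists (1 + `|X| / c0); first by rewrite addr_ge0// divr_ge0// ltW.
have t0 : 0 <= `|X| / c0 by rewrite divr_ge0// ltW.
rewrite -/X -ler_pdivrMl// [_^-1 * _]mulrC.
apply: le_trans (_ : `|X| / c0 <= _); first by rewrite ler_pM2r ?invr_gt0// ler_norm.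
by have := sqr_ge0 (`|X| / c0); rewrite expr2; nra.
Qed.

End UniformEstimates.

Section Nondegeneracy.
Variables (R : realType) (d : nat).
Local Notation E := 'rV[R]_d.
Variables (c0 C0 : R) (Cq Kb : R -> R) (S : E -> E -> R) (a b : E -> E -> E).
Variables T Ti : E * E -> E * E.
Hypothesis td : twist_data c0 C0 Cq Kb S a b T.
Variables (n : nat) (m : 'rV[int]_d).
Hypothesis n0 : (0 < n)%N.
Hypothesis d0 : (0 < d)%N.
Hypothesis lipT : forall M, exists L, forall z z', `|z| <= M -> `|z'| <= M ->
  `|T z - T z'| <= L * `|z - z'|.
Hypothesis lipTi : forall M, exists L, forall z z', `|z| <= M -> `|z'| <= M ->
  `|Ti z - Ti z'| <= L * `|z - z'|.
Hypothesis TK : cancel T Ti.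

Local Notation W := (action S n).

Lemma iter_cancel j : cancel (iter j T) (iter j Ti).
Proof. by elim: j => // j IH z; rewrite iterSr iterS TK IH. Qed.

(* If [eta] is in the kernel, the end point of the orbit of [(q, gamma q + t eta)] moves by
   [o(t)], hence its action exceeds the minimum by [o(t^2)] only; shifting the end point
   along the defect of momentum then shows that this defect is [o(t)] as well. *)
Lemma nondegenerate gamma q (eta : E) : lip_lag_graph T n m gamma ->
  (forall kap, 0 < kap -> exists2 rho, 0 < rho & forall s t,
     0 <= s -> s <= t -> t <= rho ->
     `|xo T (q, gamma q + t *: eta) n - xo T (q, gamma q + s *: eta) n| <= kap * (t - s)) ->
  eta = 0.
Proof.
move=> gg Hk; apply/eqP; rewrite -normr_eq0; apply/eqP.
have [U [w cw _]] := graph_calibration td n0 d0 lipT gg.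
have [D1 D10 HD1] := graph_step_bound td n m.
have quadU := calibrated_quad td n0 d0 lipT gg D10 HD1 cw.
have [c1 c2 _] := cw; have [_ _ _ _ og] := gg.
pose z (t : R) := (q, gamma q + t *: eta).
pose M := `|q| + `|gamma q| + `|eta|.
have M0 : 0 <= M by rewrite !addr_ge0.
have zM t : 0 <= t <= 1 -> `|z t| <= M.
  move=> /andP[t0 t1]; rewrite norm_pairE ge_max /=; apply/andP; split.
    by rewrite /M -addrA lerDl addr_ge0.
  apply: le_trans (ler_normD _ _) _; rewrite /M -addrA; apply: ler_wpDl => //.
  by rewrite lerD2l normrZ ger0_norm// ler_piMl.
have zD s t : `|z t - z s| = `|t - s| * `|eta|.
  rewrite norm_pairE /= subrr normr0 opprD addrACA subrr add0r -scalerBl normrZ.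
  by apply/max_idPr; rewrite mulr_ge0.
have [L L0 HL] := lip_iter_upto n lipT M.
have z01 : 0 <= (0 : R) <= 1 by rewrite lexx ler01.
pose Lam := L * `|eta|; have Lam0 : 0 <= Lam by rewrite mulr_ge0.
have itD j s t : (j <= n)%N -> 0 <= s <= 1 -> 0 <= t <= 1 ->
    `|iter j T (z t) - iter j T (z s)| <= Lam * `|t - s|.
  move=> jn hs ht; apply: le_trans (HL j jn _ _ (zM _ ht) (zM _ hs)) _.
  by rewrite zD [`|t - s| * _]mulrC mulrA.
pose y t := xo T (z t).
have yD j s t : (j <= n)%N -> 0 <= s <= 1 -> 0 <= t <= 1 -> `|y t j - y s j| <= Lam * `|t - s|.
  by move=> jn hs ht; apply: le_trans (itD j s t jn hs ht); exact: norm_fst (iter j T (z t) - iter j T (z s)).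
have pD j s t : (j <= n)%N -> 0 <= s <= 1 -> 0 <= t <= 1 ->
    `|po T (z t) j - po T (z s) j| <= Lam * `|t - s|.
  by move=> jn hs ht; apply: le_trans (itD j s t jn hs ht); exact: norm_snd (iter j T (z t) - iter j T (z s)).
pose D := D1 + 2 * Lam.
have D0 : 0 <= D by rewrite addr_ge0// mulr_ge0.
have z0 : z 0 = (q, gamma q) by rewrite /z scale0r addr0.
have yn0 : y 0 n = q + intv R m by rewrite /y z0 /xo og.
have pn0 : po T (z 0) n = gamma q by rewrite z0 /po og.
have stepD t i : 0 <= t <= 1 -> (i < n)%N -> `|y t i.+1 - y t i| <= D.
  move=> ht lin.
  have -> : y t i.+1 - y t i = (y 0 i.+1 - y 0 i) + ((y t i.+1 - y 0 i.+1) - (y t i - y 0 i)).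
    by rewrite subrBACA [RHS]addrC subrK.
  have t1 : `|t - 0| <= 1 by rewrite subr0; case/andP: ht => h1 h2; rewrite ger0_norm.
  have bd j : (j <= n)%N -> `|y t j - y 0 j| <= Lam.
    by move=> jn; apply: le_trans (yD j 0 t jn z01 ht) _; rewrite ler_piMr.
  apply: le_trans (ler_normD _ _) _; apply: lerD.
    by rewrite /y z0; exact: (graph_step td n0 d0 lipT gg D10 HD1).
  apply: le_trans (ler_normB _ _) _; rewrite mulr_natl mulr2n; apply: lerD; first exact: bd.
  by apply: bd; exact: ltnW.
have CqD0 := Cq_ge0 td D0 d0; have CqD10 := Cq_ge0 td D10 d0.
pose g t := W (y t) - dotp (gamma q) (y t n).
have grow kap tau : 0 < kap -> 0 <= tau <= 1 ->
    (forall s t, 0 <= s -> s <= t -> t <= tau -> `|y t n - y s n| <= kap * (t - s)) ->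
    `|g tau - g 0| <= d%:R * Lam * tau * kap * tau.
  move=> k0 /andP[tau0 tau1] Hkap.
  have rho0 : 0 < (Lam + 1)^-1 by rewrite invr_gt0 ltr_wpDl.
  have A0 : 0 <= Cq D * (n%:R * (4 * Lam ^+ 2)).
    by apply: mulr_ge0 => //; apply: mulr_ge0 => //; apply: mulr_ge0 => //; exact: sqr_ge0.
  apply: (flat_curve A0 tau0 rho0) => s t s0 st tt str.
  have ts0 : 0 <= t - s by rewrite subr_ge0.
  have hs : 0 <= s <= 1 by rewrite s0 (le_trans st)// (le_trans tt).
  have ht : 0 <= t <= 1 by rewrite (le_trans s0 st) (le_trans tt).
  pose u i := y t i - y s i.
  have uL i : (i <= n)%N -> `|u i| <= Lam * (t - s).
    by move=> lin; have := yD i s t lin hs ht; rewrite (ger0_norm ts0).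
  have u1 i : (i <= n)%N -> `|u i| <= 1.
    move=> lin; apply: le_trans (uL i lin) _.
    apply: le_trans (_ : (Lam + 1) * (Lam + 1)^-1 <= 1).
      by apply: ler_pM => //; rewrite lerDl.
    by rewrite divff// gt_eqF// ltr_wpDl.
  have h := orbit_action_quad td (fun i lin => stepD s i hs lin) u1.
  have e1 : W (fun i => xo T (z s) i + u i) = W (y t).
    by apply: eq_action => i _; rewrite /u subrKC.
  have u0 : u 0%N = 0 by rewrite /u /y /xo /= subrr.
  rewrite e1 u0 dotp0r subr0 in h.
  have -> : g t - g s = (W (y t) - W (y s) - dotp (po T (z s) n) (u n)) +
      dotp (po T (z s) n - gamma q) (u n).
    by rewrite /g /u dotpBl !dotpBr; ring.
  apply: le_trans (ler_normD _ _) _; rewrite addrC; apply: lerD.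
    apply: le_trans (norm_dotp _ _) _.
    have -> : d%:R * Lam * tau * kap * (t - s) = (d%:R * (Lam * tau)) * (kap * (t - s)) by ring.
    apply: ler_pM; [exact: mulr_ge0|exact: normr_ge0| |exact: Hkap].
    apply: ler_wpM2l => //; rewrite -pn0; apply: le_trans (pD n 0 s (leqnn _) z01 hs) _.
    by apply: ler_wpM2l => //; rewrite subr0 ger0_norm// (le_trans st).
  apply: le_trans h _; rewrite -mulrA; apply: ler_wpM2l => //.
  apply: le_trans (_ : \sum_(i < n) (2 * (Lam * (t - s))) ^+ 2 <= _).
    apply: ler_sum => i _; rewrite ler_pXn2r ?nnegrE ?addr_ge0 ?mulr_ge0//.
    by rewrite mulr_natl mulr2n; apply: lerD; apply: uL => //; exact: ltnW.
  rewrite sumr_const card_ord -[X in X <= _]mulr_natl le_eqVlt; apply/orP; left; apply/eqP; ring.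
pose C := Cq D + Cq D1; have CC0 : 0 <= C by exact: addr_ge0.
pose del := (6 * C + 6)^-1.
have del0 : 0 < del by rewrite invr_gt0; lra.
have delC : C * del <= 1/6.
  rewrite /del ler_pdivrMr; last by lra.
  by have := CC0; lra.
have del1 : del <= 1/6.
  by rewrite /del -[X in _ <= X]invrK lef_pV2 ?posrE; [|lra|lra]; rewrite invf_div divr1; have := CC0; lra.
pose B := 2 / del * (d%:R * Lam + 2 * C).
have B0 : 0 <= B.
  apply: mulr_ge0; first by rewrite divr_ge0// ltW.
  by apply: addr_ge0; apply: mulr_ge0.
have defect kap tau : 0 < kap <= 1 -> 0 < tau <= 1 -> tau * (1 + Lam) <= 1 ->
    (forall s t, 0 <= s -> s <= t -> t <= tau -> `|y t n - y s n| <= kap * (t - s)) ->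
    `|po T (z tau) n - gamma q| ^+ 2 <= B * kap * tau ^+ 2.
  move=> /andP[k0 k1] /andP[tau0 tau1] tauL Hkap.
  have ht : 0 <= tau <= 1 by rewrite ltW.
  set p := po T (z tau) n - gamma q.
  have pL : `|p| <= Lam * tau.
    by have := pD n 0 tau (leqnn _) z01 ht; rewrite pn0 subr0 gtr0_norm.
  set x := y tau n - y 0 n.
  have xk : `|x| <= kap * tau by have := Hkap 0 tau; rewrite subr0; apply => //; exact: ltW.
  have dp : `|del *: p| = del * `|p| by rewrite normrZ gtr0_norm.
  have dp1 : `|del *: p| <= 1.
    rewrite dp; apply: le_trans (_ : 1 * (Lam * tau) <= 1).
      by apply: ler_pM => //; [exact: ltW|lra].
    by move: tauL; lra.
  have xd1 : `|x - del *: p| <= 1.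
    apply: le_trans (ler_normB _ _) _; rewrite dp.
    have h1 : kap * tau <= tau by apply: ler_piMl => //; exact: ltW.
    have h2 : del * `|p| <= 1 * (Lam * tau) by apply: ler_pM => //; [exact: ltW|lra].
    by move: tauL; lra.
  have hU := quadU q _ xd1.
  pose u i : E := if i == n then - (del *: p) else 0.
  have u1 i : (i <= n)%N -> `|u i| <= 1 by move=> _; rewrite /u; case: eqP; rewrite ?normrN ?normr0.
  have hW := orbit_action_quad td (fun i lin => stepD tau i ht lin) u1.
  have hc := c1 (fun i => xo T (z tau) i + u i).
  have un : u n = - (del *: p) by rewrite /u eqxx.
  have [n' en] : exists n', n = n'.+1 by exists n.-1; rewrite prednK.
  have u0 : u 0%N = 0 by rewrite /u en.
  have us : \sum_(i < n) (`|u i| + `|u i.+1|) ^+ 2 = (del * `|p|) ^+ 2.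
    rewrite en big_ord_recr big1 ?add0r => [|i _] /=.
      by rewrite /u en eqxx /= (ltn_eqF (ltnSn n')) normr0 normrN dp !add0r.
    rewrite /u en eqSS !ltn_eqF ?normr0 ?addr0 ?expr0n// /= ltnS ltnW//; exact: ltn_ord.
  rewrite us un u0 dotp0r subr0 dotpNr dotpZr -/(y tau) in hW.
  rewrite un u0 addr0 -/(y tau) in hc.
  have ynE : y tau n - del *: p - intv R m = q + (x - del *: p).
    by rewrite /x yn0; apply/rowP => j; rewrite !mxE; ring.
  rewrite ynE [y tau 0%N]/= in hc.
  have hg := grow kap tau k0 ht Hkap.
  have W0 : W (y 0) = w by rewrite /y z0 c2.
  have gE : g tau - g 0 = W (y tau) - w - dotp (gamma q) x.
    by rewrite /g W0 /x dotpBr; ring.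
  have key : del * dotp p p <= d%:R * Lam * tau * kap * tau + Cq D * (del * `|p|) ^+ 2 +
      Cq D1 * `|x - del *: p| ^+ 2.
    have e2 : dotp p p = dotp (po T (z tau) n) p - dotp (gamma q) p by rewrite {1}/p dotpBl.
    rewrite e2 mulrBr.
    have e3 : dotp (gamma q) (x - del *: p) = dotp (gamma q) x - del * dotp (gamma q) p.
      by rewrite dotpBr dotpZr.
    move: hU hW hg; rewrite gE e3 !ler_norml => /andP[hU _] /andP[_ hW] /andP[_ hg].
    move: hU hW hg hc; clear; lra.
  have pp := dotp_sqr_ge p.
  have xx : `|x - del *: p| ^+ 2 <= 2 * (kap * tau) ^+ 2 + 2 * (del * `|p|) ^+ 2.
    apply: le_trans (_ : (kap * tau + del * `|p|) ^+ 2 <= _).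
      rewrite ler_pXn2r ?nnegrE//.
        by apply: le_trans (ler_normB _ _) _; rewrite dp lerD2r.
      by apply: addr_ge0; apply: mulr_ge0 => //; exact: ltW.
    by have := sqr_ge0 (kap * tau - del * `|p|); rewrite !expr2; lra.
  have k2 : (kap * tau) ^+ 2 <= kap * tau ^+ 2.
    rewrite exprMn; apply: ler_wpM2r; first exact: sqr_ge0.
    by rewrite expr2 ler_piMl// ltW.
  have h1 : Cq D * (del * `|p|) ^+ 2 <= C * (del * `|p|) ^+ 2.
    by apply: ler_wpM2r; [exact: sqr_ge0|rewrite lerDl].
  have h2 : Cq D1 * `|x - del *: p| ^+ 2 <= C * (2 * (kap * tau ^+ 2) + 2 * (del * `|p|) ^+ 2).
    apply: ler_pM => //; first by rewrite lerDr.
    by apply: le_trans xx _; lra.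
  have h3 : C * (del * `|p|) ^+ 2 <= del / 6 * `|p| ^+ 2.
    have -> : C * (del * `|p|) ^+ 2 = (C * del) * (del * `|p| ^+ 2) by ring.
    have -> : del / 6 * `|p| ^+ 2 = (1/6) * (del * `|p| ^+ 2) by field.
    by apply: ler_wpM2r => //; apply: mulr_ge0; [exact: ltW|exact: sqr_ge0].
  have h4 : del * `|p| ^+ 2 <= del * dotp p p by apply: ler_wpM2l => //; exact: ltW.
  have h5 : del / 2 * `|p| ^+ 2 <= (d%:R * Lam + 2 * C) * kap * tau ^+ 2.
    have e5 : d%:R * Lam * tau * kap * tau = d%:R * Lam * kap * tau ^+ 2 by ring.
    have e6 : C * (2 * (kap * tau ^+ 2) + 2 * (del * `|p|) ^+ 2) =
       2 * C * kap * tau ^+ 2 + 2 * (C * (del * `|p|) ^+ 2) by ring.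
    rewrite e5 in key; rewrite e6 in h2.
    have -> : (d%:R * Lam + 2 * C) * kap * tau ^+ 2 = d%:R * Lam * kap * tau ^+ 2 + 2 * C * kap * tau ^+ 2 by ring.
    move: key h1 h2 h3 h4.
    move: (C * (del * `|p|) ^+ 2) (`|p| ^+ 2) (Cq D * _) (Cq D1 * _) (d%:R * Lam * kap * tau ^+ 2)
      (2 * C * kap * tau ^+ 2) (del * dotp p p) => x1 x2 x3 x4 x5 x6 x7; lra.
  have -> : B * kap * tau ^+ 2 = 2 / del * ((d%:R * Lam + 2 * C) * kap * tau ^+ 2) by rewrite /B; ring.
  have -> : `|p| ^+ 2 = 2 / del * (del / 2 * `|p| ^+ 2) by field; rewrite gt_eqF.
  by apply: ler_wpM2l => //; rewrite divr_ge0// ltW.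
apply/eqP; rewrite eq_le normr_ge0 andbT leNgt; apply/negP => eta0.
have bndT t : 0 <= t <= 1 -> `|iter n T (z t)| <= `|iter n T (0, 0)| + L * M.
  move=> ht.
  have n00 : `|(0, 0) : E * E| = 0 by rewrite norm_pairE /= normr0 maxxx.
  have -> : iter n T (z t) = iter n T (0, 0) + (iter n T (z t) - iter n T (0, 0)) by rewrite subrKC.
  apply: le_trans (ler_normD _ _) _; rewrite lerD2l.
  apply: le_trans (HL n (leqnn _) _ _ (zM t ht) _) _; first by rewrite n00.
  apply: ler_wpM2l => //; apply: le_trans (ler_normB _ _) _; rewrite n00 addr0; exact: zM.
have [L' L'0 HL'] := lip_iter lipTi (`|iter n T (0, 0)| + L * M) n.
pose e := `|eta| / (2 * (L' + 1)).
have L'1 : 0 < L' + 1 by rewrite ltr_wpDl.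
have e0 : 0 < e by rewrite divr_gt0// mulr_gt0.
have : e ^+ 2 <= 0.
  have rho0 : 0 < Num.min 1 e by rewrite lt_min ltr01.
  apply: (ler_of_small rho0 B0) => kap /andP[k0]; rewrite le_min => /andP[k1 ke].
  have [rho rhop Hrho] := Hk kap k0.
  pose tau := Num.min rho (1 + Lam)^-1.
  have L1 : 0 < 1 + Lam by rewrite ltr_pwDl.
  have tau0 : 0 < tau by rewrite lt_min rhop invr_gt0.
  have tauL : tau * (1 + Lam) <= 1.
    apply: le_trans (_ : (1 + Lam)^-1 * (1 + Lam) <= 1); last by rewrite mulVf// gt_eqF.
    by apply: ler_wpM2r; [exact: ltW|rewrite ge_min lexx orbT].
  have tau1 : tau <= 1.
    have h : 0 <= tau * Lam by apply: mulr_ge0 => //; exact: ltW.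
    by move: tauL; rewrite mulrDr mulr1; lra.
  have Hkap s t : 0 <= s -> s <= t -> t <= tau -> `|y t n - y s n| <= kap * (t - s).
    by move=> s0 st tt; apply: Hrho => //; apply: le_trans tt _; rewrite ge_min lexx.
  have kk : 0 < kap <= 1 by rewrite k0.
  have tt : 0 < tau <= 1 by rewrite tau0.
  have hd := defect kap tau kk tt tauL Hkap.
  have ht : 0 <= tau <= 1 by rewrite ltW.
  have := HL' _ _ (bndT tau ht) (bndT 0 z01).
  rewrite !iter_cancel zD subr0 gtr0_norm// => hz.
  have hn : `|iter n T (z tau) - iter n T (z 0)| <= kap * tau + `|po T (z tau) n - gamma q|.
    rewrite norm_pairE ge_max; apply/andP; split.
      apply: le_trans (_ : kap * tau <= _); last by rewrite lerDl.
      by have := Hkap 0 tau; rewrite subr0; apply => //; exact: ltW.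
    rewrite -pn0; apply: ler_wpDl => //; apply: mulr_ge0; exact: ltW.
  set P := `|_ - gamma q| in hd hn.
  have eP : tau * e <= P.
    have h1 : tau * `|eta| <= (L' + 1) * (kap * tau + P).
      apply: le_trans hz _; apply: ler_pM => //; by rewrite lerDl.
    have h2 : tau * `|eta| = (L' + 1) * (2 * (tau * e)) by rewrite /e; field; rewrite gt_eqF.
    rewrite h2 ler_pM2l// in h1.
    have h3 : kap * tau <= tau * e by rewrite mulrC; apply: ler_wpM2l => //; exact: ltW.
    by move: h1 h3; lra.
  have h6 : (tau * e) ^+ 2 <= B * kap * tau ^+ 2.
    apply: le_trans hd; rewrite ler_pXn2r ?nnegrE//; last exact: normr_ge0.
    by apply: mulr_ge0; exact: ltW.
  by move: h6; rewrite exprMn mulrC ler_pM2r// exprn_gt0.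
by rewrite leNgt exprn_gt0.
Qed.

End Nondegeneracy.

(** * Limits of periodic graphs *)

Lemma cvg_pair_filter (I : Type) (F : set_system I) (Y Z : topologicalType) (f : I -> Y)
  (g : I -> Z) (l : Y) (l' : Z) : Filter F ->
  f @ F --> l -> g @ F --> l' -> (fun i => (f i, g i)) @ F --> (l, l').
Proof.
move=> FF cf cg A [[B1 B2] [/= h1 h2] H].
have {}h1 : F (f @^-1` B1) by exact: cf.
have {}h2 : F (g @^-1` B2) by exact: cg.
have : F (fun i => A (f i, g i)); last by [].
by apply: filterS (filterI h1 h2) => y [a1 a2]; apply: H.
Qed.

Section LimitsOfGraphs.
Variables (R : realType) (d : nat).
Local Notation E := 'rV[R]_d.

Lemma ultra_compact_cvg (I : Type) (F : set_system I) (X : topologicalType) (g : I -> X)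
  (K : set X) : UltraFilter F -> compact K -> F [set i | K (g i)] ->
  exists2 p, K p & g @ F --> p.
Proof.
move=> UF cK FK; have [p [Kp cp]] := cK (g @ F) _ FK.
exists p => // V pV; have [//|FV] := in_ultra_setVsetC (g @^-1` V) UF.
by have [x [/= h1 h2]] := cp (~` V) V FV pV.
Qed.

Lemma cvg_norm_le (I : Type) (F : set_system I) (V : normedModType R) (f : I -> V) (l : V) (c : R) :
  ProperFilter F -> f @ F --> l -> F [set i | `|f i| <= c] -> `|l| <= c.
Proof. by move=> PF fl Fc; apply: cvgr_to_le (cvg_norm fl) Fc. Qed.

Variables (T_ : R -> E * E -> E * E) (n : nat) (m : 'rV[int]_d).
Hypothesis cT : continuous (fun x : R * (E * E) => T_ x.1 x.2).

Lemma continuous_iter j : continuous (fun x : R * (E * E) => iter j (T_ x.1) x.2).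
Proof.
elim: j => [|j IH] x; first exact: cvg_snd.
apply: (@continuous_comp _ _ _ (fun x : R * (E * E) => (x.1, iter j (T_ x.1) x.2))
  (fun x : R * (E * E) => T_ x.1 x.2)); last exact: cT.
by apply: cvg_pair_for; [exact: cvg_fst|exact: IH].
Qed.

Definition unif_graph (M L C eps : R) (gamma : E -> E) := [/\ lip_lag_graph (T_ eps) n m gamma,
  forall q, `|gamma q| <= M, forall q v, `|gamma (q + v) - gamma q| <= L * `|v|
  & exists2 U : E -> R, U 0 = 0 &
     forall q v, `|v| <= 1 -> `|U (q + v) - U q - dotp (gamma q) v| <= C * `|v| ^+ 2].

Lemma graph_limit (M L C eps0 : R) (gam : R -> E -> E) (F : set_system R) :
  0 <= M -> 0 <= L -> 0 <= C -> UltraFilter F -> F --> eps0 ->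
  F [set eps | unif_graph M L C eps (gam eps)] ->
  exists2 gamma, lip_lag_graph (T_ eps0) n m gamma & forall q, gam eps q @[eps --> F] --> gamma q.
Proof.
move=> M0 L0 C0 UF Feps FG.
have PF : ProperFilter F by exact: ultra_proper.
have exgamma : forall q, exists g : E, gam eps q @[eps --> F] --> g.
  move=> q; have [|p _ h] := ultra_compact_cvg (g := fun eps => gam eps q) UF (@segment_box_compact _ d M).
    by apply: filterS FG => eps [_ gM _ _]; exact: gM.
  by exists p.
have [gamma Hg] := boolp.choice exgamma.
have exUf : forall eps, exists U : E -> R, unif_graph M L C eps (gam eps) -> U 0 = 0 /\
    forall q v, `|v| <= 1 -> `|U (q + v) - U q - dotp (gam eps q) v| <= C * `|v| ^+ 2.
  move=> eps; have [[_ _ _ [U h1 h2]]|nu] := pselect (unif_graph M L C eps (gam eps)); first by exists U.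
  by exists (fun=> 0) => h; case: nu.
have [Uf HUf] := boolp.choice exUf.
have Ub eps q : unif_graph M L C eps (gam eps) -> `|Uf eps q| <= d%:R * M * `|q|.
  move=> ug; have [U0 quadU] := HUf eps ug; have [_ gM _ _] := ug.
  pose g (t : R) := Uf eps (t *: q).
  have a1 : 0 <= C * `|q| ^+ 2 by rewrite mulr_ge0// sqr_ge0.
  have q1 : 0 < `|q| + 1 by rewrite ltr_wpDl.
  have a2 : 0 < (`|q| + 1)^-1 by rewrite invr_gt0.
  have := @flat_curve R g (d%:R * M * `|q|) (C * `|q| ^+ 2) 1 _ a1 ler01 a2.
  rewrite mulr1 /g scale1r scale0r U0 subr0; apply => s t s0 st t1 str.
  have ts0 : 0 <= t - s by rewrite subr_ge0.
  have v1 : `|(t - s) *: q| <= 1.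
    rewrite normrZ ger0_norm//; apply: le_trans (_ : (`|q| + 1)^-1 * (`|q| + 1) <= 1).
      by apply: ler_pM => //; rewrite lerDl.
    by rewrite mulVf// gt_eqF.
  have := quadU (s *: q) _ v1; rewrite -scalerDl subrKC => h.
  have -> : Uf eps (t *: q) - Uf eps (s *: q) = dotp (gam eps (s *: q)) ((t - s) *: q) +
     (Uf eps (t *: q) - Uf eps (s *: q) - dotp (gam eps (s *: q)) ((t - s) *: q)) by rewrite subrKC.
  apply: le_trans (ler_normD _ _) _; apply: lerD.
    apply: le_trans (norm_dotp _ _) _; rewrite normrZ (ger0_norm ts0).
    have -> : d%:R * M * `|q| * (t - s) = d%:R * M * ((t - s) * `|q|) by ring.
    by apply: ler_wpM2r; [exact: mulr_ge0|exact: ler_wpM2l].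
  by apply: le_trans h _; rewrite normrZ (ger0_norm ts0) exprMn [_ ^+ 2 * _]mulrC mulrA.
have exU : forall q, exists u : R, Uf eps q @[eps --> F] --> u.
  move=> q; have cK : compact `[- (d%:R * M * `|q|), d%:R * M * `|q|] by exact: segment_compact.
  have [|p _ h] := ultra_compact_cvg (g := fun eps => Uf eps q) UF cK.
    by apply: filterS FG => eps ug; rewrite /= in_itv /= -ler_norml; exact: Ub.
  by exists p.
have [U HU] := boolp.choice exU.
have lipg q v : `|gamma (q + v) - gamma q| <= L * `|v|.
  apply: (@cvg_norm_le _ F _ (fun eps => gam eps (q + v) - gam eps q)).
    by apply: cvgB; exact: Hg.
  by apply: filterS FG => eps [_ _ Lg _]; exact: Lg.
have cgam : continuous gamma.
  apply: (@lip_continuous _ _ _ gamma L) => x y.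
  by have := lipg y (x - y); rewrite subrKC.
have cdotp q v : dotp (gam eps q) v @[eps --> F] --> dotp (gamma q) v.
  apply: (@cvg_comp _ _ _ (fun eps => gam eps q) (fun x => dotp x v) _ _ _ (Hg q)).
  have cd : continuous (fun x : E => dotp x v).
    by apply: dotp_continuous; [move=> x; exact: cvg_id|exact: cst_continuous].
  exact: cd.
exists gamma => //; split=> //.
- move=> q k; have h1 := Hg (q + intv R k); have h2 := Hg q.
  apply: (cvg_unique (@norm_hausdorff R E) h1).
  apply: cvg_trans h2; apply: near_eq_cvg.
  by apply: filterS FG => eps [[_ pg _ _ _] _ _ _]; rewrite pg.
- apply: (@potential_lagrangian _ _ _ cgam U C) => q v v1.
  apply: (@cvg_norm_le _ F _ (fun eps => Uf eps (q + v) - Uf eps q - dotp (gam eps q) v)).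
    by apply: cvgB; [apply: cvgB; exact: HU|exact: cdotp].
  by apply: filterS FG => eps ug; have [_ h] := HUf eps ug; exact: h.
- by exists L.
move=> q.
have h1 : iter n (T_ eps) (q, gam eps q) @[eps --> F] --> iter n (T_ eps0) (q, gamma q).
  apply: (@cvg_comp _ _ _ (fun eps : R => (eps, (q, gam eps q)))
     (fun x : R * (E * E) => iter n (T_ x.1) x.2) _ (nbhs (eps0, (q, gamma q)))); last exact: (@continuous_iter n (eps0, (q, gamma q))).
  apply: cvg_pair_filter; first exact: Feps.
  by apply: cvg_pair_filter; [exact: cvg_cst|exact: Hg].
have h2 : (q + intv R m, gam eps q) @[eps --> F] --> (q + intv R m, gamma q).
  by apply: cvg_pair_filter; [exact: cvg_cst|exact: Hg].
apply: (cvg_unique (@norm_hausdorff R (E * E)%type) h1).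
apply: cvg_trans h2; apply: near_eq_cvg.
by apply: filterS FG => eps [[_ _ _ _ og] _ _ _]; rewrite og.
Qed.

Hypothesis unif : forall eps0, exists M L C, [/\ 0 <= M, 0 <= L, 0 <= C &
  forall eps gamma, `|eps - eps0| <= 1 -> lip_lag_graph (T_ eps) n m gamma -> unif_graph M L C eps gamma].
Hypothesis unique : forall eps gamma gamma', lip_lag_graph (T_ eps) n m gamma ->
  lip_lag_graph (T_ eps) n m gamma' -> gamma =1 gamma'.

Local Notation A := [set eps | exists gamma, lip_lag_graph (T_ eps) n m gamma].

Lemma graph_filter (eps0 : R) (B : set R) (gam : R -> E -> E) :
  (forall eps, B eps -> lip_lag_graph (T_ eps) n m (gam eps)) -> closure B eps0 ->
  exists F : set_system R, exists gamma, [/\ UltraFilter F, F B, lip_lag_graph (T_ eps0) n m gamma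
    & forall q, gam eps q @[eps --> F] --> gamma q].
Proof.
move=> Bg clB.
have PF : ProperFilter (within B (nbhs eps0)) by exact: within_nbhs_proper.
have [F [UF sF]] := ultraFilterLemma PF.
have FB : F B by apply: sF; exact: withinT.
have Fe : F --> eps0 by move=> V nV; apply: sF; apply: (@filterS _ (nbhs eps0) _ _ _ _ nV) => x Vx _.
have [M [L [C [M0 L0 C0 H]]]] := unif eps0.
have FG : F [set eps | unif_graph M L C eps (gam eps)].
  have Fn : F [set eps | `|eps - eps0| <= 1].
    apply: Fe; apply/nbhs_ballP; exists 1 => //= eps; by rewrite /ball /= distrC => /ltW.
  by apply: filterS2 FB Fn => eps Be he; apply: H => //; exact: Bg.
have [gamma gg Hg] := graph_limit M0 L0 C0 UF Fe FG.
by exists F, gamma; split.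
Qed.

Lemma graph_closed : closed A.
Proof.
move=> eps0 clA.
have exgam : forall eps, exists g, A eps -> lip_lag_graph (T_ eps) n m g.
  by move=> eps; have [[g gg]|nA] := pselect (A eps); [exists g|exists (fun=> 0) => /nA].
have [gam Hg] := boolp.choice exgam.
have [F [gamma [_ _ gg _]]] := graph_filter (B := A) Hg clA.
by exists gamma.
Qed.

Lemma graph_continuous (eps0 : R) gamma0 (q : E) : lip_lag_graph (T_ eps0) n m gamma0 ->
  forall kap, 0 < kap -> exists2 rho, 0 < rho & forall eps gamma, `|eps - eps0| <= rho ->
    lip_lag_graph (T_ eps) n m gamma -> `|gamma q - gamma0 q| <= kap.
Proof.
move=> gg0 kap k0; apply: contrapT => H.
have H' rho : 0 < rho -> exists eps, `|eps - eps0| <= rho /\ exists gamma,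
    lip_lag_graph (T_ eps) n m gamma /\ kap < `|gamma q - gamma0 q|.
  move=> rho0; apply: contrapT => H'; apply: H; exists rho => // eps gamma he gg.
  by rewrite leNgt; apply/negP => hk; apply: H'; exists eps; split=> //; exists gamma.
pose B := [set eps | exists gamma, lip_lag_graph (T_ eps) n m gamma /\ kap < `|gamma q - gamma0 q|].
have exgam : forall eps, exists g, B eps -> lip_lag_graph (T_ eps) n m g /\ kap < `|g q - gamma0 q|.
  by move=> eps; have [[g gg]|nA] := pselect (B eps); [exists g|exists (fun=> 0) => /nA].
have [gam Hg] := boolp.choice exgam.
have clB : closure B eps0.
  move=> V /nbhs_ballP[r /= r0 rV]; have r2 : 0 < r / 2 by exact: divr_gt0.
  have [eps [he eB]] := H' (r / 2) r2.
  exists eps; split=> //; apply: rV; rewrite /ball /= distrC (le_lt_trans he)//.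
  by rewrite ltr_pdivrMr// ltr_pMr// ltr1n.
have Bg eps : B eps -> lip_lag_graph (T_ eps) n m (gam eps) by move=> /Hg[].
have [F [gamma [UF FB gg cg]]] := graph_filter Bg clB.
have PF : ProperFilter F by exact: ultra_proper.
have h1 : gam eps q @[eps --> F] --> gamma0 q by rewrite -(unique gg gg0).
have h2 : F [set eps | `|gamma0 q - gam eps q| < kap] by exact: (cvgr_dist_lt _ _ h1).
have [eps [/= h3 /Hg[_ h4]]] := filter_ex (filterI h2 FB).
by have := lt_trans h3 h4; rewrite distrC ltxx.
Qed.

End LimitsOfGraphs.

(** * Continuation in the parameter *)

Section Clamp.
Variable R : realType.
Local Notation C := R[i].
Local Open Scope complex_scope.
Local Notation nc := (@ComplexField.Normc.normc R).

Definition clamp (rho : R) (s : C) : C := (rho / Num.max rho (nc s))%:C * s.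

Lemma clamp_id rho s : 0 < rho -> nc s <= rho -> clamp rho s = s.
Proof. by move=> r0 h; rewrite /clamp max_l// divff ?mul1r// gt_eqF. Qed.

Lemma nc_clamp rho s : 0 < rho -> nc (clamp rho s) <= rho.
Proof.
move=> r0; have m0 : 0 < Num.max rho (nc s) by rewrite lt_max r0.
rewrite /clamp normcM normc_real ger0_norm; last by rewrite divr_ge0 ?ltW.
by rewrite mulrAC ler_pdivrMr// ler_pM2l// le_max lexx orbT.
Qed.

Lemma clamp_ccont rho : 0 < rho -> ccont (clamp rho).
Proof.
move=> r0 z k k0; pose B := 1 + nc z / rho.
have B0 : 0 < B by rewrite ltr_pwDl// divr_ge0 ?normc_ge0 ?ltW.
exists (k / B) => [|z' hz]; first exact: divr_gt0.
have max0 s : 0 < Num.max rho (nc s) by rewrite lt_max r0.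
have maxr s : rho <= Num.max rho (nc s) by rewrite le_max lexx.
pose phi s := rho / Num.max rho (nc s).
have phi1 s : 0 <= phi s <= 1.
  by apply/andP; split; [rewrite divr_ge0// ltW|rewrite ler_pdivrMr// mul1r].
have -> : clamp rho z' - clamp rho z = (phi z')%:C * (z' - z) + (phi z' - phi z)%:C * z.
  by rewrite /clamp -/(phi z) -/(phi z') rmorphB /=; ring.
have h1 : nc ((phi z')%:C * (z' - z)) <= nc (z' - z).
  rewrite normcM normc_real ger0_norm; last by case/andP: (phi1 z').
  by rewrite ler_piMl ?normc_ge0//; case/andP: (phi1 z').
have mm : `|Num.max rho (nc z) - Num.max rho (nc z')| <= nc (z' - z).
  apply: le_trans (_ : `|nc z - nc z'| <= _); last by rewrite normcB; exact: ler_dist_normc.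
  have [a1|a1] := leP rho (nc z); have [a2|a2] := leP rho (nc z') => //.
  - rewrite !ger0_norm ?subr_ge0//; last by rewrite (le_trans (ltW a2)).
    by rewrite lerD2l lerN2 ltW.
  - rewrite !ler0_norm ?subr_le0//; last by rewrite (le_trans (ltW a1)).
    by rewrite !opprB lerD2l lerN2 ltW.
  - by rewrite subrr normr0.
have h2 : `|phi z' - phi z| <= nc (z' - z) / rho.
  have -> : phi z' - phi z = phi z' * ((Num.max rho (nc z) - Num.max rho (nc z')) / Num.max rho (nc z)).
    by rewrite /phi; field; rewrite !gt_eqF.
  rewrite normrM ger0_norm; last by case/andP: (phi1 z').
  apply: le_trans (_ : 1 * `|(Num.max rho (nc z) - Num.max rho (nc z')) / Num.max rho (nc z)| <= _).
    by apply: ler_wpM2r => //; case/andP: (phi1 z').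
  rewrite mul1r normrM normfV (gtr0_norm (max0 z)); apply: ler_pM => //.
    by rewrite invr_ge0 ltW.
  by rewrite lef_pV2 ?posrE.
apply: le_trans (ler_normcD _ _) _.
apply: le_trans (_ : nc (z' - z) + nc (z' - z) / rho * nc z <= _).
  apply: lerD => //; rewrite normcM normc_real; apply: ler_wpM2r => //; exact: normc_ge0.
have -> : nc (z' - z) + nc (z' - z) / rho * nc z = nc (z' - z) * B by rewrite /B; field; rewrite gt_eqF.
by rewrite -ler_pdivlMr.
Qed.

Lemma small_power (M : R) (k : R) : 0 < k -> exists N : nat, `|M| * (4 / 7) ^+ N <= k.
Proof.
move=> k0.
have h : (fun N => geometric `|M| (4 / 7 : R) N) @ \oo --> (0 : R).
  by apply: cvg_geometric; rewrite ger0_norm; lra.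
have /(_ _ k k0) := @cvgr0_norm_le _ _ _ _ _ _ h => -[N _ HN]; exists N.
by have := HN N (leqnn _); rewrite /geometric /= ger0_norm// mulr_ge0// exprn_ge0//; lra.
Qed.

End Clamp.

Section CurveComposition.
Variable R : realType.
Local Notation C := R[i].
Local Open Scope complex_scope.
Local Notation nc := (@ComplexField.Normc.normc R).

Definition rcderiv (V : normedModType C) (c : C -> V) (s : C) (D : V) :=
  forall k : R, 0 < k -> exists2 r : R, 0 < r & forall s', nc (s' - s) <= r ->
    rnorm (c s' - c s - (s' - s) *: D) <= k * nc (s' - s).

Definition rccont (V : normedModType C) (c : C -> V) := forall s (k : R), 0 < k ->
  exists2 r : R, 0 < r & forall s', nc (s' - s) <= r -> rnorm (c s' - c s) <= k.

Lemma rcderiv_pair (V W : normedModType C) (c : C -> V) (c' : C -> W) s D D' :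
  rcderiv c s D -> rcderiv c' s D' -> rcderiv (fun s => (c s, c' s)) s ((D, D') : V * W).
Proof.
move=> h h' k k0; have [r r0 H] := h k k0; have [r' r'0 H'] := h' k k0.
exists (Num.min r r') => [|s']; first by rewrite lt_min r0.
rewrite le_min => /andP[h1 h2].
by rewrite rnorm_pair ge_max; apply/andP; split; [exact: H|exact: H'].
Qed.

Lemma rcderiv_cst (V : normedModType C) (v : V) s : rcderiv (fun=> v) s 0.
Proof.
move=> k k0; exists 1 => // s' _; rewrite subrr scaler0 subr0 rnorm0.
by rewrite mulr_ge0 ?normc_ge0// ltW.
Qed.

Lemma rcderiv_shift (c0 : C) s : rcderiv (fun s => c0 + s : C^o) s 1.
Proof.
move=> k k0; exists 1 => // s' _.
rewrite (_ : c0 + s' - (c0 + s) - (s' - s) *: 1 = 0) ?rnorm0 ?mulr_ge0 ?normc_ge0 ?ltW//.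
by rewrite -[(s' - s) *: 1]/((s' - s) * 1); ring.
Qed.

Lemma rcderiv_coords d (c : C -> 'rV[C]_d) s : (forall j, cdiff (fun s => c s 0 j) s) ->
  exists D, rcderiv c s D.
Proof.
move=> /boolp.choice[D HD]; exists (\row_j D j) => k k0.
have exr : forall j : 'I_d, exists r : R, 0 < r /\ forall s', nc (s' - s) <= r ->
    nc (c s' 0 j - c s 0 j - D j * (s' - s)) <= k * nc (s' - s).
  by move=> j; have [r r0 H] := HD j k k0; exists r.
have [r Hr] := boolp.choice exr.
exists (\big[Num.min/1]_(j < d) r j).
  by apply: (big_ind (fun x => 0 < x)) => // [x y x0 y0|j _]; [rewrite lt_min x0|case: (Hr j)].
move=> s' hs; apply: rnorm_mx_le => [|i j]; first by rewrite mulr_ge0 ?normc_ge0// ltW.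
rewrite ord1 !mxE [(s' - s) * _]mulrC; apply: (Hr j).2; apply: le_trans hs _.
exact: bigmin_le_cond.
Qed.

Lemma rccont_pair (V W : normedModType C) (c : C -> V) (c' : C -> W) :
  rccont c -> rccont c' -> rccont (fun s => (c s, c' s) : V * W).
Proof.
move=> h h' s k k0; have [r r0 H] := h s k k0; have [r' r'0 H'] := h' s k k0.
exists (Num.min r r') => [|s']; first by rewrite lt_min r0.
rewrite le_min => /andP[h1 h2].
by rewrite rnorm_pair ge_max; apply/andP; split; [exact: H|exact: H'].
Qed.

Lemma comp_ccont (V W : normedModType C) (G : V -> W) (c : C -> V) l : continuous G ->
  rccont c -> coordf l -> ccont (fun s => l (G (c s))).
Proof.
move=> cG cc cl s k k0.
have [r r0 H] := (rcontinuousP G (c s)).1 (cG (c s)) k k0.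
have [r' r'0 H'] := cc s r r0; exists r' => // s' hs.
by rewrite -coordfB//; apply: le_trans (cl.2 _) _; apply: H; exact: H'.
Qed.

Lemma comp_cdiff (V W : normedModType C) (G : V -> W) (c : C -> V) l s D :
  differentiable G (c s) -> rcderiv c s D -> coordf l -> cdiff (fun s => l (G (c s))) s.
Proof.
move=> dG dc cl; exists (l ('d G (c s) D)) => k k0.
have [K K0 HK] := diff_rbounded dG.
pose B := rnorm D + 1; have B0 : 0 < B by rewrite ltr_wpDl ?rnorm_ge0.
have k1 : 0 < k / (2 * B) by rewrite divr_gt0// mulr_gt0.
have [r r0 H] := diff_reps dG k1.
have k2 : 0 < Num.min 1 (k / (2 * K)) by rewrite lt_min ltr01 divr_gt0// mulr_gt0.
have [r' r'0 H'] := dc _ k2.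
exists (Num.min r' (r / B)) => [|s']; first by rewrite lt_min r'0 divr_gt0.
rewrite le_min => /andP[h1 h2]; have h3 := H' s' h1.
have h4 : rnorm (c s' - c s) <= B * nc (s' - s).
  have -> : c s' - c s = (c s' - c s - (s' - s) *: D) + (s' - s) *: D by rewrite subrK.
  apply: le_trans (ler_rnormD _ _) _; rewrite rnormZ /B mulrDl mul1r addrC [nc _ * _]mulrC lerD2l.
  apply: le_trans h3 _; rewrite ler_piMl ?normc_ge0// ge_min lexx //.
have h5 : rnorm (c s' - c s) <= r.
  by apply: le_trans h4 _; rewrite mulrC -ler_pdivlMr.
have h6 := H (c s') h5.
have -> : l (G (c s')) - l (G (c s)) - l ('d G (c s) D) * (s' - s) =
    l ((G (c s') - G (c s) - 'd G (c s) (c s' - c s)) + 'd G (c s) (c s' - c s - (s' - s) *: D)).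
  have -> : 'd G (c s) (c s' - c s - (s' - s) *: D) = 'd G (c s) (c s' - c s) - (s' - s) *: 'd G (c s) D.
    by rewrite linearB linearZ.
  rewrite coordfD// !coordfB// coordfZ//; ring.
apply: le_trans (cl.2 _) _; apply: le_trans (ler_rnormD _ _) _.
have h7 : rnorm ('d G (c s) (c s' - c s - (s' - s) *: D)) <= k / 2 * nc (s' - s).
  apply: le_trans (HK _) _; rewrite -ler_pdivlMl//; apply: le_trans h3 _.
  rewrite mulrA; apply: ler_wpM2r; first exact: normc_ge0.
  apply: le_trans (_ : k / (2 * K) <= _); first by rewrite ge_min lexx orbT.
  by rewrite le_eqVlt; apply/orP; left; apply/eqP; field; rewrite gt_eqF.
have h8 : k / (2 * B) * rnorm (c s' - c s) <= k / 2 * nc (s' - s).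
  apply: le_trans (_ : k / (2 * B) * (B * nc (s' - s)) <= _).
    by apply: ler_wpM2l => //; exact: ltW.
  by rewrite le_eqVlt; apply/orP; left; apply/eqP; field; rewrite gt_eqF.
by apply: le_trans (lerD (le_trans h6 h8) h7) _; rewrite -mulrDl -splitr.
Qed.

End CurveComposition.

Lemma continuous_axpy (R : realType) (X : topologicalType) (W : normedModType R) (g h : X -> W) (a : R) :
  continuous g -> continuous h -> continuous (fun x => a *: g x + h x).
Proof.
move=> cg ch q; apply: cvgD; last exact: ch.
by apply: cvgZl_tmp; exact: cg.
Qed.

Section LagrangianLimits.
Variables (R : realType) (d : nat).
Local Notation E := 'rV[R]_d.

Lemma loop_form_continuous (gamma : E -> E) (nu : R -> E) : continuous gamma -> C1 nu ->
  continuous (fun t => dotp (gamma (nu t)) (derive1 nu t)).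
Proof.
move=> cg [dnu cdnu].
have cnu : continuous nu by move=> t; exact: differentiable_continuous.
have -> : derive1 nu = (fun t => 'd nu t 1).
  by apply/funext => t; rewrite derive1E'.
apply: dotp_continuous; last exact: cdnu.
by move=> t; apply: continuous_comp; [exact: cnu|exact: cg].
Qed.

Lemma lagrangian_linear (a : R) (g h : E -> E) : continuous g -> lagrangian g ->
  continuous h -> lagrangian h ->
  continuous (fun q => a *: g q + h q) /\ lagrangian (fun q => a *: g q + h q).
Proof.
move=> cg lg ch lh.
have cgh : continuous (fun q => a *: g q + h q) by exact: (@continuous_axpy R E E).
split=> // nu nuC nu1.
have c1 := loop_form_continuous cg nuC; have c2 := loop_form_continuous ch nuC.
have I1 := lg nu nuC nu1; have I2 := lh nu nuC nu1.
rewrite (Rintegral_primitive c1 (primP c1)) in I1.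
rewrite (Rintegral_primitive c2 (primP c2)) in I2.
have D t : is_derive t (1 : R) (a *: prim (fun t => dotp (g (nu t)) (derive1 nu t)) +
    prim (fun t => dotp (h (nu t)) (derive1 nu t))) (dotp (a *: g (nu t) + h (nu t)) (derive1 nu t)).
  have d1 := primP c1 t; have d2 := primP c2 t; apply: is_derive_eq.
  by rewrite dotpDl dotpZl.
rewrite (Rintegral_primitive (loop_form_continuous cgh nuC) D) !fctE.
by rewrite opprD addrACA -scalerBr I1 I2 scaler0 addr0.
Qed.

Lemma lagrangian_limit (g : E -> E) : continuous g ->
  (forall del, 0 < del -> exists h : E -> E, [/\ continuous h, lagrangian h &
     forall q, `|g q - h q| <= del]) -> lagrangian g.
Proof.
move=> cg H nu nuC nu1.
have c1 := loop_form_continuous cg nuC.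
rewrite (Rintegral_primitive c1 (primP c1)).
apply/eqP; rewrite -normr_eq0; apply/eqP/le_anti; rewrite normr_ge0 andbT.
have cdn : continuous (fun t => `|derive1 nu t|).
  move=> t; apply: (@continuous_comp _ _ _ (derive1 nu) (fun x : E => `|x|)); last exact: norm_continuous.
  have -> : derive1 nu = (fun t => 'd nu t 1).
    by apply/funext => t'; rewrite derive1E'//; exact: nuC.1.
  exact: nuC.2.
have [t0 _ N] := EVT_max ler01 (continuous_subspaceT cdn).
have N0 : 0 <= d%:R * `|derive1 nu t0| by rewrite mulr_ge0.
apply: (ler_of_small (ltr01 : 0 < 1 :> R) N0) => del /andP[del0 _].
have [h [ch lh Hh]] := H del del0.
have c2 := loop_form_continuous ch nuC.
have I2 := lh nu nuC nu1; rewrite (Rintegral_primitive c2 (primP c2)) in I2.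
have := @primitive_close R _ _ _ _ 0 1 0 (d%:R * `|derive1 nu t0| * del) ler01 (primP c1) (primP c2).
rewrite I2 mul0r !subr0 mulr1; apply=> t t01.
rewrite -dotpBl subr0; apply: le_trans (norm_dotp _ _) _.
rewrite mulrAC; apply: ler_pM; [by rewrite mulr_ge0|exact: normr_ge0| |exact: Hh].
by apply: ler_wpM2l; [exact: ler0n|apply: N; rewrite in_itv].
Qed.

End LagrangianLimits.

Lemma RevB (R : realType) d (u w : 'rV[R[i]]_d) : Rev (u - w) = Rev u - Rev w.
Proof. by apply/rowP => j; rewrite !mxE; case: (u 0 j) => a b; case: (w 0 j). Qed.

Section Projections.
Variables (R : realType) (V W : normedModType R[i]).

Lemma differentiable_fst (z : V * W) : differentiable (@fst V W) z.
Proof.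
apply: (reps_differentiable (L := @fst V W) _ _ _).1 => //.
  by exists 1 => h; rewrite mul1r rnorm_pair le_max lexx.
move=> k k0; exists 1 => // x _; rewrite subrr rnorm0.
by rewrite mulr_ge0 ?rnorm_ge0// ltW.
Qed.

Lemma differentiable_snd (z : V * W) : differentiable (@snd V W) z.
Proof.
apply: (reps_differentiable (L := @snd V W) _ _ _).1 => //.
  by exists 1 => h; rewrite mul1r rnorm_pair le_max lexx orbT.
move=> k k0; exists 1 => // x _; rewrite subrr rnorm0.
by rewrite mulr_ge0 ?rnorm_ge0// ltW.
Qed.

Lemma differentiable_comp_pair (U X : normedModType R[i]) (f : U -> V) (g : U -> W) (h : V * W -> X) x :
  differentiable f x -> differentiable g x -> (forall z, differentiable h z) ->
  differentiable (fun x => h (f x, g x)) x.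
Proof.
move=> df dg dh; apply: (@differentiable_comp _ U (V * W)%type X (fun x => (f x, g x)) h) => //.
exact: differentiable_pair.
Qed.

End Projections.

Section Continuation.
Variables (R : realType) (d : nat).
Local Notation C := R[i].
Local Notation E := 'rV[R]_d.
Local Notation Ec := 'rV[C]_d.
Local Open Scope complex_scope.
Local Notation nc := (@ComplexField.Normc.normc R).
Let Z2 : normedModType C := (Ec * Ec)%type.
Let Z : normedModType C := (C^o * Z2)%type.
Let V : normedModType C := (C^o * Ec)%type.
Let VX : normedModType C := (V * Ec)%type.
Variables (T_ : R -> E * E -> E * E) (n : nat) (m : 'rV[int]_d) (Tc : Z -> Z2).
Hypothesis dTc : forall z, differentiable Tc z.
Hypothesis TcE : forall eps q p, Tc (eps%:C, (complexify q, complexify p)) =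
  (complexify (T_ eps (q, p)).1, complexify (T_ eps (q, p)).2).

Definition Hn j (x : Z) : Z2 := iter j (fun z => Tc (x.1, z)) x.2.

Lemma HnE j eps q p : Hn j (eps%:C, (complexify q, complexify p)) =
  (complexify (iter j (T_ eps) (q, p)).1, complexify (iter j (T_ eps) (q, p)).2).
Proof.
elim: j => // j IH; rewrite /Hn iterS -/(Hn j _) IH TcE iterS.
by rewrite -surjective_pairing.
Qed.

Lemma dHn j x : differentiable (Hn j) x.
Proof.
elim: j => [|j IH]; first exact: differentiable_snd.
exact: (@differentiable_comp_pair R C^o Z2 Z Z2 (@fst C^o Z2) (Hn j) Tc x (differentiable_fst x) IH dTc).
Qed.

Definition Phi (x : VX) : Ec := (Hn n (x.1.1, (x.1.2, x.2))).1 - x.1.2 - intv C m.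

Lemma dPhi x : differentiable Phi x.
Proof.
have d1 : differentiable (fun x : VX => x.1.1 : C^o) x.
  exact: (@differentiable_comp _ VX V C^o (@fst V Ec) (@fst C^o Ec) x (differentiable_fst x) (differentiable_fst x.1)).
have d2 : differentiable (fun x : VX => x.1.2 : Ec) x.
  exact: (@differentiable_comp _ VX V Ec (@fst V Ec) (@snd C^o Ec) x (differentiable_fst x) (differentiable_snd x.1)).
have d3 : differentiable (fun x : VX => (x.1.2, x.2) : Z2) x.
  exact: (@differentiable_pair _ VX Ec Ec _ _ x d2 (differentiable_snd x)).
have d4 : differentiable (fun x : VX => Hn n (x.1.1, (x.1.2, x.2))) x.
  exact: (@differentiable_comp_pair R C^o Z2 VX Z2 _ _ (Hn n) x d1 d3 (dHn n)).
have d5 : differentiable (fun x : VX => (Hn n (x.1.1, (x.1.2, x.2))).1 : Ec) x.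
  exact: (@differentiable_comp _ VX Z2 Ec _ (@fst Ec Ec) x d4 (differentiable_fst _)).
have d6 : differentiable (fun x : VX => (Hn n (x.1.1, (x.1.2, x.2))).1 - x.1.2 : Ec) x.
  exact: (@differentiableB _ VX Ec _ _ x d5 d2).
exact: (@differentiableB _ VX Ec _ (fun=> intv C m) x d6 (differentiable_cst _ _)).
Qed.

Lemma PhiE eps q p : Phi ((eps%:C, complexify q), complexify p) =
  complexify ((iter n (T_ eps) (q, p)).1 - q - intv R m).
Proof. by rewrite /Phi /= HnE /= !complexifyB complexify_intv. Qed.

Hypothesis cT : continuous (fun x : R * (E * E) => T_ x.1 x.2).
Hypothesis unif : forall eps0, exists M L C0, [/\ 0 <= M, 0 <= L, 0 <= C0 &
  forall eps gamma, `|eps - eps0| <= 1 -> lip_lag_graph (T_ eps) n m gamma -> unif_graph T_ n m M L C0 eps gamma].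
Hypothesis unique : forall eps gamma gamma', lip_lag_graph (T_ eps) n m gamma ->
  lip_lag_graph (T_ eps) n m gamma' -> gamma =1 gamma'.
Hypothesis nondeg : forall eps gamma q eta, lip_lag_graph (T_ eps) n m gamma ->
  (forall kap, 0 < kap -> exists2 rho, 0 < rho & forall s t,
     0 <= s -> s <= t -> t <= rho ->
     `|xo (T_ eps) (q, gamma q + t *: eta) n - xo (T_ eps) (q, gamma q + s *: eta) n| <= kap * (t - s)) ->
  eta = 0.

Lemma Phi_real_diff eps q p (u : E) :
  exists A : E, 'd Phi (((eps%:C, complexify q), complexify p) : VX) (0, complexify u) = complexify A.
Proof.
pose z0 : VX := ((eps%:C, complexify q), complexify p); rewrite -[X in 'd Phi X]/z0.
exists (Rev ('d Phi z0 (0, complexify u))); rewrite cplx_Re_complexify//.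
apply/eqP; rewrite -normr_eq0; apply/eqP/le_anti; rewrite normr_ge0 andbT.
have h1 : `|Imv ('d Phi z0 (0, complexify u))| <= 0; last exact: h1.
have r10 : 0 < 1 :> R by [].
apply: (ler_of_small (A := `|u|) r10) => // k /andP[k0 _].
have [r r0 H] := entire_strict_diff z0 (@coord_norming_mx R 1 d) dPhi k0.
pose t := r / (`|u| + 1); have u1 : 0 < `|u| + 1 by rewrite ltr_wpDl.
have t0 : 0 < t by rewrite divr_gt0.
have tu : t * `|u| <= r.
  apply: le_trans (_ : t * (`|u| + 1) <= _); last by rewrite /t divfK// gt_eqF.
  by apply: ler_wpM2l; [exact: ltW|rewrite lerDl].
pose z1 : VX := ((eps%:C, complexify q), complexify (p + t *: u)).
have dz : z1 - z0 = (t%:C : C) *: ((0, complexify u) : VX).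
  rewrite /z1 /z0 complexifyD complexifyZ; congr (_, _) => /=.
    by rewrite subrr scaler0.
  by rewrite addrAC subrr add0r.
have nz : rnorm (z1 - z0) = t * `|u|.
  rewrite dz rnormZ normc_real gtr0_norm// rnorm_pair rnorm0 rnorm_complexify.
  by rewrite max_r.
have := H z1 z0; rewrite nz subrr rnorm0 => /(_ tu (ltW r0)).
rewrite dz linearZ /z1 /z0 !PhiE -complexifyB => h.
have := le_trans (norm_Imv _) h.
have -> : forall (x : E) (w : Ec), Imv (complexify x - t%:C *: w) = - t *: Imv w.
  by move=> x w; apply/rowP => j; rewrite !mxE /=; case: (w 0 j) => a b /=; ring.
rewrite normrZ normrN gtr0_norm// => h'.
by rewrite -(ler_pM2l t0) (le_trans h')// le_eqVlt; apply/orP; left; apply/eqP; ring.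
Qed.

Lemma Phi_real_kernel eps gamma q (u : E) : lip_lag_graph (T_ eps) n m gamma ->
  'd Phi (((eps%:C, complexify q), complexify (gamma q)) : VX) (0, complexify u) = 0 -> u = 0.
Proof.
move=> gg; pose z0 : VX := ((eps%:C, complexify q), complexify (gamma q)).
rewrite -[X in 'd Phi X]/z0 => ker.
apply: (nondeg (q := q) gg) => kap k0.
pose u1 := `|u| + 1; have u10 : 0 < u1 by rewrite ltr_wpDl.
have k1 : 0 < kap / u1 by rewrite divr_gt0.
have [r r0 H] := entire_strict_diff z0 (@coord_norming_mx R 1 d) dPhi k1.
exists (r / u1) => [|s t s0 st tr]; first by rewrite divr_gt0.
pose zz (t : R) : VX := ((eps%:C, complexify q), complexify (gamma q + t *: u)).
have dz (s' t' : R) : zz t' - zz s' = ((t' - s')%:C : C) *: ((0, complexify u) : VX).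
  rewrite /zz !complexifyD !complexifyZ; congr (_, _) => /=.
    by rewrite subrr scaler0.
  by rewrite opprD addrACA subrr add0r -scalerBl rmorphB.
have nz (s' t' : R) : s' <= t' -> rnorm (zz t' - zz s') = (t' - s') * `|u|.
  move=> h; rewrite dz rnormZ normc_real ger0_norm ?subr_ge0// rnorm_pair rnorm0 rnorm_complexify.
  by rewrite max_r.
have z00 : zz 0 = z0 by rewrite /zz scale0r addr0.
have small (t' : R) : 0 <= t' -> t' <= r / u1 -> rnorm (zz t' - z0) <= r.
  move=> t0 tr'; rewrite -z00 nz// subr0; apply: le_trans (_ : r / u1 * u1 <= _); last by rewrite divfK// gt_eqF.
  by apply: ler_pM => //; rewrite lerDl.
have := H (zz t) (zz s) (small t (le_trans s0 st) tr) (small s s0 (le_trans st tr)).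
have kz : 'd Phi z0 ((t - s)%:C *: ((0, complexify u) : VX)) = 0.
  by rewrite linearZ /= ker; exact: scaler0.
rewrite nz// dz kz subr0 /zz !PhiE -complexifyB rnorm_complexify.
have -> : forall x y : E, x - q - intv R m - (y - q - intv R m) = x - y.
  by move=> x y; rewrite !opprB; apply/rowP => j; rewrite !mxE; ring.
move=> h; apply: le_trans h _.
have -> : kap / u1 * ((t - s) * `|u|) = kap * (t - s) * (`|u| / u1) by field; rewrite gt_eqF.
rewrite ler_piMr//; first by rewrite mulr_ge0 ?subr_ge0// ltW.
by rewrite ler_pdivrMr// mul1r lerDl.
Qed.

Lemma Phi_inj eps gamma q : lip_lag_graph (T_ eps) n m gamma -> forall x : Ec,
  'd Phi (((eps%:C, complexify q), complexify (gamma q)) : VX) (0, x) = 0 -> x = 0.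
Proof.
move=> gg x; pose z0 : VX := ((eps%:C, complexify q), complexify (gamma q)).
rewrite -[X in 'd Phi X]/z0 => ker.
have xE : x = complexify (Rev x) + 'i%C *: complexify (Imv x).
  apply/rowP => j; rewrite !mxE; case: (x 0 j) => a b /=; apply/eqP; rewrite eq_complex /=.
  by rewrite !(mul0r, mul1r, subr0, addr0, add0r, mulr0) !eqxx.
have pE : ((0, x) : VX) = ((0, complexify (Rev x)) : VX) + 'i%C *: ((0, complexify (Imv x)) : VX).
  by rewrite {1}xE; congr (_, _) => /=; rewrite scaler0 addr0.
have [A EA] := Phi_real_diff eps q (gamma q) (Rev x).
have [B EB] := Phi_real_diff eps q (gamma q) (Imv x).
move: ker; rewrite pE linearD linearZ EA EB => h.
have AB0 : A = 0 /\ B = 0.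
  split; apply/rowP => j; move/rowP: h => /(_ j); rewrite !mxE /= => /eqP;
    by rewrite eq_complex /= !(mul0r, mul1r, subr0, addr0, add0r, mulr0) => /andP[/eqP ? /eqP ?].
have R0 : Rev x = 0 by apply: (Phi_real_kernel (q := q) gg); rewrite EA AB0.1 complexify0.
have I0 : Imv x = 0 by apply: (Phi_real_kernel (q := q) gg); rewrite EB AB0.2 complexify0.
by rewrite xE R0 I0 complexify0 scaler0 addr0.
Qed.

Variable eps0 : R.

(* [f] is an extension of [eps0 + s |-> gamma_(eps0 + s) q] to complex [s]. *)
Definition germ (rho : R) (q : E) (f : C -> Ec) := [/\ rccont f,
  forall s, nc s < rho -> forall j, cdiff (fun s => f s 0 j) s,
  forall s, nc s <= rho -> rnorm (f s) <= rho^-1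
  & forall eps gamma, `|eps - eps0| <= rho -> lip_lag_graph (T_ eps) n m gamma ->
      f (eps - eps0)%:C = complexify (gamma q)].

Definition germs (rho : R) (q : E) := forall q', `|q' - q| <= rho ->
  exists f f', [/\ germ rho q f, germ rho q' f'
    & forall s, nc s <= rho -> rnorm (f s - f' s) <= rho^-1 * `|q' - q|].

Variable gamma0 : E -> E.
Hypothesis gg0 : lip_lag_graph (T_ eps0) n m gamma0.

Lemma local_germs q0 : exists2 rho1, 0 < rho1 & forall rho, 0 < rho <= rho1 ->
  forall q, `|q - q0| <= rho1 -> germs rho q.
Proof.
pose v0 : V := (eps0%:C, complexify q0).
have P0 : Phi ((v0, complexify (gamma0 q0)) : VX) = 0.
  have [_ _ _ _ og] := gg0.
  by rewrite PhiE og /= addrAC addrK subrr complexify0.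
have [r [rho [L [Y [[r0 rho0 L0] [Y1 Y2 Y3 Y4]]]]]] :=
  implicit_function dPhi P0 (Phi_inj (q := q0) gg0).
have [M [Lg [C0 [M0 Lg0 _ ug]]]] := unif eps0.
have r20 : 0 < r / 2 by rewrite divr_gt0.
have [rho' rho'0 Hc] := graph_continuous cT unif unique q0 gg0 r20.
pose B := rnorm (complexify (gamma0 q0)) + r + L + 1.
have B0 : 0 < B by rewrite ltr_wpDl// !addr_ge0 ?rnorm_ge0// ltW.
have Lg1 : 0 < Lg + 1 by rewrite ltr_wpDl.
pose rho1 := Num.min (Num.min (rho / 4) (Num.min 1 rho')) (Num.min B^-1 (r / (4 * (Lg + 1)))).
exists rho1; first by rewrite !lt_min !divr_gt0 ?mulr_gt0// invr_gt0 B0 ltr01 rho'0.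
move=> rh /andP[rh0]; rewrite !le_min => /andP[/andP[rh1 /andP[rh2 rh3]] /andP[rh4 rh5]] q.
rewrite !le_min => /andP[/andP[q1 /andP[q2 q3]] /andP[q4 q5]] q' qq'.
pose f x (s : C) := Y (eps0%:C + clamp rh s, complexify x).
have vE x s : ((eps0%:C + s, complexify x) : V) - v0 = (s, complexify (x - q0)).
  by rewrite complexifyB; congr (_, _) => /=; rewrite addrAC subrr add0r.
have vn x s : nc s <= rh -> `|x - q0| <= rho / 2 -> rnorm (((eps0%:C + s, complexify x) : V) - v0) < rho.
  move=> hs hx; rewrite vE rnorm_pair gt_max rnorm_complex rnorm_complexify; apply/andP; split.
    apply: le_lt_trans hs _; apply: le_lt_trans rh1 _; rewrite ltr_pdivrMr// ltr_pMr// ltr1n//.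
  by apply: le_lt_trans hx _; rewrite ltr_pdivrMr// ltr_pMr// ltr1n.
have isgerm x : `|x - q0| <= rho / 2 -> `|x - q0| <= r / (2 * (Lg + 1)) -> germ rh x (f x).
  move=> x1 x2; split.
  - move=> s k k0; have [e e0 H] := clamp_ccont rh0 s (divr_gt0 k0 L0); exists e => // s' hs.
    apply: le_trans (Y3 _ _ _ _) _; try (by apply: ltW; apply: vn => //; exact: nc_clamp).
    have -> : (eps0%:C + clamp rh s', complexify x) - (eps0%:C + clamp rh s, complexify x) =
        ((clamp rh s' - clamp rh s, 0) : V).
      by congr (_, _) => /=; [rewrite opprD addrACA subrr add0r|rewrite subrr].
    rewrite rnorm_pair rnorm0 max_l ?rnorm_ge0// rnorm_complex mulrC -ler_pdivlMr//; exact: H.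
  - move=> s hs j.
    have hv := vn x s (ltW hs) x1.
    have [D HD] := Y4 _ ((1, 0) : V) j hv.
    exists D => k k0; have [e e0 H] := HD k k0.
    exists (Num.min e (rh - nc s)) => [|s']; first by rewrite lt_min e0 subr_gt0.
    rewrite le_min => /andP[h1 h2].
    have cs : clamp rh s = s by rewrite clamp_id// ltW.
    have cs' : clamp rh s' = s'.
      rewrite clamp_id//; have -> : s' = (s' - s) + s by rewrite subrK.
      by apply: le_trans (ler_normcD _ _) _; move: h2; lra.
    have := H (s' - s); rewrite subr0 => /(_ h1).
    have -> : ((eps0%:C + s, complexify x) : V) + (s' - s) *: ((1, 0) : V) = (eps0%:C + s', complexify x).
      congr (_, _) => /=; last by rewrite scaler0 addr0.
      by rewrite [_ *: _]mulr1 -addrA subrKC.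
    by rewrite scale0r addr0 /f cs cs'.
  - move=> s hs; rewrite /f clamp_id//.
    have [h _] := Y1 _ (ltW (vn x s hs x1)).
    have -> : Y (eps0%:C + s, complexify x) = (Y (eps0%:C + s, complexify x) - complexify (gamma0 q0)) + complexify (gamma0 q0) by rewrite subrK.
    apply: le_trans (ler_rnormD _ _) _; apply: le_trans (_ : B <= _).
      by rewrite /B; have := ltW L0; lra.
    by rewrite -[B]invrK lef_pV2 ?posrE// invr_gt0.
  move=> eps gamma he gg.
  have ncs : nc (eps - eps0)%:C <= rh by rewrite normc_real.
  rewrite /f clamp_id//.
  have -> : eps0%:C + (eps - eps0)%:C = eps%:C by rewrite -rmorphD /= subrKC.
  apply/esym; apply: Y2.
  - have := vn x (eps - eps0)%:C ncs x1; rewrite -rmorphD /= subrKC; exact: ltW.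
  - rewrite -complexifyB rnorm_complexify.
    have [_ _ lipg _] := ug eps gamma (le_trans he rh2) gg.
    have h1 := lipg q0 (x - q0); rewrite subrKC in h1.
    have h2 := Hc eps gamma (le_trans he rh3) gg.
    have -> : gamma x - gamma0 q0 = (gamma x - gamma q0) + (gamma q0 - gamma0 q0) by rewrite addrA subrK.
    apply: le_trans (ler_normD _ _) _; rewrite [leRHS](splitr r); apply: lerD => //.
    apply: le_trans h1 _; apply: le_trans (_ : (Lg + 1) * `|x - q0| <= _).
      by apply: ler_wpM2r => //; rewrite lerDl.
    rewrite -ler_pdivlMl//; apply: le_trans x2 _.
    by rewrite le_eqVlt; apply/orP; left; apply/eqP; field; rewrite gt_eqF.
  - have [_ _ _ _ og] := gg.
    by rewrite PhiE og /= addrAC addrK subrr complexify0.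
have a1 : `|q - q0| <= rho / 2 by apply: le_trans q1 _; apply: ler_pM => //; [exact: ltW|rewrite lef_pV2 ?posrE// ler_nat].
have a2 : `|q - q0| <= r / (2 * (Lg + 1)).
  apply: le_trans q5 _; apply: ler_pM => //; [exact: ltW|by rewrite invr_ge0 mulr_ge0// ltW|].
  by rewrite lef_pV2 ?posrE ?mulr_gt0// ler_pM2r// ler_nat.
have tri : `|q' - q0| <= `|q' - q| + `|q - q0|.
  by apply: le_trans (ler_normD _ _); rewrite addrA subrK.
have b1 : `|q' - q0| <= rho / 2.
  apply: le_trans tri _; apply: le_trans (lerD (le_trans qq' rh1) q1) _.
  by rewrite le_eqVlt; apply/orP; left; apply/eqP; field.
have b2 : `|q' - q0| <= r / (2 * (Lg + 1)).
  apply: le_trans tri _; apply: le_trans (lerD (le_trans qq' rh5) q5) _.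
  by rewrite le_eqVlt; apply/orP; left; apply/eqP; field; rewrite gt_eqF.
exists (f q), (f q'); split; [exact: isgerm|exact: isgerm|].
move=> s hs; rewrite /f clamp_id//.
apply: le_trans (Y3 _ _ (ltW (vn q s hs a1)) (ltW (vn q' s hs b1))) _.
have -> : (eps0%:C + s, complexify q) - (eps0%:C + s, complexify q') = ((0, complexify (q - q')) : V).
  by rewrite complexifyB; congr (_, _) => /=; rewrite subrr.
rewrite rnorm_pair rnorm0 max_r ?rnorm_ge0// rnorm_complexify distrC; apply: ler_wpM2r => //.
apply: le_trans (_ : B <= _).
  by rewrite /B; have := rnorm_ge0 (complexify (gamma0 q0)); have := ltW r0; lra.
by rewrite -[B]invrK lef_pV2 ?posrE// invr_gt0.
Qed.

Lemma uniform_germs : exists2 rho, 0 < rho & forall q, `|q| <= 1 -> germs rho q.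
Proof.
have cK := @segment_box_compact R d 1.
have N : \forall rho \near 0^'+, [set v : E | `|v| <= 1] `<=` germs rho.
  apply: ((compact_near_coveringP _).1 cK) => q0 _.
  have [rho1 rho10 H] := local_germs q0.
  near=> q rho => /=; apply: H; last first.
    rewrite distrC; near: q; apply: cvgr_dist_le => //.
  apply/andP; split; near: rho; first exact: nbhs_right_gt.
  exact: nbhs_right_le.
have /filter_ex[rho [h1 h2]] : \forall rho \near (0 : R)^'+, 0 < rho /\ [set v : E | `|v| <= 1] `<=` germs rho.
  by near=> rho; split; near: rho; [exact: nbhs_right_gt|exact: N].
by exists rho => // q q1; exact: h2.
Unshelve. all: by end_near. Qed.

Lemma germ_shift rho q (k : 'rV[int]_d) f : germ rho (q + intv R k) f -> germ rho q f.
Proof.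
move=> [f1 f2 f3 f4]; split=> // eps gamma he gg.
by rewrite (f4 _ gamma)//; have [_ -> _ _ _] := gg.
Qed.

Lemma all_germs : exists2 rho, 0 < rho & forall q, germs rho q.
Proof.
have [rho rho0 H] := uniform_germs; exists rho => // q q' hq.
have [k hk] := floor_reduction q.
have := H _ hk (q' + intv R k); rewrite opprD addrACA subrr addr0 => /(_ hq)[f [f' [h1 h2 h3]]].
by exists f, f'; split; [exact: germ_shift h1|exact: germ_shift h2|].
Qed.

Local Notation A := [set eps | exists gamma, lip_lag_graph (T_ eps) n m gamma].

Lemma distinct_points (r : R) k : 0 < r -> limit_point A eps0 -> exists xs : seq R,
  [/\ size xs = k, uniq xs & forall y, y \in xs -> `|y| <= r /\ A (eps0 + y)].
Proof.
move=> r0 lA; elim: k => [|k [xs [sx ux Hx]]]; first by exists [::].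
have [B] : exists2 B : R, 0 < B & forall y, y \in xs -> y != 0 -> B <= `|y|.
  elim: {sx ux Hx} xs => [|x xs [B B0 HB]]; first by exists 1.
  have [->|x0] := eqVneq x 0.
    by exists B => // y; rewrite inE => /orP[/eqP ->|/HB//]; rewrite eqxx.
  exists (Num.min B `|x|) => [|y]; first by rewrite lt_min B0 normr_gt0.
  rewrite inE => /orP[/eqP -> _|hy y0]; first by rewrite ge_min lexx orbT.
  by rewrite ge_min HB.
move=> B0 HB.
have nb : nbhs eps0 [set eps | `|eps0 - eps| < Num.min r B].
  by apply/nbhs_ballP; exists (Num.min r B) => //=; rewrite lt_min r0.
have [eps [e0 Ae]] := lA _ nb; rewrite /= lt_min => /andP[er eB].
have ne0 : eps - eps0 != 0 by rewrite subr_eq0.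
exists ((eps - eps0) :: xs); split=> [|/=|y]; first by rewrite /= sx.
  rewrite ux andbT; apply/negP => /HB /(_ ne0); rewrite distrC => h.
  by have := lt_le_trans eB h; rewrite ltxx.
rewrite inE => /orP[/eqP ->|]; last exact: Hx.
by rewrite distrC subrKC; split=> //; exact: ltW.
Qed.

Hypothesis lA : limit_point A eps0.

Lemma rccont_coord f j : rccont f -> ccont (fun s => (f s : Ec) 0 j).
Proof.
move=> cf s k k0; have [r r0 H] := cf s k k0; exists r => // s' hs.
by apply: le_trans (H s' hs); have := rnorm_coord (f s' - f s) 0 j; rewrite !mxE.
Qed.

Section Value.
Variables (rho x : R).
Hypothesis rho0 : 0 < rho.
Hypothesis xr : `|x| <= rho / 8.

Let xrho : nc x%:C < rho.
Proof. by rewrite normc_real (le_lt_trans xr)// ltr_pdivrMr// ltr_pMr// ltr1n. Qed.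

Lemma rho8_le (y : R) : `|y| <= rho / 8 -> nc y%:C <= rho.
Proof. by move=> h; rewrite normc_real (le_trans h)// ler_pdivrMr// ler_peMr// ?ler1n// ltW. Qed.

Lemma germ_approx (del : R) : 0 < del -> exists h : E -> E,
  [/\ continuous h, Defs.periodic h, lagrangian h
  & forall q f, germ rho q f -> rnorm (f x%:C - complexify (h q)) <= del].
Proof.
move=> del0.
have [N HN] := small_power rho^-1 del0.
have r8 : 0 < rho / 8 by rewrite divr_gt0.
have [xs [sx ux Hx]] := distinct_points N r8 lA.
have hxs y : y \in xs -> `|y| <= rho / 8 by move=> /Hx[].
have [a Ha] := interpolation rho0 xr ux hxs.
have exg : forall eps, exists g : E -> E, A eps -> lip_lag_graph (T_ eps) n m g.
  by move=> eps; have [[g gg]|nA] := pselect (A eps); [exists g|exists (fun=> 0) => /nA].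
have [gam Hg] := boolp.choice exg.
pose h q := \sum_(y <- xs) a y *: gam (eps0 + y) q.
have hc : continuous h /\ lagrangian h.
  have : forall y, y \in xs -> lip_lag_graph (T_ (eps0 + y)) n m (gam (eps0 + y)).
    by move=> y /Hx[_]; exact: Hg.
  rewrite /h; elim: xs {sx ux Hx hxs Ha h} => [|y xs IH] gy.
    have -> : (fun q : E => \sum_(y <- [::]) a y *: gam (eps0 + y) q) = (fun=> 0).
      by apply/funext => q; rewrite big_nil.
    split; first exact: cst_continuous.
    move=> nu _ _; rewrite (_ : (fun _ => _) = cst 0); last by apply/funext => t; rewrite dotp0l.
    by rewrite Rintegral_cst// mul0r.
  have -> : (fun q : E => \sum_(y <- y :: xs) a y *: gam (eps0 + y) q) =
      (fun q => a y *: gam (eps0 + y) q + \sum_(y <- xs) a y *: gam (eps0 + y) q).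
    by apply/funext => q; rewrite big_cons.
  have [|c1 l1] := IH; first by move=> z zxs; apply: gy; rewrite inE zxs orbT.
  have [c2 _ l2 _ _] := gy y (mem_head _ _).
  exact: lagrangian_linear.
exists h; split; [exact: hc.1| |exact: hc.2|].
  move=> q k; rewrite /h big_seq [RHS]big_seq; apply: eq_bigr => y /Hx[_ /Hg[_ pg _ _ _]].
  by rewrite pg.
move=> q f gf; apply: rnorm_mx_le => [|i j]; first exact: ltW.
have [f1 f2 f3 f4] := gf.
have dh : disc_hol (fun s => f s 0 j) rho [::] rho^-1.
  split; [exact: rccont_coord|by move=> s hs _; exact: f2|].
  by move=> s hs; apply: le_trans (f3 s _); [exact: rnorm_coord|rewrite hs].
have := Ha _ _ _ dh (fun y _ => isT); rewrite sx => h1.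
have e1 : complexify (h q) 0 j = \sum_(y <- xs) (a y)%:C * f y%:C 0 j.
  rewrite mxE /h summxE rmorph_sum /= big_seq [RHS]big_seq; apply: eq_bigr => y yxs.
  have [yr Ay] := Hx y yxs.
  have := f4 (eps0 + y) _ _ (Hg _ Ay); rewrite [eps0 + y]addrC addrK => ->.
    by rewrite !mxE rmorphM.
  by have := rho8_le yr; rewrite normc_real.
rewrite ord1 !mxE -[real_complex R (h q 0 j)]/(real_complex R (h q 0 j)).
have -> : real_complex R (h q 0 j) = complexify (h q) 0 j by rewrite mxE.
rewrite e1; apply: le_trans h1 _; apply: le_trans HN.
by apply: ler_wpM2r; [apply: exprn_ge0; lra|exact: ler_norm].
Qed.

Lemma germ_graph q f : germ rho q f ->
  Hn n ((eps0 + x)%:C, (complexify q, f x%:C)) = (complexify (q + intv R m), f x%:C).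
Proof.
move=> [f1 f2 f3 f4].
pose G (z : Z) : Z2 := Hn n z - (z.2 + ((intv C m, 0) : Z2)).
have dG z : differentiable G z.
  have d2 : differentiable (fun z : Z => z.2 : Z2) z by exact: (@differentiable_snd R C^o Z2 z).
  have d3 : differentiable (fun z : Z => z.2 + ((intv C m, 0) : Z2) : Z2) z.
    exact: (@differentiableD _ Z Z2 _ (fun=> ((intv C m, 0) : Z2)) z d2 (differentiable_cst _ _)).
  exact: (@differentiableB _ Z Z2 _ _ z (dHn n z) d3).
have cG : continuous G by move=> z; exact: differentiable_continuous (dG z).
pose c (s : C) : Z := (eps0%:C + s, (complexify q, f s)).
have cc : rccont c.
  apply: (@rccont_pair R C^o Z2 (fun s => eps0%:C + s : C^o) (fun s => (complexify q, f s) : Z2)).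
    by move=> s k k0; exists k => // s' hs; rewrite opprD addrACA subrr add0r rnorm_complex.
  apply: (@rccont_pair R Ec Ec (fun=> complexify q) f) => // s k k0.
  by exists k => // s' hs; rewrite subrr rnorm0 ltW.
have dc s : nc s < rho -> exists D, rcderiv c s D.
  move=> hs; have [D HD] := rcderiv_coords (f2 s hs).
  exists ((1, (0, D)) : Z).
  apply: (@rcderiv_pair R C^o Z2 _ (fun s => (complexify q, f s) : Z2)); first exact: rcderiv_shift.
  exact: (@rcderiv_pair R Ec Ec (fun=> complexify q) f s 0 D (rcderiv_cst (complexify q : Ec) s) HD).
suff : G (c x%:C) = 0.
  rewrite /G /c -rmorphD /= => /eqP; rewrite subr_eq0 => /eqP ->.
  by congr (_, _) => /=; rewrite ?addr0// complexifyD complexify_intv.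
have n2 : coord_norming Z2 by apply: coord_norming_pair; exact: coord_norming_mx.
apply/eqP; rewrite -rnorm_eq0; apply/eqP/le_anti; rewrite rnorm_ge0 andbT.
apply: n2 => // l cl.
pose g s := l (G (c s)).
have cg : ccont g by exact: comp_ccont.
have [z0 _ Hz] := disc_max (ltW rho0) (ccont_normc cg).
have dh : disc_hol g rho [::] (nc (g z0)).
  split=> // [s hs _|s hs]; last by apply: Hz; rewrite hs.
  by have [D HD] := dc s hs; exact: comp_cdiff HD cl.
apply/ler_addgt0Pr => e e0; rewrite add0r.
have [N HN] := small_power (nc (g z0)) e0.
have r8 : 0 < rho / 8 by rewrite divr_gt0.
have [xs [sx ux Hx]] := distinct_points N r8 lA.
have hxs y : y \in xs -> `|y| <= rho / 8 by move=> /Hx[].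
have [a Ha] := interpolation rho0 xr ux hxs.
have := Ha _ _ _ dh (fun y _ => isT); rewrite sx big_seq big1 => [|y yxs].
  rewrite subr0 => h1; apply: le_trans h1 _; apply: le_trans HN.
  by apply: ler_wpM2r; [apply: exprn_ge0; lra|exact: ler_norm].
have [yr [gam gy]] := Hx y yxs.
have fy : f y%:C = complexify (gam q).
  have := f4 (eps0 + y) _ _ gy; rewrite [eps0 + y]addrC addrK; apply.
  by have := rho8_le yr; rewrite normc_real.
have [_ _ _ _ og] := gy.
rewrite /g /G /c fy -rmorphD /= HnE og /=.
have -> : (complexify (q + intv R m), complexify (gam q)) -
    ((complexify q, complexify (gam q)) + ((intv C m, 0) : Z2)) = 0 :> Z2.
  apply/eqP; rewrite subr_eq0; apply/eqP; congr (_, _) => /=; last by rewrite addr0.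
  by rewrite complexifyD complexify_intv.
by rewrite coordf0// mulr0.
Qed.

End Value.

Lemma graph_near : exists2 r, 0 < r & forall eps, `|eps - eps0| <= r -> A eps.
Proof.
have [rho rho0 H] := all_germs.
exists (rho / 8) => [|eps]; first by rewrite divr_gt0.
set x := eps - eps0 => xr.
have epsE : eps = eps0 + x by rewrite /x subrKC.
have exf : forall q : E, exists f, germ rho q f.
  by move=> q; have [|f [_ [h _ _]]] := H q q; [rewrite subrr normr0 ltW|exists f].
have [F HF] := boolp.choice exf.
pose gamma q := Rev (F q x%:C).
have approx del : 0 < del -> exists h : E -> E,
    [/\ continuous h, Defs.periodic h, lagrangian h
    & forall q f, germ rho q f -> rnorm (f x%:C - complexify (h q)) <= del].
  exact: germ_approx.
have near (q : E) (f : C -> Ec) (del : R) (h : E -> E) : rnorm (f x%:C - complexify (h q)) <= del -> `|Rev (f x%:C) - h q| <= del.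
  move=> hd; apply: le_trans hd.
  have -> : Rev (f x%:C) - h q = Rev (f x%:C - complexify (h q)) by rewrite RevB Rev_complexify.
  exact: norm_Rev.
have real q f : germ rho q f -> f x%:C = complexify (Rev (f x%:C)).
  move=> gf; rewrite cplx_Re_complexify//.
  apply/eqP; rewrite -normr_eq0; apply/eqP/le_anti; rewrite normr_ge0 andbT.
  apply/ler_addgt0Pr => e e0; rewrite add0r.
  have [h [_ _ _ Hh]] := approx e e0; apply: le_trans (Hh q f gf).
  have -> : Imv (f x%:C) = Imv (f x%:C - complexify (h q)).
    by apply/rowP => j; rewrite !mxE; case: (f x%:C 0 j) => a b /=; rewrite subr0.
  exact: norm_Imv.
have eqg q f : germ rho q f -> Rev (f x%:C) = gamma q.
  move=> gf; apply/eqP; rewrite -subr_eq0 -normr_eq0; apply/eqP/le_anti; rewrite normr_ge0 andbT.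
  apply/ler_addgt0Pr => e e0; rewrite add0r.
  have e2 : 0 < e / 2 by rewrite divr_gt0.
  have [h [_ _ _ Hh]] := approx _ e2.
  have h1 := near _ _ _ _ (Hh q f gf); have h2 := near _ _ _ _ (Hh q (F q) (HF q)).
  have -> : Rev (f x%:C) - gamma q = (Rev (f x%:C) - h q) - (gamma q - h q) by rewrite subrBACA subrr subr0.
  by apply: le_trans (ler_normB _ _) _; rewrite [leRHS](splitr e); exact: lerD.
have x8 := rho8_le rho0 xr.
have bnd q : `|gamma q| <= rho^-1.
  have [_ _ f3 _] := HF q; apply: le_trans (f3 _ x8); exact: norm_Rev.
have lip q q' : `|gamma q' - gamma q| <= 2 * rho^-1 * (1 + rho^-1) * `|q' - q|.
  have i0 : 0 < rho^-1 by rewrite invr_gt0.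
  have [hq|hq] := leP `|q' - q| rho.
    have [f [f' [h1 h2 h3]]] := H q q' hq.
    rewrite -(eqg q f h1) -(eqg q' f' h2) distrC.
    have -> : Rev (f x%:C) - Rev (f' x%:C) = Rev (f x%:C - f' x%:C) by rewrite RevB.
    apply: le_trans (norm_Rev _) _; apply: le_trans (h3 _ x8) _; apply: ler_wpM2r => //.
    by have := mulr_gt0 i0 i0; lra.
  apply: le_trans (ler_normB _ _) _; apply: le_trans (lerD (bnd _) (bnd _)) _.
  have h1 : 1 <= rho^-1 * `|q' - q| by rewrite mulrC ler_pdivlMr// mul1r ltW.
  have -> : 2 * rho^-1 * (1 + rho^-1) * `|q' - q| = 2 * rho^-1 * `|q' - q| + 2 * rho^-1 * (rho^-1 * `|q' - q|) by ring.
  have h2 : 2 * rho^-1 * 1 <= 2 * rho^-1 * (rho^-1 * `|q' - q|) by apply: ler_wpM2l => //; rewrite mulr_ge0// ltW.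
  have h3 : 0 <= 2 * rho^-1 * `|q' - q| by apply: mulr_ge0 => //; rewrite mulr_ge0// ltW.
  by lra.
have cg : continuous gamma.
  by apply: (@lip_continuous _ _ _ gamma (2 * rho^-1 * (1 + rho^-1))) => y z; exact: lip.
exists gamma; split=> //.
- move=> q k; apply/eqP; rewrite -subr_eq0 -normr_eq0; apply/eqP/le_anti; rewrite normr_ge0 andbT.
  apply/ler_addgt0Pr => e e0; rewrite add0r.
  have e2 : 0 < e / 2 by rewrite divr_gt0.
  have [h [_ ph _ Hh]] := approx _ e2.
  have h1 := near _ _ _ _ (Hh _ _ (HF (q + intv R k))); have h2 := near _ _ _ _ (Hh _ _ (HF q)).
  rewrite ph in h1.
  have -> : gamma (q + intv R k) - gamma q = (gamma (q + intv R k) - h q) - (gamma q - h q) by rewrite subrBACA subrr subr0.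
  by apply: le_trans (ler_normB _ _) _; rewrite [leRHS](splitr e); exact: lerD.
- apply: lagrangian_limit => // del del0; have [h [ch _ lh Hh]] := approx del del0.
  by exists h; split=> // q; apply: near; exact: Hh.
- exists (2 * rho^-1 * (1 + rho^-1)).
    by rewrite !mulr_ge0 ?addr_ge0// invr_ge0 ltW.
  by move=> q v; have := lip q (q + v); rewrite [q + v - q]addrAC subrr add0r.
move=> q; have := germ_graph rho0 xr (HF q).
rewrite -epsE (real _ _ (HF q)) -/(gamma q) HnE => -[/complexify_inj h1 /complexify_inj h2].
by rewrite [LHS]surjective_pairing h1 h2.
Qed.

End Continuation.

(** * Symplectic twist maps *)

Section LocallyLipschitz.
Variable R : realType.

Definition loclip (V W : normedModType R) (f : V -> W) := forall M, exists L, forall z z',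
  `|z| <= M -> `|z'| <= M -> `|f z - f z'| <= L * `|z - z'|.

Lemma loclip_ge0 (V W : normedModType R) (f : V -> W) : loclip f ->
  forall M, exists2 L, 0 <= L & forall z z', `|z| <= M -> `|z'| <= M -> `|f z - f z'| <= L * `|z - z'|.
Proof.
move=> lf M; have [L H] := lf M; exists `|L| => // z z' h h'.
apply: le_trans (H z z' h h') _; apply: ler_wpM2r => //; exact: ler_norm.
Qed.

Lemma loclip_bounded (V W : normedModType R) (f : V -> W) : loclip f ->
  forall M, exists2 B, 0 <= B & forall z, `|z| <= M -> `|f z| <= B.
Proof.
move=> lf M; have [L L0 H] := loclip_ge0 lf `|M|.
exists (L * `|M| + `|f 0|) => [|z hz]; first by rewrite addr_ge0// mulr_ge0.
have -> : f z = (f z - f 0) + f 0 by rewrite subrK.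
have zM : `|z| <= `|M| by apply: le_trans hz _; exact: ler_norm.
apply: le_trans (ler_normD _ _) _; rewrite lerD2r; apply: le_trans (H z 0 zM _) _; first by rewrite normr0.
by rewrite subr0; apply: ler_wpM2l.
Qed.

Lemma loclip_comp (V W X : normedModType R) (f : V -> W) (g : W -> X) :
  loclip f -> loclip g -> loclip (g \o f).
Proof.
move=> lf lg M; have [B _ HB] := loclip_bounded lf M; have [L L0 H] := loclip_ge0 lf M.
have [L' L'0 H'] := loclip_ge0 lg B; exists (L' * L) => z z' h h' /=.
apply: le_trans (H' _ _ (HB _ h) (HB _ h')) _; rewrite -mulrA; apply: ler_wpM2l => //; exact: H.
Qed.

Lemma loclip_lin (V W : normedModType R) (f g : V -> W) (a : R) :
  loclip f -> loclip g -> loclip (fun z => f z + a *: g z).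
Proof.
move=> lf lg M; have [L L0 H] := loclip_ge0 lf M; have [L' L'0 H'] := loclip_ge0 lg M.
exists (L + `|a| * L') => z z' h h'.
have -> : f z + a *: g z - (f z' + a *: g z') = (f z - f z') + a *: (g z - g z').
  by rewrite opprD addrACA scalerBr.
apply: le_trans (ler_normD _ _) _; rewrite mulrDl; apply: lerD; first exact: H.
by rewrite normrZ -mulrA; apply: ler_wpM2l => //; exact: H'.
Qed.

Lemma loclip_pair (V W X : normedModType R) (f : V -> W) (g : V -> X) :
  loclip f -> loclip g -> loclip (fun z => (f z, g z) : W * X).
Proof.
move=> lf lg M; have [L L0 H] := loclip_ge0 lf M; have [L' L'0 H'] := loclip_ge0 lg M.
exists (L + L') => z z' h h'; rewrite prod_normE /= ge_max mulrDl; apply/andP; split.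
  by apply: le_trans (H _ _ h h') _; rewrite lerDl mulr_ge0.
by apply: le_trans (H' _ _ h h') _; rewrite lerDr mulr_ge0.
Qed.

Lemma loclip_short (V W : normedModType R) (f : V -> W) :
  (forall z z', `|f z - f z'| <= `|z - z'|) -> loclip f.
Proof. by move=> H M; exists 1 => z z' _ _; rewrite mul1r. Qed.

Lemma loclip_fst (V W : normedModType R) : loclip (@fst V W).
Proof. by apply: loclip_short => z z'; rewrite [leRHS]prod_normE /= le_max lexx. Qed.

Lemma loclip_snd (V W : normedModType R) : loclip (@snd V W).
Proof. by apply: loclip_short => z z'; rewrite [leRHS]prod_normE /= le_max lexx orbT. Qed.

Lemma loclip_cst (V W : normedModType R) (w : W) : loclip (fun _ : V => w).
Proof. by apply: loclip_short => z z'; rewrite subrr normr0. Qed.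

Lemma loclip_continuous (V W : normedModType R) (f : V -> W) : loclip f -> continuous f.
Proof.
move=> lf x; have [L L0 H] := loclip_ge0 lf (`|x| + 1).
apply/cvgrPdist_le => e e0; have L1 : 0 < L + 1 by rewrite ltr_wpDl.
near=> y.
have y1 : `|y| <= `|x| + 1.
  have -> : y = x + (y - x) by rewrite subrKC.
  apply: le_trans (ler_normD _ _) _; rewrite lerD2l distrC; near: y.
  exact: cvgr_dist_le.
apply: le_trans (H _ _ _ y1) _; first by rewrite lerDl.
apply: le_trans (_ : (L + 1) * `|x - y| <= _).
  by apply: ler_wpM2r => //; rewrite lerDl.
rewrite -ler_pdivlMl//; near: y; apply: cvgr_dist_le => //.
by rewrite mulr_gt0// invr_gt0.
Unshelve. all: by end_near. Qed.

Variable d : nat.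
Local Notation C := R[i].
Local Notation E := 'rV[R]_d.
Local Notation Ec := 'rV[C]_d.
Local Open Scope complex_scope.
Local Notation nc := (@ComplexField.Normc.normc R).
Local Notation cplx2 z := ((complexify z.1, complexify z.2) : Ec * Ec).

Lemma cplx2B (z z' : E * E) : cplx2 z - cplx2 z' = cplx2 (z - z').
Proof. by rewrite !complexifyB. Qed.

Lemma rnorm_cplx2 (z : E * E) : rnorm (cplx2 z) = `|z|.
Proof. by rewrite rnorm_pair /= !rnorm_complexify prod_normE. Qed.

Lemma entire_loclip (h : Ec * Ec -> Ec) : (forall z, differentiable h z) ->
  loclip (fun z : E * E => Rev (h (cplx2 z))).
Proof.
move=> dh M; pose hr (z : E * E) := Rev (h (cplx2 z)).
pose P (rho : R) (z : E * E) := forall z', `|z' - z| <= rho ->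
  `|hr z| <= rho^-1 /\ `|hr z' - hr z| <= rho^-1 * `|z' - z|.
pose K := [set v : E | `|v| <= M] `*` [set v : E | `|v| <= M].
have cK : compact K by apply: compact_setX; exact: segment_box_compact.
have N : \forall rho \near 0^'+, K `<=` P rho.
  apply: ((compact_near_coveringP _).1 cK) => z0 _.
  have [r r0 [B HB]] := entire_locally_bounded dh (cplx2 z0).
  have lipB := entire_lip dh (@coord_norming_mx R 1 d) r0 HB.
  have B0 : 0 <= B by apply: le_trans (HB (cplx2 z0) _); rewrite ?rnorm_ge0// subrr rnorm0 ltW.
  pose B1 := B + 4 * B / r + 1.
  have q0 : 0 <= 4 * B / r by rewrite divr_ge0 ?mulr_ge0// ltW.
  have B10 : 0 < B1 by rewrite ltr_wpDl// addr_ge0.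
  near=> z rho => z' hz'.
  have rho0 : 0 < rho by near: rho; exact: nbhs_right_gt.
  have rho1 : rho <= r / 4 by near: rho; apply: nbhs_right_le; rewrite divr_gt0.
  have rho2 : rho <= B1^-1 by near: rho; apply: nbhs_right_le; rewrite invr_gt0.
  have zz : `|z - z0| <= r / 4.
    by rewrite distrC; near: z; apply: cvgr_dist_le => //; rewrite divr_gt0.
  have B1r : B1 <= rho^-1 by rewrite -[B1]invrK lef_pV2 ?posrE// invr_gt0.
  have c1 : rnorm (cplx2 z - cplx2 z0) <= r / 2.
    by rewrite cplx2B rnorm_cplx2 (le_trans zz)// ler_pM2l// lef_pV2 ?posrE// ler_nat.
  have c2 : rnorm (cplx2 z' - cplx2 z0) <= r / 2.
    rewrite cplx2B rnorm_cplx2.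
    have -> : z' - z0 = (z' - z) + (z - z0) by rewrite addrA subrK.
    apply: le_trans (ler_normD _ _) _; apply: le_trans (lerD (le_trans hz' rho1) zz) _.
    by rewrite le_eqVlt; apply/orP; left; apply/eqP; field.
  split.
    apply: le_trans (norm_Rev _) _; apply: le_trans (HB _ _) _.
      by apply: le_trans c1 _; rewrite ler_pdivrMr// ler_pMr// ler1n.
    by apply: le_trans B1r; rewrite /B1; lra.
  rewrite /hr -RevB; apply: le_trans (norm_Rev _) _; apply: le_trans (lipB _ _ c2 c1) _.
  rewrite cplx2B rnorm_cplx2; apply: ler_wpM2r => //.
  by apply: le_trans B1r; rewrite /B1; lra.
have /filter_ex[rho [r0 HP]] : \forall rho \near (0 : R)^'+, 0 < rho /\ K `<=` P rho.
  by near=> rho; split; near: rho; [exact: nbhs_right_gt|exact: N].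
have i0 : 0 < rho^-1 by rewrite invr_gt0.
have inK z : `|z| <= M -> K z.
  by rewrite prod_normE /= ge_max => /andP[].
exists (rho^-1 + 2 * rho^-1 * rho^-1) => z z' zM z'M; rewrite -/(hr z) -/(hr z').
have [hz|hz] := leP `|z - z'| rho.
  have [_ h1] := HP z' (inK _ z'M) z hz; apply: le_trans h1 _.
  by rewrite mulrDl lerDl !mulr_ge0// ltW.
have r1 : `|z - z| <= rho by rewrite subrr normr0 ltW.
have r2 : `|z' - z'| <= rho by rewrite subrr normr0 ltW.
have [h1 _] := HP z (inK _ zM) z r1; have [h2 _] := HP z' (inK _ z'M) z' r2.
apply: le_trans (ler_normB _ _) _; apply: le_trans (lerD h1 h2) _.
apply: le_trans (_ : 2 * rho^-1 * (rho^-1 * `|z - z'|) <= _).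
  have h3 : 1 <= rho^-1 * `|z - z'| by rewrite ler_pdivlMl// mulr1 ltW.
  apply: le_trans (_ : 2 * rho^-1 * 1 <= _); first by lra.
  by apply: ler_wpM2l => //; rewrite mulr_ge0// ltW.
have -> : (rho^-1 + 2 * rho^-1 * rho^-1) * `|z - z'| =
    rho^-1 * `|z - z'| + 2 * rho^-1 * (rho^-1 * `|z - z'|) by ring.
by rewrite lerDr; apply: mulr_ge0 => //; exact: ltW.
Unshelve. all: by end_near. Qed.

End LocallyLipschitz.

Section DirectionalDerivatives.
Variable R : realType.

Lemma eps_is_derive (V : normedModType R) (f : V -> R) (x v : V) (df : R) :
  (forall k : R, 0 < k -> exists2 r : R, 0 < r &
    forall t, `|t| <= r -> `|f (x + t *: v) - f x - df * t| <= k * `|t|) ->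
  is_derive x v f df.
Proof.
move=> H.
have cv : (fun h : R => h^-1 *: (f (h *: v + x) - f x)) @ (0 : R)^' --> df.
  apply/cvgrPdist_le => k k0; have [r r0 Hr] := H k k0.
  have N : \forall h \near (0 : R)^', `|h| <= r /\ h != 0.
    near=> h; split; last by near: h; exact: nbhs_dnbhs_neq.
    near: h; apply: nbhs_dnbhs.
    by near=> h; rewrite ltW// -[h]subr0 -normrN opprB; near: h; exact: nbhs0_lt.
  near=> h; have [hr h0] : `|h| <= r /\ h != 0 by near: h; exact: N.
  have := Hr h hr; rewrite [x + _]addrC => h1.
  rewrite -(ler_pM2l (_ : 0 < `|h|)) ?normr_gt0// -normrM mulrBr [h^-1 *: _]/(h^-1 * _).
  by rewrite mulrA divff// mul1r distrC [h * df]mulrC [_ * k]mulrC.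
by split; [apply/cvg_ex; exists df|apply: cvg_lim].
Unshelve. all: by end_near. Qed.

Lemma line_is_derive (V : normedModType R) (f : V -> R) (z w : V) (t : R) :
  differentiable f (z + t *: w) ->
  is_derive t 1 (fun t => f (z + t *: w)) ('d f (z + t *: w) w).
Proof.
move=> df; apply: eps_is_derive1 => k k0.
pose B := `|w| + 1; have B0 : 0 < B by rewrite ltr_wpDl.
have kB : 0 < k / B by rewrite divr_gt0.
have [r r0 Hr] := diff_eps df kB.
exists (r / B) => [|t' ht]; first by rewrite divr_gt0.
have dz : z + t' *: w - (z + t *: w) = (t' - t) *: w.
  by rewrite opprD addrACA subrr add0r scalerBl.
have nz : `|z + t' *: w - (z + t *: w)| <= B * `|t' - t|.
  by rewrite dz normrZ mulrC; apply: ler_wpM2r => //; rewrite lerDl.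
have dE : 'd f (z + t *: w) (z + t' *: w - (z + t *: w)) = 'd f (z + t *: w) w * (t' - t).
  by rewrite dz linearZ; exact: mulrC.
have := Hr (z + t' *: w); rewrite dE => h.
apply: le_trans (h _) _; first apply: le_trans nz _.
  by rewrite -ler_pdivlMl// mulrC.
apply: le_trans (_ : k / B * (B * `|t' - t|) <= _).
  by apply: ler_wpM2l => //; exact: ltW.
by rewrite mulrA divfK// gt_eqF.
Qed.

Variable d : nat.
Local Notation C := R[i].
Local Notation E := 'rV[R]_d.
Local Notation Ec := 'rV[C]_d.
Local Open Scope complex_scope.
Local Notation nc := (@ComplexField.Normc.normc R).
Let Z2 : normedModType C := (Ec * Ec)%type.
Local Notation cplx2 z := ((complexify z.1, complexify z.2) : Z2).

Lemma real_is_derive (h : Z2 -> Ec) (z w : E * E) (j : 'I_d) : differentiable h (cplx2 z) ->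
  is_derive z w (fun z : E * E => Rev (h (cplx2 z)) 0 j) (Rev ('d h (cplx2 z) (cplx2 w)) 0 j).
Proof.
move=> dh; apply: eps_is_derive => k k0.
pose B := `|w| + 1; have B0 : 0 < B by rewrite ltr_wpDl.
have kB : 0 < k / B by rewrite divr_gt0.
have [r r0 Hr] := diff_reps dh kB.
exists (r / B) => [|t ht]; first by rewrite divr_gt0.
have dz : cplx2 (z + t *: w) - cplx2 z = t%:C *: cplx2 w.
  by rewrite cplx2B addrAC subrr add0r /= !complexifyZ.
have nz : rnorm (cplx2 (z + t *: w) - cplx2 z) <= B * `|t|.
  by rewrite cplx2B addrAC subrr add0r rnorm_cplx2 normrZ mulrC; apply: ler_wpM2r => //; rewrite lerDl.
have h1 := Hr _ (le_trans nz (_ : _ <= r)).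
have {}h1 : rnorm (h (cplx2 (z + t *: w)) - h (cplx2 z) - t%:C *: 'd h (cplx2 z) (cplx2 w)) <= k * `|t|.
  have -> : t%:C *: 'd h (cplx2 z) (cplx2 w) = 'd h (cplx2 z) (cplx2 (z + t *: w) - cplx2 z).
    by rewrite dz linearZ.
  apply: le_trans (h1 _) _; first by rewrite -ler_pdivlMl// mulrC.
  apply: le_trans (_ : k / B * (B * `|t|) <= _).
    by apply: ler_wpM2l => //; exact: ltW.
  by rewrite mulrA divfK// gt_eqF.
apply: le_trans h1; apply: le_trans (norm_Rev _).
apply: le_trans (mx_coord_le _ 0 j); rewrite le_eqVlt; apply/orP; left; apply/eqP; congr (`| _ |).
rewrite !mxE; case: (h _ 0 j) => a1 b1; case: (h _ 0 j) => a2 b2; case: ('d h _ _ 0 j) => a3 b3 /=; ring.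
Qed.

End DirectionalDerivatives.

Lemma continuous_add_scale (R : realType) (X : topologicalType) (W : normedModType R)
  (k : X -> R) (g h : X -> W) : continuous k -> continuous g -> continuous h ->
  continuous (fun x => h x + k x *: g x).
Proof. by move=> ck cg ch x; apply: cvgD; [exact: ch|apply: cvgZ; [exact: ck|exact: cg]]. Qed.

Section Lifts.
Variables (R : realType) (d : nat).
Local Notation E := 'rV[R]_d.

Lemma torus_piP (q q' : E) : torus_pi q = torus_pi q' <-> exists k : 'rV[int]_d, q' = q + intv R k.
Proof.
rewrite /torus_pi; split=> [/eqP|[k ->]].
  by rewrite eqmodE => /asboolP.
by apply/eqP; rewrite eqmodE; apply/asboolP; exists k.
Qed.

Lemma torus_reprK (x : torus R d) : torus_pi (torus_repr x) = x.
Proof. by rewrite /torus_pi /torus_repr reprK. Qed.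

Lemma integer_valued_const (f : R -> R) : continuous f ->
  (forall t, exists z : int, f t = z%:~R) -> f 1 = f 0.
Proof.
move=> cf fz; apply/eqP/negP => /negP f01.
have [w0 w0E] := fz 0; have [w1 w1E] := fz 1.
have neq : w1 != w0 by apply: contra f01 => /eqP e; rewrite w1E w0E e.
have iv v : Num.min (f 0) (f 1) <= v <= Num.max (f 0) (f 1) -> exists z : int, v = z%:~R.
  move=> hv; have [c _ <-] := IVT ler01 (continuous_subspaceT cf) hv; exact: fz.
have half (w : int) : ~ exists z : int, (w%:~R + 1/2 : R) = z%:~R.
  move=> [z hz]; have h2 : (2 * (z - w))%:~R = (1 : int)%:~R :> R.
    by rewrite intrM intrB -hz; field.
  have {}h2 : 2 * (z - w) = 1 by apply/eqP; rewrite -(eqr_int R) h2.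
  have : (2 %| (2 * (z - w)))%Z by apply: dvdz_mulr.
  by rewrite h2.
have [lt01|lt10|//] := ltgtP w0 w1; last by rewrite eq_sym in neq; move/eqP: neq.
- apply: (half w0); apply: iv; rewrite w0E w1E.
  have h : w0%:~R + 1 <= w1%:~R :> R by rewrite -[1]/(1%:~R) -intrD ler_int lezD1.
  by rewrite ge_min le_max; apply/andP; split; apply/orP; [left|right]; lra.
- apply: (half w1); apply: iv; rewrite w0E w1E.
  have h : w1%:~R + 1 <= w0%:~R :> R by rewrite -[1]/(1%:~R) -intrD ler_int lezD1.
  by rewrite ge_min le_max; apply/andP; split; apply/orP; [right|left]; lra.
Qed.

Lemma lattice_valued_const (X : normedModType R) (f : X -> E) : continuous f ->
  (forall x, exists k : 'rV[int]_d, f x = intv R k) -> exists k, forall x, f x = intv R k.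
Proof.
move=> cf fk; have [k0 k0E] := fk 0; exists k0 => x; rewrite -k0E.
apply/rowP => j; pose g (t : R) := f (t *: x) 0 j.
have -> : f x 0 j = g 1 by rewrite /g scale1r.
have -> : f 0 0 j = g 0 by rewrite /g scale0r.
apply: integer_valued_const => t; last by have [k kE] := fk (t *: x); exists (k 0 j); rewrite /g kE mxE.
apply: (@continuous_comp _ _ _ (fun t : R => f (t *: x)) (fun M : E => M 0 j)); last exact: coord_continuous.
apply: (@continuous_comp _ _ _ (fun t : R => t *: x) f); last exact: cf.
exact: scalel_continuous.
Qed.

Lemma lifts_differ (f : torus R d * E -> torus R d * E) (F F' : E * E -> E * E) :
  is_lift f F -> is_lift f F' -> exists k : 'rV[int]_d, forall x, F' x = ((F x).1 + intv R k, (F x).2).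
Proof.
move=> [cF hF] [cF' hF'].
have [|x|k Hk] := @lattice_valued_const (E * E)%type (fun x => (F' x).1 - (F x).1).
- move=> x; apply: cvgB.
    by apply: (@continuous_comp _ _ _ F' fst); [exact: cF'|exact: cvg_fst].
  by apply: (@continuous_comp _ _ _ F fst); [exact: cF|exact: cvg_fst].
- have : Defs.cover (F x) = Defs.cover (F' x) by rewrite hF hF'.
  by rewrite /Defs.cover => -[/torus_piP[k ->] _]; exists k; rewrite addrAC subrr add0r.
exists k => x; rewrite -(Hk x) subrKC [LHS]surjective_pairing; congr (_, _).
have : Defs.cover (F x) = Defs.cover (F' x) by rewrite hF hF'.
by rewrite /Defs.cover => -[_ ->].
Qed.

Lemma derive_shift (f : E -> R) (q k v : E) : (forall x, f (x + k) = f x) ->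
  'D_v f (q + k) = 'D_v f q.
Proof.
move=> pf; rewrite /derive.
have -> : (fun h : R => h^-1 *: ((f \o shift (q + k)) (h *: v) - f (q + k))) =
   (fun h : R => h^-1 *: ((f \o shift q) (h *: v) - f q)).
  by apply/funext => h /=; rewrite addrA !pf.
by [].
Qed.

Variable G : torus R d -> R.
Local Notation Gr := (G \o @torus_pi R d).

Lemma Gr_periodic q (k : 'rV[int]_d) : Gr (q + intv R k) = Gr q.
Proof. by rewrite /=; congr G; apply/esym/torus_piP; exists k. Qed.

Definition grad (q : E) : E := \row_i 'D_(evec R i) Gr q.

Lemma grad_periodic q (k : 'rV[int]_d) : grad (q + intv R k) = grad q.
Proof. by apply/rowP => j; rewrite !mxE derive_shift// => x; exact: Gr_periodic. Qed.

Lemma torus_gradE q : torus_grad G (torus_pi q) = grad q.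
Proof.
have /torus_piP[k e] : torus_pi (torus_repr (torus_pi q)) = torus_pi q by rewrite torus_reprK.
by rewrite [in RHS]e grad_periodic.
Qed.

Lemma perturbed_lift (f : torus R d * E -> torus R d * E) (F : E * E -> E * E) (F_ : R -> E * E -> E * E) :
  continuous grad -> is_lift f F -> continuous_family_of_lifts (perturbed f G) F_ ->
  exists k : 'rV[int]_d, forall eps q p, F_ eps (q, p) =
    ((F (q, p + eps *: grad q)).1 + intv R k, (F (q, p + eps *: grad q)).2).
Proof.
move=> cg [cF hF] [cF_ hF_].
pose s (x : R * (E * E)) : E * E := (x.2.1, x.2.2 + x.1 *: grad x.2.1).
have c21 : continuous (fun x : R * (E * E) => x.2.1).
  by move=> x; apply: (@continuous_comp _ _ _ (@snd R (E * E)%type) fst); [exact: cvg_snd|exact: cvg_fst].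
have c22 : continuous (fun x : R * (E * E) => x.2.2).
  by move=> x; apply: (@continuous_comp _ _ _ (@snd R (E * E)%type) snd); exact: cvg_snd.
have cgr : continuous (fun x : R * (E * E) => grad x.2.1).
  by move=> x; apply: (@continuous_comp _ _ _ (fun x : R * (E * E) => x.2.1) grad); [exact: c21|exact: cg].
have csum : continuous (fun x : R * (E * E) => x.2.2 + x.1 *: grad x.2.1).
  by apply: (@continuous_add_scale R (R * (E * E))%type E) => // x; exact: cvg_fst.
have cs : continuous s.
  by move=> x; apply: (@cvg_pair_for _ _ _ (fun x : R * (E * E) => x.2.1) _ x); [exact: c21|exact: csum].
have hc x : Defs.cover (F_ x.1 x.2) = Defs.cover (F (s x)).
  have [_ ->] := hF_ x.1; rewrite hF /perturbed /s /Defs.cover /=; congr f.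
  by rewrite torus_gradE.
have [|x|k Hk] := @lattice_valued_const (R * (E * E))%type (fun x => (F_ x.1 x.2).1 - (F (s x)).1).
- move=> x; apply: cvgB.
    by apply: (@continuous_comp _ _ _ (fun x : R * (E * E) => F_ x.1 x.2) fst); [exact: cF_|exact: cvg_fst].
  apply: (@continuous_comp _ _ _ (fun x => F (s x)) fst); last exact: cvg_fst.
  by apply: (@continuous_comp _ _ _ s F); [exact: cs|exact: cF].
- have := esym (hc x); rewrite /Defs.cover => -[/torus_piP[k ->] _].
  by exists k; rewrite addrAC subrr add0r.
exists k => eps q p; have := Hk (eps, (q, p)); rewrite /s /= => <-.
rewrite subrKC [LHS]surjective_pairing; congr (_, _).
by have := hc (eps, (q, p)); rewrite /Defs.cover /s /= => -[_ ->].
Qed.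

End Lifts.

Lemma is_derive_add_quadratic (R : realType) (f : R -> R) (D a b s : R) : is_derive s 1 f D ->
  is_derive s 1 (fun s => f s + a * s - b * (s * s)) (D + a - 2 * b * s).
Proof.
move=> Df.
have -> : (fun s => f s + a * s - b * (s * s)) =
  f + a *: (id : R -> R) - b *: ((id : R -> R) * (id : R -> R)) by apply/funext.
have d1 := is_derive_id s (1 : R).
apply: (is_derive_eq (is_deriveB (is_deriveD Df (is_deriveZ a d1)) (is_deriveZ b (is_deriveM d1 d1)))).
by rewrite /GRing.scale /=; ring.
Qed.

Section SecondDerivatives.
Variables (R : realType) (d : nat).
Local Notation C := R[i].
Local Notation E := 'rV[R]_d.
Local Notation Ec := 'rV[C]_d.
Local Open Scope complex_scope.
Let Z2 : normedModType C := (Ec * Ec)%type.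
Let E2 : normedModType R := (E * E)%type.
Local Notation cplx2 z := ((complexify z.1, complexify z.2) : Z2).

Lemma is_derive_line (V : normedModType R) (f : V -> R) (z w : V) (t D : R) :
  is_derive (z + t *: w) w f D -> is_derive t 1 (fun t => f (z + t *: w)) D.
Proof.
move=> [h1 h2].
have e : (fun h : R => h^-1 *: (((fun t => f (z + t *: w)) \o shift t) (h *: (1 : R)) - f (z + t *: w))) =
    (fun h : R => h^-1 *: ((f \o shift (z + t *: w)) (h *: w) - f (z + t *: w))).
  apply/funext => h /=; congr (_ *: (f _ - _)).
  by rewrite [h *: 1]mulr1 scalerDl addrCA.
by split; [rewrite /derivable e; exact: h1|rewrite /derive e; exact: h2].
Qed.

Variables (hC : Z2 -> Ec) (io : E -> E2).
Hypothesis dhC : forall z, differentiable hC z.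
Hypothesis io_lin : linear io.

Lemma hess_line (z : E2) (v : E) (t : R) :
  is_derive t 1 (fun t => dotp (Rev (hC (cplx2 (z + t *: io v)))) v)
    (dotp (v *m \matrix_(i, j) 'D_(io (evec R i)) (fun z : E2 => Rev (hC (cplx2 z)) 0 j) (z + t *: io v)) v).
Proof.
set y := z + t *: io v.
pose L (u : E) : E := Rev ('d hC (cplx2 y) (cplx2 (io u))).
have Llin (a : R) u w : L (a *: u + w) = a *: L u + L w.
  rewrite /L io_lin /=.
  have -> : (complexify (a *: (io u).1 + (io w).1), complexify (a *: (io u).2 + (io w).2)) =
     a%:C *: cplx2 (io u) + cplx2 (io w) :> Z2.
    by congr (_, _) => /=; rewrite complexifyD complexifyZ.
  rewrite linearP; apply/rowP => j; rewrite !mxE.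
  by case: ('d hC _ _ 0 j) => a1 b1; case: ('d hC _ _ 0 j) => a2 b2 /=; ring.
have L0 : L 0 = 0 by have := Llin (-1) 0 0; rewrite scaler0 addr0 scaleN1r addNr.
have LD u w : L (u + w) = L u + L w by have := Llin 1 u w; rewrite !scale1r.
have LZ a u : L (a *: u) = a *: L u by have := Llin a u 0; rewrite L0 !addr0.
have vE : v = \sum_(i < d) v 0 i *: evec R i by rewrite {1}(row_sum_delta v).
have hE : v *m (\matrix_(i, j) 'D_(io (evec R i)) (fun z : E2 => Rev (hC (cplx2 z)) 0 j) y) = L v.
  rewrite [in RHS]vE (big_morph L LD L0); apply/rowP => j; rewrite mxE summxE.
  apply: eq_bigr => i _; rewrite LZ !mxE; congr (_ * _).
  have := @real_is_derive R d hC y (io (evec R i)) j (dhC _); case=> _ ->.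
  by rewrite mxE.
rewrite hE.
have D j : is_derive t (1 : R) (fun t => Rev (hC (cplx2 (z + t *: io v))) 0 j) (L v 0 j).
  apply: (@is_derive_line E2 (fun z : E2 => Rev (hC (cplx2 z)) 0 j)).
  exact: (@real_is_derive R d hC y (io v) j (dhC _)).
have -> : (fun t => dotp (Rev (hC (cplx2 (z + t *: io v)))) v) =
   \sum_(j < d) ((v 0 j) *: (fun t => Rev (hC (cplx2 (z + t *: io v))) 0 j)).
  apply/funext => s; rewrite fct_sumE; apply: eq_bigr => j _; rewrite mulrC //.
have -> : dotp (L v) v = \sum_(j < d) (v 0 j) *: L v 0 j.
  by apply: eq_bigr => j _; rewrite mulrC.
by apply: is_derive_sum.
Qed.

End SecondDerivatives.

Section ScalarMultiple.
Local Notation nc := (@ComplexField.Normc.normc _).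

Lemma differentiable_scale (R : realType) (V W : normedModType R[i]) (s : V -> (R[i])^o) (v : V -> W) z :
  differentiable s z -> differentiable v z -> differentiable (fun x => s x *: v x) z.
Proof.
move=> ds dv; have [Ks Ks0 HKs] := diff_rbounded ds; have [Kv Kv0 HKv] := diff_rbounded dv.
pose B := nc (s z) + rnorm (v z) + Ks + 2.
have B0 : 0 < B by rewrite ltr_wpDl// !addr_ge0 ?normc_ge0 ?rnorm_ge0// ltW.
apply: (reps_differentiable (L := fun h => s z *: 'd v z h + 'd s z h *: v z) _ _ _).1.
- move=> a x y; have -> : 'd v z (a *: x + y) = a *: 'd v z x + 'd v z y by rewrite linearP.
  have -> : 'd s z (a *: x + y) = a * 'd s z x + 'd s z y by rewrite linearP.
  by rewrite !scalerDr scalerDl !scalerA [s z * a]mulrC addrACA.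
- exists (nc (s z) * Kv + Ks * rnorm (v z)) => h.
  apply: le_trans (ler_rnormD _ _) _; rewrite !rnormZ mulrDl; apply: lerD.
    by rewrite -mulrA; apply: ler_wpM2l; [exact: normc_ge0|exact: HKv].
  rewrite mulrAC; apply: ler_wpM2r; first exact: rnorm_ge0.
  by rewrite -rnorm_complex; exact: HKs.
move=> k k0; have k1 : 0 < Num.min 1 (k / (3 * B)) by rewrite lt_min ltr01 divr_gt0// mulr_gt0.
have [r1 r10 H1] := diff_reps ds k1; have [r2 r20 H2] := diff_reps dv k1.
pose r := Num.min (Num.min r1 r2) (Num.min B^-1 (k / (3 * (B * Kv)))).
exists r; first by rewrite !lt_min r10 r20 invr_gt0 B0 divr_gt0// mulr_gt0// mulr_gt0.
move=> x; rewrite !le_min => /andP[/andP[h1 h2] /andP[h3 h4]].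
have {}H1 := H1 x h1; have {}H2 := H2 x h2; set h := x - z in h1 h2 h3 h4 H1 H2 *.
have hn0 := rnorm_ge0 h.
have min1 : Num.min 1 (k / (3 * B)) <= 1 by rewrite ge_min lexx.
have mink : Num.min 1 (k / (3 * B)) <= k / (3 * B) by rewrite ge_min lexx orbT.
rewrite rnorm_complex in H1.
have sx : nc (s x - s z) <= (Ks + 1) * rnorm h.
  have -> : s x - s z = (s x - s z - 'd s z h) + 'd s z h by rewrite subrK.
  apply: le_trans (ler_normcD _ _) _; rewrite mulrDl mul1r addrC; apply: lerD.
    by rewrite -rnorm_complex; exact: HKs.
  by apply: le_trans H1 _; rewrite ler_piMl.
have sz : nc (s x) <= B.
  have -> : s x = (s x - s z) + s z by rewrite subrK.
  apply: le_trans (ler_normcD _ _) _; apply: le_trans (lerD sx (lexx _)) _.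
  have : (Ks + 1) * rnorm h <= 1.
    apply: le_trans (_ : B * B^-1 <= 1); last by rewrite divff// gt_eqF.
    apply: ler_pM => //; first by rewrite addr_ge0// ltW.
    by rewrite /B; have := normc_ge0 (s z); have := rnorm_ge0 (v z); lra.
  by rewrite /B; have := rnorm_ge0 (v z); have := ltW Ks0; lra.
have -> : s x *: v x - s z *: v z - (s z *: 'd v z h + 'd s z h *: v z) =
   s x *: (v x - v z - 'd v z h) + (s x - s z) *: 'd v z h + (s x - s z - 'd s z h) *: v z.
  rewrite !scalerBr !scalerBl.
  move: (s x *: v x) (s z *: v z) (s z *: 'd v z h) ('d s z h *: v z) (s x *: v z) (s x *: 'd v z h) => a b c e f1 f2.
  have -> : a - f1 - f2 + (f2 - c) = a - c - f1 by rewrite addrA subrK addrAC.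
  have -> : a - c - f1 + (f1 - b - e) = a - c - b - e by rewrite !addrA subrK.
  by rewrite opprD addrA [a - b - c]addrAC.
apply: le_trans (ler_rnormD _ _) _; apply: le_trans (lerD (ler_rnormD _ _) (lexx _)) _.
rewrite !rnormZ.
have t1 : nc (s x) * rnorm (v x - v z - 'd v z h) <= k / 3 * rnorm h.
  apply: le_trans (_ : B * (k / (3 * B) * rnorm h) <= _).
    apply: ler_pM => //; [exact: normc_ge0|exact: rnorm_ge0|].
    by apply: le_trans H2 _; apply: ler_wpM2r.
  by rewrite le_eqVlt; apply/orP; left; apply/eqP; field; rewrite gt_eqF.
have t2 : nc (s x - s z) * rnorm ('d v z h) <= k / 3 * rnorm h.
  apply: le_trans (_ : (B * (k / (3 * (B * Kv)))) * (Kv * rnorm h) <= _).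
    apply: ler_pM; [exact: normc_ge0|exact: rnorm_ge0| |exact: HKv].
    apply: le_trans sx _; apply: ler_pM => //; first by rewrite addr_ge0// ltW.
    by rewrite /B; have := normc_ge0 (s z); have := rnorm_ge0 (v z); lra.
  by rewrite le_eqVlt; apply/orP; left; apply/eqP; field; rewrite !gt_eqF.
have t3 : nc (s x - s z - 'd s z h) * rnorm (v z) <= k / 3 * rnorm h.
  apply: le_trans (_ : (k / (3 * B) * rnorm h) * B <= _).
    apply: ler_pM; [exact: normc_ge0|exact: rnorm_ge0| |].
      by apply: le_trans H1 _; apply: ler_wpM2r.
    by rewrite /B; have := normc_ge0 (s z); have := ltW Ks0; lra.
  by rewrite le_eqVlt; apply/orP; left; apply/eqP; field; rewrite gt_eqF.
move: t1 t2 t3; lra.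
Qed.

End ScalarMultiple.

Lemma inverse_diff (R : realType) (X Y : normedModType R) (tw gr : X -> X) (S : X -> R)
  (p1 p2 : {linear X -> Y}) (z w : X) : cancel gr tw -> (forall x, p1 (tw x) = p1 x) ->
  continuous p1 -> continuous p2 -> differentiable tw (gr z) -> differentiable gr z ->
  differentiable S (tw (gr z)) ->
  [/\ 'd (fun y => S (tw y)) (gr z) ('d gr z w) = 'd S z w,
      'd (fun y => p2 (tw y)) (gr z) ('d gr z w) = p2 w
    & p1 ('d gr z w) = p1 w].
Proof.
move=> grK p1tw c1 c2 dtw dgr dS.
have tg : tw \o gr = idfun by apply/funext => x; exact: grK.
have e : 'd tw (gr z) ('d gr z w) = w.
  have := @diff_comp _ _ _ _ gr tw z dgr dtw; rewrite tg => /(congr1 (fun f => f w)) /= <-.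
  by rewrite (@diff_lin _ X X idfun)// => x; exact: cvg_id.
have d1 x : differentiable p1 x by exact: linear_differentiable.
have d2 x : differentiable p2 x by exact: linear_differentiable.
split.
- have := @diff_comp _ _ _ _ tw S (gr z) dtw dS.
  by move=> /(congr1 (fun f => f ('d gr z w))) /= ->; rewrite e grK.
- have := @diff_comp _ _ _ _ tw p2 (gr z) dtw (d2 _).
  by move=> /(congr1 (fun f => f ('d gr z w))) /= ->; rewrite e diff_lin.
- rewrite -[in RHS]e; have := @diff_comp _ _ _ _ tw p1 (gr z) dtw (d1 _).
  have -> : p1 \o tw = p1 by apply/funext => x; exact: p1tw.
  by move=> /(congr1 (fun f => f ('d gr z w))) /=; rewrite !diff_lin.
Qed.

Section TwistMap.
Variables (R : realType) (d : nat).
Local Notation C := R[i].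
Local Notation E := 'rV[R]_d.
Local Notation Ec := 'rV[C]_d.
Local Open Scope complex_scope.
Let Z2 : normedModType C := (Ec * Ec)%type.
Let E2 : normedModType R := (E * E)%type.
Local Notation cplx2 z := ((complexify z.1, complexify z.2) : Z2).
Variables (F : E2 -> E2) (S : E2 -> R) (FC FCi gC : Z2 -> Z2) (gr : E2 -> E2).
Hypothesis F_per : forall (k : 'rV[int]_d) q p,
  F (q + intv R k, p) = ((F (q, p)).1 + intv R k, (F (q, p)).2).
Hypothesis dF : forall x, differentiable (twist_coord F) x.
Hypothesis dgr : forall x, differentiable gr x.
Hypothesis grK : cancel gr (twist_coord F).
Hypothesis twK : cancel (twist_coord F) gr.
Hypothesis S_gen : generating_function F S.
Hypothesis dFC : forall z, differentiable FC z.
Hypothesis dFCi : forall z, differentiable FCi z.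
Hypothesis FCK : cancel FC FCi.
Hypothesis dgC : forall z, differentiable gC z.
Hypothesis gCK : cancel (twist_coord FC) gC.
Hypothesis FCE : forall z : E2, FC (cplx2 z) = cplx2 (F z).

Definition a0 (z : E2) : E := - (gr z).2.
Definition b0 (z : E2) : E := (F (gr z)).2.

Lemma gr1 z : (gr z).1 = z.1.
Proof. by have := grK z; rewrite /twist_coord => /(congr1 fst). Qed.

Lemma F_gr1 z : (F (gr z)).1 = z.2.
Proof. by have := grK z; rewrite /twist_coord => /(congr1 snd). Qed.

Lemma gCE z : gC (cplx2 z) = cplx2 (gr z).
Proof.
have <- : twist_coord FC (cplx2 (gr z)) = cplx2 z.
  by rewrite /twist_coord /= [FC _]FCE /= F_gr1 gr1.
exact: gCK.
Qed.

Definition aC (z : Z2) : Ec := - (gC z).2.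
Definition bC (z : Z2) : Ec := (FC (gC z)).2.

Lemma daC z : differentiable aC z.
Proof.
have d2 : differentiable (fun z => (gC z).2 : Ec) z.
  exact: (@differentiable_comp _ Z2 Z2 Ec gC (@snd Ec Ec) z (dgC z) (differentiable_snd _)).
exact: (@differentiableN _ Z2 Ec _ z d2).
Qed.

Lemma dbC z : differentiable bC z.
Proof.
have d1 : differentiable (fun z => FC (gC z)) z.
  exact: (@differentiable_comp _ Z2 Z2 Z2 gC FC z (dgC z) (dFC _)).
exact: (@differentiable_comp _ Z2 Z2 Ec _ (@snd Ec Ec) z d1 (differentiable_snd _)).
Qed.

Lemma a0E z : a0 z = Rev (aC (cplx2 z)).
Proof.
rewrite /aC gCE /= /a0; apply/rowP => j; rewrite !mxE /=.
by rewrite -mulrN1.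
Qed.

Lemma b0E z : b0 z = Rev (bC (cplx2 z)).
Proof. by rewrite /bC gCE FCE /= Rev_complexify. Qed.

Lemma loclip_a0 : loclip a0.
Proof. by have -> : a0 = (fun z => Rev (aC (cplx2 z))); [apply/funext => z; exact: a0E|exact: entire_loclip daC]. Qed.

Lemma loclip_b0 : loclip b0.
Proof. by have -> : b0 = (fun z => Rev (bC (cplx2 z))); [apply/funext => z; exact: b0E|exact: entire_loclip dbC]. Qed.

Lemma dS z : differentiable S z.
Proof. by case: S_gen. Qed.

Lemma dSE z w : 'd S z w = dotp (a0 z) w.1 + dotp (b0 z) w.2.
Proof.
have [_ _ gen] := S_gen.
have c1 : continuous (@fst E E) by move=> x; exact: cvg_fst.
have c2 : continuous (@snd E E) by move=> x; exact: cvg_snd.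
have dSz : differentiable S (twist_coord F (gr z)) by rewrite grK; exact: dS.
have [h1 h2 h3] := @inverse_diff R E2 E (twist_coord F) gr S (@fst E E) (@snd E E) z w grK
  (fun=> erefl) c1 c2 (dF _) (dgr z) dSz.
have g := gen (gr z) ('d gr z w).
have {g}g := etrans (esym h1) g.
rewrite g /a0 /b0 dotpNl [RHS]addrC h3; congr (dotp _ _ + _); exact: h2.
Qed.

Lemma gr_periodic (k : 'rV[int]_d) q Q :
  gr (q + intv R k, Q + intv R k) = ((gr (q, Q)).1 + intv R k, (gr (q, Q)).2).
Proof.
rewrite -[RHS]twK; congr gr; rewrite /twist_coord /= F_per /= -surjective_pairing.
by rewrite F_gr1 gr1.
Qed.

Lemma a0_periodic (k : 'rV[int]_d) q Q : a0 (q + intv R k, Q + intv R k) = a0 (q, Q).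
Proof. by rewrite /a0 gr_periodic. Qed.

Lemma b0_periodic (k : 'rV[int]_d) q Q : b0 (q + intv R k, Q + intv R k) = b0 (q, Q).
Proof. by rewrite /b0 gr_periodic F_per /= -surjective_pairing. Qed.

Lemma periodic_est (c : E2 -> E) (D : R) : 0 <= D -> loclip c ->
  (forall (k : 'rV[int]_d) q Q, c (q + intv R k, Q + intv R k) = c (q, Q)) ->
  exists2 K, 0 <= K & forall q Q, `|Q - q| <= D -> `|c (q, Q)| <= K /\
    forall u v, `|u| <= 1 -> `|v| <= 1 -> `|c (q + u, Q + v) - c (q, Q)| <= K * (`|u| + `|v|).
Proof.
move=> D0 lc pc.
have [B B0 HB] := loclip_bounded lc (D + 2); have [L L0 HL] := loclip_ge0 lc (D + 2).
exists (B + L) => [|q Q hQ]; first exact: addr_ge0.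
have [k hk] := floor_reduction q.
set q' := q + intv R k in hk; set Q' := Q + intv R k.
have hQ' : `|Q'| <= D + 1.
  have -> : Q' = (Q - q) + q' by rewrite /Q' /q' addrA subrK.
  by apply: le_trans (ler_normD _ _) _; exact: lerD.
have z1 : `|((q', Q') : E2)| <= D + 2 by rewrite norm_pairE /= ge_max; apply/andP; split; lra.
split; first by rewrite -(pc k); apply: le_trans (HB _ z1) _; rewrite lerDl.
move=> u v u1 v1; rewrite -(pc k q) -(pc k (q + u)) -/q' -/Q'.
rewrite [q + u + _]addrAC [Q + v + _]addrAC -/q' -/Q'.
have z2 : `|((q' + u, Q' + v) : E2)| <= D + 2.
  rewrite norm_pairE /= ge_max; apply/andP; split.
    by apply: le_trans (ler_normD _ _) _; lra.
  by apply: le_trans (ler_normD _ _) _; lra.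
apply: le_trans (HL _ _ z2 z1) _.
apply: ler_pM => //; first by rewrite lerDr.
rewrite norm_pairE /= ge_max [q' + u]addrC addrK [Q' + v]addrC addrK.
by rewrite lerDl lerDr !normr_ge0.
Qed.

Lemma ab_est (D : R) : 0 <= D -> exists2 K, 0 <= K & forall q Q, `|Q - q| <= D ->
  [/\ `|a0 (q, Q)| <= K, `|b0 (q, Q)| <= K & forall u v, `|u| <= 1 -> `|v| <= 1 ->
    `|a0 (q + u, Q + v) - a0 (q, Q)| <= K * (`|u| + `|v|) /\
    `|b0 (q + u, Q + v) - b0 (q, Q)| <= K * (`|u| + `|v|)].
Proof.
move=> D0; have [K K0 H] := periodic_est D0 loclip_a0 a0_periodic.
have [K' K'0 H'] := periodic_est D0 loclip_b0 b0_periodic.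
exists (K + K') => [|q Q hQ]; first exact: addr_ge0.
have [h1 h2] := H q Q hQ; have [h1' h2'] := H' q Q hQ; split.
- by apply: le_trans h1 _; rewrite lerDl.
- by apply: le_trans h1' _; rewrite lerDr.
move=> u v u1 v1; have uv0 : 0 <= `|u| + `|v| by rewrite addr_ge0.
split; rewrite mulrDl.
  by apply: le_trans (h2 u v u1 v1) _; rewrite lerDl mulr_ge0.
by apply: le_trans (h2' u v u1 v1) _; rewrite lerDr mulr_ge0.
Qed.

Lemma S_line (z w : E2) (t : R) : is_derive t 1 (fun t => S (z + t *: w))
  (dotp (a0 (z + t *: w)) w.1 + dotp (b0 (z + t *: w)) w.2).
Proof. by rewrite -dSE; apply: line_is_derive; exact: dS. Qed.

Lemma S_quad (D : R) : 0 <= D -> exists2 K, 0 <= K & forall q Q u v, `|Q - q| <= D ->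
  `|u| <= 1 -> `|v| <= 1 ->
  `|S (q + u, Q + v) - S (q, Q) - dotp (a0 (q, Q)) u - dotp (b0 (q, Q)) v| <= K * (`|u| + `|v|) ^+ 2.
Proof.
move=> D0; have [K K0 H] := ab_est D0; exists (d%:R * K) => [|q Q u v hQ u1 v1]; first exact: mulr_ge0.
have [_ _ HL] := H q Q hQ.
pose z : E2 := (q, Q); pose w : E2 := (u, v).
have [t /andP[t0 t1]] := mvt_segment ler01 (fun t _ => S_line z w t).
rewrite scale1r scale0r addr0 subr0 mulr1 => e.
have -> : S (q + u, Q + v) - S (q, Q) = S (z + w) - S z by [].
rewrite e.
have su : `|t *: u| <= `|u| by rewrite normrZ ger0_norm// ler_piMl.
have sv : `|t *: v| <= `|v| by rewrite normrZ ger0_norm// ler_piMl.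
have [l1 l2] := HL _ _ (le_trans su u1) (le_trans sv v1).
have -> : z + t *: w = (q + t *: u, Q + t *: v) by [].
set a1 := a0 (q + _, _) in l1 *; set b1 := b0 (q + _, _) in l2 *.
have -> : dotp a1 w.1 + dotp b1 w.2 - dotp (a0 (q, Q)) u - dotp (b0 (q, Q)) v =
   dotp (a1 - a0 (q, Q)) u + dotp (b1 - b0 (q, Q)) v by rewrite !dotpBl /=; ring.
have uv : `|t *: u| + `|t *: v| <= `|u| + `|v| by exact: lerD.
apply: le_trans (ler_normD _ _) _.
have -> : d%:R * K * (`|u| + `|v|) ^+ 2 = d%:R * (K * (`|u| + `|v|)) * `|u| + d%:R * (K * (`|u| + `|v|)) * `|v| by ring.
apply: lerD; apply: le_trans (norm_dotp _ _) _; apply: ler_wpM2r => //; apply: ler_wpM2l => //.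
  by apply: le_trans l1 _; apply: ler_wpM2l.
by apply: le_trans l2 _; apply: ler_wpM2l.
Qed.

Lemma derive_q_S (j : 'I_d) : 'D_((evec R j, 0) : E2) S = (fun z : E2 => Rev (aC (cplx2 z)) 0 j).
Proof.
by apply/funext => z; rewrite deriveE ?dSE /= ?dotp0r ?addr0 ?dotp_evec -?a0E//; exact: dS.
Qed.

Lemma derive_Q_S (j : 'I_d) : 'D_((0, evec R j) : E2) S = (fun z : E2 => Rev (bC (cplx2 z)) 0 j).
Proof.
by apply/funext => z; rewrite deriveE ?dSE /= ?dotp0r ?add0r ?dotp_evec -?b0E//; exact: dS.
Qed.

Lemma hess_qQE z : hess_qQ S z = \matrix_(i, j) 'D_((evec R i, 0) : E2) (fun z : E2 => Rev (bC (cplx2 z)) 0 j) z.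
Proof. by apply/matrixP => i j; rewrite [LHS]mxE [RHS]mxE derive_Q_S. Qed.

Lemma hess_qqE z : hess_qq S z = \matrix_(i, j) 'D_((evec R i, 0) : E2) (fun z : E2 => Rev (aC (cplx2 z)) 0 j) z.
Proof. by apply/matrixP => i j; rewrite [LHS]mxE [RHS]mxE derive_q_S. Qed.

Lemma hess_QQE z : hess_QQ S z = \matrix_(i, j) 'D_((0, evec R i) : E2) (fun z : E2 => Rev (bC (cplx2 z)) 0 j) z.
Proof. by apply/matrixP => i j; rewrite [LHS]mxE [RHS]mxE derive_Q_S. Qed.

Lemma linear_left : linear (fun u : E => (u, 0) : E2).
Proof. by move=> a u v; congr (_, _) => /=; rewrite scaler0 addr0. Qed.

Lemma linear_right : linear (fun u : E => (0, u) : E2).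
Proof. by move=> a u v; congr (_, _) => /=; rewrite scaler0 addr0. Qed.

Lemma b0_line_q q Q v (t : R) : is_derive t 1 (fun t => dotp (b0 (q + t *: v, Q)) v)
  (dotp (v *m hess_qQ S (q + t *: v, Q)) v).
Proof.
have zE s : ((q, Q) : E2) + s *: ((v, 0) : E2) = (q + s *: v, Q) by congr (_, _) => /=; rewrite scaler0 addr0.
have := hess_line dbC linear_left (q, Q) v t; rewrite zE -hess_qQE.
by congr (is_derive _ _ _ _); apply/funext => s; rewrite zE -b0E.
Qed.

Lemma a0_line_q q Q v (t : R) : is_derive t 1 (fun t => dotp (a0 (q + t *: v, Q)) v)
  (dotp (v *m hess_qq S (q + t *: v, Q)) v).
Proof.
have zE s : ((q, Q) : E2) + s *: ((v, 0) : E2) = (q + s *: v, Q) by congr (_, _) => /=; rewrite scaler0 addr0.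
have := hess_line daC linear_left (q, Q) v t; rewrite zE -hess_qqE.
by congr (is_derive _ _ _ _); apply/funext => s; rewrite zE -a0E.
Qed.

Lemma b0_line_Q q Q v (t : R) : is_derive t 1 (fun t => dotp (b0 (q, Q + t *: v)) v)
  (dotp (v *m hess_QQ S (q, Q + t *: v)) v).
Proof.
have zE s : ((q, Q) : E2) + s *: ((0, v) : E2) = (q, Q + s *: v) by congr (_, _) => /=; rewrite scaler0 addr0.
have := hess_line dbC linear_right (q, Q) v t; rewrite zE -hess_QQE.
by congr (is_derive _ _ _ _); apply/funext => s; rewrite zE -b0E.
Qed.

Hypothesis sp : strongly_positive S.

Lemma S_coercive : exists2 c0, 0 < c0 & exists C0, forall q Q, c0 * `|Q - q| ^+ 2 - C0 <= S (q, Q).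
Proof.
have [al [be [al0 _ Hsp]]] := sp.
have [K K0 H] := ab_est (lexx 0).
pose M := d%:R * K; have M0 : 0 <= M by rewrite mulr_ge0.
have [B HB] : exists B, forall q, - S (q, q) <= B.
  apply: (@periodic_bounded _ _ (fun q => - S (q, q))) => [q|q k]; last by case: S_gen => ->.
  have cS : {for q, continuous (fun q : E => S (q, q))}.
    apply: (@continuous_comp E (E * E)%type R (fun q => (q, q)) S q); last exact: differentiable_continuous (dS _).
    by apply: (@cvg_pair_for E E E id id q); exact: cvg_id.
  apply: (@continuous_comp E R R (fun q => S (q, q)) (fun x => - x) q cS).
  by apply: (@lip_continuous R R R -%R 1) => x y; rewrite mul1r -opprD normrN.
exists (al / 4); first by rewrite divr_gt0.
exists (M ^+ 2 / al + B) => q Q; set v := Q - q.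
have vv := dotp_sqr_ge v.
have slope (s : R) : 0 <= s <= 1 -> - (M * `|v|) + al * s * `|v| ^+ 2 <= dotp (b0 (q, q + s *: v)) v.
  move=> /andP[s0 s1].
  have [t t01] := mvt_segment s0 (fun t _ => b0_line_q q (q + s *: v) v t).
  rewrite scale0r addr0 subr0 => e.
  have /andP[_ h1] := Hsp (q + t *: v) (q + s *: v) v.
  have [_ h2 _] := H (q + s *: v) (q + s *: v) ltac:(by rewrite subrr normr0).
  have h3 : - (M * `|v|) <= dotp (b0 (q + s *: v, q + s *: v)) v.
    rewrite lerNl; apply: le_trans (ler_norm _) _; rewrite normrN.
    by apply: le_trans (norm_dotp _ _) _; apply: ler_wpM2r => //; apply: ler_wpM2l.
  have h4 : dotp (v *m hess_qQ S (q + t *: v, q + s *: v)) v * s <= - al * dotp v v * s.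
    by apply: ler_wpM2r.
  have h5 : al * s * `|v| ^+ 2 <= al * s * dotp v v.
    by apply: ler_wpM2l => //; rewrite mulr_ge0// ltW.
  have e2 : - al * dotp v v * s = - (al * s * dotp v v) by ring.
  by lra.
pose phi (s : R) := S ((q, q) + s *: ((0, v) : E2)).
have dphi (s : R) : is_derive s 1 phi (dotp (b0 (q, q + s *: v)) v).
  have := S_line (q, q) (0, v) s; rewrite /= dotp0r add0r.
  by rewrite (_ : ((q, q) : E2) + s *: ((0, v) : E2) = (q, q + s *: v)) //; congr (_, _) => /=; rewrite scaler0 addr0.
pose chi (s : R) := phi s + (M * `|v|) * s - (al / 2 * `|v| ^+ 2) * (s * s).
have dchi (s : R) : is_derive s 1 chi (dotp (b0 (q, q + s *: v)) v + M * `|v| - al * s * `|v| ^+ 2).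
  have -> : al * s * `|v| ^+ 2 = 2 * (al / 2 * `|v| ^+ 2) * s by field.
  exact: is_derive_add_quadratic (dphi s).
have [s /andP[s0 s1]] := mvt_segment ler01 (fun s _ => dchi s).
rewrite subr0 mulr1 => e.
have h6 := slope s ltac:(by rewrite s0).
have c1 : chi 1 - chi 0 = S (q, Q) - S (q, q) + M * `|v| - al / 2 * `|v| ^+ 2.
  rewrite /chi /phi scale1r scale0r addr0 !mulr0 !mulr1 addr0 subr0.
  have -> : ((q, q) : E2) + ((0, v) : E2) = (q, Q) by congr (_, _) => /=; rewrite ?addr0// /v subrKC.
  by ring.
have h7 : 0 <= al / 4 * (`|v| - 2 * M / al) ^+ 2 by apply: mulr_ge0; [lra|exact: sqr_ge0].
have e7 : al / 4 * (`|v| - 2 * M / al) ^+ 2 = al / 4 * `|v| ^+ 2 - M * `|v| + M ^+ 2 / al by field; rewrite gt_eqF.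
have h8 := HB q.
by rewrite e7 in h7; rewrite c1 in e; lra.
Qed.

Variables (Gr : E -> R) (g : E -> E) (gc : Ec -> Ec) (k : 'rV[int]_d).
Hypothesis dGr : forall q, differentiable Gr q.
Hypothesis dGrE : forall q u, 'd Gr q u = dotp (g q) u.
Hypothesis Gr_per : forall q (l : 'rV[int]_d), Gr (q + intv R l) = Gr q.
Hypothesis g_per : forall q (l : 'rV[int]_d), g (q + intv R l) = g q.
Hypothesis dgc : forall q, differentiable gc q.
Hypothesis gcE : forall q, gc (complexify q) = complexify (g q).

Lemma loclip_F : loclip F.
Proof.
have FE : F = (fun z => (Rev (FC (cplx2 z)).1, Rev (FC (cplx2 z)).2)).
  by apply/funext => z; rewrite FCE /= !Rev_complexify -surjective_pairing.
rewrite FE; apply: (@loclip_pair R E2 E E (fun z => Rev (FC (cplx2 z)).1) (fun z => Rev (FC (cplx2 z)).2));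
  [apply: (@entire_loclip R d (fun z => (FC z).1)) => z|apply: (@entire_loclip R d (fun z => (FC z).2)) => z].
  exact: (@differentiable_comp _ Z2 Z2 Ec FC (@fst Ec Ec) z (dFC z) (differentiable_fst _)).
exact: (@differentiable_comp _ Z2 Z2 Ec FC (@snd Ec Ec) z (dFC z) (differentiable_snd _)).
Qed.

Lemma loclip_g : loclip g.
Proof.
have h : loclip (fun z : E2 => g z.1).
  have -> : (fun z : E2 => g z.1) = (fun z => Rev (gc (cplx2 z).1)).
    by apply/funext => z; rewrite /= gcE Rev_complexify.
  apply: (@entire_loclip R d (fun z => gc z.1)) => z.
  exact: (@differentiable_comp _ Z2 Ec Ec (@fst Ec Ec) gc z (differentiable_fst _) (dgc _)).
have i : loclip (fun q : E => (q, q) : E2).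
  by apply: (@loclip_pair R E E E id id); apply: loclip_short.
exact: (@loclip_comp R E E2 E _ _ i h).
Qed.

Definition Teps (eps : R) (z : E2) : E2 :=
  let w := F (z.1, z.2 + eps *: g z.1) in (w.1 + intv R k, w.2).

Definition Tinv (eps : R) (z : E2) : E2 :=
  let w := FCi (cplx2 ((z.1 - intv R k, z.2) : E2)) in
  (Rev w.1, Rev w.2 - eps *: g (Rev w.1)).

Lemma TepsK eps : cancel (Teps eps) (Tinv eps).
Proof.
move=> [q p]; rewrite /Tinv /Teps /= addrK.
have -> : (complexify (F (q, p + eps *: g q)).1, complexify (F (q, p + eps *: g q)).2) =
  FC (cplx2 ((q, p + eps *: g q) : E2)) by rewrite FCE.
by rewrite FCK /= !Rev_complexify addrK.
Qed.

Lemma loclip_Teps eps : loclip (Teps eps).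
Proof.
have l1 : loclip (fun z : E2 => g z.1) by exact: (@loclip_comp R E2 E E _ _ (@loclip_fst R E E) loclip_g).
have l2 : loclip (fun z : E2 => (z.1, z.2 + eps *: g z.1) : E2).
  apply: (@loclip_pair R E2 E E); first exact: loclip_fst.
  exact: (@loclip_lin R E2 E _ _ eps (@loclip_snd R E E) l1).
have l3 := @loclip_comp R E2 E2 E2 _ _ l2 loclip_F.
have l4 : loclip (fun z : E2 => (F (z.1, z.2 + eps *: g z.1)).1 + (1 : R) *: intv R k).
  apply: (@loclip_lin R E2 E); last exact: loclip_cst.
  exact: (@loclip_comp R E2 E2 E _ _ l3 (@loclip_fst R E E)).
have -> : Teps eps = (fun z : E2 => ((F (z.1, z.2 + eps *: g z.1)).1 + (1 : R) *: intv R k,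
    (F (z.1, z.2 + eps *: g z.1)).2)) by apply/funext => z; rewrite /Teps /= scale1r.
apply: (@loclip_pair R E2 E E) => //.
exact: (@loclip_comp R E2 E2 E _ _ l3 (@loclip_snd R E E)).
Qed.

Lemma loclip_Tinv eps : loclip (Tinv eps).
Proof.
have l0 : loclip (fun z : E2 => (z.1 + (- 1 : R) *: intv R k, z.2) : E2).
  apply: (@loclip_pair R E2 E E); last exact: loclip_snd.
  by apply: (@loclip_lin R E2 E); [exact: loclip_fst|exact: loclip_cst].
have e1 : loclip (fun z : E2 => Rev (FCi (cplx2 z)).1).
  apply: (@entire_loclip R d (fun z => (FCi z).1)) => z.
  exact: (@differentiable_comp _ Z2 Z2 Ec FCi (@fst Ec Ec) z (dFCi z) (differentiable_fst _)).
have e2 : loclip (fun z : E2 => Rev (FCi (cplx2 z)).2).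
  apply: (@entire_loclip R d (fun z => (FCi z).2)) => z.
  exact: (@differentiable_comp _ Z2 Z2 Ec FCi (@snd Ec Ec) z (dFCi z) (differentiable_snd _)).
have f1 := @loclip_comp R E2 E2 E _ _ l0 e1; have f2 := @loclip_comp R E2 E2 E _ _ l0 e2.
have f3 := @loclip_comp R E2 E E _ _ f1 loclip_g.
have -> : Tinv eps = (fun z : E2 => (Rev (FCi (cplx2 ((z.1 + (- 1 : R) *: intv R k, z.2) : E2))).1,
   Rev (FCi (cplx2 ((z.1 + (- 1 : R) *: intv R k, z.2) : E2))).2 + (- eps) *:
   g (Rev (FCi (cplx2 ((z.1 + (- 1 : R) *: intv R k, z.2) : E2))).1))).
  by apply/funext => z; rewrite /Tinv /= scaleN1r scaleNr.
apply: (@loclip_pair R E2 E E) => //.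
exact: (@loclip_lin R E2 E _ _ (- eps) f2 f3).
Qed.

Lemma continuous_Teps : continuous (fun x : R * (E * E) => Teps x.1 x.2).
Proof.
have c21 : continuous (fun x : R * (E * E) => x.2.1).
  by move=> x; apply: (@continuous_comp _ _ _ (@snd R (E * E)%type) fst); [exact: cvg_snd|exact: cvg_fst].
have c22 : continuous (fun x : R * (E * E) => x.2.2).
  by move=> x; apply: (@continuous_comp _ _ _ (@snd R (E * E)%type) snd); exact: cvg_snd.
have cgr : continuous (fun x : R * (E * E) => g x.2.1).
  move=> x; apply: (@continuous_comp _ _ _ (fun x : R * (E * E) => x.2.1) g); [exact: c21|exact: loclip_continuous loclip_g _].
have csum : continuous (fun x : R * (E * E) => x.2.2 + x.1 *: g x.2.1).
  by apply: (@continuous_add_scale R (R * (E * E))%type E) => // x; exact: cvg_fst.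
have cs : continuous (fun x : R * (E * E) => (x.2.1, x.2.2 + x.1 *: g x.2.1)).
  by move=> x; apply: (@cvg_pair_for _ _ _ (fun x : R * (E * E) => x.2.1) _ x); [exact: c21|exact: csum].
have cF : continuous (fun x : R * (E * E) => F (x.2.1, x.2.2 + x.1 *: g x.2.1)).
  move=> x; apply: (@continuous_comp _ E2 E2 (fun x : R * (E * E) => (x.2.1, x.2.2 + x.1 *: g x.2.1)) F x); [exact: cs|exact: loclip_continuous loclip_F _].
have l : loclip (fun z : E2 => (z.1 + (1 : R) *: intv R k, z.2) : E2).
  apply: (@loclip_pair R E2 E E); last exact: loclip_snd.
  by apply: (@loclip_lin R E2 E); [exact: loclip_fst|exact: loclip_cst].
have -> : (fun x : R * (E * E) => Teps x.1 x.2) = (fun x : R * (E * E) =>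
    (fun z : E2 => (z.1 + (1 : R) *: intv R k, z.2) : E2) (F (x.2.1, x.2.2 + x.1 *: g x.2.1))).
  by apply/funext => x; rewrite /Teps /= scale1r.
move=> x; apply: (@continuous_comp _ E2 E2 (fun x : R * (E * E) => F (x.2.1, x.2.2 + x.1 *: g x.2.1))
  (fun z : E2 => (z.1 + (1 : R) *: intv R k, z.2) : E2) x); [exact: cF|exact: loclip_continuous l _].
Qed.

Let Z3 : normedModType C := (C^o * Z2)%type.

Definition TC (x : Z3) : Z2 :=
  FC ((x.2.1, x.2.2 + x.1 *: gc x.2.1) : Z2) + ((intv C k, 0) : Z2).

Lemma dTC x : differentiable TC x.
Proof.
have d0 : differentiable (@fst C^o Z2) x by exact: differentiable_fst.
have d2 : differentiable (@snd C^o Z2) x by exact: differentiable_snd.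
have d21 : differentiable (fun x : Z3 => x.2.1 : Ec) x.
  exact: (@differentiable_comp _ Z3 Z2 Ec (@snd C^o Z2) (@fst Ec Ec) x d2 (differentiable_fst _)).
have d22 : differentiable (fun x : Z3 => x.2.2 : Ec) x.
  exact: (@differentiable_comp _ Z3 Z2 Ec (@snd C^o Z2) (@snd Ec Ec) x d2 (differentiable_snd _)).
have dg : differentiable (fun x : Z3 => gc x.2.1) x.
  exact: (@differentiable_comp _ Z3 Ec Ec (fun x : Z3 => x.2.1) gc x d21 (dgc _)).
have dZ : differentiable (fun x : Z3 => x.1 *: gc x.2.1 : Ec) x.
  exact: (@differentiable_scale R Z3 Ec (@fst C^o Z2) _ x d0 dg).
have ds : differentiable (fun x : Z3 => x.2.2 + x.1 *: gc x.2.1 : Ec) x.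
  exact: (@differentiableD _ Z3 Ec _ _ x d22 dZ).
have dF3 : differentiable (fun x : Z3 => FC ((x.2.1, x.2.2 + x.1 *: gc x.2.1) : Z2)) x.
  exact: (@differentiable_comp_pair R Ec Ec Z3 Z2 _ _ FC x d21 ds dFC).
exact: (@differentiableD _ Z3 Z2 _ (fun=> ((intv C k, 0) : Z2)) x dF3 (differentiable_cst _ _)).
Qed.

Lemma TCE eps q p : TC (eps%:C, (complexify q, complexify p)) =
  (complexify (Teps eps (q, p)).1, complexify (Teps eps (q, p)).2).
Proof.
rewrite /TC /Teps /= gcE -complexifyZ -complexifyD.
have := FCE ((q, p + eps *: g q) : E2); rewrite /= => ->.
by congr (_, _) => /=; rewrite ?addr0// complexifyD complexify_intv.
Qed.

Definition Seps eps (q Q : E) := S (q, Q - intv R k) + eps * Gr q.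
Definition aeps eps (q Q : E) := a0 (q, Q - intv R k) + eps *: g q.
Definition beps (q Q : E) := b0 (q, Q - intv R k).

Lemma Teps_gen eps z z' : Teps eps z = z' <-> z.2 = - aeps eps z.1 z'.1 /\ z'.2 = beps z.1 z'.1.
Proof.
rewrite /Teps /aeps /beps /a0 /b0; case: z z' => [q p] [Q P] /=; split=> [[<- <-]|[-> ->]].
  rewrite !(addrK (intv R k)); have -> : gr (q, (F (q, p + eps *: g q)).1) = (q, p + eps *: g q) by exact: (twK (q, p + eps *: g q)).
  by split=> //=; rewrite opprD opprK addrK.
rewrite opprD opprK subrK.
have -> : (q, (gr (q, Q - intv R k)).2) = gr (q, Q - intv R k).
  by rewrite [RHS]surjective_pairing gr1.
by rewrite F_gr1 /= subrK.
Qed.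

Lemma Gr_bounded : exists2 K, 0 <= K & forall q, `|Gr q| <= K.
Proof.
have cn : continuous (fun q => `|Gr q|).
  by move=> q; apply: continuous_comp; [exact: differentiable_continuous (dGr q)|exact: norm_continuous].
have [M HM] := periodic_bounded cn (fun q l => congr1 (fun x => `|x|) (Gr_per q l)).
by exists M => //; exact: le_trans (HM 0).
Qed.

Lemma g_est : exists2 K, 0 <= K & forall q, `|g q| <= K /\
  forall u, `|u| <= 1 -> `|g (q + u) - g q| <= K * `|u|.
Proof.
have l1 : loclip (fun z : E2 => g z.1) by exact: (@loclip_comp R E2 E E _ _ (@loclip_fst R E E) loclip_g).
have [K K0 H] := @periodic_est (fun z => g z.1) 0 (lexx 0) l1 (fun l q Q => g_per q l).
exists K => // q; have [|h1 h2] := H q q; first by rewrite subrr normr0.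
by split=> // u u1; have := h2 u 0 u1; rewrite normr0 => /(_ ler01); rewrite [`|u| + 0]addr0.
Qed.

Lemma Gr_quad : exists2 K, 0 <= K & forall q u, `|u| <= 1 ->
  `|Gr (q + u) - Gr q - dotp (g q) u| <= K * `|u| ^+ 2.
Proof.
have [K K0 H] := g_est; exists (d%:R * K) => [|q u u1]; first exact: mulr_ge0.
have D (t : R) : is_derive t 1 (fun t => Gr (q + t *: u)) (dotp (g (q + t *: u)) u).
  by rewrite -dGrE; apply: line_is_derive; exact: dGr.
have [t /andP[t0 t1]] := mvt_segment ler01 (fun t _ => D t).
rewrite scale1r scale0r addr0 subr0 mulr1 => ->; rewrite -dotpBl.
have su : `|t *: u| <= `|u| by rewrite normrZ ger0_norm// ler_piMl.
apply: le_trans (norm_dotp _ _) _.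
have -> : d%:R * K * `|u| ^+ 2 = d%:R * (K * `|u|) * `|u| by ring.
apply: ler_wpM2r => //; apply: ler_wpM2l => //.
apply: le_trans ((H q).2 _ (le_trans su u1)) _; exact: ler_wpM2l.
Qed.

Lemma td_uniform (B : R) : 0 <= B -> exists c0 C0 Cq Kb, forall eps, `|eps| <= B ->
  twist_data c0 C0 Cq Kb (Seps eps) (aeps eps) beps (Teps eps).
Proof.
move=> B0; have [c0 c00 [C0 HC]] := S_coercive.
have [GM GM0 HG] := Gr_bounded; have [Kg Kg0 Hg] := g_est; have [KG KG0 HKG] := Gr_quad.
set kn := `|intv R k|; have kn0 : 0 <= kn by exact: normr_ge0.
have D0 (D : R) : 0 <= `|D| + kn by rewrite addr_ge0.
have exq : forall D : R, exists K, 0 <= K /\ forall q Q u v, `|Q - q| <= `|D| + kn ->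
  `|u| <= 1 -> `|v| <= 1 ->
  `|S (q + u, Q + v) - S (q, Q) - dotp (a0 (q, Q)) u - dotp (b0 (q, Q)) v| <= K * (`|u| + `|v|) ^+ 2.
  by move=> D; have [K K0 H] := S_quad (D0 D); exists K.
have [Kq HKq] := boolp.choice exq.
have exb : forall D : R, exists K, 0 <= K /\ forall q Q, `|Q - q| <= `|D| + kn ->
    `|a0 (q, Q)| <= K /\ `|b0 (q, Q)| <= K.
  by move=> D; have [K K0 H] := ab_est (D0 D); exists K; split=> // q Q /H[].
have [Ka HKa] := boolp.choice exb.
have shift q Q (D : R) : `|Q - q| <= D -> `|Q - intv R k - q| <= `|D| + kn.
  move=> h; rewrite addrAC; apply: le_trans (ler_normB _ _) _; rewrite lerD2r.
  by apply: le_trans h _; exact: ler_norm.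
exists (c0 / 2), (C0 + c0 * kn ^+ 2 + B * GM), (fun D => Kq D + B * KG), (fun D => Ka D + B * Kg).
move=> eps he; split.
- move=> l q Q; rewrite /Seps Gr_per; congr (_ + _).
  by rewrite addrAC; case: S_gen => ->.
- have l : loclip (fun z : E2 => (z.1, z.2 + (- 1 : R) *: intv R k) : E2).
    apply: (@loclip_pair R E2 E E); first exact: loclip_fst.
    by apply: (@loclip_lin R E2 E); [exact: loclip_snd|exact: loclip_cst].
  have cS : continuous (fun z : E2 => S (z.1, z.2 + (- 1 : R) *: intv R k)).
    move=> z; apply: (@continuous_comp E2 E2 R (fun z : E2 => (z.1, z.2 + (- 1 : R) *: intv R k) : E2) S z);
      [exact: loclip_continuous l _|exact: differentiable_continuous (dS _)].
  have cG : continuous (fun z : E2 => Gr z.1).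
    by move=> z; apply: (@continuous_comp E2 E R (@fst E E) Gr z); [exact: cvg_fst|exact: differentiable_continuous (dGr _)].
  have := @continuous_axpy R E2 R _ _ eps cG cS.
  have -> : (fun z : E2 => eps *: Gr z.1 + S (z.1, z.2 + (- 1 : R) *: intv R k)) =
     (fun z : E * E => Seps eps z.1 z.2); last by [].
  by apply/funext => z; rewrite /Seps scaleN1r addrC.
- move=> q Q; rewrite /Seps.
  have h1 := HC q (Q - intv R k).
  have h2 : `|Q - q| <= `|Q - intv R k - q| + kn.
    by have := ler_normD (Q - intv R k - q) (intv R k); rewrite addrAC subrK.
  have h3 : c0 / 2 * `|Q - q| ^+ 2 <= c0 * `|Q - intv R k - q| ^+ 2 + c0 * kn ^+ 2.
    set x := `|Q - q| in h2 *; set y := `|Q - intv R k - q| in h2 *.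
    have h4 : x ^+ 2 <= (y + kn) ^+ 2 by rewrite ler_pXn2r ?nnegrE ?addr_ge0//; exact: normr_ge0.
    have h5 : (y + kn) ^+ 2 <= 2 * y ^+ 2 + 2 * kn ^+ 2.
      by have := sqr_ge0 (y - kn); rewrite !expr2; lra.
    have h6 : c0 / 2 * x ^+ 2 <= c0 / 2 * (2 * y ^+ 2 + 2 * kn ^+ 2).
      by apply: ler_wpM2l; [lra|exact: le_trans h5].
    by lra.
  have h7 : - (B * GM) <= eps * Gr q.
    rewrite lerNl -mulNr; apply: le_trans (ler_norm _) _; rewrite normrM normrN.
    by apply: ler_pM.
  by lra.
- by rewrite divr_gt0.
- move=> D q Q u v hQ u1 v1; rewrite /Seps /aeps /beps.
  have [K0 H] := HKq D.
  have h1 := H q (Q - intv R k) u v (shift q Q D hQ) u1 v1.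
  have h2 := HKG q u u1.
  have -> : Q + v - intv R k = Q - intv R k + v by rewrite addrAC.
  set S1 := S (q + u, _) in h1 *.
  have -> : S1 + eps * Gr (q + u) - (S (q, Q - intv R k) + eps * Gr q) -
      dotp (a0 (q, Q - intv R k) + eps *: g q) u - dotp (b0 (q, Q - intv R k)) v =
      (S1 - S (q, Q - intv R k) - dotp (a0 (q, Q - intv R k)) u - dotp (b0 (q, Q - intv R k)) v) +
      eps * (Gr (q + u) - Gr q - dotp (g q) u).
    by rewrite dotpDl dotpZl; ring.
  apply: le_trans (ler_normD _ _) _; rewrite mulrDl; apply: lerD => //.
  rewrite normrM; apply: le_trans (_ : B * (KG * `|u| ^+ 2) <= _); first exact: ler_pM.
  rewrite mulrA; apply: ler_wpM2l; first exact: mulr_ge0.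
  by rewrite ler_pXn2r ?nnegrE ?addr_ge0// lerDl.
- move=> D q Q hQ; have [K0 H] := HKa D; have [h1 h2] := H q (Q - intv R k) (shift q Q D hQ).
  split; last by apply: le_trans h2 _; rewrite lerDl mulr_ge0.
  apply: le_trans (ler_normD _ _) _; apply: lerD => //; rewrite normrZ.
  by apply: ler_pM => //; case: (Hg q).
- exact: Teps_gen.
Qed.

Hypothesis d0 : (0 < d)%N.

Section PeriodicGraphs.
Variables (n : nat) (m : 'rV[int]_d).
Hypothesis n0 : (0 < n)%N.

Lemma Teps_data eps : exists c0 C0 Cq Kb,
  twist_data c0 C0 Cq Kb (Seps eps) (aeps eps) beps (Teps eps).
Proof.
have [c0 [C0 [Cq [Kb H]]]] := td_uniform (normr_ge0 eps).
by exists c0, C0, Cq, Kb; exact: H.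
Qed.

Lemma Teps_unique eps gamma gamma' : lip_lag_graph (Teps eps) n m gamma ->
  lip_lag_graph (Teps eps) n m gamma' -> gamma =1 gamma'.
Proof.
have [c0 [C0 [Cq [Kb td]]]] := Teps_data eps.
exact: (graph_unique td n0 d0 (loclip_Teps eps)).
Qed.

Lemma Teps_nondegenerate eps gamma q eta : lip_lag_graph (Teps eps) n m gamma ->
  (forall kap, 0 < kap -> exists2 rho, 0 < rho & forall s t,
     0 <= s -> s <= t -> t <= rho ->
     `|xo (Teps eps) (q, gamma q + t *: eta) n - xo (Teps eps) (q, gamma q + s *: eta) n| <= kap * (t - s)) ->
  eta = 0.
Proof.
have [c0 [C0 [Cq [Kb td]]]] := Teps_data eps.
exact: (nondegenerate td n0 d0 (loclip_Teps eps) (loclip_Tinv eps) (TepsK eps)).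
Qed.

Lemma Teps_unif eps0 : exists M L C0, [/\ 0 <= M, 0 <= L, 0 <= C0 &
  forall eps gamma, `|eps - eps0| <= 1 -> lip_lag_graph (Teps eps) n m gamma ->
    unif_graph Teps n m M L C0 eps gamma].
Proof.
have [GM GM0 HG] := Gr_bounded.
pose B := `|eps0| + 1; have B0 : 0 <= B by rewrite addr_ge0.
have [c0 [C0 [Cq [Kb td]]]] := td_uniform B0.
have e0B : `|eps0| <= B by rewrite lerDl.
have c00 := td_c0 (td _ e0B).
pose lin : nat -> E := linear_path R n m.
pose X := \sum_(i < n) (`|S (lin i, lin i.+1 - intv R k)| + B * GM) + n%:R * `|C0|.
pose D := 1 + `|X| / c0.
have t0 : 0 <= `|X| / c0 by rewrite divr_ge0// ltW.
have D0 : 0 <= D by rewrite addr_ge0.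
have HX : X <= c0 * D ^+ 2.
  rewrite -ler_pdivrMl// [_^-1 * _]mulrC; apply: le_trans (_ : `|X| / c0 <= _).
    by rewrite ler_pM2r ?invr_gt0// ler_norm.
  by rewrite /D; have := sqr_ge0 (`|X| / c0); rewrite !expr2; nra.
have HD eps : `|eps| <= B -> action (Seps eps) n (linear_path R n m) + n%:R * `|C0| <= c0 * D ^+ 2.
  move=> he; apply: le_trans HX; rewrite lerD2r; apply: ler_sum => i _; apply: lerD; first exact: ler_norm.
  by apply: le_trans (ler_norm _) _; rewrite normrM; exact: ler_pM.
have Cq0 := Cq_ge0 (td _ e0B) D0 d0.
have Kb0 : 0 <= Kb D.
  by apply: le_trans (td_bound (td _ e0B) (_ : `|0 - 0| <= D)).1; rewrite ?normr_ge0// subrr normr0.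
exists (Kb D), (6 * Cq D + 4 * Kb D), (Cq D); split=> //.
  by rewrite addr_ge0// mulr_ge0.
move=> eps gamma he gg.
have eB : `|eps| <= B.
  have -> : eps = eps0 + (eps - eps0) by rewrite subrKC.
  by apply: le_trans (ler_normD _ _) _; rewrite lerD2l.
have tde := td _ eB; have lT := loclip_Teps eps.
have [U [w cw U0]] := graph_calibration tde n0 d0 lT gg.
split=> //.
- exact: (graph_norm tde n0 d0 lT gg D0 (HD _ eB)).
- exact: (graph_lip tde n0 d0 lT gg D0 (HD _ eB)).
- by exists U => //; exact: (calibrated_quad tde n0 d0 lT gg D0 (HD _ eB) cw).
Qed.

Definition graph_params := [set eps | exists gamma, lip_lag_graph (Teps eps) n m gamma].

Lemma graph_params_closed : closed graph_params.
Proof. exact: (graph_closed continuous_Teps Teps_unif). Qed.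

Lemma graph_params_near eps0 : limit_point graph_params eps0 ->
  exists2 r, 0 < r & forall eps, `|eps - eps0| <= r -> graph_params eps.
Proof.
move=> lA.
have [gamma0 gg0] : graph_params eps0.
  by apply: graph_params_closed; exact: subset_limit_point.
exact: (graph_near dTC TCE continuous_Teps Teps_unif Teps_unique Teps_nondegenerate
  gg0 lA).
Qed.

Lemma limit_points_all : limit_point graph_params !=set0 -> graph_params = setT.
Proof.
move=> lA0.
have cl : closed (limit_point graph_params).
  by apply: limit_point_closed; apply: hausdorff_accessible; exact: Rhausdorff.
have op : open (limit_point graph_params).
  rewrite openE => eps0 lA; have [r r0 Hr] := graph_params_near lA.
  apply/nbhs_ballP; exists r => //= eps; rewrite /ball /= => he V nV.
  have nb : nbhs eps (V `&` ball eps0 r).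
    apply: filterI => //; apply/nbhs_ballP; exists (r - `|eps0 - eps|); first by rewrite /= subr_gt0.
    move=> y; rewrite /ball /= => hy.
    have -> : eps0 - y = (eps0 - eps) + (eps - y) by rewrite addrA subrK.
    by apply: le_lt_trans (ler_normD _ _) _; move: hy; lra.
  have [e /= e0 He] := (nbhs_ballP _ _).1 nb.
  have be : ball eps e (eps + e / 2).
    by rewrite /ball /= opprD addrA subrr add0r normrN gtr0_norm ?divr_gt0// ltr_pdivrMr// ltr_pMr// ltr1n.
  have [h1 h2] := He _ be.
  exists (eps + e / 2); split=> //.
    by rewrite -subr_eq0 [eps + _]addrC addrK gt_eqF// divr_gt0.
  by apply: Hr; rewrite distrC ltW.
have lT : limit_point graph_params = setT.
  have cR : connected [set: R] by apply/connected_intervalP => x y _ _ z _.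
  apply: (cR _ lA0); first by exists (limit_point graph_params); rewrite ?setTI.
  by exists (limit_point graph_params); rewrite ?setTI.
apply/seteqP; split=> // x _; apply: graph_params_closed.
by apply: subset_limit_point; rewrite lT.
Qed.

Lemma graph_params_dichotomy : graph_params = setT \/ graph_params `<=` isolated graph_params.
Proof.
have [h|h] := pselect (limit_point graph_params !=set0); first by left; exact: limit_points_all.
right=> x Ax; have : closure graph_params x by exact: subset_closure.
by rewrite closure_isolated_limit_point => -[//|lx]; case: h; exists x.
Qed.

Section BoundedRate.
Variable N : R.
Hypothesis N0 : 0 <= N.
Hypothesis HN : forall z, `|hess_qq S z| <= N /\ `|hess_QQ S z| <= N.

Lemma hess_le (H : 'M[R]_d) (v : E) : `|H| <= N -> dotp (v *m H) v <= d%:R ^+ 2 * N * `|v| ^+ 2.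
Proof.
move=> hH; apply: le_trans (ler_norm _) _; apply: le_trans (norm_dotp _ _) _.
have -> : d%:R ^+ 2 * N * `|v| ^+ 2 = d%:R * (d%:R * (`|v| * N)) * `|v| by ring.
apply: ler_wpM2r => //; apply: ler_wpM2l => //; apply: mx_norm_le; first by rewrite !mulr_ge0.
move=> i j; rewrite mxE; apply: le_trans (ler_norm_sum _ _ _) _.
apply: le_trans (_ : \sum_(l < d) `|v| * N <= _); last by rewrite sumr_const card_ord mulr_natl.
apply: ler_sum => l _; rewrite normrM; apply: ler_pM => //; first exact: mx_coord_le.
by apply: le_trans hH; exact: mx_coord_le.
Qed.

Lemma second_difference (f df ddf : R -> R) (K : R) :
  (forall t : R, is_derive t 1 f (df t)) -> (forall t : R, is_derive t 1 df (ddf t)) ->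
  (forall t, ddf t <= K) -> 0 <= K -> f 1 + f (- 1) - 2 * f 0 <= 2 * K.
Proof.
move=> Df Ddf HK K0.
pose h (t : R) := f t + f (- t).
have Dh (t : R) : is_derive t 1 h (df t - df (- t)).
  have d1 := Df t; have d2 := Df (- t).
  have dn : is_derive t (1 : R) (- (id : R -> R)) (- 1) by apply: is_deriveN.
  have d3 : is_derive t 1 (f \o (- (id : R -> R))) (df (- t) * (- 1)).
    exact: (@is_derive1_comp _ f (- (id : R -> R))).
  have -> : h = f + (f \o (- (id : R -> R))) by apply/funext.
  by apply: is_derive_eq; rewrite mulrN1.
have [t /andP[t0 t1]] := mvt_segment ler01 (fun t _ => Dh t).
have -> : h 1 - h 0 = f 1 + f (- 1) - 2 * f 0 by rewrite /h oppr0; ring.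
rewrite subr0 mulr1 => e.
have nt : - t <= t by lra.
have [s _ e2] := mvt_segment nt (fun s _ => Ddf s).
rewrite e2 in e; have := HK s.
have : ddf s * (t - - t) <= K * (t - - t) by apply: ler_wpM2r => //; lra.
have : K * (t - - t) <= K * 2 by apply: ler_wpM2l => //; lra.
by move: e; lra.
Qed.

Let K2 (v : E) := d%:R ^+ 2 * N * `|v| ^+ 2.
Let K20 v : 0 <= K2 v.
Proof. by apply: mulr_ge0; [apply: mulr_ge0 => //; exact: sqr_ge0|exact: sqr_ge0]. Qed.

Lemma S_second_q q Q v : S (q + v, Q) + S (q - v, Q) - 2 * S (q, Q) <= 2 * K2 v.
Proof.
have Df (t : R) : is_derive t 1 (fun t => S (q + t *: v, Q)) (dotp (a0 (q + t *: v, Q)) v).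
  have zE s : ((q, Q) : E2) + s *: ((v, 0) : E2) = (q + s *: v, Q) by congr (_, _) => /=; rewrite scaler0 addr0.
  have := S_line (q, Q) (v, 0) t; rewrite zE /= dotp0r addr0.
  by congr (is_derive _ _ _ _); apply/funext => s; rewrite zE.
have := second_difference Df (fun t => a0_line_q q Q v t) (fun t => hess_le v (HN _).1) (K20 v).
by rewrite scale1r scaleN1r scale0r addr0.
Qed.

Lemma S_second_Q q Q v : S (q, Q + v) + S (q, Q - v) - 2 * S (q, Q) <= 2 * K2 v.
Proof.
have Df (t : R) : is_derive t 1 (fun t => S (q, Q + t *: v)) (dotp (b0 (q, Q + t *: v)) v).
  have zE s : ((q, Q) : E2) + s *: ((0, v) : E2) = (q, Q + s *: v) by congr (_, _) => /=; rewrite scaler0 addr0.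
  have := S_line (q, Q) (0, v) t; rewrite zE /= dotp0r add0r.
  by congr (is_derive _ _ _ _); apply/funext => s; rewrite zE.
have := second_difference Df (fun t => b0_line_Q q Q v t) (fun t => hess_le v (HN _).2) (K20 v).
by rewrite scale1r scaleN1r scale0r addr0.
Qed.

Lemma graph_double eps gamma : lip_lag_graph (Teps eps) n m gamma -> lip_lag_graph (Teps eps) (n + n) (m + m) gamma.
Proof.
move=> [h1 h2 h3 h4 og]; split=> // q.
have -> : intv R (m + m) = intv R m + intv R m by rewrite /intv raddfD.
by rewrite iterD og -(h2 q m) og h2 addrA.
Qed.

Lemma action_ends (L : E -> E -> R) (j : nat) (y : nat -> E) :
  action L j.+2 y = L (y 0%N) (y 1%N) + \sum_(i < j) L (y i.+1) (y i.+2) + L (y j.+1) (y j.+2).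
Proof. by rewrite /action big_ord_recr big_ord_recl. Qed.

Lemma second_variation eps gamma q v : lip_lag_graph (Teps eps) n m gamma ->
  0 <= 4 * K2 v + eps * (Gr (q + v) + Gr (q - v) - 2 * Gr q).
Proof.
move=> /graph_double gg.
have [c0 [C0 [Cq [Kb td]]]] := Teps_data eps.
have nn0 : (0 < n + n)%N by rewrite addn_gt0 n0.
have [U [w [c1 c2 _] _]] := graph_calibration td nn0 d0 (loclip_Teps eps) gg.
have [_ _ _ _ og] := gg.
pose x := xo (Teps eps) (q, gamma q).
have [j nj] : exists j, (n + n)%N = j.+2.
  by case: (n) n0 => // n' _; exists (n' + n')%N; rewrite addSn addnS.
have xn : x j.+2 = q + intv R (m + m) by rewrite /x /xo -nj og.
pose y (v : E) i := x i + (if (i == 0%N) || (i == j.+2) then v else 0).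
have Wy u : action (Seps eps) (n + n) (y u) - w = (Seps eps (q + u) (x 1%N) - Seps eps q (x 1%N)) +
    (Seps eps (x j.+1) (x j.+2 + u) - Seps eps (x j.+1) (x j.+2)).
  rewrite -(c2 q) -/x nj !action_ends.
  have -> : \sum_(i < j) Seps eps (y u i.+1) (y u i.+2) = \sum_(i < j) Seps eps (x i.+1) (x i.+2).
    apply: eq_bigr => i _; have ij := ltn_ord i; rewrite /y /= !eqSS.
    by rewrite !ltn_eqF ?addr0// ltnS ltnW.
  rewrite /y /= !eqSS eqxx (ltn_eqF (ltnSn j)) !addr0.
  have -> : x 0%N = q by [].
  by ring.
have low u : 0 <= action (Seps eps) (n + n) (y u) - w.
  rewrite subr_ge0; have := c1 (y u).
  have -> : y u (n + n)%N - intv R (m + m) = y u 0%N.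
    by rewrite /y nj eqxx orbT /= xn addrAC addrK.
  by rewrite lerD2l.
have h1 := low v; have h2 := low (- v); rewrite !Wy in h1 h2.
have h3 := S_second_q q (x 1%N - intv R k) v.
have h4 := S_second_Q (x j.+1) (x j.+2 - intv R k) v.
move: h1 h2; rewrite /Seps [x j.+2 + v - _]addrAC [x j.+2 - v - _]addrAC.
by move: h3 h4; lra.
Qed.

Lemma graph_params_bounded : (exists q q', Gr q <> Gr q') -> exists B, forall eps, graph_params eps -> `|eps| <= B.
Proof.
move=> [q1 [q2 q12]].
have cG : continuous Gr by move=> q; exact: differentiable_continuous (dGr q).
have A0 : [set v : E | `|v| <= 1] !=set0 by exists 0; rewrite /= normr0.
have cA := @segment_box_compact R d 1.
have [qM _ HM] := compact_EVT_max A0 cA (continuous_subspaceT cG).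
have [qm _ Hm] := compact_EVT_min A0 cA (continuous_subspaceT cG).
have {}HM q : Gr q <= Gr qM.
  by have [l hl] := floor_reduction q; rewrite -(Gr_per q l); apply: HM; rewrite inE.
have {}Hm q : Gr qm <= Gr q.
  by have [l hl] := floor_reduction q; rewrite -(Gr_per q l); apply: Hm; rewrite inE.
pose kap := Gr qM - Gr qm.
have k0 : 0 < kap.
  rewrite subr_gt0 lt_neqAle Hm andbT; apply/eqP => e; apply: q12; apply/eqP.
  by rewrite eq_le; apply/andP; split; apply: le_trans (HM _) _; rewrite -e.
exists (4 * K2 (qm - qM) / kap) => eps [gamma gg].
have e1 : `|qM - qm| = `|qm - qM| by rewrite distrC.
have h1 := second_variation qM (qm - qM) gg.
have h2 := second_variation qm (qM - qm) gg.
rewrite {1}/K2 e1 -/(K2 _) in h2; rewrite !subrKC in h1 h2.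
have g1 := HM (qM - (qm - qM)); have g2 := Hm (qm - (qM - qm)).
rewrite ler_pdivlMr//.
rewrite /kap; have [e0|e0] := leP 0 eps.
  have : eps * (Gr qm + Gr (qM - (qm - qM)) - 2 * Gr qM) <= eps * (Gr qm - Gr qM) by apply: ler_wpM2l => //; lra.
  by rewrite ger0_norm//; lra.
have : eps * (Gr qM + Gr (qm - (qM - qm)) - 2 * Gr qm) <= eps * (Gr qM - Gr qm).
  by apply: ler_wnM2l; [exact: ltW|lra].
by rewrite ltr0_norm//; lra.
Qed.

Lemma graph_params_finite : (exists q q', Gr q <> Gr q') -> finite_set graph_params.
Proof.
move=> /graph_params_bounded[B HB]; apply: contrapT => infA.
have bA : bounded_set graph_params.
  exists B; split; first exact: num_real.
  by move=> M BM eps Ae; apply: le_trans (HB _ Ae) _; exact: ltW.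
have AT := limit_points_all (infinite_bounded_limit_point_nonempty infA bA).
have : graph_params (`|B| + 1) by rewrite AT.
move=> /HB; rewrite ger0_norm; last by rewrite addr_ge0.
by move=> h; have := le_trans h (ler_norm B); rewrite gerDl ler10.
Qed.

End BoundedRate.
End PeriodicGraphs.
End TwistMap.

Lemma continuous_sum (R : realType) (X : topologicalType) (W : normedModType R) n (f : 'I_n -> X -> W) :
  (forall i, continuous (f i)) -> continuous (fun x => \sum_(i < n) f i x).
Proof.
elim: n f => [|n IH] f cf.
  have -> : (fun x => \sum_(i < 0) f i x) = cst 0 by apply/funext => x; rewrite big_ord0.
  by move=> x; exact: cvg_cst.
have -> : (fun x => \sum_(i < n.+1) f i x) =
    (fun x => \sum_(i < n) f (widen_ord (leqnSn n) i) x + f ord_max x).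
  by apply/funext => x; rewrite big_ord_recr.
by move=> x; apply: cvgD; [exact: IH|exact: cf].
Qed.

Lemma continuous_scale_cst (R : realType) (X : topologicalType) (W : normedModType R) (s : X -> R) (w : W) :
  continuous s -> continuous (fun x => s x *: w).
Proof. by move=> cs x; apply: cvgZl; exact: cs. Qed.

Section Assembly.
Variables (R : realType) (d : nat).
Local Notation C := R[i].
Local Notation E := 'rV[R]_d.
Local Notation Ec := 'rV[C]_d.
Local Open Scope complex_scope.
Local Notation nc := (@ComplexField.Normc.normc R).
Let Z2 : normedModType C := (Ec * Ec)%type.
Let Z1 : normedModType C := Ec.
Let E2 : normedModType R := (E * E)%type.

Lemma lipschitz_globalP (V W : normedModType R) (f : V -> W) :
  lipschitz f <-> exists2 L : R, 0 <= L & forall x v, `|f (x + v) - f x| <= L * `|v|.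
Proof.
split=> [|[L L0 HL]].
  move=> /pinfty_ex_gt0[L L0 HL]; exists L; [exact: ltW|move=> x v].
  have := HL (x + v, x) (conj I I) => /=; rewrite [x + v - x]addrAC subrr add0r; exact.
have pf : ProperFilter (globally ([set: V] `*` [set: V])).
  exact: (@globally_properfilter _ _ (0, 0)).
apply: (@klipschitzW R V W L f _ pf) => -[x y] _ /=.
by have := HL y (x - y); rewrite subrKC.
Qed.

Lemma is_derive_part (ph : C -> R) (Gc : Z1 -> C^o) (q v : E) :
  (forall x y, ph (x + y) = ph x + ph y) -> (forall (t : R) x, ph (t%:C * x) = t * ph x) ->
  (forall x, `|ph x| <= nc x) -> differentiable Gc (complexify q : Z1) ->
  is_derive q v (fun q => ph (Gc (complexify q))) (ph ('d Gc (complexify q : Z1) (complexify v))).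
Proof.
move=> phD phZ ph1 dG; apply: eps_is_derive => k k0.
have phB x y : ph (x - y) = ph x - ph y.
  have -> : - y = (- 1)%:C * y by rewrite rmorphN1 mulN1r.
  by rewrite phD phZ mulN1r.
pose B := `|v| + 1; have B0 : 0 < B by rewrite ltr_wpDl.
have kB : 0 < k / B by rewrite divr_gt0.
have [r r0 Hr] := diff_reps dG kB.
exists (r / B) => [|t ht]; first by rewrite divr_gt0.
have dz : complexify (q + t *: v) - complexify q = t%:C *: complexify v.
  by rewrite complexifyD complexifyZ addrAC subrr add0r.
have nz : rnorm (complexify (q + t *: v) - complexify q) <= B * `|t|.
  rewrite -complexifyB rnorm_complexify addrAC subrr add0r normrZ mulrC.
  by apply: ler_wpM2r => //; rewrite lerDl.
have h1 := Hr _ (le_trans nz (_ : _ <= r)).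
have {}h1 : nc (Gc (complexify (q + t *: v)) - Gc (complexify q) - t%:C * 'd Gc (complexify q : Z1) (complexify v)) <= k * `|t|.
  rewrite -rnorm_complex.
  have -> : t%:C * 'd Gc (complexify q : Z1) (complexify v) = 'd Gc (complexify q : Z1) (complexify (q + t *: v) - complexify q).
    by rewrite dz linearZ.
  apply: le_trans (h1 _) _; first by rewrite -ler_pdivlMl// mulrC.
  apply: le_trans (_ : k / B * (B * `|t|) <= _).
    by apply: ler_wpM2l => //; exact: ltW.
  by rewrite mulrA divfK// gt_eqF.
apply: le_trans h1; apply: le_trans (ph1 _).
by rewrite !phB phZ [t * _]mulrC.
Qed.

Lemma diff_real_extension (Gc : Z1 -> C^o) (G0 : E -> R) (q v : E) :
  (forall q, Gc (complexify q) = (G0 q)%:C) -> differentiable Gc (complexify q : Z1) ->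
  'd Gc (complexify q : Z1) (complexify v) = ('D_v G0 q)%:C.
Proof.
move=> GE dG.
have h1 : is_derive q v G0 (complex.Re ('d Gc (complexify q : Z1) (complexify v))).
  have -> : G0 = fun q => complex.Re (Gc (complexify q)) by apply/funext => y; rewrite GE.
  apply: is_derive_part => //.
  - by move=> [a b] [a' b'].
  - by move=> t [a b] /=; rewrite mul0r subr0.
  - by move=> x; exact: ler_Re.
have h2 : is_derive q v (cst 0 : E -> R) (complex.Im ('d Gc (complexify q : Z1) (complexify v))).
  have -> : cst 0 = fun q => complex.Im (Gc (complexify q)) by apply/funext => y; rewrite GE.
  apply: is_derive_part => //.
  - by move=> [a b] [a' b'].
  - by move=> t [a b] /=; rewrite mul0r addr0.
  - by move=> x; exact: ler_Im.
case: h1 => _ h1; case: h2 => _; rewrite derive_cst => h2; rewrite h1.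
by case: ('d Gc _ _) h2 => a b /= <-.
Qed.

Lemma differentiable_translate (K : numFieldType) (X : normedModType K) (g : X -> X) (k : X) :
  (forall z, differentiable g z) -> forall z, differentiable (fun z => g (z - k)) z.
Proof.
move=> dg z; have ds : differentiable (fun z : X => z - k) z by apply: differentiableB.
exact: (@differentiable_comp K X X X (fun z => z - k) g z ds (dg _)).
Qed.

Lemma analytic_lift (f : torus R d * E -> torus R d * E) (F : E2 -> E2) :
  analyticity_property f -> is_lift f F -> exists FC FCi gC : Z2 -> Z2,
  [/\ forall z, differentiable FC z, forall z, differentiable FCi z, forall z, differentiable gC z,
      cancel FC FCi /\ cancel (twist_coord FC) gC
    & forall z : E2, FC (complexify z.1, complexify z.2) = (complexify (F z).1, complexify (F z).2)].
Proof.
move=> [Fc [[Fi [FcK _ dFc dFi]] [F' F'l F'E] [g [gK _ _ dg]] _]] Fl.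
have [k kE] := lifts_differ F'l Fl.
pose K : Z2 := (intv C k, 0); pose K' : Z2 := (0, intv C k).
exists (fun z => Fc z + K), (fun z => Fi (z - K)), (fun z => g (z - K')); split.
- by move=> z; apply: (@differentiableD C Z2 Z2 Fc (cst K)); [exact: dFc|exact: differentiable_cst].
- exact: differentiable_translate.
- exact: differentiable_translate.
- split=> z; first by rewrite addrK.
  rewrite -[RHS]gK; congr g; rewrite /twist_coord /=.
  by congr (_, _) => /=; rewrite ?subr0 ?addrK.
- case=> q p; rewrite F'E kE /=; congr (_, _) => /=; last by rewrite addr0.
  by rewrite complexifyD complexify_intv.
Qed.

Variables (G : torus R d -> R) (Gc : Z1 -> C^o).
Hypothesis dG : forall q, differentiable (G \o @torus_pi R d) q.
Hypothesis dGc : forall z, differentiable Gc z.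
Hypothesis GcE : forall q, Gc (complexify q) = (G (torus_pi q))%:C.

Definition grad_c (z : Z1) : Z1 := \sum_(i < d) 'd Gc z (evec C i) *: evec C i.

Lemma differentiable_grad_c z : differentiable grad_c z.
Proof.
have -> : grad_c = \sum_(i < d) (fun z => 'd Gc z (evec C i) *: evec C i : Z1).
  by apply/funext => y; rewrite fct_sumE.
apply: differentiable_sum => i; apply: (@differentiable_scale R Z1 Z1 (fun z => 'd Gc z (evec C i))).
  exact: differentiable_partial.
exact: differentiable_cst.
Qed.

Lemma complexify_evec (i : 'I_d) : complexify (evec R i) = evec C i :> Ec.
Proof. by apply/rowP => j; rewrite !mxE rmorph_nat. Qed.

Lemma grad_cE q : grad_c (complexify q) = complexify (grad G q).
Proof.
apply/rowP => j; rewrite /grad_c summxE (bigD1 j)//= big1 ?addr0 => [|i ij].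
  rewrite !mxE !eqxx mulr1 -complexify_evec; exact: diff_real_extension.
by rewrite !mxE eqxx eq_sym (negPf ij) mulr0.
Qed.

Lemma diff_grad q u : 'd (G \o @torus_pi R d) q u = dotp (grad G q) u.
Proof.
rewrite {1}(row_sum_delta u) linear_sum /dotp; apply: eq_bigr => i _.
by rewrite linearZ /= -deriveE// mxE mulrC.
Qed.

End Assembly.

Lemma sup_norm_add_bound (R : realType) (d : nat) (A B : 'rV[R]_d * 'rV[R]_d -> 'M[R]_d) :
  (sup_norm A + sup_norm B < +oo)%E ->
  exists2 N : R, 0 <= N & forall z, `|A z| <= N /\ `|B z| <= N.
Proof.
have le_sup (H : 'rV[R]_d * 'rV[R]_d -> 'M[R]_d) z : ((`|H z|)%:E <= sup_norm H)%E.
  by apply: ereal_sup_ubound; exists z.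
have sup0 (H : 'rV[R]_d * 'rV[R]_d -> 'M[R]_d) : (0 <= sup_norm H)%E.
  by apply: le_trans (le_sup H 0); rewrite lee_fin.
move: (sup0 A) (sup0 B) (le_sup A) (le_sup B).
case: (sup_norm A) => [x| |]; case: (sup_norm B) => [y| |] // x0 y0 hA hB _.
rewrite !lee_fin in x0 y0; exists (x + y) => [|z]; first exact: addr_ge0.
split; first by have := hA z; rewrite lee_fin; lra.
by have := hB z; rewrite lee_fin; lra.
Qed.

Theorem theorem1 (R : realType) (d : nat) (d_ge1 : (1 <= d)%N)
    (f : torus R d * 'rV[R]_d -> torus R d * 'rV[R]_d)
    (F : 'rV[R]_d * 'rV[R]_d -> 'rV[R]_d * 'rV[R]_d)
    (S : 'rV[R]_d * 'rV[R]_d -> R)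
    (f_twist : symplectic_twist_map f)
    (F_lift : is_lift f F)
    (S_gen : twist_lift F S)
    (G : torus R d -> R)
    (G_C2 : C2 (G \o @torus_pi R d))
    (F_ : R -> 'rV[R]_d * 'rV[R]_d -> 'rV[R]_d * 'rV[R]_d)
    (F_lifts : continuous_family_of_lifts (perturbed f G) F_) :
  (strongly_positive S -> analyticity_property f -> has_entire_extension G ->
    forall (m : 'rV[int]_d) (n : nat), (0 < n)%N -> coprime_vec m n ->
      let A := [set eps : R | has_lip_lag_periodic_graph (F_ eps) m n] in
      A = setT \/ A `<=` isolated A) /\
  (strongly_positive S -> analyticity_property f -> has_entire_extension G ->
    bounded_rate S -> ~ (exists c, forall x, G x = c) ->
    forall (m : 'rV[int]_d) (n : nat), (0 < n)%N -> coprime_vec m n ->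
      finite_set [set eps : R | has_lip_lag_periodic_graph (F_ eps) m n]).
Proof.
have [F_per [gr [twK grK [dF _] [dgr _]]] gen] := S_gen.
have dG : forall q, differentiable (G \o @torus_pi R d) q := G_C2.1.1.
have cg : continuous (grad G).
  have -> : grad G = (fun q => \sum_(j < d) 'd (G \o @torus_pi R d) q (evec R j) *: evec R j).
    apply/funext => q; rewrite [LHS]row_sum_delta; apply: eq_bigr => j _.
    by rewrite mxE deriveE.
  apply: continuous_sum => j; apply: continuous_scale_cst; exact: G_C2.1.2.
have [k kE] := perturbed_lift cg F_lift F_lifts.
have F_E eps : F_ eps = Teps F (grad G) k eps by apply/funext => -[q p]; exact: kE.
have AE m n : [set eps | has_lip_lag_periodic_graph (F_ eps) m n] = graph_params F (grad G) k n m.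
  apply/seteqP; split=> eps /=; rewrite F_E.
    by move=> [gamma [h1 h2 /lipschitz_globalP h3 h4 h5]]; exists gamma; split.
  by move=> [gamma [h1 h2 h3 h4 h5]]; exists gamma; split => //; exact/lipschitz_globalP.
split=> [sp an [Gc dGc GcE] m n n0 _ A|sp an [Gc dGc GcE] br Gnc m n n0 _].
  have [FC [FCi [gC [dFC dFCi dgC [FCK gCK] FCE]]]] := analytic_lift an F_lift.
  rewrite /A AE; exact: (graph_params_dichotomy F_per dF dgr grK twK gen dFC dFCi FCK dgC gCK FCE sp k
    dG (diff_grad dG) (@Gr_periodic _ _ G) (@grad_periodic _ _ G) (differentiable_grad_c dGc)
    (grad_cE dGc GcE) d_ge1 m n0).
have [FC [FCi [gC [dFC dFCi dgC [FCK gCK] FCE]]]] := analytic_lift an F_lift.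
have [N N0 HN] := sup_norm_add_bound br.
have Gnc' : exists q q', (G \o @torus_pi R d) q <> (G \o @torus_pi R d) q'.
  apply: contrapT => h; apply: Gnc; exists (G (torus_pi 0)) => x; rewrite -[x]torus_reprK.
  by apply: contrapT => hx; apply: h; exists (torus_repr x), 0.
rewrite AE; exact: (graph_params_finite F_per dF dgr grK twK gen dFC dFCi FCK dgC gCK FCE sp k
    dG (diff_grad dG) (@Gr_periodic _ _ G) (@grad_periodic _ _ G) (differentiable_grad_c dGc)
    (grad_cE dGc GcE) d_ge1 m n0 N0 HN Gnc').
Qed.
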